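(* Let $N\ge 1$ be an integer, let $\rho:\mathbb{R}^3\to\mathbb{R}$ be measurable with $\rho\ge 0$ and $\int_{\mathbb{R}^3}\rho\,d\mathbf{r}=N$, and let $\boldsymbol{\kappa}=(\kappa_1,\kappa_2,\kappa_3):\mathbb{R}^3\to\mathbb{R}^3$ be measurable. Assume that $\rho\in L^1(\mathbb{R}^3)\cap L^q(\mathbb{R}^3)$ for some $q>1$, that $\rho^{-1}|\nabla\rho|^2\in L^1_{\mathrm{loc}}(\mathbb{R}^3)$, that $\rho\,\kappa_\alpha^2\in L^1_{\mathrm{loc}}(\mathbb{R}^3)$, and that $(1+r^2)\,\rho\,(\partial\kappa_\beta/\partial r_\alpha)^2\in L^1_{\mathrm{loc}}(\mathbb{R}^3)$ for all $\alpha,\beta\in\{1,2,3\}$, where $r=|\mathbf{r}|$. Then there exists $D\in\mathcal{D}_{N,1}$ with density $\rho_D=\rho$ and paramagnetic current density $\mathbf{j}_{\mathrm{p};D}=\frac12\rho\boldsymbol{\kappa}$ (both a.e.).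
   Context: All derivatives are weak (distributional) derivatives; in particular the hypotheses presuppose that $\rho$ has a weak gradient in $L^1_{\mathrm{loc}}(\mathbb{R}^3)$ (with $\rho^{-1}|\nabla\rho|^2$ read as $0$ where $\rho=0$) and that $\kappa_\beta\in L^1_{\mathrm{loc}}(\mathbb{R}^3)$ has weak partial derivatives in $L^1_{\mathrm{loc}}(\mathbb{R}^3)$. $\mathcal{D}_{N,1}$ (the set of one-particle reduced density matrices, 1-rdms, of mixed $N$-electron states) consists of those $D\in L^2(\mathbb{R}^3\times\mathbb{R}^3)$ that are kernels of trace-class operators on $L^2(\mathbb{R}^3)$, are Hermitian ($D(\mathbf{r},\mathbf{s})=D(\mathbf{s},\mathbf{r})^*$ a.e.), satisfy $0\le\iint\phi^*(\mathbf{r})D(\mathbf{r},\mathbf{s})\phi(\mathbf{s})\,d\mathbf{r}\,d\mathbf{s}\le 2\|\phi\|_2^2$ for all $\phi\in L^2(\mathbb{R}^3)$, and have $\operatorname{Tr}D=N$. Kernel product: $(B*C)(x,y)=\int B(x,z)C(z,y)\,dz$, and $G^\dagger(\mathbf{r},\mathbf{u})=G(\mathbf{u},\mathbf{r})^*$, so $(G^\dagger*G)(\mathbf{r},\mathbf{s})=\int G(\mathbf{u},\mathbf{r})^*G(\mathbf{u},\mathbf{s})\,d\mathbf{u}$. $\nabla_i$ is the weak gradient with respect to the $i$th argument. $L^2(\mathbb{R}^3\times\mathbb{R}^3_{\mathrm{loc}})$ is the set of functions lying in $L^2(\mathbb{R}^3\times K)$ for every compact $K\subset\mathbb{R}^3$.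 $D\in\mathcal{D}_{N,1}$ has locally finite kinetic energy if the weak derivative $\nabla_1\cdot\nabla_2D$ is the kernel of a trace-class operator over $L^2(K)$ for every compact $K\subset\mathbb{R}^3$; equivalently, there is a factorization $D=G^\dagger*G$ a.e. with $G\in L^2(\mathbb{R}^3\times\mathbb{R}^3)$ and $\nabla_2G\in L^2(\mathbb{R}^3\times\mathbb{R}^3_{\mathrm{loc}})$. The density of $D$ is $\rho_D(\mathbf{r})=(G^\dagger*G)(\mathbf{r},\mathbf{r})$ for any factorization $D=G^\dagger*G$ with $G\in L^2(\mathbb{R}^3\times\mathbb{R}^3)$. The current density of $D$ is defined when $D$ has locally finite kinetic energy (so ''$D$ has current $\mathbf{j}$'' includes this property): $\mathbf{j}_{\mathrm{p};D}=\operatorname{Re}\mathbf{c}_D$, with $\mathbf{c}_D(\mathbf{r})=\int[-\mathrm{i}\nabla_2G^*(\mathbf{u},\mathbf{r})]\,G(\mathbf{u},\mathbf{r})\,d\mathbf{u}$ for any factorization $D=G^\dagger*G$ a.e. with $G\in L^2(\mathbb{R}^3\times\mathbb{R}^3)$ and $\nabla_2G\in L^2(\mathbb{R}^3\times\mathbb{R}^3_{\mathrm{loc}})$. These are independent of the factorization (a.e.). *)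

(* Defs.v *)
From HB Require Import structures.
From mathcomp Require Import all_boot all_order all_algebra complex.
From mathcomp Require Import all_classical all_reals all_analysis.

Set Implicit Arguments.
Unset Strict Implicit.
Unset Printing Implicit Defensive.

Import Order.TTheory GRing.Theory Num.Theory.
Import numFieldNormedType.Exports.

Local Open Scope classical_set_scope.
Local Open Scope ring_scope.
Local Open Scope complex_scope.

(* [measurableTypeR R] is [R] with its Borel sigma-algebra, so measurability
   below is Borel measurability. *)
Notation R3 R := (measurableTypeR R * measurableTypeR R * measurableTypeR R)%type.

Section ProductSigmaFinite.
Local Open Scope ereal_scope.
Context d1 d2 (T1 : measurableType d1) (T2 : measurableType d2) (R : realType).
Variable m1 : {sigma_finite_measure set T1 -> \bar R}.
Variable m2 : {sigma_finite_measure set T2 -> \bar R}.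

Lemma product_sigma_finite : sigma_finite setT (m1 \x m2).
Proof.
have /sigma_finiteP[F [TF ndF Foo]] := sigma_finiteT m1.
have /sigma_finiteP[G [TG ndG Goo]] := sigma_finiteT m2.
exists (fun n => F n `*` G n).
 rewrite -setXTT TF TG predeqE => -[x y]; split.
    move=> [/= [n _ Fnx] [k _ Gky]]; exists (maxn n k) => //; split.
    - by move: x Fnx; exact/subsetPset/ndF/leq_maxl.
    - by move: y Gky; exact/subsetPset/ndG/leq_maxr.
  by move=> [n _ []/= ? ?]; split; exists n.
move=> k; have [? ?] := Foo k; have [? ?] := Goo k.
split; first exact: measurableX.
by rewrite product_measure1E// lte_mul_pinfty// ge0_fin_numE.
Qed.

End ProductSigmaFinite.

Section Space.
Context {R : realType}.

Definition leb2 := (@lebesgue_measure R \x @lebesgue_measure R)%E.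
HB.instance Definition _ := Measure.on leb2.
(* The instance of the library for a product of sigma-finite measures is
   shadowed by the one for subprobabilities, hence this declaration. *)
HB.instance Definition _ :=
  Measure_isSigmaFinite.Build _ _ _ leb2 (product_sigma_finite _ _).

Definition leb3 := (leb2 \x @lebesgue_measure R)%E.
HB.instance Definition _ := Measure.on leb3.
HB.instance Definition _ :=
  Measure_isSigmaFinite.Build _ _ _ leb3 (product_sigma_finite _ _).

Definition leb6 := (leb3 \x leb3)%E.
HB.instance Definition _ := Measure.on leb6.
HB.instance Definition _ :=
  Measure_isSigmaFinite.Build _ _ _ leb6 (product_sigma_finite _ _).

Definition basis3 (a : 'I_3) : R3 R :=
  ((a == 0 :> nat)%N%:R, (a == 1 :> nat)%N%:R, (a == 2 :> nat)%N%:R).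

Definition sqnorm3 (r : R3 R) : R := r.1.1 ^+ 2 + r.1.2 ^+ 2 + r.2 ^+ 2.

End Space.

Section Distributions.
Context {R : realType} {V : normedModType R}.

Fixpoint iter_derive (vs : seq V) (phi : V -> R) : V -> R :=
  if vs is v :: vs' then 'D_v (iter_derive vs' phi) else phi.

(* In finite dimension this is C^oo: all iterated directional derivatives
   exist everywhere and are continuous. *)
Definition smooth (phi : V -> R) : Prop :=
  forall vs : seq V, continuous (iter_derive vs phi) /\
    forall x v, derivable (iter_derive vs phi) x v.

Definition test_function (phi : V -> R) : Prop :=
  smooth phi /\ compact (closure [set x | phi x != 0]).

End Distributions.

(* [compact] needs a topological and [integrable] a measurable type; the library
   has no structure joining the two, so R^3 and R^6 are treated separately. *)
Definition L1_loc3 {R : realType} (f : R3 R -> R) : Prop :=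
  measurable_fun setT f /\
  forall K : set (R3 R), compact K -> leb3.-integrable K (EFin \o f).

Definition L1_loc6 {R : realType} (f : R3 R * R3 R -> R) : Prop :=
  measurable_fun setT f /\
  forall K : set (R3 R * R3 R), compact K -> leb6.-integrable K (EFin \o f).

Section WeakDerivatives.
Context {R : realType}.

(* [g] is the weak derivative of [f] in the direction [v]. *)
Definition weak_derivative3 (f g : R3 R -> R) (v : R3 R) : Prop :=
  [/\ L1_loc3 f, L1_loc3 g &
    forall phi : R3 R -> R, test_function phi ->
      \int[leb3]_x (f x * 'D_v phi x) = - \int[leb3]_x (g x * phi x)].

Definition weak_derivative6 (f g : R3 R * R3 R -> R) (v : R3 R * R3 R) : Prop :=
  [/\ L1_loc6 f, L1_loc6 g &
    forall phi : R3 R * R3 R -> R, test_function phi ->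
      \int[leb6]_p (f p * 'D_v phi p) = - \int[leb6]_p (g p * phi p)].

(* [V a] is the weak derivative of [G] with respect to the [a]-th coordinate of
   the second argument. *)
Definition weak_gradient2 (G : R3 R * R3 R -> R[i])
    (V : 'I_3 -> R3 R * R3 R -> R[i]) : Prop :=
  forall a,
    weak_derivative6
      (@complex.Re R \o G) (@complex.Re R \o V a) (0, basis3 a) /\
    weak_derivative6
      (@complex.Im R \o G) (@complex.Im R \o V a) (0, basis3 a).

(* [g] is the weak derivative [nabla_1 . nabla_2 f]; integrating by parts twice
   produces no sign. *)
Definition weak_div12 (f g : R3 R * R3 R -> R) : Prop :=
  [/\ L1_loc6 f, L1_loc6 g &
    forall phi : R3 R * R3 R -> R, test_function phi ->
      \int[leb6]_p
        (f p * \sum_(a < 3) 'D_(basis3 a, 0) ('D_(0, basis3 a) phi) p) =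
      \int[leb6]_p (g p * phi p)].

Definition weak_div12C (D T : R3 R * R3 R -> R[i]) : Prop :=
  weak_div12 (@complex.Re R \o D) (@complex.Re R \o T) /\
  weak_div12 (@complex.Im R \o D) (@complex.Im R \o T).

End WeakDerivatives.

Section ComplexIntegration.
Context {R : realType} d {T : measurableType d}.
Variable mu : {measure set T -> \bar R}.

Definition cintegral (A : set T) (f : T -> R[i]) : R[i] :=
  (\int[mu]_(x in A) complex.Re (f x)) +i*
  (\int[mu]_(x in A) complex.Im (f x)).

Definition sqnormC (z : R[i]) : R := complex.Re z ^+ 2 + complex.Im z ^+ 2.

Definition L2 (A : set T) (f : T -> R[i]) : Prop :=
  [/\ measurable_fun A (@complex.Re R \o f),
      measurable_fun A (@complex.Im R \o f) &
      (\int[mu]_(x in A) (sqnormC (f x))%:E < +oo)%E].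

End ComplexIntegration.

(* Hilbert-Schmidt kernels on L^2(K), for K a measurable subset of R^3. *)
Section Kernels.
Context {R : realType}.
Variable K : set (R3 R).
Implicit Types (f : R3 R -> R[i]) (B C P : R3 R * R3 R -> R[i]).

Definition inner f g : R[i] := cintegral leb3 K (fun x => (f x)^*%C * g x).

Definition L2_onb (e : nat -> R3 R -> R[i]) : Prop :=
  [/\ forall k, L2 leb3 K (e k),
      forall j k, inner (e j) (e k) = (j == k)%:R &
      forall f, L2 leb3 K f ->
        (fun n => \int[leb3]_(x in K)
           (sqnormC (f x - \sum_(k < n) inner (e k) f * e k x))%:E)%E
          @ \oo --> 0%E].

Definition kernel_form B f : R[i] :=
  cintegral leb6 (K `*` K) (fun p => (f p.1)^*%C * B p * f p.2).

Definition kernel_mul B C : R3 R * R3 R -> R[i] :=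
  fun p => cintegral leb3 K (fun z => B (p.1, z) * C (z, p.2)).

Definition kernel_adj B : R3 R * R3 R -> R[i] := fun p => (B (p.2, p.1))^*%C.

(* In the order of [R[i]], [0 <= z] says that [z] is real and nonnegative. *)
Definition kernel_psd B : Prop :=
  forall f, L2 leb3 K f -> 0 <= kernel_form B f.

(* [P] is the kernel of [|B| = sqrt (B^dagger B)]. *)
Definition kernel_abs B P : Prop :=
  [/\ L2 leb6 (K `*` K) P, kernel_psd P &
      {ae leb6, forall p, (K `*` K) p ->
         kernel_mul P P p = kernel_mul (kernel_adj B) B p}].

(* Tr |B| < +oo. The trace of the nonnegative operator |B| is the same in every
   orthonormal basis. The quantifier also covers null sets K, for which
   L^2(K) = 0 has no orthonormal sequence. Trace-class operators are
   Hilbert-Schmidt, so their kernels are in L^2. *)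
Definition trace_class_kernel B : Prop :=
  L2 leb6 (K `*` K) B /\
  exists2 P, kernel_abs B P &
    forall e, L2_onb e ->
      (\sum_(0 <= k <oo) (complex.Re (kernel_form P (e k)))%:E < +oo)%E.

Definition has_trace B (t : R[i]) : Prop :=
  forall e, L2_onb e ->
    series (fun k => complex.Re (kernel_form B (e k))) @ \oo --> complex.Re t /\
    series (fun k => complex.Im (kernel_form B (e k))) @ \oo --> complex.Im t.

End Kernels.

Section ReducedDensityMatrices.
Context {R : realType}.
Implicit Types (D G : R3 R * R3 R -> R[i]) (V : 'I_3 -> R3 R * R3 R -> R[i]).

Definition rdm1 (N : nat) D : Prop :=
  [/\ trace_class_kernel setT D,
      {ae leb6, forall p, D p = (D (p.2, p.1))^*%C},
      forall phi, L2 leb3 setT phi ->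
        0 <= kernel_form setT D phi <= 2 * inner setT phi phi &
      has_trace setT D N%:R].

Definition factorization D G : Prop :=
  L2 leb6 setT G /\
  {ae leb6, forall p, D p = kernel_mul setT (kernel_adj G) G p}.

(* A factorization together with a representative [V] of [nabla_2 G], which
   lies in L^2(R^3 x R^3_loc). *)
Definition regular_factorization D G V : Prop :=
  [/\ factorization D G, weak_gradient2 G V &
      forall a (K : set (R3 R)), compact K -> L2 leb6 (setT `*` K) (V a)].

Definition locally_finite_kinetic_energy D : Prop :=
  exists2 T : R3 R * R3 R -> R[i], weak_div12C D T &
    forall K : set (R3 R), compact K -> trace_class_kernel K T.

Definition has_density D (rho : R3 R -> R) : Prop :=
  (exists G, factorization D G) /\
  forall G, factorization D G ->
    {ae leb3, forall r, kernel_mul setT (kernel_adj G) G (r, r) = (rho r)%:C}.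

(* The [a]-th component of c_D computed from [G] and [V = nabla_2 G]; the weak
   gradient of G^* is the conjugate of that of G. *)
Definition complex_current G V (a : 'I_3) (r : R3 R) : R[i] :=
  cintegral leb3 setT (fun u => - 'i%C * (V a (u, r))^*%C * G (u, r)).

Definition has_paramagnetic_current D (j : 'I_3 -> R3 R -> R) : Prop :=
  [/\ locally_finite_kinetic_energy D,
      exists G V, regular_factorization D G V &
      forall G V, regular_factorization D G V ->
        forall a, {ae leb3, forall r,
          complex.Re (complex_current G V a r) = j a r}].

End ReducedDensityMatrices.

(* Main.v *)
(** The density matrix is a superposition, over a centre [u], of orbitals
    localized near [u] and carrying a linear phase:
      G(u, x) = sqrt (rho x) g(u - x) exp (i theta(u, x)),
      theta(u, x) = 1/2 sum_b (u_b - x_b) kappa_b(x),    D = G^dagger * G,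
    where [g] is an even C^1 product cutoff supported in the cube of side [2d]
    with [int g^2 = 1]. The density of [D] is [rho]. Only the phase contributes
    to the current, and since the first moments of [g^2] vanish it contributes
    [rho kappa / 2]. As [|u - x|] is bounded on the support of [g], the kinetic
    energy is locally controlled by [|grad rho|^2 / rho], [rho],
    [rho kappa^2] and [rho |grad kappa|^2].

    The bound [D <= 2] is obtained by choosing [d]: by Cauchy-Schwarz on the
    cube around [u], the norm of [D] is at most a constant times the largest
    mass that [rho] puts in a cube of side [2d], which is small with [d] as
    [rho] is integrable.

    Weak derivatives are computed through absolute continuity along almost
    every line, where the product rule, the chain rule and the square root are
    elementary. That density and current do not depend on the factorization
    follows from the separability of L^2: if the integral of
    [sum_i P_i(u, r) Q_i(u, s)] over [u] vanishes for a.e. [(r, s)], then it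
    vanishes for [s = r] and a.e. [r], since a.e. slice [Q_i(., r)] is a limit
    of slices [Q_i(., s)] with [s] outside a null set. *)

Require Import Defs.
From mathcomp Require Import finmap.
From HB Require Import structures.
From mathcomp Require Import all_boot all_order all_algebra complex.
From mathcomp Require Import all_classical all_reals all_analysis.
From mathcomp Require Import measurable_realfun ring lra.

Set Implicit Arguments.
Unset Strict Implicit.
Unset Printing Implicit Defensive.

Import Order.TTheory GRing.Theory Num.Theory.
Import numFieldNormedType.Exports.

Local Open Scope classical_set_scope.
Local Open Scope ring_scope.

(** * Real integrals *)

(** A single orbital with a phase [S] has current proportional to [rho grad S], hence a curl-free
    velocity. An arbitrary [kappa] is reached because every centre [u] carries its own phase: its
    gradient at [x] is [- kappa(x) / 2] plus a term odd in [u - x], which averaging over [u]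
    removes. The minus sign is undone by the convention [- i (nabla_2 G)^* G] for the current.

    The obstacle to a direct computation is that the factors of [G] are differentiable only weakly
    and that products of their derivatives are not locally integrable for free. Along a line each
    factor is absolutely continuous, hence bounded, so products and compositions can be
    differentiated first, and integrability is checked once, on the final expression, by the energy
    bound.

    The constants come from the bound [D <= 2]. The form of [D] expands into four real squared
    norms, each entering with a factor 2, so each kernel [A], [B] may have squared norm at most 1/2.
    For the explicit cutoff this squared norm is at most [15 eps], where [eps] bounds the mass of
    [rho] in the small cubes; hence [eps = 1/30]. *)

Section RealIntegrals.
Context d (T : measurableType d) (R : realType).
Variable mu : {measure set T -> \bar R}.
Implicit Types f g : T -> R.

Definition ig f : Prop := mu.-integrable setT (EFin \o f).

Lemma ae_mono2 (P Q S : T -> Prop) : (forall x, P x -> Q x -> S x) ->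
  {ae mu, forall x, P x} -> {ae mu, forall x, Q x} -> {ae mu, forall x, S x}.
Proof. by move=> h; exact: filterS2. Qed.

Lemma ae_mono (P S : T -> Prop) : (forall x, P x -> S x) ->
  {ae mu, forall x, P x} -> {ae mu, forall x, S x}.
Proof. by move=> h; exact: filterS. Qed.

Lemma ig_meas f : ig f -> measurable_fun setT f.
Proof. by case/integrableP => /measurable_EFinP. Qed.

Lemma igP f : ig f <->
  measurable_fun setT f /\ (\int[mu]_x `|f x|%:E < +oo)%E.
Proof.
split.
  by move=> h; split; [exact: ig_meas|case/integrableP: h].
by move=> [mf fi]; apply/integrableP; split => //; exact/measurable_EFinP.
Qed.

Lemma ig_le f g : measurable_fun setT f -> (forall x, `|f x| <= g x) ->
  ig g -> ig f.
Proof.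
move=> mf fg ig_g; apply: (le_integrable _ _ _ ig_g) => //.
  exact/measurable_EFinP.
by move=> x _ /=; rewrite lee_fin (le_trans (fg x))// ler_norm.
Qed.

Lemma igD f g : ig f -> ig g -> ig (fun x => f x + g x).
Proof. by move=> hf hg; exact: (integrableD _ hf hg). Qed.

Lemma igZ (c : R) f : ig f -> ig (fun x => c * f x).
Proof. by move=> hf; exact: (integrableZl _ c hf). Qed.

Lemma igN f : ig f -> ig (fun x => - f x).
Proof. by move=> hf; exact: (integrableN hf). Qed.

Lemma igB f g : ig f -> ig g -> ig (fun x => f x - g x).
Proof. by move=> hf hg; apply: igD => //; exact: igN. Qed.

Lemma ig0 : ig (fun=> 0).
Proof. exact: integrable0. Qed.

Lemma ig_norm f : ig f -> ig (fun x => `|f x|).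
Proof. by move=> hf; exact: (integrable_norm hf). Qed.

Lemma ig_sum (I : Type) (s : seq I) (h : I -> T -> R) :
  (forall i, ig (h i)) -> ig (fun x => \sum_(i <- s) h i x).
Proof.
move=> hi; elim: s => [|i s ih].
  by under eq_fun do rewrite big_nil; exact: ig0.
by under eq_fun do rewrite big_cons; exact: igD.
Qed.

Lemma ig_ae f g : measurable_fun setT g ->
  {ae mu, forall x, f x = g x} -> ig f -> ig g.
Proof.
move=> mg fg /igP[mf fi]; apply/igP; split => //.
rewrite -(@ge0_ae_eq_integral _ _ _ mu setT (fun x => `|f x|%:E))//.
- by apply/measurable_EFinP; apply: measurableT_comp.
- by apply/measurable_EFinP; apply: measurableT_comp.
by apply: filterS fg => x -> _.
Qed.

Lemma rint_ae f g : measurable_fun setT f -> measurable_fun setT g ->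
  {ae mu, forall x, f x = g x} -> \int[mu]_x f x = \int[mu]_x g x.
Proof.
move=> mf mg fg; congr fine; apply: ae_eq_integral => //.
- exact/measurable_EFinP.
- exact/measurable_EFinP.
by apply: filterS fg => x -> _.
Qed.

Lemma rintD f g : ig f -> ig g ->
  \int[mu]_x (f x + g x) = \int[mu]_x f x + \int[mu]_x g x.
Proof. by move=> hf hg; rewrite RintegralD. Qed.

Lemma rintB f g : ig f -> ig g ->
  \int[mu]_x (f x - g x) = \int[mu]_x f x - \int[mu]_x g x.
Proof. by move=> hf hg; rewrite RintegralB. Qed.

Lemma rintZ (c : R) f : ig f -> \int[mu]_x (c * f x) = c * \int[mu]_x f x.
Proof. by move=> hf; rewrite RintegralZl. Qed.

Lemma rintN f : ig f -> \int[mu]_x (- f x) = - \int[mu]_x f x.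
Proof.
move=> hf; under eq_Rintegral do rewrite -mulN1r.
by rewrite rintZ// mulN1r.
Qed.

Lemma rint0 : \int[mu]_x (0 : R) = 0.
Proof. by rewrite /Rintegral integral0. Qed.

Lemma rint_sum (I : Type) (s : seq I) (h : I -> T -> R) :
  (forall i, ig (h i)) ->
  \int[mu]_x (\sum_(i <- s) h i x) = \sum_(i <- s) \int[mu]_x h i x.
Proof.
move=> hi; elim: s => [|i s ih].
  by rewrite big_nil; under eq_Rintegral do rewrite big_nil; exact: rint0.
rewrite big_cons -ih -rintD//; last exact: ig_sum.
by under eq_Rintegral do rewrite big_cons.
Qed.

Lemma rint_le f g : ig f -> ig g -> (forall x, f x <= g x) ->
  \int[mu]_x f x <= \int[mu]_x g x.
Proof. by move=> hf hg fg; apply: le_Rintegral => // x _; exact: fg. Qed.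

Lemma rint_ge0 f : (forall x, 0 <= f x) -> 0 <= \int[mu]_x f x.
Proof. by move=> f0; apply: Rintegral_ge0 => x _; exact: f0. Qed.

Lemma EFin_rint f : ig f -> ((\int[mu]_x f x)%:E = \int[mu]_x (f x)%:E)%E.
Proof. by move=> hf; rewrite fineK//; exact: (integrable_fin_num _ hf). Qed.

Lemma rint_normle f : ig f -> `|\int[mu]_x f x| <= \int[mu]_x `|f x|.
Proof. by move=> hf; apply: le_normr_Rintegral. Qed.

Lemma rint_dct (f_ : nat -> T -> R) f g :
  (forall n, measurable_fun setT (f_ n)) -> measurable_fun setT f ->
  {ae mu, forall x, f_ n x @[n --> \oo] --> f x} -> ig g ->
  (forall n x, `|f_ n x| <= g x) ->
  ig f /\ \int[mu]_x f_ n x @[n --> \oo] --> \int[mu]_x f x.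
Proof.
move=> mf_ mf cf hg fg.
have [||||h1 _ h3] := @dominated_convergence _ _ _ mu setT measurableT
  (fun n => EFin \o f_ n) (EFin \o f) (EFin \o g)
  _ _ _ hg _.
  by move=> n; exact/measurable_EFinP.
  exact/measurable_EFinP.
  by apply: filterS cf => x cx _; apply: cvg_EFin => //; exact: nearW.
  by apply: nearW => x n _; rewrite lee_fin.
split => //; apply: fine_cvg; rewrite fineK//.
exact: (integrable_fin_num _ h1).
Qed.

Lemma ig_indic (A : set T) : measurable A -> (mu A < +oo)%E -> ig (\1_A).
Proof.
move=> mA Afin; apply/igP; split; first exact: measurable_indic.
rewrite (eq_integral (fun x => (\1_A x)%:E)); last first.
  by move=> t _; rewrite ger0_norm.
by rewrite integral_indic// setIT.
Qed.

Lemma rint_indic (A : set T) : measurable A ->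
  \int[mu]_x (\1_A x : R) = fine (mu A).
Proof. by move=> mA; rewrite /Rintegral integral_indic// setIT. Qed.

Lemma ig_bounded_mul f g (M : R) : measurable_fun setT f ->
  (forall x, `|f x| <= M) -> ig g -> ig (fun x => f x * g x).
Proof.
move=> mf fM hg; apply: (@ig_le _ (fun x => M * `|g x|)).
- by apply: measurable_funM => //; exact: ig_meas.
- by move=> x; rewrite normrM ler_wpM2r.
- by apply: igZ; exact: ig_norm.
Qed.

Lemma norm_indic_le1 (A : set T) x : `|\1_A x : R| <= 1.
Proof. by rewrite indicE ger0_norm// lern1; case: (_ \in _). Qed.

Lemma ig_indicM (A : set T) f : measurable A -> ig f -> ig (fun x => \1_A x * f x).
Proof.
move=> mA hf; by apply: (@ig_bounded_mul _ _ 1) => // x; exact: norm_indic_le1.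
Qed.

End RealIntegrals.

(** * Fubini and Tonelli for real-valued integrals *)

Section RealFubini.
Context d1 d2 (T1 : measurableType d1) (T2 : measurableType d2) (R : realType).
Variable m1 : {sigma_finite_measure set T1 -> \bar R}.
Variable m2 : {sigma_finite_measure set T2 -> \bar R}.
Implicit Types f : T1 * T2 -> R.

(** Tonelli makes the integrals of the positive and negative parts measurable; the real integral is
    [fine] of their difference, so slices that are not integrable, where it takes a default value,
    do no harm. *)
Lemma measurable_par1 f : measurable_fun setT f ->
  measurable_fun setT (fun x => \int[m2]_y f (x, y)).
Proof.
move=> /measurable_EFinP mf; apply: measurableT_comp => //.
under eq_fun do rewrite integralE.
apply: emeasurable_funB.
  apply: (eq_measurable_fun (fubini_F m2 (EFin \o f)^\+%E)).
    by move=> ? _; apply: eq_integral => ? _; rewrite !funeposE.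
  by apply: measurable_fun_fubini_tonelli_F => //; exact: measurable_funepos.
apply: (eq_measurable_fun (fubini_F m2 (EFin \o f)^\-%E)).
  by move=> ? _; apply: eq_integral => ? _; rewrite !funenegE.
by apply: measurable_fun_fubini_tonelli_F => //; exact: measurable_funeneg.
Qed.

Lemma measurable_par2 f : measurable_fun setT f ->
  measurable_fun setT (fun y => \int[m1]_x f (x, y)).
Proof.
move=> /measurable_EFinP mf; apply: measurableT_comp => //.
under eq_fun do rewrite integralE.
apply: emeasurable_funB.
  apply: (eq_measurable_fun (fubini_G m1 (EFin \o f)^\+%E)).
    by move=> ? _; apply: eq_integral => ? _; rewrite !funeposE.
  by apply: measurable_fun_fubini_tonelli_G => //; exact: measurable_funepos.
apply: (eq_measurable_fun (fubini_G m1 (EFin \o f)^\-%E)).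
  by move=> ? _; apply: eq_integral => ? _; rewrite !funenegE.
by apply: measurable_fun_fubini_tonelli_G => //; exact: measurable_funeneg.
Qed.

Lemma ig_tonelli1 f : measurable_fun setT f ->
  (\int[m1]_x \int[m2]_y `|f (x, y)|%:E < +oo)%E -> ig (m1 \x m2)%E f.
Proof.
by move=> mf fi; apply/integrable12ltyP => //; exact/measurable_EFinP.
Qed.

Lemma ig_tonelli2 f : measurable_fun setT f ->
  (\int[m2]_y \int[m1]_x `|f (x, y)|%:E < +oo)%E -> ig (m1 \x m2)%E f.
Proof.
by move=> mf fi; apply/integrable21ltyP => //; exact/measurable_EFinP.
Qed.

(** Integrability of the slices belongs to the hypothesis because the real integral of a
    non-integrable function is a default value, whose bound would carry no information. *)
Lemma ig_tonelli1' f (g : T1 -> R) : measurable_fun setT f ->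
  {ae m1, forall x, ig m2 (fun y => f (x, y)) /\
     \int[m2]_y `|f (x, y)| <= g x} -> ig m1 g ->
  ig (m1 \x m2)%E f.
Proof.
move=> mf h hg; apply: ig_tonelli1 => //.
have mF : measurable_fun setT (fun x => \int[m2]_y `|(f (x, y))%:E|)%E.
  apply: (measurable_fun_fubini_tonelli_F (fun p => `|(f p)%:E|)%E) => //.
  by apply: measurableT_comp => //; exact/measurable_EFinP.
apply: (@le_lt_trans _ _ (\int[m1]_x `|g x|%:E)%E); last by case/igP: hg.
apply: ae_ge0_le_integral => //.
- by move=> x _; apply: integral_ge0 => y _; rewrite lee_fin.
- by apply/measurable_EFinP; apply: measurableT_comp => //; exact: ig_meas hg.
apply: filterS h => x [hx1 hx2] _.
rewrite -EFin_rint; last exact: ig_norm.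
by rewrite lee_fin (le_trans hx2)// ler_norm.
Qed.

Lemma ig_tonelli2' f (g : T2 -> R) : measurable_fun setT f ->
  {ae m2, forall y, ig m1 (fun x => f (x, y)) /\
     \int[m1]_x `|f (x, y)| <= g y} -> ig m2 g ->
  ig (m1 \x m2)%E f.
Proof.
move=> mf h hg; apply: ig_tonelli2 => //.
have mF : measurable_fun setT (fun y => \int[m1]_x `|(f (x, y))%:E|)%E.
  apply: (measurable_fun_fubini_tonelli_G (fun p => `|(f p)%:E|)%E) => //.
  by apply: measurableT_comp => //; exact/measurable_EFinP.
apply: (@le_lt_trans _ _ (\int[m2]_x `|g x|%:E)%E); last by case/igP: hg.
apply: ae_ge0_le_integral => //.
- by move=> x _; apply: integral_ge0 => y _; rewrite lee_fin.
- by apply/measurable_EFinP; apply: measurableT_comp => //; exact: ig_meas hg.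
apply: filterS h => x [hx1 hx2] _.
rewrite -EFin_rint; last exact: ig_norm.
by rewrite lee_fin (le_trans hx2)// ler_norm.
Qed.

Section integrable.
Variable f : T1 * T2 -> R.
Hypothesis hf : ig (m1 \x m2)%E f.

Lemma rfub_ae1 : {ae m1, forall x, ig m2 (fun y => f (x, y))}.
Proof. exact: (ae_integrable1 hf). Qed.

Lemma rfub_ae2 : {ae m2, forall y, ig m1 (fun x => f (x, y))}.
Proof. exact: (ae_integrable2 hf). Qed.

Lemma rfub_ig1 : ig m1 (fun x => \int[m2]_y f (x, y)).
Proof.
have h := integrable_fubini_F hf.
apply/integrableP; split.
  by apply/measurable_EFinP; apply: measurable_par1; exact: ig_meas hf.
have /integrableP[mF] := h.
apply: le_lt_trans; apply: ae_ge0_le_integral => //.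
- apply/measurable_EFinP; apply: measurableT_comp => //.
  by apply: measurable_par1; exact: ig_meas hf.
- exact: measurableT_comp.
(* The real and the extended inner integrals are compared on the integrable slices, that is, almost
   everywhere. *)
by apply: filterS rfub_ae1 => x hx _; rewrite /comp EFin_rint.
Qed.

Lemma rfub_ig2 : ig m2 (fun y => \int[m1]_x f (x, y)).
Proof.
have mf := ig_meas hf.
apply/igP; split; first exact: measurable_par2.
have := (integrable21ltyP m1 m2 (measurable_int _ hf)).1 hf.
apply: le_lt_trans; apply: ae_ge0_le_integral => //.
- apply/measurable_EFinP; apply: measurableT_comp => //.
  exact: measurable_par2.
- by move=> x _; apply: integral_ge0.
- apply: (measurable_fun_fubini_tonelli_G (fun p => `|(f p)%:E|)%E) => //.
  by apply: measurableT_comp => //; exact/measurable_EFinP.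
apply: filterS rfub_ae2 => x hx _.
rewrite -EFin_rint; last exact: ig_norm.
by rewrite lee_fin; exact: rint_normle.
Qed.

Lemma rfub1 :
  \int[(m1 \x m2)%E]_p f p = \int[m1]_x \int[m2]_y f (x, y).
Proof.
rewrite /Rintegral -(integral12_prod_meas1 hf); congr fine.
apply: ae_eq_integral => //.
- by have /integrableP[] := integrable_fubini_F hf.
- by have /integrableP[] := rfub_ig1.
by apply: filterS rfub_ae1 => x hx _; rewrite [RHS]EFin_rint.
Qed.

Lemma rfub2 :
  \int[(m1 \x m2)%E]_p f p = \int[m2]_y \int[m1]_x f (x, y).
Proof.
rewrite /Rintegral -(integral21_prod_meas1 hf); congr fine.
apply: ae_eq_integral => //.
- exact: measurable_fubini_G hf.
- by have /integrableP[] := rfub_ig2.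
by apply: filterS rfub_ae2 => x hx _; rewrite [RHS]EFin_rint.
Qed.

Lemma rfub12 : \int[m1]_x \int[m2]_y f (x, y) = \int[m2]_y \int[m1]_x f (x, y).
Proof. by rewrite -rfub1 rfub2. Qed.

End integrable.

End RealFubini.

(** * Null sets in product spaces *)

Section AeProduct.
Context d1 d2 (T1 : measurableType d1) (T2 : measurableType d2) (R : realType).
Variable m1 : {sigma_finite_measure set T1 -> \bar R}.
Variable m2 : {sigma_finite_measure set T2 -> \bar R}.

Lemma null_xsection (N : set (T1 * T2)) : measurable N ->
  (m1 \x m2)%E N = 0%E <-> {ae m1, forall x, m2 (xsection N x) = 0%E}.
Proof.
move=> mN; rewrite /product_measure1.
have mF := measurable_fun_xsection m2 mN.
have -> : (\int[m1]_x (m2 \o xsection N) x)%E = (\int[m1]_x `|(m2 \o xsection N) x|)%E.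
  by apply: eq_integral => x _; rewrite gee0_abs.
split.
  move=> /(ae_eq_integral_abs m1 measurableT mF).1.
  by apply: filterS => x; exact.
move=> h; apply/(ae_eq_integral_abs m1 measurableT mF).2.
by apply: filterS h => x hx _.
Qed.

Lemma null_ysection (N : set (T1 * T2)) : measurable N ->
  (m1 \x m2)%E N = 0%E <-> {ae m2, forall y, m1 (ysection N y) = 0%E}.
Proof.
(* The product measure integrates the measures of sections over the first factor; by uniqueness it
   equals [\x^], which integrates them over the second. *)
move=> mN; have -> : (m1 \x m2)%E N = (m1 \x^ m2)%E N.
  by apply: product_measure_unique => // B C mB mC; rewrite /= product_measure2E.
rewrite /product_measure2.
have mF := measurable_fun_ysection m1 mN.
have -> : (\int[m2]_x (m1 \o ysection N) x)%E = (\int[m2]_x `|(m1 \o ysection N) x|)%E.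
  by apply: eq_integral => x _; rewrite gee0_abs.
split.
  move=> /(ae_eq_integral_abs m2 measurableT mF).1.
  by apply: filterS => x; exact.
move=> h; apply/(ae_eq_integral_abs m2 measurableT mF).2.
by apply: filterS h => x hx _.
Qed.

Lemma ae_prod_ae1 (S : T1 * T2 -> Prop) :
  {ae (m1 \x m2)%E, forall p, S p} ->
  {ae m1, forall x, {ae m2, forall y, S (x, y)}}.
Proof.
move=> [N [mN N0 SN]]; apply: filterS ((null_xsection mN).1 N0) => x Nx.
exists (xsection N x); split => //; first exact: measurable_xsection.
by move=> y nS; rewrite /xsection/= inE; apply: SN.
Qed.

Lemma ae_prod_ae2 (S : T1 * T2 -> Prop) :
  {ae (m1 \x m2)%E, forall p, S p} ->
  {ae m2, forall y, {ae m1, forall x, S (x, y)}}.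
Proof.
move=> [N [mN N0 SN]]; apply: filterS ((null_ysection mN).1 N0) => x Nx.
exists (ysection N x); split => //; first exact: measurable_ysection.
by move=> y nS; rewrite /ysection/= inE; apply: SN.
Qed.

(** Converse of [ae_prod_ae1]. Measurability is essential: Fubini says nothing about a
    non-measurable set all of whose sections are null. *)
Lemma ae1_ae_prod (S : T1 * T2 -> Prop) : measurable [set p | S p] ->
  {ae m1, forall x, {ae m2, forall y, S (x, y)}} ->
  {ae (m1 \x m2)%E, forall p, S p}.
Proof.
move=> mS h; apply/negligibleP; first exact: measurableC.
apply/null_xsection; first exact: measurableC.
apply: filterS h => x hx; apply: measure_negligible.
  by apply: measurable_xsection; exact: measurableC.
by apply: negligibleS hx => y; rewrite /xsection/= inE.
Qed.

Lemma ae2_ae_prod (S : T1 * T2 -> Prop) : measurable [set p | S p] ->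
  {ae m2, forall y, {ae m1, forall x, S (x, y)}} ->
  {ae (m1 \x m2)%E, forall p, S p}.
Proof.
move=> mS h; apply/negligibleP; first exact: measurableC.
apply/null_ysection; first exact: measurableC.
apply: filterS h => x hx; apply: measure_negligible.
  by apply: measurable_ysection; exact: measurableC.
by apply: negligibleS hx => y; rewrite /ysection/= inE.
Qed.

End AeProduct.

(** * Change of variables under a measure-preserving map *)

Section MeasurePreserving.
Context d (T : measurableType d) (R : realType).
Variable mu : {measure set T -> \bar R}.
Variable phi : T -> T.
Hypothesis mphi : measurable_fun setT phi.
Hypothesis muphi : forall A, measurable A -> mu (phi @^-1` A) = mu A.

Lemma preserving_ge0_integral (f : T -> \bar R) : measurable_fun setT f ->
  (forall x, 0 <= f x)%E -> (\int[mu]_x f (phi x) = \int[mu]_x f x)%E.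
Proof.
move=> mf f0.
have := @ge0_integral_pushforward _ _ _ _ R phi mphi mu setT f measurableT mf
  (fun x _ => f0 x).
rewrite preimage_setT => <-; apply: eq_measure_integral => A mA _.
exact: muphi.
Qed.

Lemma preserving_ig (f : T -> R) : ig mu f -> ig mu (fun x => f (phi x)).
Proof.
move=> /igP[mf fi]; apply/igP; split; first exact: measurableT_comp.
rewrite (preserving_ge0_integral (f := fun x => `|f x|%:E))//.
by apply/measurable_EFinP; apply: measurableT_comp.
Qed.

Lemma preserving_rint (f : T -> R) : measurable_fun setT f ->
  \int[mu]_x f (phi x) = \int[mu]_x f x.
Proof.
move=> mf; have mf' : measurable_fun setT (EFin \o f) by exact/measurable_EFinP.
have hp := preserving_ge0_integral (measurable_funepos mf')
  (fun x => funepos_ge0 _ x).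
have hn := preserving_ge0_integral (measurable_funeneg mf')
  (fun x => funeneg_ge0 _ x).
rewrite /Rintegral integralE [in RHS]integralE -hp -hn; congr (fine (_ - _)%E).
  by apply: eq_integral => x _; rewrite !funeposE.
by apply: eq_integral => x _; rewrite !funenegE.
Qed.

End MeasurePreserving.

(** * Cubes as a compact exhaustion of the space *)

Section Cubes.
Context {R : realType}.
Local Notation mu := (@lebesgue_measure R).

Definition cube (r : R) : set (R3 R) :=
  (`[- r, r]%classic `*` `[- r, r]%classic) `*` `[- r, r]%classic.

Lemma cubeP r x : cube r x <-> [/\ `|x.1.1| <= r, `|x.1.2| <= r & `|x.2| <= r].
Proof.
rewrite /cube/= !in_itv/= -!ler_norml; split.
  by move=> [[]].
by move=> [].
Qed.

Lemma measurable_cube r : measurable (cube r).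
Proof. by apply: measurableX => //; exact: measurableX. Qed.

Lemma compact_cube r : compact (cube r).
Proof.
by apply: compact_setX; [apply: compact_setX|]; exact: segment_compact.
Qed.

Lemma leb3X (A B C : set (measurableTypeR R)) :
  measurable A -> measurable B -> measurable C ->
  leb3 ((A `*` B) `*` C) = (mu A * mu B * mu C)%E.
Proof.
move=> mA mB mC; rewrite [LHS]product_measure1E//; last exact: measurableX.
by congr (_ * _)%E; exact: product_measure1E.
Qed.

Lemma leb3_cube_lty r : (leb3 (cube r) < +oo)%E.
Proof.
rewrite /cube leb3X// !lebesgue_measure_itv/=.
by case: ifP => _; rewrite -?EFinB -?EFinM ltry.
Qed.

Lemma compact_sub_cube (K : set (R3 R)) : compact K ->
  exists n : nat, K `<=` cube n%:R.
Proof.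
move=> /compact_bounded[M [_ hM]].
exists (Num.truncn (`|M| + 1)).+1 => x Kx.
have /hM : M < `|M| + 1 by rewrite (le_lt_trans (ler_norm M))// ltrDl.
move=> /(_ x Kx) h.
have {}h : Num.max (Num.max `|x.1.1| `|x.1.2|) `|x.2| <= `|M| + 1 by exact: h.
have h' := le_trans h (ltW (truncnS_gt _)).
by move: h'; rewrite !ge_max => /andP[/andP[? ?] ?]; apply/cubeP.
Qed.

Lemma compact6_sub_cube (K : set (R3 R * R3 R)) : compact K ->
  exists n : nat, K `<=` cube n%:R `*` cube n%:R.
Proof.
move=> /compact_bounded[M [_ hM]].
exists (Num.truncn (`|M| + 1)).+1 => -[x y] Kx.
have /hM : M < `|M| + 1 by rewrite (le_lt_trans (ler_norm M))// ltrDl.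
move=> /(_ _ Kx) h.
have {}h : Num.max (Num.max (Num.max `|x.1.1| `|x.1.2|) `|x.2|)
  (Num.max (Num.max `|y.1.1| `|y.1.2|) `|y.2|) <= `|M| + 1 by exact: h.
have h' := le_trans h (ltW (truncnS_gt _)).
move: h'; rewrite !ge_max => /andP[/andP[/andP[? ?] ?] /andP[/andP[? ?] ?]].
by split; apply/cubeP.
Qed.

Lemma cube_subset (r s : R) : r <= s -> cube r `<=` cube s.
Proof.
move=> rs x /cubeP[h1 h2 h3]; apply/cubeP.
by rewrite !(le_trans _ rs).
Qed.

Lemma bigcup_cube : \bigcup_n cube n%:R = setT.
Proof.
apply/seteqP; split => // x _.
exists (Num.truncn (`|x.1.1| + `|x.1.2| + `|x.2|)).+1 => //.
have h := ltW (truncnS_gt (`|x.1.1| + `|x.1.2| + `|x.2|)).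
apply/cubeP; split; apply: le_trans h.
- by rewrite -addrA lerDl addr_ge0.
- by rewrite -addrA addrCA lerDl addr_ge0.
- by rewrite lerDr addr_ge0.
Qed.

End Cubes.

(** * Compact sets belong to the product sigma-algebra *)

Section CompactMeasurable.
Context {R : realType}.

(** A compact set is the intersection over [n] of finite unions of balls of radius [1/(n+1)] centred
    in it, so any sigma-algebra containing the balls contains it. This links the product topology
    with the sigma-algebra generated by rectangles. *)
Lemma compact_in_sigma_algebra (V : normedModType R) (M : set (set V)) :
  sigma_algebra setT M -> (forall x (e : R), M (ball x e)) ->
  forall K, compact K -> M K.
Proof.
move=> sM mB K cK.
have [M0 MC MU] := sM.
pose T := g_sigma_algebraType M.
have mM (A : set T) : measurable A -> M A.
  by rewrite /measurable/= sigma_algebra_id.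
have Mm (A : set T) : M A -> measurable A by exact: sub_sigma_algebra.
have /choice[D hD] : forall n : nat, exists D : set V,
    [/\ finite_set D, D `<=` K & K `<=` \bigcup_(x in D) ball x n.+1%:R^-1].
  move=> n; have := cK; rewrite compact_cover => /(_ V K (fun x => (ball x n.+1%:R^-1)°)).
  have h1 i : K i -> open ((ball i n.+1%:R^-1)°) by move=> _; exact: open_interior.
  have h2 : K `<=` cover K (fun x => (ball x n.+1%:R^-1)°).
    by move=> x Kx; exists x => //; apply: nbhsx_ballx; rewrite invr_gt0.
  move=> /(_ h1 h2)[D DK KD]; exists [set` D]; split; first exact: finite_fset.
    by move=> x /DK; rewrite inE.
  by move=> x /KD [y Dy xy]; exists y => //; exact: interior_subset xy.
have -> : K = \bigcap_n \bigcup_(x in D n) ball x n.+1%:R^-1.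
  apply/seteqP; split => [x Kx n _|x Kx]; first by have [_ _] := hD n; apply.
  have /closure_id -> : closed K by apply: compact_closed => //; exact: norm_hausdorff.
  move=> B /nbhs_ballP[e /= e0 eB].
  have [n] : exists n : nat, n.+1%:R^-1 < e.
    exists (Num.truncn e^-1); rewrite invf_plt ?posrE//; exact: truncnS_gt.
  move=> ne.
  have [y Dy xy] := Kx n I.
  exists y; split; first by have [_ DK _] := hD n; exact: DK.
  apply: eB; apply: ball_sym; apply: le_ball xy; exact: ltW.
apply/mM; apply: bigcapT_measurable => n.
apply: fin_bigcup_measurable; first by have [] := hD n.
by move=> x _; apply: Mm; exact: mB.
Qed.

Lemma compact_measurable3 (K : set (R3 R)) : compact K -> measurable K.
Proof.
apply: (@compact_in_sigma_algebra _ (measurable : set (set (R3 R)))).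
  exact: sigma_algebra_measurable.
move=> x e.
have -> : ball x e = (ball x.1.1 e `*` ball x.1.2 e) `*` ball x.2 e by [].
by apply: measurableX; [apply: measurableX|]; exact: measurable_ball.
Qed.

Lemma compact_measurable6 (K : set (R3 R * R3 R)) : compact K -> measurable K.
Proof.
apply: (@compact_in_sigma_algebra _ (measurable : set (set (R3 R * R3 R)))).
  exact: sigma_algebra_measurable.
move=> x e.
have -> : ball x e = ((ball x.1.1.1 e `*` ball x.1.1.2 e) `*` ball x.1.2 e) `*`
  ((ball x.2.1.1 e `*` ball x.2.1.2 e) `*` ball x.2.2 e) by [].
by do !apply: measurableX; exact: measurable_ball.
Qed.

End CompactMeasurable.

(** * Local integrability tested on cubes *)

Section LocallyIntegrable.
Context {R : realType}.
Implicit Types f : R3 R -> R.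

Lemma L1_loc3_cube f r : L1_loc3 f -> ig leb3 (fun x => \1_(cube r) x * f x).
Proof.
move=> [mf hf]; have := hf _ (@compact_cube R r).
move=> /(integrable_mkcond _ (measurable_cube r)).
apply: eq_integrable => // x _ /=.
by rewrite patchE indicE; case: ifP => _; rewrite ?mul1r ?mul0r.
Qed.

Lemma ig_cube_L1_loc3 f : measurable_fun setT f ->
  (forall n : nat, ig leb3 (fun x => \1_(cube n%:R) x * f x)) -> L1_loc3 f.
Proof.
move=> mf h; split => // K cK; have [n Kn] := compact_sub_cube cK.
apply: (integrableS (measurable_cube n%:R)) => //; first exact: compact_measurable3.
apply/(integrable_mkcond _ (measurable_cube n%:R)).
apply: eq_integrable (h n) => // x _ /=.
by rewrite patchE indicE; case: ifP => _; rewrite ?mul1r ?mul0r.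
Qed.

Lemma ig_cube_cst (r c : R) : ig leb3 (fun x => \1_(cube r) x * c).
Proof.
under eq_fun do rewrite mulrC; apply: igZ.
exact: ig_indic (measurable_cube r) (leb3_cube_lty r).
Qed.

Lemma restrict_cube6 (f : R3 R * R3 R -> R) r s :
  (EFin \o f) \_ (cube r `*` cube s) =
  EFin \o (fun p => \1_(cube r) p.1 * \1_(cube s) p.2 * f p).
Proof.
apply/funext => x; rewrite patchE /= !indicE in_setX.
by case: (_ \in _); case: (_ \in _); rewrite /= ?mul1r ?mul0r.
Qed.

Lemma measurable_cube6 (r s : R) : measurable (cube r `*` cube s).
Proof. by apply: measurableX; exact: measurable_cube. Qed.

Lemma L1_loc6_cube (f : R3 R * R3 R -> R) r s : L1_loc6 f ->
  ig leb6 (fun p => \1_(cube r) p.1 * \1_(cube s) p.2 * f p).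
Proof.
move=> [mf hf]; rewrite /ig -restrict_cube6.
apply: (integrable_mkcond _ (measurable_cube6 r s)).1.
exact: hf (compact_setX (@compact_cube R r) (@compact_cube R s)).
Qed.

Lemma ig_cube_L1_loc6 (f : R3 R * R3 R -> R) : measurable_fun setT f ->
  (forall n : nat, ig leb6 (fun p => \1_(cube n%:R) p.1 * \1_(cube n%:R) p.2 * f p)) ->
  L1_loc6 f.
Proof.
move=> mf h; split => // K cK; have [n Kn] := compact6_sub_cube cK.
apply: (integrableS (measurable_cube6 n%:R n%:R)) => //.
  exact: compact_measurable6.
apply: (integrable_mkcond _ (measurable_cube6 n%:R n%:R)).2.
by rewrite restrict_cube6; exact: h.
Qed.

End LocallyIntegrable.

(** * Translation invariance of Lebesgue measure *)

Section Translation.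
Context {R : realType}.
Local Notation mu := (@lebesgue_measure R).
Local Notation mR := (measurableTypeR R).

Lemma measurable_shift1 (c : R) :
  measurable_fun setT (fun x : mR => (x + c : mR)).
Proof. by apply: measurable_funD. Qed.

Lemma lebesgue_measure_shift (c : R) (A : set mR) :
  measurable A -> mu ((fun x => x + c) @^-1` A) = mu A.
Proof.
move=> mA; symmetry.
have mf := measurable_shift1 c.
apply: (@lebesgue_measure_unique _ (pushforward mu (fun x : mR => (x + c : mR)))) => //.
move=> _ [[a b] _ <-].
rewrite /= /pushforward.
have -> : (fun x : mR => (x + c : mR)) @^-1` `]a, b] = `]a - c, b - c]%classic.
  by apply/seteqP; split => x /=; rewrite !in_itv/= ltrBlDr lerBrDr.
rewrite !lebesgue_measure_itv/= !lte_fin ltrD2r.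
by case: ifP => // _; rewrite -!EFinB; congr (_%:E); lra.
Qed.

Definition shift3 (c : R3 R) (x : R3 R) : R3 R := x + c.

Lemma measurable_shift3 (c : R3 R) : measurable_fun setT (shift3 c).
Proof.
have -> : shift3 c = fun x => (x.1.1 + c.1.1, x.1.2 + c.1.2, x.2 + c.2) by [].
by do 2?apply: measurable_fun_pair => /=;
  (apply: measurable_funD => //; repeat apply: measurableT_comp => //).
Qed.

Lemma leb3_shift (c : R3 R) (A : set (R3 R)) : measurable A ->
  leb3 (shift3 c @^-1` A) = leb3 A.
Proof.
have m2 : measurable_fun setT
    (fun y : mR * mR => (y.1 + c.1.1, y.2 + c.1.2) : mR * mR).
  by apply: measurable_fun_pair; (apply: measurable_funD => //).
have leb2_shift (B : set (mR * mR)) : measurable B ->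
    leb2 ((fun y => (y.1 + c.1.1, y.2 + c.1.2)) @^-1` B) = leb2 B.
  move=> mB; symmetry.
  apply: (@product_measure_unique _ _ _ _ _ _ _ (pushforward leb2
    (fun y : mR * mR => (y.1 + c.1.1, y.2 + c.1.2) : mR * mR))) => //.
  move=> C D mC mD; rewrite /= /pushforward.
  rewrite -[in RHS](lebesgue_measure_shift c.1.1 mC).
  rewrite -[in RHS](lebesgue_measure_shift c.1.2 mD).
  apply: product_measure1E.
  - by rewrite -[X in measurable X]setTI; exact: measurable_shift1.
  - by rewrite -[X in measurable X]setTI; exact: measurable_shift1.
move=> mA; symmetry; have m3 := measurable_shift3 c.
apply: (@product_measure_unique _ _ _ _ _ _ _ (pushforward leb3 (shift3 c))) => //.
move=> C D mC mD; rewrite /= /pushforward.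
rewrite -[in RHS](leb2_shift _ mC) -[in RHS](lebesgue_measure_shift c.2 mD).
apply: product_measure1E.
- by rewrite -[X in measurable X]setTI; exact: m2.
- by rewrite -[X in measurable X]setTI; exact: measurable_shift1.
Qed.

Lemma ig_shift3 c (f : R3 R -> R) : ig leb3 f -> ig leb3 (fun x => f (x + c)).
Proof. exact: (preserving_ig (measurable_shift3 c) (leb3_shift c)). Qed.

Lemma rint_shift3 c (f : R3 R -> R) : measurable_fun setT f ->
  \int[leb3]_x f (x + c) = \int[leb3]_x f x.
Proof. exact: (preserving_rint (measurable_shift3 c) (leb3_shift c)). Qed.

End Translation.

(** * Test functions *)

Section Smooth.
Context {R : realType} {V : normedModType R}.
Implicit Types f g : V -> R.

Definition derivable_cts f :=
  continuous f /\ forall x v, derivable f x v.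

(** Iterated derivatives never leave the class [C], so a single differentiation step replaces any
    induction on the order of the derivative in the proofs below. *)
Lemma smooth_of_class (C : (V -> R) -> Prop) :
  (forall f, C f -> derivable_cts f /\ forall v, C ('D_v f)) ->
  forall f, C f -> smooth f.
Proof.
move=> hC f Cf vs; have : C (iter_derive vs f).
  by elim: vs => //= v vs ih; exact: (hC _ ih).2.
by move=> /hC[].
Qed.

Lemma smooth_derivable_cts f : smooth f -> derivable_cts f.
Proof. by move=> /(_ [::]). Qed.

Lemma smooth_derive f v : smooth f -> smooth ('D_v f).
Proof.
move=> sf vs; have -> : iter_derive vs ('D_v f) = iter_derive (rcons vs v) f.
  by elim: vs => //= w vs ->.
exact: sf.
Qed.

Lemma derivable_ctsD f g : derivable_cts f -> derivable_cts g ->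
  derivable_cts (fun x => f x + g x).
Proof.
move=> [cf df] [cg dg]; split => [x|x v]; first by apply: cvgD; [exact: cf|exact: cg].
by apply: derivableD.
Qed.

Lemma derivable_ctsM f g : derivable_cts f -> derivable_cts g ->
  derivable_cts (fun x => f x * g x).
Proof.
move=> [cf df] [cg dg]; split => [x|x v]; first by apply: cvgM; [exact: cf|exact: cg].
by apply: derivableM.
Qed.

(** The algebra generated by [B]. By the sum and product rules, stability under derivation only has
    to be checked on [B]. *)
Inductive generated (B : (V -> R) -> Prop) : (V -> R) -> Prop :=
| gen_base f : B f -> generated B f
| gen_cst c : generated B (fun=> c)
| gen_add f g : generated B f -> generated B g -> generated B (fun x => f x + g x)
| gen_mul f g : generated B f -> generated B g -> generated B (fun x => f x * g x).

Lemma smooth_generated (B : (V -> R) -> Prop) :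
  (forall f, B f -> derivable_cts f /\ forall v, generated B ('D_v f)) ->
  forall f, generated B f -> smooth f.
Proof.
move=> hB; apply: smooth_of_class => f; elim => {f}.
- by move=> f /hB.
- move=> c; split; first by split => [x|x v]; [exact: cst_continuous|exact: derivable_cst].
  move=> v; rewrite (_ : 'D_v _ = fun=> 0); first exact: gen_cst.
  by apply/funext => x; exact: derive_cst.
- move=> f g Bf [df df'] Bg [dg dg']; split; first exact: derivable_ctsD.
  move=> v; rewrite (_ : 'D_v _ = fun x => 'D_v f x + 'D_v g x).
    exact: gen_add.
  by apply/funext => x; apply: deriveD; [exact: df.2|exact: dg.2].
- move=> f g Bf [df df'] Bg [dg dg']; split; first exact: derivable_ctsM.
  move=> v; rewrite (_ : 'D_v _ = fun x => f x * 'D_v g x + g x * 'D_v f x).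
    by apply: gen_add; apply: gen_mul.
  by apply/funext => x; apply: deriveM; [exact: df.2|exact: dg.2].
Qed.

Lemma smoothM f g : smooth f -> smooth g -> smooth (fun x => f x * g x).
Proof.
move=> sf sg; apply: (@smooth_generated smooth); last by apply: gen_mul; exact: gen_base.
move=> h sh; split; first exact: smooth_derivable_cts.
by move=> v; apply: gen_base; exact: smooth_derive.
Qed.

End Smooth.

(** * Composition with affine maps *)

Section AffineComposition.
Context {R : realType} {V W : normedModType R}.
Variables (A : V -> W) (L : V -> W).
Hypothesis AL : forall (h : R) v x, A (h *: v + x) = h *: L v + A x.
Hypothesis cA : continuous A.

(** The difference quotients of both sides are the same function of the step; [AL] states affinity
    in exactly the form that makes them coincide. *)
Lemma derive_affine (f : W -> R) x v : 'D_v (f \o A) x = 'D_(L v) f (A x).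
Proof.
by rewrite /derive; under eq_fun do rewrite /= AL.
Qed.

Lemma derivable_affine (f : W -> R) x v : derivable f (A x) (L v) ->
  derivable (f \o A) x v.
Proof.
by rewrite /derivable => h; under eq_fun do rewrite /= AL.
Qed.

Lemma smooth_affine (f : W -> R) : smooth f -> smooth (f \o A).
Proof.
move=> sf; apply: (@smooth_of_class _ _ (fun g => exists2 f, smooth f & g = f \o A)).
  move=> _ [{sf}f sf ->]; have [cf df] := smooth_derivable_cts sf; split.
    split; last by move=> x v; exact: derivable_affine.
    by move=> x; apply: continuous_comp; [exact: cA|exact: cf].
  move=> v; exists ('D_(L v) f); first exact: smooth_derive.
  by apply/funext => x; exact: derive_affine.
by exists f.
Qed.

End AffineComposition.

(** * Smooth approximations of interval indicators *)

Section Bump.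
Context {R : realType}.

(* the case [n = 0] is the usual flat function; the others arise as derivatives *)
Definition flat (n : nat) (x : R) : R :=
  if 0 < x then x^-1 ^+ n * expR (- x^-1) else 0.

Lemma flat_ge0 n x : 0 <= flat n x.
Proof.
rewrite /flat; case: ifP => // x0.
by rewrite mulr_ge0 ?expR_ge0// exprn_ge0// invr_ge0 ltW.
Qed.

(** From [exp y >= y^(n+2) / (n+2)!] at [y = 1/x]. A quadratic bound is what forces the derivative
    at 0 to vanish. *)
Lemma flat_le n x : flat n x <= n.+2`!%:R * x ^+ 2.
Proof.
rewrite /flat; case: ifP => x0; last by rewrite mulr_ge0 ?sqr_ge0.
have xV0 : 0 <= x^-1 by rewrite invr_ge0 ltW.
have h := expR_ge1Dxn n.+1 xV0.
rewrite expRN ler_pdivrMr ?expR_gt0//.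
have : n.+2`!%:R * x ^+ 2 * (x^-1 ^+ n.+2 / n.+2`!%:R) <= n.+2`!%:R * x ^+ 2 * expR x^-1.
  apply: ler_wpM2l; first by rewrite mulr_ge0 ?sqr_ge0.
  by apply: le_trans h; rewrite lerDr.
apply: le_trans.
have f0 : n.+2`!%:R != 0 :> R by rewrite pnatr_eq0 -lt0n fact_gt0.
have xn0 : x != 0 by rewrite gt_eqF.
rewrite le_eqVlt; apply/orP; left; apply/eqP.
rewrite !exprS expr0; set w := x^-1 ^+ n; set c := n.+2`!%:R.
by field; rewrite f0 xn0.
Qed.

(** The linear span of the functions [flat n] is stable under differentiation, so the smoothness of
    [flat 0] reduces to this one computation. *)
Lemma is_derive_flat n (x : R) :
  is_derive x 1 (flat n) (flat n.+2 x - n%:R * flat n.+1 x).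
Proof.
have [x0|x0|x0] := ltgtP 0 x.
- pose f0 : R -> R := fun y => y^-1 ^+ n * expR (- y^-1).
  apply: (@near_eq_is_derive _ _ _ f0).
    near=> y; rewrite /flat ifT//; near: y; exact: lt_nbhsr.
  have xn0 : x != 0 by rewrite gt_eqF.
  have h1 : is_derive x 1 (fun y : R => y^-1) (- x^-1 ^+ 2).
    have := @is_deriveV _ id x 1 1 xn0 (is_derive_id x 1).
    by move=> h; apply: is_derive_eq; rewrite /GRing.scale/= mulr1 exprVn.
  have h2 := @is_deriveX _ _ (fun y : R => y^-1) n x 1 _ h1.
  have h3 := @is_deriveN _ _ _ (fun y : R => y^-1) x 1 _ h1.
  have h4 := @is_derive1_comp _ (@expR R) (- (fun y : R => y^-1)) x _ _ _ h3.
  have {h4}h5 := is_deriveM h2 (h4 _ (is_derive_expR _)).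
  have -> : f0 = ((fun y : R => y^-1) ^+ n * (expR \o - (fun y : R => y^-1)))%R.
    by apply/funext => y; rewrite /f0 !fctE.
  apply: (is_derive_eq h5).
  rewrite /flat x0 /= !fctE opprK /GRing.scale/=; clear h2 h5.
  clear f0; case: n => [|n]; first by rewrite !mul0r !mulr0; ring.
  by rewrite /= !exprS; ring.
- pose f0 : R -> R := fun y => 0.
  apply: (@near_eq_is_derive _ _ _ f0).
    near=> y; rewrite /flat ifF//; apply/negbTE; rewrite -leNgt ltW//; near: y; exact: lt_nbhsl.
  by apply: is_derive_eq; rewrite /flat ltNge (ltW x0)/= mulr0 subr0.
- rewrite -x0 /flat ltxx mulr0 subr0.
  have h : (fun h => h^-1 *: ((flat n \o shift 0) (h *: 1) - flat n 0)) @ 0^' --> (0 : R).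
    rewrite [X in X @ _](_ : _ = fun h => h^-1 * flat n h); last first.
      apply/funext => h; rewrite /= addr0 /GRing.scale/= mulr1.
      by rewrite [flat n 0]/flat ltxx subr0.
    apply/cvgrPdist_le => e e0.
    pose c : R := n.+2`!%:R.
    have c0 : 0 < c by rewrite /c ltr0n fact_gt0.
    near=> h; rewrite sub0r normrN.
    rewrite normrM normfV (ger0_norm (flat_ge0 _ _)).
    have hn0 : h != 0 by near: h; exact: nbhs_dnbhs_neq.
    have hp : 0 < `|h| by rewrite normr_gt0.
    rewrite mulrC ler_pdivrMr// (le_trans (flat_le _ _))// -/c -[h ^+ 2]ger0_norm ?sqr_ge0//.
    rewrite normrX expr2 mulrA ler_pM2r// mulrC -ler_pdivlMr//.
    near: h; apply: dnbhs0_le; exact: divr_gt0.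
  by apply: DeriveDef; [exact: cvgP h|exact: cvg_lim h].
Unshelve. all: by end_near. Qed.

Lemma smooth_flat : smooth (flat 0).
Proof.
apply: (@smooth_generated _ _ (fun f => exists n, f = flat n)); last first.
  by apply: gen_base; exists 0%N.
move=> _ [n ->].
have df x : differentiable (flat n) x.
  by apply/derivable1_diffP; have [] := is_derive_flat n x.
split.
  split=> [x|x v]; first exact: differentiable_continuous.
  exact: diff_derivable.
move=> v; rewrite (_ : 'D_v _ = fun x => v * (flat n.+2 x + (- n%:R) * flat n.+1 x)).
  apply: gen_mul; first exact: gen_cst.
  apply: gen_add; first by apply: gen_base; exists n.+2.
  apply: gen_mul; first exact: gen_cst.
  by apply: gen_base; exists n.+1.
apply/funext => x; rewrite deriveE//.
have [_ h] := is_derive_flat n x.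
rewrite -[in LHS](mulr1 v) -[v * 1]/(v *: (1 : R)) linearZ/= -deriveE// h.
by rewrite mulNr.
Qed.

(** Both factors vanish at and beyond an endpoint, and each tends to 1 inside since [flat 0 (n x)]
    does for [x > 0]: these are smooth functions, bounded by the indicator of []a, b[] and
    converging to it. *)
Definition plateau (a b : R) (n : nat) (x : R) : R :=
  flat 0 (n.+1%:R * (x - a)) * flat 0 (n.+1%:R * (b - x)).

Lemma smooth_plateau a b n : smooth (plateau a b n).
Proof.
apply: smoothM.
  apply: (@smooth_affine _ _ _ (fun x => n.+1%:R * (x - a)) (fun x => n.+1%:R * x) _ _ _ smooth_flat).
    by move=> h v x; rewrite /GRing.scale/=; ring.
  move=> x; apply: cvgM; first exact: cvg_cst.
  by apply: cvgB; [exact: cvg_id|exact: cvg_cst].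
apply: (@smooth_affine _ _ _ (fun x => n.+1%:R * (b - x)) (fun x => - n.+1%:R * x) _ _ _ smooth_flat).
  by move=> h v x; rewrite /GRing.scale/=; ring.
move=> x; apply: cvgM; first exact: cvg_cst.
by apply: cvgB; [exact: cvg_cst|exact: cvg_id].
Qed.

Lemma flat0_le1 (x : R) : flat 0 x <= 1.
Proof.
rewrite /flat; case: ifP => // x0.
by rewrite expr0 mul1r expR_le1 oppr_le0 invr_ge0 ltW.
Qed.

Lemma flat_eq0 n (x : R) : x <= 0 -> flat n x = 0.
Proof. by move=> x0; rewrite /flat ltNge x0. Qed.

Lemma plateau_ge0 a b n x : 0 <= plateau a b n x.
Proof. by rewrite mulr_ge0// flat_ge0. Qed.

Lemma plateau_le a b n x : plateau a b n x <= \1_`]a, b[ x.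
Proof.
have [/=|] := boolP (x \in `]a, b[%classic); rewrite indicE => h; rewrite ?h ?(negbTE h) /=.
  by rewrite mulr_ile1 ?flat_ge0 ?flat0_le1.
move: h; rewrite notin_setE/= in_itv/= => /negP; rewrite negb_and -!leNgt => /orP[h|h].
  by rewrite /plateau flat_eq0 ?mul0r// mulr_ge0_le0// subr_le0.
by rewrite /plateau (@flat_eq0 _ (_ * (b - x))) ?mulr0// mulr_ge0_le0// subr_le0.
Qed.

Lemma cvg_flat0 (x : R) : 0 < x -> flat 0 (n.+1%:R * x) @[n --> \oo] --> (1 : R).
Proof.
move=> x0.
rewrite [X in X @ _ --> _](_ : _ = fun n => expR (- (harmonic n * x^-1))); last first.
  by apply/funext => n; rewrite /flat mulr_gt0// expr0 mul1r invfM.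
rewrite -expR0 -oppr0; apply: continuous_cvg; first exact: continuous_expR.
by apply: cvgN; rewrite -[0](mul0r x^-1); apply: cvgMr_tmp; exact: cvg_harmonic.
Qed.

Lemma cvg_plateau a b x : plateau a b n x @[n --> \oo] --> (\1_`]a, b[ x : R).
Proof.
have [h|h] := boolP (x \in `]a, b[%classic).
  rewrite indicE h /= -[1]mulr1.
  move: h; rewrite inE/= in_itv/= => /andP[ax xb].
  by apply: cvgM; apply: cvg_flat0; rewrite subr_gt0.
apply: (@squeeze_cvgr _ _ _ _ (fun=> 0) (fun=> \1_`]a, b[ x)).
- by apply: nearW => n; rewrite plateau_ge0 plateau_le.
- by rewrite indicE (negbTE h); exact: cvg_cst.
- exact: cvg_cst.
Qed.

End Bump.

Lemma continuous_fst (U V : topologicalType) : continuous (fun p : U * V => p.1).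
Proof.
move=> p B hB; exists (B, setT) => /=; first by split => //; exact: filterT.
by move=> q [].
Qed.

Lemma continuous_snd (U V : topologicalType) : continuous (fun p : U * V => p.2).
Proof.
move=> p B hB; exists (setT, B) => /=; first by split => //; exact: filterT.
by move=> q [].
Qed.

Lemma continuous_pairl (U V : topologicalType) (u : U) :
  continuous (fun v : V => (u, v)).
Proof.
move=> x B [[P Q] /= [hP hQ] hB]; apply: filterS hQ => y Qy.
by apply: hB; split => //; exact: nbhs_singleton hP.
Qed.

Lemma continuous_pairr (U V : topologicalType) (v : V) :
  continuous (fun u : U => (u, v)).
Proof.
move=> x B [[P Q] /= [hP hQ] hB]; apply: filterS hP => y Py.
by apply: hB; split => //; exact: nbhs_singleton hQ.
Qed.

(** * Test functions and their supports *)

Section TestFunctions.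
Context {R : realType} {V : normedModType R}.
Implicit Types phi : V -> R.

Lemma smooth_compact_test phi (K : set V) : smooth phi -> compact K ->
  (forall x, phi x != 0 -> K x) -> test_function phi.
Proof.
move=> sphi cK hK; split => //.
have clK : closed K by apply: compact_closed => //; exact: norm_hausdorff.
apply: (subclosed_compact _ cK); first exact: closed_closure.
by rewrite [X in _ `<=` X](closure_id K).1//; apply: closureS.
Qed.

Lemma test_smooth phi : test_function phi -> smooth phi.
Proof. by case. Qed.

Lemma test_derive phi v : test_function phi -> test_function ('D_v phi).
Proof.
move=> [sphi cK]; apply: (smooth_compact_test (smooth_derive v sphi) cK) => x.
apply: contra_neqP => nx; rewrite (@near_eq_derive _ _ _ _ (fun=> 0)).
  exact: derive_cst.
have : nbhs x (~` closure [set x | phi x != 0]).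
  by apply: open_nbhs_nbhs; split => //; exact/closed_openC/closed_closure.
apply: filterS => y ny; apply/eqP; apply: contra_notT ny => hy.
exact: subset_closure.
Qed.

End TestFunctions.

Section TestAffine.
Context {R : realType} {V W : normedModType R}.
Variables (A L : V -> W) (B : W -> V).
Hypothesis AL : forall (h : R) v x, A (h *: v + x) = h *: L v + A x.
Hypothesis cA : continuous A.
Hypothesis cB : continuous B.
Hypothesis AK : forall x, B (A x) = x.

Lemma test_affine (phi : W -> R) : test_function phi -> test_function (phi \o A).
Proof.
move=> [sphi cK].
apply: (@smooth_compact_test _ _ _ (B @` closure [set x | phi x != 0])).
- exact: (smooth_affine AL cA).
- by apply: continuous_compact cK; exact: continuous_subspaceT.
- move=> x hx; exists (A x); last exact: AK.
  exact: subset_closure.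
Qed.

End TestAffine.

(** * Measurability and integrability against test functions *)

Section ContinuousMeasurable.
Context {R : realType}.

(** A closed set is a countable union of compact ones, its intersections with the cubes. *)
Lemma closed_measurable3 (F : set (R3 R)) : closed F -> measurable F.
Proof.
move=> cF; have -> : F = \bigcup_n (F `&` cube n%:R).
  by rewrite -setI_bigcupr bigcup_cube setIT.
apply: bigcupT_measurable => n; apply: compact_measurable3.
by rewrite setIC; apply: compact_closedI => //; exact: compact_cube.
Qed.

Lemma closed_measurable6 (F : set (R3 R * R3 R)) : closed F -> measurable F.
Proof.
move=> cF; have -> : F = \bigcup_n (F `&` (cube n%:R `*` cube n%:R)).
  rewrite -setI_bigcupr; apply/esym/setIidPl => p _.
  have [n _ hn] : (\bigcup_n cube n%:R) p.1 by rewrite bigcup_cube.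
  have [m _ hm] : (\bigcup_n cube n%:R) p.2 by rewrite bigcup_cube.
  exists (maxn n m) => //; split.
    by apply: cube_subset hn; rewrite ler_nat leq_maxl.
  by apply: cube_subset hm; rewrite ler_nat leq_maxr.
apply: bigcupT_measurable => n; apply: compact_measurable6.
rewrite setIC; apply: compact_closedI => //.
by apply: compact_setX; exact: compact_cube.
Qed.

Lemma measurable_fun_of_open d (T : measurableType d) (f : T -> R) :
  (forall a b : R, measurable (f @^-1` `]a, b[)) -> measurable_fun setT f.
Proof.
move=> h; apply: (measurability _ (RGenOpens.measurableE R)) => //.
by move=> _ [_ [a [b ->]] <-]; rewrite setTI; exact: h.
Qed.

Lemma continuous_measurable3 (f : R3 R -> R) : continuous f -> measurable_fun setT f.
Proof.
move=> /continuousP cf; apply: measurable_fun_of_open => a b.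
rewrite -[X in measurable X]setCK; apply: measurableC.
by apply: closed_measurable3; apply: open_closedC; apply: cf; exact: interval_open.
Qed.

Lemma continuous_measurable6 (f : R3 R * R3 R -> R) : continuous f ->
  measurable_fun setT f.
Proof.
move=> /continuousP cf; apply: measurable_fun_of_open => a b.
rewrite -[X in measurable X]setCK; apply: measurableC.
by apply: closed_measurable6; apply: open_closedC; apply: cf; exact: interval_open.
Qed.

Lemma test_measurable3 (phi : R3 R -> R) : test_function phi -> measurable_fun setT phi.
Proof. by move=> /test_smooth/smooth_derivable_cts[? _]; exact: continuous_measurable3. Qed.

Lemma test_measurable6 (phi : R3 R * R3 R -> R) : test_function phi ->
  measurable_fun setT phi.
Proof. by move=> /test_smooth/smooth_derivable_cts[? _]; exact: continuous_measurable6. Qed.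

Lemma test_bounded (V : normedModType R) (phi : V -> R) : test_function phi ->
  exists2 M : R, 0 <= M & forall x, `|phi x| <= M.
Proof.
move=> [sphi cK]; have [cphi _] := smooth_derivable_cts sphi.
have /compact_bounded[M [_ hM]] :
    compact (phi @` closure [set x | phi x != 0]).
  by apply: continuous_compact cK; exact: continuous_subspaceT.
exists (`|M| + 1); first by rewrite addr_ge0.
move=> x; have [->|x0] := eqVneq (phi x) 0; first by rewrite normr0 addr_ge0.
apply: hM; first by rewrite (le_lt_trans (ler_norm M))// ltrDl.
by exists x => //; exact: subset_closure.
Qed.

Lemma test_le3 (phi : R3 R -> R) : test_function phi ->
  exists (M : R) (n : nat), 0 <= M /\ forall x, `|phi x| <= M * \1_(cube n%:R) x.
Proof.
move=> tphi; have [M M0 hM] := test_bounded tphi.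
have [n hn] := compact_sub_cube tphi.2.
exists M, n; split => // x; have [->|x0] := eqVneq (phi x) 0.
  by rewrite normr0 mulr_ge0.
rewrite indicE mem_set ?mulr1//.
by apply: hn; exact: subset_closure.
Qed.

Lemma test_le6 (phi : R3 R * R3 R -> R) : test_function phi ->
  exists (M : R) (n : nat), 0 <= M /\
    forall p, `|phi p| <= M * (\1_(cube n%:R) p.1 * \1_(cube n%:R) p.2).
Proof.
move=> tphi; have [M M0 hM] := test_bounded tphi.
have [n hn] := compact6_sub_cube tphi.2.
exists M, n; split => // x; have [->|x0] := eqVneq (phi x) 0.
  by rewrite normr0 !mulr_ge0.
have [h1 h2] : (cube n%:R `*` cube n%:R) x by apply: hn; exact: subset_closure.
by rewrite !indicE !mem_set ?mulr1.
Qed.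

Lemma ig_L1_loc_test (f phi : R3 R -> R) : L1_loc3 f -> test_function phi ->
  ig leb3 (fun x => f x * phi x).
Proof.
move=> hf tphi; have [M [n [M0 hM]]] := test_le3 tphi.
apply: (@ig_le _ _ _ _ _ (fun x => M * `|\1_(cube n%:R) x * f x|)).
- by apply: measurable_funM; [exact: hf.1|exact: test_measurable3].
- move=> x; rewrite !normrM mulrA mulrC ler_wpM2r//.
  have i0 (A : set (R3 R)) y : 0 <= (\1_A y : R) by [].
  by rewrite (ger0_norm (i0 _ x)) hM.
- by apply: igZ; apply: ig_norm; exact: L1_loc3_cube.
Qed.

Lemma ig_L1_loc_test6 (f phi : R3 R * R3 R -> R) : L1_loc6 f -> test_function phi ->
  ig leb6 (fun x => f x * phi x).
Proof.
move=> hf tphi; have [M [n [M0 hM]]] := test_le6 tphi.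
apply: (@ig_le _ _ _ _ _ (fun x => M * `|\1_(cube n%:R) x.1 * \1_(cube n%:R) x.2 * f x|)).
- by apply: measurable_funM; [exact: hf.1|exact: test_measurable6].
- move=> x; rewrite !normrM mulrA mulrC ler_wpM2r//.
  have i0 (A : set (R3 R)) y : 0 <= (\1_A y : R) by [].
  by rewrite (ger0_norm (i0 _ x.1)) (ger0_norm (i0 _ x.2)) hM.
- by apply: igZ; apply: ig_norm; exact: L1_loc6_cube.
Qed.

End ContinuousMeasurable.

(** * Translates, slices and tensor products of test functions *)

Section TestConstructions.
Context {R : realType}.
Implicit Types (phi psi : R3 R -> R) (Phi : R3 R * R3 R -> R).

Lemma test_shift phi c : test_function phi -> test_function (fun x => phi (x + c)).
Proof.
apply: (@test_affine _ _ _ (fun x => x + c) id (fun x => x - c)).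
- by move=> h v x; rewrite addrA.
- by move=> x; apply: cvgD; [exact: cvg_id|exact: cvg_cst].
- by move=> x; apply: cvgB; [exact: cvg_id|exact: cvg_cst].
- by move=> x; rewrite addrK.
Qed.

Lemma derive_shift3 phi c e x : 'D_e (fun x => phi (x + c)) x = 'D_e phi (x + c).
Proof.
by apply: (@derive_affine _ _ _ (fun x => x + c) id) => h v y; rewrite addrA.
Qed.

Lemma test_slice1 Phi u : test_function Phi -> test_function (fun r => Phi (u, r)).
Proof.
apply: (@test_affine _ _ _ (fun r => (u, r)) (fun r => (0, r)) snd).
- by move=> h v x; congr (_, _); rewrite /= scaler0 add0r.
- exact: continuous_pairl.
- exact: continuous_snd.
- by [].
Qed.

Lemma derive_slice1 Phi u e r :
  'D_e (fun r => Phi (u, r)) r = 'D_(0, e) Phi (u, r).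
Proof.
apply: (@derive_affine _ _ _ (fun r => (u, r)) (fun r => (0, r))).
by move=> h v x; congr (_, _); rewrite /= scaler0 add0r.
Qed.

Lemma test_slice2 Phi s : test_function Phi -> test_function (fun r => Phi (r, s)).
Proof.
apply: (@test_affine _ _ _ (fun r => (r, s)) (fun r => (r, 0)) fst).
- by move=> h v x; congr (_, _); rewrite /= scaler0 add0r.
- exact: continuous_pairr.
- exact: continuous_fst.
- by [].
Qed.

Lemma derive_slice2 Phi s e r :
  'D_e (fun r => Phi (r, s)) r = 'D_(e, 0) Phi (r, s).
Proof.
apply: (@derive_affine _ _ _ (fun r => (r, s)) (fun r => (r, 0))).
by move=> h v x; congr (_, _); rewrite /= scaler0 add0r.
Qed.

Lemma smooth_fst phi : smooth phi -> smooth (fun p : R3 R * R3 R => phi p.1).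
Proof.
apply: (@smooth_affine _ _ _ (fun p : R3 R * R3 R => p.1) (fun p : R3 R * R3 R => p.1)) => //.
exact: continuous_fst.
Qed.

Lemma smooth_snd phi : smooth phi -> smooth (fun p : R3 R * R3 R => phi p.2).
Proof.
apply: (@smooth_affine _ _ _ (fun p : R3 R * R3 R => p.2) (fun p : R3 R * R3 R => p.2)) => //.
exact: continuous_snd.
Qed.

Lemma test_tensor psi phi : test_function psi -> test_function phi ->
  test_function (fun p : R3 R * R3 R => psi p.1 * phi p.2).
Proof.
move=> [s1 c1] [s2 c2]; apply: (smooth_compact_test _ (compact_setX c1 c2)).
  by apply: smoothM; [exact: smooth_fst|exact: smooth_snd].
move=> p; rewrite mulf_eq0 negb_or => /andP[h1 h2].
by split; exact: subset_closure.
Qed.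

Lemma derive_tensor psi phi e p : test_function psi -> test_function phi ->
  'D_(0, e) (fun p : R3 R * R3 R => psi p.1 * phi p.2) p = psi p.1 * 'D_e phi p.2.
Proof.
move=> tpsi tphi; case: p => u r.
rewrite -derive_slice1 /=.
have [_ dphi] := smooth_derivable_cts tphi.1.
exact: (@deriveZ _ _ _ phi (psi u) r e).
Qed.

Lemma test_box_plateau (a1 b1 a2 b2 a3 b3 : R) n : test_function
  (fun x : R3 R => plateau a1 b1 n x.1.1 * plateau a2 b2 n x.1.2 * plateau a3 b3 n x.2).
Proof.
apply: (@smooth_compact_test _ _ _
  ((`[a1, b1]%classic `*` `[a2, b2]%classic) `*` `[a3, b3]%classic)).
- apply: smoothM; [apply: smoothM|].
  + apply: (@smooth_affine _ (R3 R) R (fun x => x.1.1) (fun x => x.1.1) _ _ _ (@smooth_plateau _ _ _ _)) => //.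
    by move=> x; apply: (@continuous_comp _ _ _ (fun x : R3 R => x.1) fst); exact: continuous_fst.
  + apply: (@smooth_affine _ (R3 R) R (fun x => x.1.2) (fun x => x.1.2) _ _ _ (@smooth_plateau _ _ _ _)) => //.
    by move=> x; apply: (@continuous_comp _ _ _ (fun x : R3 R => x.1) snd); [exact: continuous_fst|exact: continuous_snd].
  + apply: (@smooth_affine _ (R3 R) R (fun x => x.2) (fun x => x.2) _ _ _ (@smooth_plateau _ _ _ _)) => //.
    exact: continuous_snd.
- by apply: compact_setX; [apply: compact_setX|]; exact: segment_compact.
have hb a b x : plateau a b n x != 0 -> `[a, b]%classic x.
  apply: contra_neqP => /= h; apply/eqP; rewrite eq_le plateau_ge0 andbT.
  apply: (le_trans (plateau_le _ _ _ _)); rewrite indicE memNset//= => h'.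
  by apply: h; exact: subset_itv_oo_cc h'.
move=> x; rewrite mulf_eq0 negb_or => /andP[+ /hb h3].
by rewrite mulf_eq0 negb_or => /andP[/hb h1 /hb h2].
Qed.

Lemma is_derive_line phi x e (t : R) : smooth phi ->
  is_derive t 1 (fun t : R => phi (x + t *: e)) ('D_e phi (x + t *: e)).
Proof.
move=> sphi; have [_ dphi] := smooth_derivable_cts sphi.
have AL (h v y : R) : x + (h *: v + y) *: e = h *: (v *: e) + (x + y *: e).
  by rewrite scalerDl scalerA addrCA.
have := @derive_affine _ R (R3 R) (fun t : R => x + t *: e) (fun t => t *: e) AL phi t 1.
rewrite /= scale1r => <-; apply/derivableP.
apply: (@derivable_affine _ R (R3 R) (fun t : R => x + t *: e) (fun t => t *: e) AL phi).
by rewrite scale1r.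
Qed.

Lemma continuous_line phi x e : continuous phi ->
  continuous (fun t : R => phi (x + t *: e)).
Proof.
move=> cphi t; apply: (@cvg_comp _ _ _ (fun t : R => x + t *: e) phi); last exact: cphi.
by apply: cvgD; [exact: cvg_cst|apply: cvgZr_tmp; exact: cvg_id].
Qed.

End TestConstructions.

Lemma sigma_countable_bigcup (T : Type) (G : set (set T)) (I : countType) (F : I -> set T) :
  (forall i, <<s G >> (F i)) -> <<s G >> (\bigcup_(i in setT) F i).
Proof.
move=> h; pose H (n : nat) := if @unpickle I n is Some i then F i else set0.
have [s0 _ sU] := @smallest_sigma_algebra _ setT G.
have -> : \bigcup_(i in setT) F i = \bigcup_n H n.
  apply/seteqP; split => [x [i _ Fx]|x [n _]].
    by exists (pickle i) => //; rewrite /H pickleK.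
  by rewrite /H; case: unpickle => // i Fx; exists i.
by apply: sU => n; rewrite /H; case: unpickle.
Qed.

(** * Rational boxes generate the Borel sets *)

Section RationalBoxes.
Context {R : realType}.
Local Notation mR := (measurableTypeR R).

Definition open_box (a1 b1 a2 b2 a3 b3 : R) : set (R3 R) :=
  [set x | [/\ a1 < x.1.1 < b1, a2 < x.1.2 < b2 & a3 < x.2 < b3]].

Definition rational (a : R) := exists q : rat, a = ratr q.

(** Stability under intersection serves the Dynkin arguments, countability the separability of L^2.
    Boxes with crossed endpoints are allowed, being empty, so that intersections stay in the
    family. *)
Definition rational_boxes : set (set (R3 R)) := [set A | exists a1 b1 a2 b2 a3 b3,
  [/\ rational a1 /\ rational b1, rational a2 /\ rational b2, rational a3 /\ rational b3 &
      A = open_box a1 b1 a2 b2 a3 b3]].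

Lemma rational_max a b : rational a -> rational b -> rational (Num.max a b).
Proof. by move=> ha hb; rewrite /Num.max; case: ifP. Qed.

Lemma rational_min a b : rational a -> rational b -> rational (Num.min a b).
Proof. by move=> ha hb; rewrite /Num.min; case: ifP. Qed.

Lemma rational_boxes_setI : setI_closed rational_boxes.
Proof.
move=> _ _ [a1 [b1 [a2 [b2 [a3 [b3 [[? ?] [? ?] [? ?] ->]]]]]]]
  [c1 [e1 [c2 [e2 [c3 [e3 [[? ?] [? ?] [? ?] ->]]]]]]].
exists (Num.max a1 c1), (Num.min b1 e1), (Num.max a2 c2), (Num.min b2 e2),
  (Num.max a3 c3), (Num.min b3 e3).
split; try by split; [exact: rational_max|exact: rational_min].
apply/seteqP; split => x; rewrite /open_box/= !gt_max !lt_min.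
  by move=> [[/andP[-> ->] /andP[-> ->] /andP[-> ->]] [/andP[-> ->] /andP[-> ->] /andP[-> ->]]].
move=> [/andP[/andP[-> ->] /andP[-> ->]] /andP[/andP[-> ->] /andP[-> ->]]
  /andP[/andP[-> ->] /andP[-> ->]]].
by split.
Qed.

Lemma open_boxE a1 b1 a2 b2 a3 b3 : open_box a1 b1 a2 b2 a3 b3 =
  (`]a1, b1[%classic `*` `]a2, b2[%classic) `*` (`]a3, b3[%classic : set mR).
Proof.
apply/seteqP; split => x; rewrite /open_box/= !in_itv/=; first by move=> [].
by move=> [[]].
Qed.

Lemma measurable_open_box a1 b1 a2 b2 a3 b3 : measurable (open_box a1 b1 a2 b2 a3 b3).
Proof.
by rewrite open_boxE; apply: measurableX => //; apply: measurableX.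
Qed.

Lemma rational_between (a b : R) : a < b -> exists q, [/\ rational q, a < q & q < b].
Proof.
move=> ab; have [q] := rat_in_itvoo ab; rewrite in_itv/= => /andP[h1 h2].
by exists (ratr q); split=> //; exists q.
Qed.

Lemma open_box_exhaust (J : (R * R) * (R * R) * (R * R)) (x : R3 R) :
  open_box J.1.1.1 J.1.1.2 J.1.2.1 J.1.2.2 J.2.1 J.2.2 x ->
  exists K : (rat * rat) * (rat * rat) * (rat * rat),
    open_box (ratr K.1.1.1) (ratr K.1.1.2) (ratr K.1.2.1) (ratr K.1.2.2)
      (ratr K.2.1) (ratr K.2.2) x /\
    open_box (ratr K.1.1.1) (ratr K.1.1.2) (ratr K.1.2.1) (ratr K.1.2.2)
      (ratr K.2.1) (ratr K.2.2) `<=` open_box J.1.1.1 J.1.1.2 J.1.2.1 J.1.2.2 J.2.1 J.2.2.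
Proof.
case: J => [[[a1 b1] [a2 b2]] [a3 b3]] [/andP[h1 k1] /andP[h2 k2] /andP[h3 k3]] /=.
have [_ [[p1 ->] s1 t1]] := rational_between h1; have [_ [[q1 ->] v1 w1]] := rational_between k1.
have [_ [[p2 ->] s2 t2]] := rational_between h2; have [_ [[q2 ->] v2 w2]] := rational_between k2.
have [_ [[p3 ->] s3 t3]] := rational_between h3; have [_ [[q3 ->] v3 w3]] := rational_between k3.
exists ((p1, q1), (p2, q2), (p3, q3)); split; first by split; apply/andP; split.
move=> y [/andP[? ?] /andP[? ?] /andP[? ?]]; split; apply/andP; split;
  by [exact: (lt_trans s1)|exact: (lt_trans s2)|exact: (lt_trans s3)|
      exact: lt_trans w1|exact: lt_trans w2|exact: lt_trans w3].
Qed.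

(** An open box with real endpoints is the union of the countably many rational boxes that it
    contains. *)
Lemma sigma_open_box a1 b1 a2 b2 a3 b3 : <<s rational_boxes >> (open_box a1 b1 a2 b2 a3 b3).
Proof.
pose B (K : (rat * rat) * (rat * rat) * (rat * rat)) :=
  open_box (ratr K.1.1.1) (ratr K.1.1.2) (ratr K.1.2.1) (ratr K.1.2.2) (ratr K.2.1) (ratr K.2.2).
pose F K : set (R3 R) :=
  if pselect (B K `<=` open_box a1 b1 a2 b2 a3 b3) then B K else set0.
have -> : open_box a1 b1 a2 b2 a3 b3 = \bigcup_(K in setT) F K.
  apply/seteqP; split => [x hx|x [K _]].
    have [K [Kx KB]] := @open_box_exhaust ((a1, b1), (a2, b2), (a3, b3)) x hx.
    by exists K => //; rewrite /F; case: pselect.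
  by rewrite /F; case: pselect => // h; exact: h.
apply: sigma_countable_bigcup => K; rewrite /F; case: pselect => [?|?]; last first.
  by have [] := @smallest_sigma_algebra _ setT rational_boxes.
apply: sub_sigma_algebra.
exists (ratr K.1.1.1), (ratr K.1.1.2), (ratr K.1.2.1), (ratr K.1.2.2), (ratr K.2.1), (ratr K.2.2).
by split=> //; split; eexists.
Qed.

Lemma rational_boxes_generate : @measurable _ (R3 R) = <<s rational_boxes >>.
Proof.
apply/seteqP; split; last first.
  apply: smallest_sub; first exact: sigma_algebra_measurable.
  by move=> _ [a1 [b1 [a2 [b2 [a3 [b3 [_ _ _ ->]]]]]]]; exact: measurable_open_box.
pose T := g_sigma_algebraType rational_boxes.
have ex (y : R) : exists n : nat, `|y| < n%:R.
  by exists (Num.truncn `|y|).+1; exact: truncnS_gt.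
have ub (a b : R) (n : nat) : `|a| < n%:R -> `|b| < n%:R -> - n%:R < a < n%:R /\ - n%:R < b < n%:R.
  by rewrite !ltr_norml.
have exh (P : nat -> set (R3 R)) (S : set (R3 R)) : (forall n, <<s rational_boxes >> (P n)) ->
    S = \bigcup_n P n -> <<s rational_boxes >> S.
  by move=> hP ->; have [_ _ sU] := @smallest_sigma_algebra _ setT rational_boxes; exact: sU.
have two (y z : R) : exists n : nat, - n%:R < y < n%:R /\ - n%:R < z < n%:R.
  have [n hn] := ex (`|y| + `|z|); exists n; apply: ub; apply: le_lt_trans hn.
    by rewrite [leRHS]ger0_norm ?addr_ge0// lerDl.
  by rewrite [leRHS]ger0_norm ?addr_ge0// lerDr.
have m1 : measurable_fun [set: T] (fun x : T => (x : R3 R).1.1 : mR).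
  apply: measurable_fun_of_open => a b; apply: (exh (fun n => open_box a b (- n%:R) n%:R (- n%:R) n%:R)).
    by move=> n; exact: sigma_open_box.
  apply/seteqP; split => [x|x [n _ []]]; rewrite /= in_itv//= => h.
  by have [n [h1 h2]] := two x.1.2 x.2; exists n.
have m2 : measurable_fun [set: T] (fun x : T => (x : R3 R).1.2 : mR).
  apply: measurable_fun_of_open => a b; apply: (exh (fun n => open_box (- n%:R) n%:R a b (- n%:R) n%:R)).
    by move=> n; exact: sigma_open_box.
  apply/seteqP; split => [x|x [n _ []]]; rewrite /= in_itv//= => h.
  by have [n [h1 h2]] := two x.1.1 x.2; exists n.
have m3 : measurable_fun [set: T] (fun x : T => (x : R3 R).2 : mR).
  apply: measurable_fun_of_open => a b; apply: (exh (fun n => open_box (- n%:R) n%:R (- n%:R) n%:R a b)).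
    by move=> n; exact: sigma_open_box.
  apply/seteqP; split => [x|x [n _ []]]; rewrite /= in_itv//= => h.
  by have [n [h1 h2]] := two x.1.1 x.1.2; exists n.
(* As the three coordinates are measurable for the generated sigma-algebra, so is the identity into
   the product sigma-algebra, which is the wanted inclusion. *)
have mid := measurable_fun_pair (measurable_fun_pair m1 m2) m3.
move=> A mA; have := mid measurableT A mA.
by rewrite setTI; congr (measurable _); apply/seteqP; split => -[[? ?] ?].
Qed.

End RationalBoxes.

(** * The fundamental lemma of the calculus of variations *)

Section DynkinIntegral.
Context d d' (T : measurableType d) (S : measurableType d') (R : realType).
Variable mu : {measure set T -> \bar R}.

Lemma sum_indic_trivIset (F : nat -> set S) (y : S) k n : trivIset setT F ->
  F k y -> \sum_(i < n) (\1_(F i) y : R) = (k < n)%:R.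
Proof.
move=> tF Fky; elim: n => [|n ih]; first by rewrite big_ord0.
rewrite big_ord_recr/= ih; have [->|nk] := eqVneq n k.
  by rewrite ltnn ltnSn add0r indicE mem_set.
have -> : \1_(F n) y = 0 :> R.
  rewrite indicE memNset// => Fny.
  have /trivIsetP/(_ n k I I nk) := tF; move/seteqP => [h' _].
  exact: (h' y (conj Fny Fky)).
by rewrite addr0 ltnS [(k <= n)%N]leq_eqVlt [k == n]eq_sym (negbTE nk).
Qed.

(** The sets [A] with vanishing integral form a Dynkin system: complements because the total
    integral is 0, disjoint unions by dominated convergence with majorant [|g|]. *)
Lemma integral_zero_dynkin (pi : T -> S) (G : set (set S)) (g : T -> R) :
  measurable_fun setT pi -> ig mu g ->
  @measurable _ S = <<s G >> -> setI_closed G ->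
  \int[mu]_x g x = 0 ->
  (forall A, G A -> \int[mu]_x (g x * \1_A (pi x)) = 0) ->
  forall A, measurable A -> \int[mu]_x (g x * \1_A (pi x)) = 0.
Proof.
move=> mpi hg mG GI g0 gG A mA.
have hgA B : measurable B -> ig mu (fun x => g x * \1_B (pi x)).
  move=> mB; under eq_fun do rewrite mulrC.
  apply: (@ig_bounded_mul _ _ _ _ _ _ 1) => //.
    by apply: measurableT_comp => //; exact: measurable_indic.
  by move=> x; rewrite indicE ger0_norm// lern1; case: (_ \in _).
apply: (@dynkin_induction _ S G (fun A => \int[mu]_x (g x * \1_A (pi x)) = 0)) => //.
- by rewrite -g0; apply: eq_Rintegral => x _; rewrite indicT /= mulr1.
- move=> B mB hB.
  have e y : \1_(~` B) y = 1 - \1_B y :> R.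
    by rewrite !indicE in_setC; case: (y \in B); rewrite /= ?subrr ?subr0.
  under eq_Rintegral do rewrite e mulrBr mulr1.
  by rewrite rintB ?g0 ?hB ?subr0//; exact: hgA.
- move=> F mF tF hF.
  have [||||_] := @rint_dct _ _ _ mu (fun n x => \sum_(i < n) (g x * \1_(F i) (pi x)))
    (fun x => g x * \1_(\bigcup_k F k) (pi x)) (fun x => `|g x|) _ _ _ (ig_norm hg) _.
  + by move=> n; apply: measurable_sum => i; apply: ig_meas; exact: hgA.
  + by apply: ig_meas; apply: hgA; exact: bigcupT_measurable.
  + apply: nearW => x; under eq_fun do rewrite -big_distrr/=.
    apply: cvgM; first exact: cvg_cst.
    have [[k _ Fk]|nF] := pselect ((\bigcup_k F k) (pi x)).
      rewrite indicE mem_set; last by exists k.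
      apply: cvg_near_cst; exists k.+1 => // n /= kn.
      by rewrite (sum_indic_trivIset _ tF Fk) kn.
    rewrite indicE memNset//; apply: cvg_near_cst; apply: nearW => n.
    by rewrite big1// => i _; rewrite indicE memNset// => Fi; apply: nF; exists i.
  + move=> n x; rewrite -big_distrr/= normrM ler_piMr//.
    have [[k _ Fk]|nF] := pselect ((\bigcup_k F k) (pi x)).
      by rewrite (sum_indic_trivIset _ tF Fk) ger0_norm// lern1; case: (_ < _)%N.
    rewrite big1 ?normr0// => i _; rewrite indicE memNset// => Fi.
    by apply: nF; exists i.
    move=> h; rewrite -(cvg_lim (@Rhausdorff R) h).
    apply: lim_near_cst => //; apply: nearW => n; rewrite rint_sum; last by move=> i; exact: hgA.
    by rewrite big1.
by rewrite -mG.
Qed.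

End DynkinIntegral.

Section FundamentalLemma.
Context {R : realType}.
Local Notation mR := (measurableTypeR R).

Lemma measurable_R3_11 : measurable_fun setT (fun x : R3 R => x.1.1).
Proof. by apply: measurableT_comp => //; exact: measurable_fst. Qed.
Lemma measurable_R3_12 : measurable_fun setT (fun x : R3 R => x.1.2).
Proof. by apply: measurableT_comp => //; exact: measurable_snd. Qed.
Lemma measurable_R3_2 : measurable_fun setT (fun x : R3 R => x.2).
Proof. exact: measurable_snd. Qed.

Lemma indic_itvoo_mul (a b c e x : R) :
  \1_`]a, b[ x * \1_`]c, e[ x = \1_`]Num.max a c, Num.min b e[ x :> R.
Proof.
have h u v : \1_`]u, v[ x = ((u < x < v)%R : bool)%:R :> R.
  by rewrite indicE; congr (_%:R); congr nat_of_bool; rewrite mem_setE in_itv.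
rewrite !h -natrM mulnb gt_max lt_min; congr (_%:R); congr nat_of_bool.
by case: (a < x); case: (c < x); case: (x < b); case: (x < e).
Qed.

Variable W : R3 R -> R.
Hypothesis hW : L1_loc3 W.
Hypothesis W0 : forall phi, test_function phi -> \int[leb3]_x (W x * phi x) = 0.

Lemma mul3_le1 (x y z : R) : 0 <= x -> 0 <= y -> 0 <= z ->
  x <= 1 -> y <= 1 -> z <= 1 -> x * y * z <= 1.
Proof.
move=> x0 y0 z0 x1 y1 z1; apply: mulr_ile1 => //; first exact: mulr_ge0.
exact: mulr_ile1.
Qed.

(** The indicator of a box is the pointwise limit of products of plateaus, test functions bounded by
    1 and supported in one fixed cube, on which [W] is integrable. *)
Lemma integral_box_eq0 a1 b1 a2 b2 a3 b3 :
  \int[leb3]_x (W x * (\1_`]a1, b1[ x.1.1 * \1_`]a2, b2[ x.1.2 * \1_`]a3, b3[ x.2)) = 0.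
Proof.
pose r : R := `|a1| + `|b1| + `|a2| + `|b2| + `|a3| + `|b3|.
have mI (a b : R) : measurable_fun setT (\1_`]a, b[ : mR -> R).
  exact: measurable_indic.
pose f n (x : R3 R) := W x * (plateau a1 b1 n x.1.1 * plateau a2 b2 n x.1.2 * plateau a3 b3 n x.2).
have mf n : measurable_fun setT (f n).
  apply: measurable_funM; first exact: hW.1.
  by apply: test_measurable3; exact: test_box_plateau.
have [|||_] := @rint_dct _ _ _ leb3 f (fun x => W x * (\1_`]a1, b1[ x.1.1 * \1_`]a2, b2[ x.1.2 * \1_`]a3, b3[ x.2))
    (fun x => `|\1_(cube r) x * W x|) mf _ _ (ig_norm (L1_loc3_cube _ hW)) _.
- apply: measurable_funM; first exact: hW.1.
  apply: measurable_funM; first apply: measurable_funM.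
  + exact: (measurableT_comp (mI _ _) measurable_R3_11).
  + exact: (measurableT_comp (mI _ _) measurable_R3_12).
  + exact: (measurableT_comp (mI _ _) measurable_R3_2).
- apply: nearW => x; apply: cvgM; first exact: cvg_cst.
  by apply: cvgM; [apply: cvgM|]; exact: cvg_plateau.
- move=> n x; have pge0 a b y := @plateau_ge0 R a b n y.
  rewrite normrM [leRHS]normrM mulrC ler_wpM2r// ger0_norm; last first.
    by apply: mulr_ge0; [apply: mulr_ge0|]; exact: pge0.
  rewrite [leRHS]ger0_norm//.
  have le1 a b y : plateau a b n y <= 1.
    by rewrite (le_trans (plateau_le _ _ _ _))// indicE lern1; case: (_ \in _).
  rewrite indicE; case: (boolP (x \in cube r)) => [_|hx] /=.
    exact: mul3_le1.
  move: hx; apply: contraNT; rewrite -ltNge => h; rewrite inE.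
  have pos a b y : plateau a b n y != 0 -> `|y| <= `|a| + `|b|.
    move=> h1; have : y \in `]a, b[%classic.
      apply: contraNT h1 => hy; rewrite eq_le plateau_ge0 andbT.
      by rewrite (le_trans (plateau_le _ _ _ _))// indicE (negbTE hy).
    rewrite inE/= in_itv/= => /andP[ay yb]; rewrite ler_norml.
    have := ler_norm b; have := ler_norm (- a); rewrite normrN.
    have := normr_ge0 a; have := normr_ge0 b; lra.
  have := gt_eqF h => /negbT; rewrite mulf_eq0 negb_or => /andP[+ /pos h3].
  rewrite mulf_eq0 negb_or => /andP[/pos h1 /pos h2].
  move: h1 h2 h3; rewrite /r.
  have := normr_ge0 a1; have := normr_ge0 a2; have := normr_ge0 a3.
  have := normr_ge0 b1; have := normr_ge0 b2; have := normr_ge0 b3.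
  by move=> *; apply/cubeP; split; lra.
move=> h; rewrite -(cvg_lim (@Rhausdorff R) h).
by apply: lim_near_cst => //; apply: nearW => n; apply: W0; exact: test_box_plateau.
Qed.

(** Cutting [W] down to a box makes it globally integrable, as the Dynkin argument requires; its
    integral then vanishes over every Borel set. *)
Lemma fundamental_lemma_on_box (N : R) : {ae leb3, forall x,
  W x * (\1_`]-N, N[ x.1.1 * \1_`]-N, N[ x.1.2 * \1_`]-N, N[ x.2) = 0}.
Proof.
have mI (A : set mR) : measurable A -> measurable_fun setT (\1_A : mR -> R).
  by move=> ?; exact: measurable_indic.
pose g (x : R3 R) := W x * (\1_`]-N, N[ x.1.1 * \1_`]-N, N[ x.1.2 * \1_`]-N, N[ x.2).
pose J A B C := \int[leb3]_x (g x * (\1_A (x.1.1) * \1_B (x.1.2) * \1_C (x.2))).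
have mABC (A B C : set mR) : measurable A -> measurable B -> measurable C ->
    measurable_fun setT (fun x : R3 R => \1_A (x.1.1) * \1_B (x.1.2) * \1_C (x.2) : R).
  move=> mA mB mC; apply: measurable_funM; first apply: measurable_funM.
  + exact: (measurableT_comp (mI _ mA) measurable_R3_11).
  + exact: (measurableT_comp (mI _ mB) measurable_R3_12).
  + exact: (measurableT_comp (mI _ mC) measurable_R3_2).
have bABC (A B C : set mR) (x : R3 R) : `|\1_A (x.1.1) * \1_B (x.1.2) * \1_C (x.2) : R| <= 1.
  rewrite !indicE -!natrM normr_nat lern1.
  by case: (_ \in A); case: (_ \in B); case: (_ \in C).
have hg : ig leb3 g.
  apply: (@ig_le _ _ _ _ _ (fun x => `|\1_(cube N) x * W x|)).
  - by apply: measurable_funM; [exact: hW.1|exact: mABC].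
  - move=> x; rewrite normrM [leRHS]normrM mulrC ler_wpM2r//.
    have [h|h] := boolP (x \in cube N).
      by rewrite [X in _ <= `|X|]indicE h normr1 bABC.
    have -> : \1_`]-N, N[ x.1.1 * \1_`]-N, N[ x.1.2 * \1_`]-N, N[ x.2 = 0 :> R.
      apply/eqP; apply: contraNT h; rewrite !mulf_eq0 !negb_or !indicE !pnatr_eq0 !eqb0 !negbK.
      rewrite !mem_setE !in_itv/= => /andP[/andP[/andP[? ?] /andP[? ?]] /andP[? ?]].
      by rewrite inE; apply/cubeP; rewrite !ler_norml; split; apply/andP; split; exact: ltW.
    by rewrite normr0.
  - by apply: ig_norm; exact: L1_loc3_cube.
(* The product of two box indicators is a box indicator, so [integral_box_eq0] applies to the
   localized function as well. *)
have Joo a1 b1 a2 b2 a3 b3 : J `]a1, b1[%classic `]a2, b2[%classic `]a3, b3[%classic = 0.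
  rewrite /J -(integral_box_eq0 (Num.max (-N) a1) (Num.min N b1)
    (Num.max (-N) a2) (Num.min N b2) (Num.max (-N) a3) (Num.min N b3)).
  by apply: eq_Rintegral => x _; rewrite -!indic_itvoo_mul /g; ring.
have g0 : \int[leb3]_x g x = 0.
  exact: (integral_box_eq0 (-N) N (-N) N (-N) N).
have boxE a1 b1 a2 b2 a3 b3 (x : R3 R) : \1_(open_box a1 b1 a2 b2 a3 b3) x =
    \1_`]a1, b1[ x.1.1 * \1_`]a2, b2[ x.1.2 * \1_`]a3, b3[ x.2 :> R.
  rewrite open_boxE !indicE !in_setX -!natrM; congr (_ %:R).
  by case: (_ \in _); case: (_ \in _); case: (_ \in _).
have J5 (E : set (R3 R)) : measurable E -> \int[leb3]_x (g x * \1_E x) = 0.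
  move=> mE.
  apply: (@integral_zero_dynkin _ _ _ _ _ leb3 id _ g (@measurable_id _ _ _) hg
    rational_boxes_generate rational_boxes_setI) => //.
  move=> _ [a1 [b1 [a2 [b2 [a3 [b3 [_ _ _ ->]]]]]]].
  rewrite -[RHS](Joo a1 b1 a2 b2 a3 b3); apply: eq_Rintegral => x _.
  by rewrite (boxE _ _ _ _ _ _ x).
have := @integral_ae_eq _ _ _ leb3 setT measurableT (cst 0%E) (EFin \o g) hg (measurable_cst _) _.
move=> h; have {}h := h _.
have : ae_eq leb3 setT (EFin \o g) (cst 0%E).
  apply: h => E _ mE; rewrite integral0.
  have hE : ig leb3 (fun x => g x * \1_E x).
    under eq_fun do rewrite mulrC.
    apply: (@ig_bounded_mul _ _ _ _ _ _ 1) => //.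
    by move=> x; rewrite indicE ger0_norm// lern1; case: (_ \in _).
  have := EFin_rint hE; rewrite J5// => h5; rewrite [RHS]h5.
  rewrite integral_mkcond; apply: eq_integral => x _.
  by rewrite patchE indicE; case: ifP => _; rewrite ?mulr1 ?mulr0.
by apply: filterS => x /(_ I)[].
Qed.

Lemma fundamental_lemma : {ae leb3, forall x, W x = 0}.
Proof.
have := ae_foralln (fun n : nat => fundamental_lemma_on_box n%:R).
apply: filterS => x hx.
pose n := (Num.truncn (`|x.1.1| + `|x.1.2| + `|x.2|)).+1.
have h : `|x.1.1| + `|x.1.2| + `|x.2| < n%:R by exact: truncnS_gt.
have := hx n; rewrite !indicE !mem_set ?mulr1//=; rewrite in_itv/= -ltr_norml;
  apply: le_lt_trans h;
  have := normr_ge0 x.1.1; have := normr_ge0 x.1.2; have := normr_ge0 x.2; lra.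
Qed.

End FundamentalLemma.

(** * Absolutely continuous functions of one variable *)

Section OneDimensional.
Context {R : realType}.
Local Notation mR := (measurableTypeR R).
Local Notation mu := (@lebesgue_measure R).
Implicit Types (w k f F : R -> R) (a b h c : R).

Definition on01 k (t : mR) : R := \1_`[0, 1] t * k t.

Definition prim k (h : R) : R := \int[mu]_t (\1_`[0, h] t * k t).

(* Absolute continuity on [0, 1], up to the choice of a representative. *)
Definition ac w k : Prop :=
  [/\ measurable_fun [set: mR] w, measurable_fun [set: mR] k, ig mu (on01 k) &
      {ae mu, forall h : mR, `[0, 1]%classic h -> w h = w 0 + prim k h}].

Lemma on01_meas k : measurable_fun [set: mR] k -> measurable_fun [set: mR] (on01 k).
Proof. by move=> mk; apply: measurable_funM => //; exact: measurable_indic. Qed.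

Lemma prim_on01 k h : `[0, 1]%classic h -> prim k h = \int[mu]_t (\1_`[0, h] t * on01 k t).
Proof.
rewrite /= in_itv/= => /andP[h0 h1]; apply: eq_Rintegral => t _.
rewrite /on01 mulrA; congr (_ * _).
rewrite !indicE !mem_setE !in_itv/= -natrM mulnb; congr (_%:R); congr nat_of_bool.
by case: (boolP (0 <= t <= h)) => //= /andP[-> th]; rewrite (le_trans th h1).
Qed.

Lemma ig_prim k h : ig mu (on01 k) -> ig mu (fun t => \1_`[0, h] t * on01 k t).
Proof.
by move=> hk; exact: ig_indicM.
Qed.

Lemma prim_normle k h : ig mu (on01 k) -> `[0, 1]%classic h ->
  `|prim k h| <= \int[mu]_t `|on01 k t|.
Proof.
move=> hk h01; rewrite prim_on01//.
apply: (le_trans (rint_normle (ig_prim h hk))).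
apply: rint_le; [exact/ig_norm/ig_prim|exact: ig_norm|move=> x].
by rewrite normrM ler_piMl// indicE ger0_norm// lern1; case: (_ \in _).
Qed.

Lemma on01D k1 k2 : on01 (fun t => k1 t + k2 t) = fun t => on01 k1 t + on01 k2 t.
Proof. by apply/funext => t; rewrite /on01 mulrDr. Qed.

Lemma on01Z c k : on01 (fun t => c * k t) = fun t => c * on01 k t.
Proof. by apply/funext => t; rewrite /on01 mulrCA. Qed.

Lemma primD k1 k2 h : ig mu (on01 k1) -> ig mu (on01 k2) -> `[0, 1]%classic h ->
  prim (fun t => k1 t + k2 t) h = prim k1 h + prim k2 h.
Proof.
move=> i1 i2 h01; rewrite !prim_on01// on01D.
by under eq_Rintegral do rewrite mulrDr; rewrite rintD//; exact: ig_prim.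
Qed.

Lemma primZ c k h : ig mu (on01 k) -> `[0, 1]%classic h ->
  prim (fun t => c * k t) h = c * prim k h.
Proof.
move=> i1 h01; rewrite !prim_on01// on01Z.
by under eq_Rintegral do rewrite mulrCA; rewrite rintZ//; exact: ig_prim.
Qed.

Lemma on01B k1 k2 : on01 (fun t => k1 t - k2 t) = fun t => on01 k1 t - on01 k2 t.
Proof. by apply/funext => t; rewrite /on01 mulrBr. Qed.

Lemma primB k1 k2 h : ig mu (on01 k1) -> ig mu (on01 k2) -> `[0, 1]%classic h ->
  prim (fun t => k1 t - k2 t) h = prim k1 h - prim k2 h.
Proof.
move=> i1 i2 h01; rewrite !prim_on01// on01B.
by under eq_Rintegral do rewrite mulrBr; rewrite rintB//; exact: ig_prim.
Qed.

Lemma prim_ae k1 k2 h : measurable_fun [set: mR] k1 -> measurable_fun [set: mR] k2 ->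
  {ae mu, forall t : mR, on01 k1 t = on01 k2 t} -> `[0, 1]%classic h ->
  prim k1 h = prim k2 h.
Proof.
move=> m1 m2 e h01; rewrite !prim_on01//; apply: rint_ae.
- by apply: measurable_funM; [exact: measurable_indic|exact: on01_meas].
- by apply: measurable_funM; [exact: measurable_indic|exact: on01_meas].
by apply: filterS e => t ->.
Qed.

Lemma acD w1 k1 w2 k2 : ac w1 k1 -> ac w2 k2 ->
  ac (fun t => w1 t + w2 t) (fun t => k1 t + k2 t).
Proof.
move=> [mw1 mk1 i1 e1] [mw2 mk2 i2 e2]; split.
- exact: measurable_funD.
- exact: measurable_funD.
- by rewrite on01D; exact: igD.
apply: filterS2 e1 e2 => h h1 h2 h01.
by rewrite primD// h1// h2// addrACA.
Qed.

Lemma acZ c w k : ac w k -> ac (fun t => c * w t) (fun t => c * k t).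
Proof.
move=> [mw mk i e]; split.
- by apply: measurable_funM.
- by apply: measurable_funM.
- by rewrite on01Z; exact: igZ.
by apply: filterS e => h hh h01; rewrite primZ// -mulrDr hh.
Qed.

Lemma rint_FTC2 F f a b : a < b ->
  (forall x : R, a <= x <= b -> is_derive x 1 F (f x)) ->
  (forall x : R, a <= x <= b -> {for x, continuous f}) ->
  \int[mu]_t (\1_`[a, b] t * f t) = F b - F a.
Proof.
move=> ab dF cf.
have cF x : a <= x <= b -> {for x, continuous F}.
  move=> xab; apply: differentiable_continuous; apply/derivable1_diffP.
  by have [] := dF x xab.
have sub x : x \in `]a, b[ -> a <= x <= b.
  by rewrite in_itv/= => /andP[? ?]; rewrite !ltW.
have := @continuous_FTC2 R f F a b ab _ _ _.
have -> : (\int[mu]_(x in `[a, b]) (f x)%:E)%E = (\int[mu]_t (\1_`[a, b] t * f t)%:E)%E.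
  rewrite integral_mkcond; apply: eq_integral => x _.
  by rewrite patchE indicE; case: ifP => _; rewrite ?mul1r ?mul0r.
move=> h; rewrite /Rintegral h//.
- apply: continuous_in_subspaceT => x; rewrite inE/= in_itv/=; exact: cf.
- split.
  + by move=> x /sub /dF[].
  + by apply: cvg_at_right_filter; apply: cF; rewrite lexx ltW.
  + by apply: cvg_at_left_filter; apply: cF; rewrite lexx ltW.
- by move=> x /sub /dF[_ <-]; rewrite derive1E.
Qed.

Lemma ig_continuous_itv f a b : (forall x : R, a <= x <= b -> {for x, continuous f}) ->
  ig mu (fun t : mR => \1_`[a, b] t * f t).
Proof.
move=> cf.
have h : mu.-integrable `[a, b] (EFin \o f).
  apply: continuous_compact_integrable; first exact: segment_compact.
  by apply: continuous_in_subspaceT => x; rewrite inE/= in_itv/=; exact: cf.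
have {}h := (@integrable_mkcond _ mR R mu `[a, b]%classic (EFin \o f) (measurable_itv _)).1 h.
apply: eq_integrable h => // x _ /=.
by rewrite patchE indicE; case: ifP => _; rewrite ?mul1r ?mul0r.
Qed.

Lemma continuous_primitive f : continuous f ->
  exists P : R -> R, forall x : R, 0 <= x <= 1 -> is_derive x 1 P (f x).
Proof.
(* The primitive starts at -1 and is controlled up to 2, so that its derivative is two-sided at 0
   and at 1. *)
move=> cf; pose P x := \int[mu]_(t in `[- 1, x]) f t.
exists P => x /andP[x0 x1].
have i : mu.-integrable `[- 1, 2] (EFin \o f).
  apply: continuous_compact_integrable; first exact: segment_compact.
  exact: continuous_subspaceT.
have [||h1 h2] := @continuous_FTC1_closed R f (-1) x 2 _ i _ (cf x).
- lra.
- lra.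
by apply: DeriveDef; [exact: h1|rewrite -derive1E; exact: h2].
Qed.

Lemma prim_FTC2 F f h : `[0, 1]%classic h ->
  (forall x : R, 0 <= x <= 1 -> is_derive x 1 F (f x)) ->
  (forall x : R, 0 <= x <= 1 -> {for x, continuous f}) ->
  F h = F 0 + prim f h.
Proof.
rewrite /= in_itv/= => /andP[h0 h1] dF cf.
move: h0; rewrite le_eqVlt => /predU1P[<-|h0].
  rewrite /prim set_itv1; under eq_Rintegral => t _.
    rewrite (_ : _ * _ = f 0 * \1_[set 0] t); last first.
      rewrite indicE; case: (boolP (t \in [set 0])); rewrite ?mul0r ?mulr0// inE => ->.
      by rewrite mul1r mulr1.
    over.
  have m0 : measurable ([set 0%R] : set mR) by exact: measurable_set1.
  have z0 : mu ([set 0%R] : set mR) = 0%E by exact: lebesgue_measure_set1.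
  have z1 : (mu ([set 0%R] : set mR) < +oo)%E by rewrite z0 ltry.
  have i0 : ig mu (\1_([set 0%R] : set mR)) by exact: (ig_indic m0 z1).
  have r0 : \int[mu]_t (\1_([set 0%R] : set mR) t : R) = 0.
    by rewrite (rint_indic _ m0) -[RHS]/(fine 0%E); congr fine.
  by rewrite rintZ// [X in _ * X]r0 mulr0 addr0.
have dF' (x : R) : 0 <= x <= h -> is_derive x 1 F (f x).
  by move=> /andP[x0 xh]; apply: dF; rewrite x0 (le_trans xh).
have cf' (x : R) : 0 <= x <= h -> {for x, continuous f}.
  by move=> /andP[x0 xh]; apply: cf; rewrite x0 (le_trans xh).
by rewrite /prim (rint_FTC2 h0 dF' cf') addrC subrK.
Qed.

Lemma ac_C1 w k : (forall x : R, is_derive x 1 w (k x)) -> continuous k -> ac w k.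
Proof.
move=> dw ck.
have cw : continuous w.
  move=> x; apply: differentiable_continuous; apply/derivable1_diffP.
  by have [] := dw x.
split.
- exact: continuous_measurable_fun.
- exact: continuous_measurable_fun.
- by apply: ig_continuous_itv => x _; exact: ck.
by apply: nearW => h h01; apply: prim_FTC2 => // x _; exact: ck.
Qed.

Lemma continuous_bounded_itv f (B : R) : continuous f ->
  exists2 M : R, 0 <= M & forall y, `|y| <= B -> `|f y| <= M.
Proof.
move=> cf; have /compact_bounded[M [_ hM]] : compact (f @` `[- B, B]).
  by apply: continuous_compact; [exact: continuous_subspaceT|exact: segment_compact].
exists (`|M| + 1); first by rewrite addr_ge0.
move=> y yB; apply: hM; first by rewrite (le_lt_trans (ler_norm M))// ltrDl.
by exists y => //=; rewrite in_itv/= -ler_norml.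
Qed.

Lemma measurable_prim_par d (X : measurableType d) (K : X * mR -> R) :
  measurable_fun setT K ->
  measurable_fun setT (fun p : X * mR => prim (fun t => K (p.1, t)) p.2).
Proof.
move=> mK.
(* The indicator of [[0, h]] is written as a condition on [(t, h)], which shows joint measurability
   although the domain of integration varies. *)
pose f (q : (X * mR) * mR) : R :=
  if (0 <= q.2) && (q.2 <= q.1.2) then K (q.1.1, q.2) else 0.
have m2 : measurable_fun setT (fun q : (X * mR) * mR => q.2) by exact: measurable_snd.
have m12 : measurable_fun setT (fun q : (X * mR) * mR => q.1.2).
  by apply: (measurableT_comp measurable_snd); exact: measurable_fst.
have m11 : measurable_fun setT (fun q : (X * mR) * mR => q.1.1).
  by apply: (measurableT_comp measurable_fst); exact: measurable_fst.
have mf : measurable_fun setT f.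
  apply: measurable_fun_ifT => //.
    by apply: measurable_and; exact: measurable_fun_ler.
  exact: (measurableT_comp mK (measurable_fun_pair m11 m2)).
apply: eq_measurable_fun (measurable_par1 mu mf) => p _.
apply: eq_Rintegral => t _; rewrite /f /= indicE mem_setE in_itv/=.
by case: ifP => _; rewrite ?mul1r ?mul0r.
Qed.

Lemma measurable_prim k : measurable_fun [set: mR] k -> measurable_fun [set: mR] (prim k).
Proof.
move=> mk.
have mK : measurable_fun setT (fun p : mR * mR => k p.2).
  by apply: (measurableT_comp mk); exact: measurable_snd.
have := measurable_prim_par mK => h.
have md : measurable_fun [set: mR] (fun x : mR => (x, x)).
  by apply: measurable_fun_pair.
by apply: eq_measurable_fun (measurableT_comp h md).
Qed.

Lemma on01_eq k1 k2 : (forall t : R, 0 <= t <= 1 -> k1 t = k2 t) -> on01 k1 = on01 k2.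
Proof.
move=> h; apply/funext => t; rewrite /on01 indicE mem_setE in_itv/=.
by case: (boolP (0 <= t <= 1)) => [/h ->//|_]; rewrite !mul0r.
Qed.

Lemma norm_on01_le k1 k2 : (forall t : R, 0 <= t <= 1 -> `|k1 t| <= k2 t) ->
  forall t, `|on01 k1 t| <= on01 k2 t.
Proof.
move=> h t; rewrite /on01 indicE mem_setE in_itv/=.
by case: (boolP (0 <= t <= 1)) => [/h ht|_]; rewrite ?mul0r ?normr0// !mul1r.
Qed.

Lemma ig_on01_bounded f k (M : R) : measurable_fun [set: mR] f ->
  (forall t : R, 0 <= t <= 1 -> `|f t| <= M) -> ig mu (on01 k) ->
  ig mu (on01 (fun t => f t * k t)).
Proof.
move=> mf fM ik.
rewrite (_ : on01 _ = fun t => on01 f t * on01 k t); last first.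
  apply/funext => t; rewrite /on01 indicE; case: (t \in _); last by rewrite !mul0r.
  by rewrite !mul1r.
apply: (@ig_bounded_mul _ _ _ _ _ _ `|M|) => //; first exact: on01_meas.
move=> t; rewrite /on01 indicE mem_setE in_itv/=.
case: (boolP (0 <= t <= 1)) => [/fM ht|_]; last by rewrite mul0r normr0.
by rewrite mul1r (le_trans ht)// ler_norm.
Qed.

(** The function [k] is approximated in L^1(0, 1) by continuous functions, for which the formula is
    the fundamental theorem of calculus. Their primitives converge uniformly, so [dPhi] is evaluated
    in a fixed bounded interval and the formula passes to the limit. *)
Lemma ac_chain Phi dPhi w k :
  (forall y : R, is_derive y 1 Phi (dPhi y)) -> continuous dPhi ->
  ac w k -> ac (Phi \o w) (fun t => dPhi (w t) * k t).
Proof.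
move=> dP cd [mw mk ik e].
have cPhi : continuous Phi.
  move=> x; apply: differentiable_continuous; apply/derivable1_diffP.
  by have [] := dP x.
pose W h := w 0 + prim k h.
have ikE : mu.-integrable `[0, 1] (EFin \o k).
  apply: (@integrable_mkcond _ mR R mu `[0, 1]%classic (EFin \o k) (measurable_itv _)).2.
  apply: eq_integrable ik => // t _ /=.
  by rewrite patchE /on01 indicE; case: ifP => _; rewrite ?mul1r ?mul0r.
have fin01 : (mu (`[0%R, 1%R]%classic : set mR) < +oo)%E.
  by rewrite /= lebesgue_measure_itv/= lte_fin ltr01 ltry.
have [g0 [cg0 ig0 cvg0]] :=
  @approximation_continuous_integrable R _ _ (measurable_itv _) fin01 ikE.
pose d0 n := \int[mu]_t `|on01 (fun t => k t - g0 n t) t|.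
have ig0' n : ig mu (on01 (g0 n)).
  by apply: ig_continuous_itv => x _; exact: cg0.
have igB' n : ig mu (on01 (fun t => k t - g0 n t)).
  by rewrite on01B; exact: igB.
have d0cvg : d0 n @[n --> \oo] --> 0.
  have -> : d0 = fine \o (fun n => \int[mu]_(z in `[0%R, 1%R]) `|(k z - g0 n z)%:E|)%E.
    apply/funext => n; rewrite /d0 /Rintegral /=; congr fine.
    rewrite [RHS]integral_mkcond; apply: eq_integral => t _.
    rewrite patchE /on01 indicE; case: (t \in _); last by rewrite mul0r normr0.
    by rewrite mul1r.
  by apply: fine_cvg; exact: cvg0.
have [n0 _ hn0] : \forall n \near \oo, d0 n <= 1.
  have := cvgr_le _ d0cvg 1; apply; exact: ltr01.
(* After this shift all L^1 distances are at most 1, which is the 1 in the common bound [B]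
   below. *)
pose g n := g0 (n + n0)%N; pose dd n := d0 (n + n0)%N.
have dcvg : dd n @[n --> \oo] --> 0 by rewrite /dd (cvg_shiftn n0 d0).
have dsmall eps : 0 < eps -> \forall n \near \oo, dd n <= eps.
  by move=> eps0; exact: (cvgr_le _ dcvg eps eps0).
have dle1 n : dd n <= 1 by apply: hn0 => /=; rewrite leq_addl.
pose Wn n h := w 0 + prim (g n) h.
have WnW n h : `[0, 1]%classic h -> `|W h - Wn n h| <= dd n.
  move=> h01; rewrite /W /Wn opprD addrACA subrr add0r -primB//; last exact: ig0'.
  exact: (prim_normle (igB' (n + n0)%N) h01).
pose B := `|w 0| + \int[mu]_t `|on01 k t| + 1.
have WB h : `[0, 1]%classic h -> `|W h| <= B.
  move=> h01; rewrite /W /B (le_trans (ler_normD _ _))//.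
  by rewrite -addrA lerD2l (le_trans (prim_normle _ _))// lerDl.
have WnB n h : `[0, 1]%classic h -> `|Wn n h| <= B.
  move=> h01; have -> : Wn n h = W h - (W h - Wn n h) by rewrite opprB addrC subrK.
  rewrite (le_trans (ler_normB _ _))// /B lerD//; last exact: (le_trans (WnW _ _ h01)).
  rewrite /W (le_trans (ler_normD _ _))// lerD2l; exact: prim_normle.
have [M M0 hM] := continuous_bounded_itv B cd.
have mW : measurable_fun [set: mR] W.
  by apply: measurable_funD => //; exact: measurable_prim.
have mg n : measurable_fun [set: mR] (g n) by apply: continuous_measurable_fun; exact: cg0.
have mWn n : measurable_fun [set: mR] (Wn n).
  by apply: measurable_funD => //; exact: measurable_prim.
have mdPhi : measurable_fun [set: mR] dPhi by exact: continuous_measurable_fun.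
have classical n h : `[0, 1]%classic h ->
    Phi (Wn n h) = Phi (w 0) + prim (fun t => dPhi (Wn n t) * g n t) h.
  move=> h01; have [P hP] := continuous_primitive (cg0 (n + n0)%N).
  have PE (x : R) : 0 <= x <= 1 -> Wn n x = w 0 + (P x - P 0).
    move=> x01; have x01' : `[0, 1]%classic x by rewrite /= in_itv.
    rewrite (prim_FTC2 x01' hP (fun y _ => cg0 (n + n0)%N y)).
    by rewrite addrAC subrr add0r.
  pose V (x : R) : R := w 0 + (P x - P 0).
  have dV (x : R) : 0 <= x <= 1 -> is_derive x 1 V (g n x).
    move=> x01; have hx := hP x x01.
    rewrite /V; apply: (is_derive_eq (is_deriveD (is_derive_cst (w 0) x 1) (is_deriveB hx (is_derive_cst (P 0) x 1)))).
    by rewrite add0r subr0.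
  have cV (x : R) : 0 <= x <= 1 -> {for x, continuous V}.
    move=> x01; apply: differentiable_continuous; apply/derivable1_diffP.
    by have [] := dV x x01.
  have h01' : 0 <= h <= 1 by move: h01; rewrite /= in_itv.
  have V0 : V 0 = w 0 by rewrite /V subrr addr0.
  have dPV (x : R) : 0 <= x <= 1 -> is_derive x 1 (Phi \o V) (dPhi (V x) * g n x).
    by move=> x01; apply: is_derive1_comp; exact: dV.
  have cPV (x : R) : 0 <= x <= 1 -> {for x, continuous (fun t => dPhi (V t) * g n t)}.
    move=> x01; apply: cvgM; last exact: cg0.
    by apply: continuous_comp; [exact: cV|exact: cd].
  have := prim_FTC2 h01 dPV cPV; rewrite /= V0 PE// -/(V h) => ->.
  congr (_ + _); rewrite !prim_on01//; apply: eq_Rintegral => t _; congr (_ * _).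
  by rewrite (@on01_eq _ (fun t => dPhi (Wn n t) * g n t))// => y y01; rewrite PE.
have ikW : ig mu (on01 (fun t => dPhi (W t) * k t)).
  apply: (@ig_on01_bounded _ _ M) => //; first exact: measurableT_comp.
  by move=> t t01; apply: hM; apply: WB; rewrite /= in_itv.
have limit h : `[0, 1]%classic h ->
    prim (fun t => dPhi (Wn n t) * g n t) h @[n --> \oo] -->
    prim (fun t => dPhi (W t) * k t) h.
  move=> h01.
  (* The error splits in two: one part is small because [g n] tends to [k] in L^1 and [dPhi] is
     bounded, the other by dominated convergence, as [Wn n] tends to [W]. *)
  pose A n := prim (fun t => dPhi (Wn n t) * (g n t - k t)) h.
  pose Bn n := prim (fun t => (dPhi (Wn n t) - dPhi (W t)) * k t) h.
  have iA n : ig mu (on01 (fun t => g n t - k t)).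
    by rewrite on01B; exact: (igB (ig0' (n + n0)%N) ik).
  have iA' n : ig mu (on01 (fun t => dPhi (Wn n t) * (g n t - k t))).
    apply: (@ig_on01_bounded _ _ M) => //; first exact: measurableT_comp.
    by move=> t t01; apply: hM; apply: WnB; rewrite /= in_itv.
  have iB' n : ig mu (on01 (fun t => (dPhi (Wn n t) - dPhi (W t)) * k t)).
    apply: (@ig_on01_bounded _ _ (M + M)) => //.
      by apply: measurable_funB; exact: measurableT_comp.
    move=> t t01; rewrite (le_trans (ler_normB _ _))// lerD// hM//.
      by apply: WnB; rewrite /= in_itv.
    by apply: WB; rewrite /= in_itv.
  have split n : prim (fun t => dPhi (Wn n t) * g n t) h =
      prim (fun t => dPhi (W t) * k t) h + (A n + Bn n).
    rewrite /A /Bn -!primD//; last by rewrite on01D; exact: igD.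
    by apply: eq_Rintegral => t _; congr (_ * _); ring.
  rewrite -[X in _ --> X]addr0; under eq_fun do rewrite split.
  apply: cvgD; first exact: cvg_cst.
  rewrite -[X in _ --> X]addr0; apply: cvgD.
    apply/norm_cvg0P; apply: (@squeeze_cvgr _ _ _ _ (fun=> 0) (fun n => M * dd n)).
    - apply: nearW => n; rewrite normr_ge0/= (le_trans (prim_normle (iA' n) h01))//.
      rewrite /dd /d0 -rintZ; last exact: ig_norm.
      apply: rint_le; [exact: ig_norm|by apply: igZ; exact: ig_norm|move=> t].
      rewrite /on01 indicE; case: (boolP (t \in _)); rewrite ?mul0r ?normr0 ?mulr0// !mul1r.
      rewrite inE => t01; rewrite normrM distrC ler_wpM2r// hM//; exact: WnB.
    - exact: cvg_cst.
    - by rewrite -(mulr0 M); apply: cvgM => //; exact: cvg_cst.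
  have [||||_] := @rint_dct _ _ _ mu
    (fun n t => \1_`[0, h] t * on01 (fun t => (dPhi (Wn n t) - dPhi (W t)) * k t) t)
    (fun=> 0) (fun t => (M + M) * `|on01 k t|) _ _ _ (igZ (M + M) (ig_norm ik)) _.
  - by move=> n; apply: ig_meas; exact: ig_prim.
  - exact: measurable_cst.
  - apply: nearW => t; rewrite /on01 !indicE.
    have [t01|_] := boolP (t \in `[0, 1]%classic); last first.
      by under eq_fun do rewrite mul0r mulr0; exact: cvg_cst.
    rewrite -[X in _ --> X](mulr0 (t \in `[0, h]%classic)%:R); apply: cvgM; first exact: cvg_cst.
    have h0 : Wn n t @[n --> \oo] --> W t.
      apply/cvgrPdist_le => eps eps0; have := dsmall eps eps0.
      by apply: filterS => n hn; apply: le_trans hn; apply: WnW; rewrite inE in t01.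
    have h1 : dPhi (Wn n t) - dPhi (W t) @[n --> \oo] --> 0.
      rewrite -[X in _ --> X](subrr (dPhi (W t))); apply: cvgB; last exact: cvg_cst.
      by apply: continuous_cvg => //; exact: cd.
    have h2 : (dPhi (Wn n t) - dPhi (W t)) * k t @[n --> \oo] --> 0.
      by rewrite -[X in _ --> X](mul0r (k t)); apply: cvgM => //; exact: cvg_cst.
    by under eq_fun do rewrite mul1r.
  - move=> n t; rewrite normrM (le_trans (ler_piMl _ (norm_indic_le1 _ _ _)))//.
    rewrite /on01 indicE; case: (boolP (t \in _)); rewrite ?mul0r ?normr0 ?mulr0// !mul1r.
    rewrite inE => t01; rewrite normrM ler_wpM2r//.
    by rewrite (le_trans (ler_normB _ _))// lerD// hM//; [exact: WnB|exact: WB].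
  rewrite rint0; apply: cvg_trans; apply: near_eq_cvg; apply: nearW => n.
  by rewrite /Bn prim_on01.
have chainW h : `[0, 1]%classic h ->
    Phi (W h) = Phi (w 0) + prim (fun t => dPhi (W t) * k t) h.
  move=> h01.
  have c1 : Phi (Wn n h) @[n --> \oo] --> Phi (W h).
    apply: continuous_cvg; first exact: cPhi.
    apply/cvgrPdist_le => eps eps0; have := dsmall eps eps0.
    by apply: filterS => n hn; apply: le_trans hn; exact: WnW.
  have c2 : Phi (Wn n h) @[n --> \oo] --> Phi (w 0) + prim (fun t => dPhi (W t) * k t) h.
    under eq_fun do rewrite classical//.
    by apply: cvgD; [exact: cvg_cst|exact: limit].
  by rewrite -(cvg_lim (@Rhausdorff R) c1); exact: (cvg_lim (@Rhausdorff R) c2).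
have mPw : measurable_fun [set: mR] (fun t => dPhi (w t) * k t).
  by apply: measurable_funM => //; exact: measurableT_comp.
have mPW : measurable_fun [set: mR] (fun t => dPhi (W t) * k t).
  by apply: measurable_funM => //; exact: measurableT_comp.
have eqae : {ae mu, forall t : mR, on01 (fun t => dPhi (W t) * k t) t =
    on01 (fun t => dPhi (w t) * k t) t}.
  apply: filterS e => t ht; rewrite /on01 indicE; case: (boolP (t \in _)); last by rewrite !mul0r.
  by rewrite inE => /ht ->.
split => //.
- by apply: measurableT_comp => //; exact: continuous_measurable_fun.
- by apply: ig_ae eqae ikW; exact: on01_meas.
apply: filterS e => h he h01.
by rewrite /= he// chainW//; congr (_ + _); exact: prim_ae.
Qed.

End OneDimensional.

(** * Measurability of the inverse *)

Section MeasurableInverse.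
Context {R : realType}.
Local Notation mR := (measurableTypeR R).

Lemma cvg_regularized_inv (y : R) : y / (y ^+ 2 + n.+1%:R^-1) @[n --> \oo] --> y^-1.
Proof.
have [->|y0] := eqVneq y 0.
  by under eq_fun do rewrite mul0r; rewrite invr0; exact: cvg_cst.
have -> : y^-1 = y / (y ^+ 2 + 0) by field.
apply: cvgM; first exact: cvg_cst.
apply: cvgV; first by rewrite addr0 expf_neq0.
by apply: cvgD; [exact: cvg_cst|exact: cvg_harmonic].
Qed.

(** The regularizations [y / (y^2 + 1/(n+1))] are continuous everywhere and vanish at 0, in
    agreement with the convention [0^-1 = 0]. *)
Lemma measurable_invr : measurable_fun [set: mR] (fun y : mR => y^-1 : R).
Proof.
apply: (@measurable_fun_cvg _ _ _ _ (fun n (y : mR) => y / (y ^+ 2 + n.+1%:R^-1))) => //.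
  move=> n; apply: continuous_measurable_fun => y.
  have p0 : 0 < y ^+ 2 + n.+1%:R^-1 by rewrite ltr_wpDl// sqr_ge0.
  apply: cvgM; first exact: cvg_id.
  apply: cvgV; first by rewrite gt_eqF.
  by apply: cvgD; [exact: exprn_continuous|exact: cvg_cst].
by move=> y _; exact: cvg_regularized_inv.
Qed.

End MeasurableInverse.

(** * Products, limits and square roots of absolutely continuous functions *)

Section AcCalculus.
Context {R : realType}.
Local Notation mR := (measurableTypeR R).
Local Notation mu := (@lebesgue_measure R).
Implicit Types (w k f F : R -> R) (a b h c : R).

Lemma ac_cst c : ac (fun=> c : R) (fun=> 0 : R).
Proof.
by apply: ac_C1; exact: cst_continuous.
Qed.

Lemma acN w k : ac w k -> ac (fun t => - w t) (fun t => - k t).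
Proof.
move=> /(acZ (-1)); congr ac; apply/funext => t; exact: mulN1r.
Qed.

Lemma acB w1 k1 w2 k2 : ac w1 k1 -> ac w2 k2 ->
  ac (fun t => w1 t - w2 t) (fun t => k1 t - k2 t).
Proof. by move=> h1 /acN h2; exact: acD. Qed.

Lemma ac_sqr w k : ac w k -> ac (fun t => w t ^+ 2) (fun t => 2 * w t * k t).
Proof.
apply: (@ac_chain _ (fun y => y ^+ 2) (fun y => 2 * y)).
  move=> y; have := @is_deriveX _ _ (@id R) 2 y 1 1 (is_derive_id y 1).
  move=> h; apply: (is_derive_eq h).
  by rewrite /GRing.scale/= mulr1 expr1.
by move=> y; apply: cvgM; [exact: cvg_cst|exact: cvg_id].
Qed.

(** Polarization reduces the product rule to [ac_sqr], that is, to the chain rule for the square. *)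
Lemma acM w1 k1 w2 k2 : ac w1 k1 -> ac w2 k2 ->
  ac (fun t => w1 t * w2 t) (fun t => k1 t * w2 t + w1 t * k2 t).
Proof.
move=> h1 h2.
have := acZ 4^-1 (acB (ac_sqr (acD h1 h2)) (ac_sqr (acB h1 h2))).
rewrite (_ : (fun t => 4^-1 * ((w1 t + w2 t) ^+ 2 - (w1 t - w2 t) ^+ 2)) = fun t => w1 t * w2 t); last first.
  by apply/funext => t; field.
rewrite (_ : (fun t => 4^-1 * (2 * (w1 t + w2 t) * (k1 t + k2 t) - _)) = fun t => k1 t * w2 t + w1 t * k2 t)//.
by apply/funext => t; field.
Qed.

(** Dominated convergence under the primitive. The value at 0 enters the formula for every [h], so
    convergence is assumed at each point rather than almost everywhere. *)
Lemma ac_limit (w_ k_ : nat -> R -> R) w k K :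
  (forall n, ac (w_ n) (k_ n)) ->
  measurable_fun [set: mR] w -> measurable_fun [set: mR] k ->
  (forall t, w_ n t @[n --> \oo] --> w t) ->
  (forall t, k_ n t @[n --> \oo] --> k t) ->
  (forall n t, `|k_ n t| <= K t) -> ig mu (on01 K) -> ac w k.
Proof.
move=> hac mw mk cw ck kK iK.
have mk_ n : measurable_fun [set: mR] (k_ n) by have [] := hac n.
have [||||ik _] := @rint_dct _ _ _ mu (fun n => on01 (k_ n)) (on01 k) (on01 K) _ _ _ iK _.
- by move=> n; exact: on01_meas.
- exact: on01_meas.
- by apply: nearW => t; apply: cvgM; [exact: cvg_cst|exact: ck].
- by move=> n; exact: norm_on01_le.
split => //.
have hn := ae_foralln (fun n => let: And4 _ _ _ e := hac n in e).
apply: filterS hn => h hh h01.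
have c1 : w_ n h @[n --> \oo] --> w h := cw h.
suff c2 : w_ n h @[n --> \oo] --> w 0 + prim k h.
  by rewrite -(cvg_lim (@Rhausdorff R) c1); exact: (cvg_lim (@Rhausdorff R) c2).
rewrite (_ : (fun n => w_ n h) = fun n => w_ n 0 + prim (k_ n) h); last first.
  by apply/funext => n; exact: hh.
apply: cvgD; first exact: cw.
rewrite (_ : (fun n => prim (k_ n) h) = fun n => \int[mu]_t (\1_`[0, h] t * on01 (k_ n) t)); last first.
  by apply/funext => n; rewrite prim_on01.
rewrite prim_on01//.
have [||||_ //] := @rint_dct _ _ _ mu (fun n t => \1_`[0, h] t * on01 (k_ n) t)
  (fun t => \1_`[0, h] t * on01 k t) (on01 K) _ _ _ iK _.
- by move=> n; apply: measurable_funM; [exact: measurable_indic|exact: on01_meas].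
- by apply: measurable_funM; [exact: measurable_indic|exact: on01_meas].
- apply: nearW => t; apply: cvgM; first exact: cvg_cst.
  by apply: cvgM; [exact: cvg_cst|exact: ck].
- move=> n t; rewrite normrM (le_trans (ler_piMl _ (norm_indic_le1 _ _ _)))//.
  exact: norm_on01_le.
Qed.

(* At [y = 0] the derivative of the regularization vanishes for every [e], so
   that the limit below needs no information on the derivative of [w] on the
   set where [w = 0]. *)
Lemma is_derive_root4 (e y : R) : 0 < e ->
  is_derive y 1 (fun y => Num.sqrt (Num.sqrt (y ^+ 2 + e)))
    (y / (2 * Num.sqrt (Num.sqrt (y ^+ 2 + e)) ^+ 3)).
Proof.
move=> e0; have p0 : 0 < y ^+ 2 + e by rewrite ltr_wpDl// sqr_ge0.
have h1 : is_derive y 1 (fun y : R => y ^+ 2 + e) (2 * y).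
  have h := is_deriveD (is_deriveX 2 (is_derive_id y (1 : R))) (is_derive_cst e y 1).
  by apply: (is_derive_eq h); rewrite /GRing.scale/= mulr1 expr1 addr0.
have q0 : 0 < Num.sqrt (y ^+ 2 + e) by rewrite sqrtr_gt0.
have h2 := @is_derive1_comp _ Num.sqrt _ y _ _ (is_derive1_sqrt p0) h1.
have h3 := @is_derive1_comp _ Num.sqrt _ y _ _ (is_derive1_sqrt q0) h2.
apply: (is_derive_eq h3).
set q := Num.sqrt (Num.sqrt _).
have q1 : 0 < q by rewrite sqrtr_gt0.
have -> : Num.sqrt (y ^+ 2 + e) = q ^+ 2 by rewrite sqr_sqrtr// ltW.
by field; rewrite gt_eqF.
Qed.

(** The square root is not C^1 at 0, so it is replaced by the fourth root of [y^2 + e]. The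
    derivatives of these regularizations along [w] are dominated, uniformly in [e], by
    [|k| / (2 sqrt w)], whose integrability is the hypothesis. *)
Lemma ac_sqrt w k : (forall t, 0 <= w t) -> ac w k ->
  ig mu (on01 (fun t => k t / (2 * Num.sqrt (w t)))) ->
  ac (fun t => Num.sqrt (w t)) (fun t => k t / (2 * Num.sqrt (w t))).
Proof.
move=> w0 acw iK.
have [mw mk _ _] := acw.
pose e n : R := n.+1%:R^-1.
have e0 n : 0 < e n by rewrite invr_gt0.
pose q n (y : R) := Num.sqrt (Num.sqrt (y ^+ 2 + e n)).
have qp n y : 0 < q n y.
  by rewrite !sqrtr_gt0 ltr_wpDl// sqr_ge0.
have cq n : continuous (q n).
  move=> y; apply: differentiable_continuous; apply/derivable1_diffP.
  by have [] := is_derive_root4 y (e0 n).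
have msqrt : measurable_fun [set: mR] (@Num.sqrt R) by apply: continuous_measurable_fun; exact: sqrt_continuous.
have cq0 t : q n (w t) @[n --> \oo] --> Num.sqrt (w t).
  have c1 : w t ^+ 2 + e n @[n --> \oo] --> w t ^+ 2 + 0.
    by apply: cvgD; [exact: cvg_cst|exact: cvg_harmonic].
  have c2 := cvg_comp _ _ c1 (@sqrt_continuous R _).
  have c3 := cvg_comp _ _ c2 (@sqrt_continuous R _).
  by move: c3; rewrite addr0 sqrtr_sqr ger0_norm.
have mKq : measurable_fun [set: mR] (fun t => k t / (2 * Num.sqrt (w t))).
  apply: measurable_funM => //; apply: (measurableT_comp measurable_invr).
  by apply: measurable_funM => //; exact: measurableT_comp.
apply: (@ac_limit (fun n t => q n (w t))
  (fun n t => (w t / (2 * q n (w t) ^+ 3)) * k t) _ _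
  (fun t => `|k t / (2 * Num.sqrt (w t))|)).
- move=> n; apply: (@ac_chain _ (q n) (fun y => y / (2 * q n y ^+ 3))) acw.
    by move=> y; exact: is_derive_root4.
  move=> y; apply: cvgM; first exact: cvg_id.
  apply: cvgV; first by rewrite mulf_neq0// expf_neq0// gt_eqF.
  apply: cvgM; first exact: cvg_cst.
  by apply: (@continuous_comp _ _ _ (q n) (fun z => z ^+ 3)); [exact: cq|exact: exprn_continuous].
- exact: measurableT_comp.
- exact: mKq.
- by move=> t; exact: cq0.
- move=> t; have [z|z] := eqVneq (w t) 0.
    rewrite z sqrtr0 mulr0 invr0 mulr0.
    by under eq_fun do rewrite mul0r mul0r; exact: cvg_cst.
  have wp : 0 < w t by rewrite lt_neqAle eq_sym z w0.
  have -> : k t / (2 * Num.sqrt (w t)) = w t / (2 * Num.sqrt (w t) ^+ 3) * k t.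
    have ws := sqr_sqrtr (w0 t).
    have : Num.sqrt (w t) != 0 by rewrite gt_eqF// sqrtr_gt0.
    move: ws; set s := Num.sqrt (w t) => <- s0.
    by field.
  apply: cvgM; last exact: cvg_cst.
  apply: cvgM; first exact: cvg_cst.
  apply: cvgV; first by rewrite mulf_neq0// expf_neq0// gt_eqF// sqrtr_gt0.
  apply: cvgM; first exact: cvg_cst.
  exact: (cvg_comp _ _ (cq0 t) (@exprn_continuous R 3 _)).
- move=> n t; rewrite normrM [leRHS]normrM mulrC ler_wpM2l//.
  have [z|z] := eqVneq (w t) 0; first by rewrite z mul0r normr0.
  have wp : 0 < w t by rewrite lt_neqAle eq_sym z w0.
  have sp : 0 < Num.sqrt (w t) by rewrite sqrtr_gt0.
  have sq : Num.sqrt (w t) <= q n (w t).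
    apply: ler_wsqrtr; rewrite -{1}(ger0_norm (w0 t)) -sqrtr_sqr.
    by apply: ler_wsqrtr; rewrite lerDl ltW.
  rewrite !ger0_norm; last 2 first.
  + by rewrite invr_ge0 mulr_ge0// ltW.
  + by rewrite divr_ge0// mulr_ge0// exprn_ge0// ltW.
  rewrite ler_pdivrMr; last by rewrite mulr_gt0// exprn_gt0.
  rewrite mulrC ler_pdivlMr ?mulr_gt0//.
  have s3 : Num.sqrt (w t) ^+ 3 <= q n (w t) ^+ 3.
    by rewrite lerXn2r// nnegrE ltW.
  have -> : w t * (2 * Num.sqrt (w t)) = 2 * Num.sqrt (w t) ^+ 3.
    by rewrite -{1}(sqr_sqrtr (w0 t)); ring.
  by rewrite ler_pM2l.
- rewrite (_ : on01 _ = fun t => `|on01 (fun t => k t / (2 * Num.sqrt (w t))) t|); first exact: ig_norm.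
  apply/funext => t; rewrite /on01 [RHS]normrM; congr (_ * _).
  by rewrite ger0_norm.
Qed.

End AcCalculus.

(** * Weak derivatives and lines *)

Section LineDerivatives.
Context {R : realType}.
Local Notation mR := (measurableTypeR R).
Local Notation mu := (@lebesgue_measure R).
Implicit Types (f g : R3 R -> R) (e : R3 R).

(** Lines are parametrized by all starting points in space, not by a hyperplane transversal to [e]:
    Fubini then acts on [leb3 \x mu], and translation invariance replaces changes of coordinates. *)
Definition line_derivative e f g : Prop :=
  [/\ measurable_fun setT f, measurable_fun setT g &
    {ae leb3, forall x, ac (fun t => f (x + t *: e)) (fun t => g (x + t *: e))}].

Lemma measurable_ray e :
  measurable_fun setT (fun p : R3 R * mR => (p.1 + (p.2 : R) *: e : R3 R)).
Proof.
have m2 : measurable_fun setT (fun p : R3 R * mR => p.2) by exact: measurable_snd.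
have m1 : measurable_fun setT (fun p : R3 R * mR => p.1) by exact: measurable_fst.
have -> : (fun p : R3 R * mR => p.1 + (p.2 : R) *: e) = fun p =>
    (p.1.1.1 + p.2 * e.1.1, p.1.1.2 + p.2 * e.1.2, p.1.2 + p.2 * e.2) by [].
apply: measurable_fun_pair; first apply: measurable_fun_pair.
- apply: measurable_funD; last exact: measurable_funM.
  exact: (measurableT_comp measurable_R3_11 m1).
- apply: measurable_funD; last exact: measurable_funM.
  exact: (measurableT_comp measurable_R3_12 m1).
- apply: measurable_funD; last exact: measurable_funM.
  exact: (measurableT_comp measurable_R3_2 m1).
Qed.

Lemma measurable_along e f : measurable_fun setT f ->
  measurable_fun setT (fun p : R3 R * mR => f (p.1 + (p.2 : R) *: e)).
Proof. by move=> mf; exact: (measurableT_comp mf (measurable_ray e)). Qed.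

Lemma measurable_line e f x : measurable_fun setT f ->
  measurable_fun [set: mR] (fun t : mR => f (x + (t : R) *: e)).
Proof.
move=> mf; exact: (measurableT_comp (measurable_along e mf) (pair1_measurable x)).
Qed.

Lemma line_cst e c : line_derivative e (fun=> c) (fun=> 0).
Proof. by split => //; apply: nearW => x; exact: ac_cst. Qed.

Lemma lineD e f1 g1 f2 g2 : line_derivative e f1 g1 -> line_derivative e f2 g2 ->
  line_derivative e (fun x => f1 x + f2 x) (fun x => g1 x + g2 x).
Proof.
move=> [m1 m1' h1] [m2 m2' h2]; split; try exact: measurable_funD.
by apply: ae_mono2 h1 h2 => x; exact: acD.
Qed.

Lemma lineM e f1 g1 f2 g2 : line_derivative e f1 g1 -> line_derivative e f2 g2 ->
  line_derivative e (fun x => f1 x * f2 x) (fun x => g1 x * f2 x + f1 x * g2 x).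
Proof.
move=> [m1 m1' h1] [m2 m2' h2]; split; first exact: measurable_funM.
  by apply: measurable_funD; exact: measurable_funM.
by apply: ae_mono2 h1 h2 => x; exact: acM.
Qed.

Lemma lineZ e c f g : line_derivative e f g ->
  line_derivative e (fun x => c * f x) (fun x => c * g x).
Proof.
move=> [m1 m1' h1]; split; try exact: measurable_funM.
by apply: ae_mono h1 => x; exact: acZ.
Qed.

Lemma line_chain e f g Phi dPhi : (forall y : R, is_derive y 1 Phi (dPhi y)) ->
  continuous dPhi -> line_derivative e f g ->
  line_derivative e (fun x => Phi (f x)) (fun x => dPhi (f x) * g x).
Proof.
move=> dP cd [mf mg h].
have cPhi : continuous Phi.
  move=> x; apply: differentiable_continuous; apply/derivable1_diffP.
  by have [] := dP x.
have mPhi : measurable_fun [set: mR] Phi by exact: continuous_measurable_fun.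
have mdPhi : measurable_fun [set: mR] dPhi by exact: continuous_measurable_fun.
split.
- exact: measurableT_comp.
- by apply: measurable_funM => //; exact: measurableT_comp.
by apply: ae_mono h => x; exact: ac_chain.
Qed.

Lemma line_C1 e f g : measurable_fun setT f -> measurable_fun setT g ->
  (forall x (t : R), is_derive t 1 (fun t : R => f (x + t *: e)) (g (x + t *: e))) ->
  (forall x, continuous (fun t : R => g (x + t *: e))) ->
  line_derivative e f g.
Proof.
by move=> mf mg df cg; split => //; apply: nearW => x; exact: ac_C1.
Qed.

Lemma line_test e phi : test_function phi -> line_derivative e phi ('D_e phi).
Proof.
move=> tphi; have tD := test_derive e tphi.
apply: line_C1.
- exact: test_measurable3.
- exact: test_measurable3.
- by move=> x t; apply: is_derive_line; exact: tphi.1.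
- by move=> x; apply: (@continuous_line _ ('D_e phi)); exact: (smooth_derivable_cts tD.1).1.
Qed.

Lemma ig_segment (h : R) : ig mu (\1_(`[0, h]%classic : set mR)).
Proof.
have mi : measurable (`[0, h]%classic : set mR) by exact: measurable_itv.
have fi : (mu (`[0%R, h]%classic : set mR) < +oo)%E.
  by rewrite /= lebesgue_measure_itv/=; case: ifP => _; rewrite -?EFinB ltry.
exact: ig_indic mi fi.
Qed.

Lemma rint_segment (h : R) : 0 <= h -> \int[mu]_t (\1_(`[0, h]%classic : set mR) t : R) = h.
Proof.
move=> h0; have mi : measurable (`[0, h]%classic : set mR) by exact: measurable_itv.
have e : mu (`[0%R, h]%classic : set mR) = h%:E.
  rewrite /= lebesgue_measure_itv/= lte_fin; case: ltP => [_|h0']; first by rewrite oppr0 adde0.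
  by congr (_%:E); apply/eqP; rewrite eq_le h0 h0'.
by transitivity (fine (mu (`[0%R, h]%classic : set mR))); [exact: rint_indic|rewrite e].
Qed.

Lemma ig_segment_ray e (k : R3 R -> R) (h : R) : ig leb3 k ->
  ig (leb3 \x mu)%E (fun p => \1_`[0, h] p.2 * k (p.1 + (p.2 : R) *: e)).
Proof.
move=> hk; have mk := ig_meas hk.
have mi : measurable_fun [set: mR] (\1_`[0, h] : mR -> R) by exact: measurable_indic.
apply: (@ig_tonelli2' _ _ _ _ _ _ _ _ (fun t : mR => \1_`[0, h] t * \int[leb3]_x `|k x|)).
- apply: measurable_funM; last exact: measurable_along.
  exact: (measurableT_comp mi measurable_snd).
- apply: nearW => t; split => /=; first by apply: igZ; exact: ig_shift3.
  under eq_Rintegral do rewrite normrM [X in X * _]ger0_norm//.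
  rewrite rintZ; last by apply: ig_norm; exact: ig_shift3.
  rewrite (@rint_shift3 _ ((t : R) *: e) (fun x => `|k x|))//.
  exact: measurableT_comp.
- by under eq_fun do rewrite mulrC; apply: igZ; exact: ig_segment.
Qed.

Lemma ae_exists_pos (P : mR -> Prop) : {ae mu, forall h : mR, P h} ->
  exists h : R, [/\ 0 < h, h <= 1 & P h].
Proof.
move=> [N [mN N0 PN]]; apply: contrapT => hn.
have sub : `]0, 1]%classic `<=` N.
  move=> h; rewrite /= in_itv/= => /andP[h0 h1]; apply: PN => Ph; apply: hn.
  by exists h.
have : (mu (`]0%R, 1%R]%classic : set mR) <= mu N)%E by apply: le_measure; rewrite ?inE.
by rewrite N0 lebesgue_measure_itv/= lte_fin ltr01 oppr0 adde0 lee_fin ler10.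
Qed.

(** Needed to exchange the quantifiers on the starting point and on the length [h] through
    [ae1_ae_prod] and [ae2_ae_prod]. *)
Lemma measurable_prim_line e f g : measurable_fun setT f -> measurable_fun setT g ->
  measurable [set p : R3 R * mR | `[0, 1]%classic p.2 ->
    f (p.1 + (p.2 : R) *: e) = f (p.1 + (0 : R) *: e) + prim (fun t => g (p.1 + t *: e)) p.2].
Proof.
move=> mf mg.
(* The implication is encoded as the vanishing of one measurable function. *)
pose F (p : R3 R * mR) := \1_`[0, 1] p.2 *
  (f (p.1 + (p.2 : R) *: e) - (f (p.1 + (0 : R) *: e) + prim (fun t => g (p.1 + t *: e)) p.2)).
have mi : measurable_fun [set: mR] (\1_`[0, 1] : mR -> R) by exact: measurable_indic.
have mF : measurable_fun setT F.
  apply: measurable_funM; first exact: (measurableT_comp mi measurable_snd).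
  apply: measurable_funB; first exact: measurable_along.
  apply: measurable_funD; last exact: (measurable_prim_par (measurable_along e mg)).
  by under eq_fun do rewrite scale0r addr0; exact: (measurableT_comp mf measurable_fst).
have := mF measurableT [set 0] (measurable_set1 0); rewrite setTI.
congr measurable; apply/seteqP; split => p /=; rewrite /F indicE.
  move=> /eqP; rewrite mulf_eq0 => /orP[|/eqP/subr0_eq//].
  by rewrite pnatr_eq0 eqb0 => /negP h hp; exfalso; apply: h; rewrite inE.
have [p01|np] := pselect (`[0, 1]%classic p.2).
  by move=> /(_ p01) /= ->; rewrite subrr mulr0.
by move=> _; rewrite memNset ?mul0r.
Qed.

(* Integrate the line formula over all starting points: by translation
   invariance the left-hand side gives 0. *)
Lemma line_integral_eq0 e w k : ig leb3 w -> ig leb3 k -> line_derivative e w k ->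
  \int[leb3]_x k x = 0.
Proof.
move=> iw ik [mw mk hl].
have hx : {ae leb3, forall x, {ae mu, forall h : mR, `[0, 1]%classic h ->
    w (x + (h : R) *: e) = w (x + (0 : R) *: e) + prim (fun t => k (x + t *: e)) h}}.
  by apply: ae_mono hl => x [_ _ _].
have [h [h0 h1 hh]] := ae_exists_pos (ae_prod_ae2 (ae1_ae_prod (measurable_prim_line e mw mk) hx)).
have h01 : `[0, 1]%classic h by rewrite /= in_itv/= ltW.
have iP := ig_segment_ray e h ik.
have e1 : \int[leb3]_x w (x + h *: e) = \int[leb3]_x (w x + prim (fun t => k (x + t *: e)) h).
  apply: rint_ae.
  - exact: (ig_meas (ig_shift3 _ iw)).
  - by apply: measurable_funD => //; exact: (ig_meas (rfub_ig1 iP)).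
  - by apply: ae_mono hh => x /(_ h01); rewrite scale0r addr0.
move: e1; rewrite rint_shift3// rintD//; last exact: (rfub_ig1 iP).
move=> /eqP; rewrite -[X in X == _]addr0 (inj_eq (addrI _)) eq_sym => /eqP.
rewrite (rfub12 iP) /=.
under eq_Rintegral => t _.
  rewrite rintZ; last exact: ig_shift3.
  rewrite rint_shift3// mulrC; over.
rewrite rintZ; last exact: ig_segment.
rewrite (rint_segment (ltW h0)) => /eqP.
by rewrite mulf_eq0 (gt_eqF h0) orbF => /eqP.
Qed.

(** By the product rule [g phi + f D_e phi] is the line derivative of the integrable function
    [f phi], hence has integral 0. *)
Lemma line_weak e f g : L1_loc3 f -> L1_loc3 g -> line_derivative e f g ->
  weak_derivative3 f g e.
Proof.
move=> hf hg hl; split => // phi tphi; have tD := test_derive e tphi.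
have i1 := ig_L1_loc_test hf tD; have i2 := ig_L1_loc_test hg tphi.
have i3 := ig_L1_loc_test hf tphi.
have := line_integral_eq0 i3 (igD i2 i1) (lineM hl (line_test e tphi)).
by rewrite rintD// => /eqP; rewrite addrC addr_eq0 => /eqP.
Qed.

End LineDerivatives.

(** * From weak derivatives to derivatives along lines *)

Section WeakToLine.
Context {R : realType}.
Local Notation mR := (measurableTypeR R).
Local Notation mu := (@lebesgue_measure R).
Implicit Types (f g : R3 R -> R) (e : R3 R).

Lemma cube_ray e x (t r : R) : cube 1 e -> `|t| <= 1 -> cube r x ->
  cube (r + 1) (x + t *: e).
Proof.
move=> /cubeP[e1 e2 e3] t1 /cubeP[x1 x2 x3]; apply/cubeP; split => /=;
  rewrite (le_trans (ler_normD _ _))// lerD// normrM mulr_ile1//.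
Qed.

Lemma indic_cube_ray e x (t r : R) : cube 1 e -> `|t| <= 1 ->
  \1_(cube r) (x + t *: e) <= \1_(cube (r + 1)) x :> R.
Proof.
move=> he t1; rewrite [in leLHS]indicE.
have [h|_] := boolP (x + t *: e \in cube r); last by [].
rewrite indicE mem_set//.
have -> : x = (x + t *: e) + (- t) *: e by rewrite scaleNr addrK.
by apply: cube_ray; rewrite ?normrN//; rewrite inE in h.
Qed.

Lemma L1_loc3_shift e f (t : R) : cube 1 e -> `|t| <= 1 -> L1_loc3 f ->
  L1_loc3 (fun x : R3 R => f (x + t *: e)).
Proof.
move=> he t1 hf; have mf : measurable_fun setT (fun x : R3 R => f (x + t *: e)).
  exact: (measurableT_comp hf.1 (measurable_shift3 (t *: e))).
apply: ig_cube_L1_loc3 => // n.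
have := ig_norm (ig_shift3 (t *: e) (L1_loc3_cube (n%:R + 1) hf)).
apply: ig_le; first by apply: measurable_funM => //; apply: measurable_indic; exact: measurable_cube.
move=> x; rewrite !normrM ler_wpM2r// !indicE.
have [xn|_] := boolP (x \in cube n%:R); last by rewrite normr0.
rewrite mem_set//; apply: cube_ray => //; by rewrite inE in xn.
Qed.

Lemma ig_local_ray e g (r : R) : cube 1 e -> L1_loc3 g ->
  ig (leb3 \x mu)%E (fun p => \1_(cube r) p.1 * (\1_`[0, 1] p.2 * g (p.1 + (p.2 : R) *: e))).
Proof.
move=> he hg.
have mi : measurable_fun [set: mR] (\1_`[0, 1] : mR -> R) by exact: measurable_indic.
have mc : measurable_fun setT (\1_(cube r) : R3 R -> R).
  by apply: measurable_indic; exact: measurable_cube.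
have := ig_norm (ig_segment_ray e 1 (L1_loc3_cube (r + 1) hg)).
apply: ig_le.
  apply: measurable_funM; first exact: (measurableT_comp mc measurable_fst).
  apply: measurable_funM; first exact: (measurableT_comp mi measurable_snd).
  exact: measurable_along hg.1.
move=> [x t] /=; rewrite [X in `|_ * (X * _)|]indicE [X in _ <= `|X * _|]indicE.
have [t01|_] := boolP (t \in `[0, 1]%classic); last by rewrite !mul0r !mulr0.
rewrite !mul1r !normrM ler_wpM2r// !indicE.
have [xr|_] := boolP (x \in cube r); last by rewrite normr0.
rewrite mem_set//; apply: cube_ray => //; last by rewrite inE in xr.
move: t01; rewrite inE/= in_itv/= => /andP[t0 t1].
by rewrite ger0_norm.
Qed.

Lemma ae_ig_line e g : cube 1 e -> L1_loc3 g ->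
  {ae leb3, forall x, ig mu (on01 (fun t => g (x + t *: e)))}.
Proof.
move=> he hg.
have := ae_foralln (fun n : nat => rfub_ae1 (ig_local_ray n%:R he hg)).
apply: ae_mono => x hx.
have [n _ xn] : (\bigcup_n cube n%:R) x by rewrite bigcup_cube.
have := hx n; rewrite /= indicE mem_set//.
by under eq_fun do rewrite mul1r.
Qed.

Lemma indic_segment_mul (h t : R) : 0 <= h <= 1 ->
  \1_`[0, h] t = \1_`[0, h] t * \1_`[0, 1] t :> R.
Proof.
move=> /andP[h0 h1]; rewrite !indicE !mem_setE !in_itv/= -natrM mulnb.
congr (_%:R); congr nat_of_bool.
by case: (boolP (0 <= t <= h)) => //= /andP[-> th]; rewrite (le_trans th h1).
Qed.

(** Tested against [phi], the increment of [f] becomes that of [phi] under a translation by [- h e],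
    which the fundamental theorem writes as an integral of [D_e phi (x - t e)] over [t]. The weak
    derivative moves it onto [g], and translating back gives [prim]; the fundamental lemma
    concludes. *)
Lemma weak_line_fixed e f g (h : R) : cube 1 e -> 0 <= h <= 1 ->
  weak_derivative3 f g e ->
  {ae leb3, forall x, f (x + h *: e) - (f x + prim (fun t => g (x + t *: e)) h) = 0}.
Proof.
move=> he h01 [hf hg fg].
have h01' : `[0, 1]%classic h by rewrite /= in_itv.
have h1 : `|h| <= 1 by case/andP: h01 => h0 h1; rewrite ger0_norm.
have mi (a b : R) : measurable_fun [set: mR] (\1_`[a, b] : mR -> R) by exact: measurable_indic.
have mP : measurable_fun setT (fun x : R3 R => prim (fun t => g (x + t *: e)) h).
  exact: (measurableT_comp (measurable_prim_par (measurable_along e hg.1)) (pair2_measurable h)).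
have igray r : ig (leb3 \x mu)%E (fun p => \1_`[0, h] p.2 *
    (\1_(cube r) p.1 * g (p.1 + (p.2 : R) *: e))).
  have mh : measurable_fun setT (fun p : R3 R * mR => \1_`[0, h] p.2 : R).
    exact: (measurableT_comp (mi 0 h) measurable_snd).
  have := @ig_bounded_mul _ _ _ _ _ _ 1 mh (fun p => norm_indic_le1 _ _ _) (ig_local_ray r he hg).
  congr ig; apply/funext => p; rewrite [in RHS](indic_segment_mul p.2 h01); ring.
have iP r : ig leb3 (fun x => \1_(cube r) x * prim (fun t => g (x + t *: e)) h).
  have := rfub_ig1 (igray r); congr ig; apply/funext => x /=.
  rewrite !indicE; case: (x \in cube r); first by rewrite mul1r; apply: eq_Rintegral => t _; rewrite mul1r.
  by rewrite mul0r; under eq_Rintegral do rewrite mul0r mulr0; exact: rint0.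
have hfs := L1_loc3_shift he h1 hf.
have hP : L1_loc3 (fun x : R3 R => prim (fun t => g (x + t *: e)) h) by exact: ig_cube_L1_loc3.
apply: fundamental_lemma.
  apply: ig_cube_L1_loc3 => [|n].
    by apply: measurable_funB; [exact: hfs.1|apply: measurable_funD => //; exact: hf.1].
  have := igB (L1_loc3_cube n%:R hfs) (igD (L1_loc3_cube n%:R hf) (iP n%:R)).
  by congr ig; apply/funext => x; rewrite mulrBr mulrDr.
move=> phi tphi.
have i1 := ig_L1_loc_test hfs tphi.
have i2 := ig_L1_loc_test hf tphi.
have i3 := ig_L1_loc_test hP tphi.
have tD := test_derive e tphi.
have cD : continuous ('D_e phi) by exact: (smooth_derivable_cts tD.1).1.
under eq_Rintegral do rewrite mulrBl mulrDl.
rewrite rintB//; last exact: igD.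
rewrite rintD//.
have eq1 : \int[leb3]_x (f (x + h *: e) * phi x) = \int[leb3]_x (f x * phi (x + (- h) *: e)).
  rewrite -[RHS](rint_shift3 (h *: e)).
    apply: eq_Rintegral => x _; congr (_ * phi _).
    by rewrite scaleNr addrK.
  apply: measurable_funM; first exact: hf.1.
  exact: (measurableT_comp (test_measurable3 tphi) (measurable_shift3 _)).
have tphis (t : R) := test_shift ((- t) *: e) tphi.
have i4 : ig leb3 (fun x => f x * phi (x + (- h) *: e)) by exact: ig_L1_loc_test.
have eq2 : \int[leb3]_x (f (x + h *: e) * phi x) - \int[leb3]_x (f x * phi x) =
    \int[leb3]_x \int[mu]_t (\1_`[0, h] t * (f x * - 'D_e phi (x + (- t) *: e))).
  rewrite eq1 -rintB//; apply: eq_Rintegral => x _.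
  have FTC : phi (x + (- h) *: e) = phi (x + (- 0) *: e) + prim (fun t => - 'D_e phi (x + (- t) *: e)) h.
    apply: (@prim_FTC2 _ (fun t => phi (x + (- t) *: e))) => // t _.
    - have d := is_derive_line x e (- t) tphi.1.
      have := @is_derive1_comp _ (fun t : R => phi (x + t *: e)) -%R t _ _ d (is_deriveNid t 1).
      by move=> d'; apply: (is_derive_eq d'); rewrite mulrN1.
    - apply: cvgN; apply: (@continuous_comp _ _ _ (fun t : R => - t) (fun s : R => 'D_e phi (x + s *: e))).
        exact: opp_continuous.
      exact: (@continuous_line _ ('D_e phi)).
  rewrite FTC oppr0 scale0r addr0 mulrDr addrAC subrr add0r.
  rewrite -rintZ; last first.
    have := @ig_continuous_itv R (fun t => - 'D_e phi (x + (- t) *: e)) 0 h; apply => t _.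
    apply: cvgN; apply: (@continuous_comp _ _ _ (fun t : R => - t) (fun s : R => 'D_e phi (x + s *: e))).
      exact: opp_continuous.
    exact: (@continuous_line _ ('D_e phi)).
  by apply: eq_Rintegral => t _; rewrite mulrCA.
have mDe : measurable_fun setT (fun p : R3 R * mR => 'D_e phi (p.1 + (- p.2) *: e)).
  apply: (measurableT_comp (test_measurable3 tD)).
  have -> : (fun p : R3 R * mR => p.1 + (- p.2) *: e) = fun p => p.1 + (p.2 : R) *: (- e).
    by apply/funext => p; rewrite scaleNr scalerN.
  exact: measurable_ray.
have iK1 : ig (leb3 \x mu)%E (fun p => \1_`[0, h] p.2 * (f p.1 * - 'D_e phi (p.1 + (- p.2) *: e))).
  have [M [n [M0 hM]]] := test_le3 tD.
  have := igZ M (ig_norm (ig_segment_ray 0 h (L1_loc3_cube (n%:R + 1) hf))).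
  apply: ig_le.
    apply: measurable_funM; first exact: (measurableT_comp (mi 0 h) measurable_snd).
    apply: measurable_funM; last exact: measurable_funN.
    exact: (measurableT_comp hf.1 measurable_fst).
  move=> [x t] /=; rewrite scaler0 addr0.
  rewrite [X in `|X * _| <= _]indicE [X in _ <= _ * `|X * _|]indicE.
  have [th|_] := boolP (t \in `[0, h]%classic); last by rewrite !mul0r normr0 mulr0.
  have t1 : `|- t| <= 1.
    move: th; rewrite inE/= in_itv/= => /andP[t0 th]; rewrite normrN ger0_norm//.
    by case/andP: h01 => _; exact: le_trans.
  have c0 : `|\1_(cube (n%:R + 1)) x : R| = \1_(cube (n%:R + 1)) x by rewrite ger0_norm.
  rewrite !mul1r !normrM normrN c0 (le_trans (ler_wpM2l _ (hM _)))//.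
  by rewrite mulrCA ler_wpM2l// mulrC ler_wpM2r//; exact: indic_cube_ray.
(* The weak derivative enters here, through the translated test functions [phi (x - t e)]. *)
have eq3 : \int[leb3]_x \int[mu]_t (\1_`[0, h] t * (f x * - 'D_e phi (x + (- t) *: e))) =
    \int[mu]_t (\1_`[0, h] t * \int[leb3]_x (g x * phi (x + (- t) *: e))).
  rewrite (rfub12 iK1); apply: eq_Rintegral => t _ /=.
  have i5 := ig_L1_loc_test hf (test_derive e (tphis t)).
  have /eqP := fg _ (tphis t); rewrite -eqr_oppLR => /eqP <-.
  rewrite -rintN// -rintZ; last exact: igN.
  by apply: eq_Rintegral => x _; rewrite derive_shift3 mulrN.
have [M M0 hM] := test_bounded tphi.
have [M' [n [_ hM']]] := test_le3 tphi.
have phic x : phi x = phi x * \1_(cube n%:R) x.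
  rewrite indicE; have [_|xn] := boolP (x \in cube n%:R); first by rewrite mulr1.
  by apply/eqP; rewrite mulr0 -normr_le0 (le_trans (hM' x))// indicE (negbTE xn) mulr0.
have iK2 : ig (leb3 \x mu)%E (fun p => \1_`[0, h] p.2 * (g (p.1 + (p.2 : R) *: e) * phi p.1)).
  have mphi : measurable_fun setT (fun p : R3 R * mR => phi p.1).
    exact: (measurableT_comp (test_measurable3 tphi) measurable_fst).
  have := ig_bounded_mul mphi (fun p => hM p.1) (igray n%:R).
  by congr ig; apply/funext => p; rewrite [in RHS]phic; ring.
have eq4 : \int[leb3]_x (prim (fun t => g (x + t *: e)) h * phi x) =
    \int[mu]_t (\1_`[0, h] t * \int[leb3]_x (g x * phi (x + (- t) *: e))).
  transitivity (\int[leb3]_x \int[mu]_t (\1_`[0, h] t * (g (x + t *: e) * phi x))).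
    apply: rint_ae.
    - exact: ig_meas i3.
    - exact: ig_meas (rfub_ig1 iK2).
    apply: ae_mono (ae_ig_line he hg) => x hx.
    rewrite prim_on01// mulrC -rintZ; last exact: ig_prim.
    apply: eq_Rintegral => t _; rewrite /on01 [in RHS](indic_segment_mul t h01); ring.
  rewrite (rfub12 iK2); apply: eq_Rintegral => t _ /=.
  have i6 := ig_shift3 (t *: e) (ig_L1_loc_test hg (tphis t)).
  have e6 x : phi (x + t *: e + (- t) *: e) = phi x by rewrite scaleNr addrK.
  rewrite -[in RHS](rint_shift3 (t *: e)); last exact: (ig_meas (ig_L1_loc_test hg (tphis t))).
  by rewrite -rintZ//; apply: eq_Rintegral => x _; rewrite e6.
by rewrite opprD addrA eq2 eq3 eq4 subrr.
Qed.

(** For each [h] the formula fails on a null set of points depending on [h]; Fubini turns this into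
    a null set of lengths [h] for almost every point. *)
Lemma weak_line e f g : cube 1 e -> weak_derivative3 f g e -> line_derivative e f g.
Proof.
move=> he w; have [hf hg _] := w; split; [exact: hf.1|exact: hg.1|].
have h1 : {ae mu, forall h : mR, {ae leb3, forall x, `[0, 1]%classic h ->
    f (x + (h : R) *: e) = f (x + (0 : R) *: e) + prim (fun t => g (x + t *: e)) h}}.
  apply: nearW => h; have [h01|h01] := pselect (`[0, 1]%classic h); last exact: nearW.
  have h01' : 0 <= h <= 1 by move: h01; rewrite /= in_itv.
  apply: ae_mono (weak_line_fixed he h01' w) => x /eqP + _.
  by rewrite subr_eq0 scale0r addr0 => /eqP.
have h2 := ae_prod_ae1 (ae2_ae_prod (measurable_prim_line e hf.1 hg.1) h1).
apply: ae_mono2 h2 (ae_ig_line he hg) => x hx ix; split => //.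
- exact: measurable_line hf.1.
- exact: measurable_line hg.1.
Qed.

Lemma cube1_basis3 (a : 'I_3) : cube 1 (basis3 a : R3 R).
Proof.
apply/cubeP; rewrite /basis3/=; split; by case: eqP => _; rewrite ?normr1 ?normr0.
Qed.

End WeakToLine.

(** * The cutoff *)

Section Profile.
Context {R : realType}.
Local Notation mR := (measurableTypeR R).
Local Notation mu := (@lebesgue_measure R).

Definition ramp (x : R) : R := Num.max 0 x.

Lemma ramp_ge0 x : 0 <= ramp x. Proof. by rewrite /ramp le_max lexx. Qed.

Lemma ramp_pos x : 0 <= x -> ramp x = x.
Proof. by move=> x0; rewrite /ramp max_r. Qed.

Lemma ramp_neg x : x <= 0 -> ramp x = 0.
Proof. by move=> x0; rewrite /ramp max_l. Qed.

Lemma continuous_ramp : continuous ramp.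
Proof.
move=> x; apply: (@continuous_max _ _ (fun=> 0) id); [exact: cvg_cst|exact: cvg_id].
Qed.

Lemma is_derive_ramp2 (x : R) : is_derive x 1 (fun y => ramp y ^+ 2) (2 * ramp x).
Proof.
have [x0|x0|x0] := ltgtP 0 x.
- rewrite ramp_pos ?ltW//.
  pose f0 : R -> R := fun y => y ^+ 2.
  apply: (@near_eq_is_derive _ _ _ f0).
    near=> y; rewrite /f0 ramp_pos// ltW//; near: y; exact: lt_nbhsr.
  have h := is_deriveX 2 (is_derive_id x (1 : R)).
  by apply: (is_derive_eq h); rewrite /GRing.scale/= mulr1 expr1.
- rewrite ramp_neg ?ltW// mulr0.
  pose f0 : R -> R := fun y => 0.
  apply: (@near_eq_is_derive _ _ _ f0).
    by near=> y; rewrite /f0 ramp_neg ?expr0n// ltW//; near: y; exact: lt_nbhsl.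
- rewrite -x0 ramp_pos// mulr0.
  have h : (fun h => h^-1 *: (((fun y => ramp y ^+ 2) \o shift 0) (h *: 1) - ramp 0 ^+ 2)) @ 0^' --> (0 : R).
    rewrite [X in X @ _](_ : _ = fun h => h^-1 * ramp h ^+ 2); last first.
      by apply/funext => h; rewrite /= addr0 /GRing.scale/= mulr1 (ramp_pos (lexx 0)) expr0n subr0.
    apply/cvgrPdist_le => e e0.
    near=> h; rewrite sub0r normrN normrM normfV.
    have hn0 : h != 0 by near: h; exact: nbhs_dnbhs_neq.
    have hp : 0 < `|h| by rewrite normr_gt0.
    rewrite mulrC ler_pdivrMr// (@le_trans _ _ (`|h| ^+ 2))//.
      rewrite normrX lerXn2r ?nnegrE// (ger0_norm (ramp_ge0 _)) /ramp ge_max normr_ge0/=.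
      exact: ler_norm.
    rewrite expr2 ler_pM2r//; near: h; exact: dnbhs0_le.
  by apply: DeriveDef; [exact: cvgP h|exact: cvg_lim h].
Unshelve. all: by end_near. Qed.

Variable d : R.
Hypothesis d0 : 0 < d.

(* 256 d^9 / 315 is the integral of (d^2 - t^2)^4 over [-d, d]. *)
Definition profile_cst : R := Num.sqrt (315 / (256 * d ^+ 9)).

(** Squaring the ramp makes the profile C^1, while its square stays a polynomial on the support, so
    that its moments are explicit. *)
Definition profile (t : R) : R := profile_cst * ramp (d ^+ 2 - t ^+ 2) ^+ 2.

Definition dprofile (t : R) : R :=
  profile_cst * (2 * ramp (d ^+ 2 - t ^+ 2) * (- (2 * t))).

Lemma is_derive_profile (t : R) : is_derive t 1 profile (dprofile t).
Proof.
have h : is_derive t 1 (fun t : R => d ^+ 2 - t ^+ 2) (- (2 * t)).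
  have h1 := is_deriveB (is_derive_cst (d ^+ 2) t 1) (is_deriveX 2 (is_derive_id t (1 : R))).
  by apply: (is_derive_eq h1); rewrite /GRing.scale/= mulr1 expr1 sub0r.
have h2 := @is_derive1_comp _ (fun y => ramp y ^+ 2) _ t _ _ (is_derive_ramp2 _) h.
have h3 := is_deriveZ profile_cst h2.
by apply: (is_derive_eq h3).
Qed.

Lemma continuous_profile : continuous profile.
Proof.
move=> x; apply: differentiable_continuous; apply/derivable1_diffP.
by have [] := is_derive_profile x.
Qed.

Lemma continuous_dprofile : continuous dprofile.
Proof.
move=> x; apply: cvgM; first exact: cvg_cst.
have h : (fun t : R => d ^+ 2 - t ^+ 2) @ x --> d ^+ 2 - x ^+ 2.
  by apply: cvgB; [exact: cvg_cst|exact: exprn_continuous].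
apply: cvgM; last by apply: cvgN; apply: cvgM; [exact: cvg_cst|exact: cvg_id].
apply: cvgM; first exact: cvg_cst.
exact: (cvg_comp _ _ h (@continuous_ramp _)).
Qed.

Lemma profile_out (t : R) : d <= `|t| -> profile t = 0 /\ dprofile t = 0.
Proof.
move=> dt; rewrite /profile /dprofile ramp_neg; first by rewrite expr0n !mulr0 mul0r mulr0.
by rewrite subr_le0 -(real_normK (num_real t)) lerXn2r// nnegrE ltW.
Qed.

Lemma profile_sqr (t : R) : profile t ^+ 2 =
  \1_`[- d, d] t * (315 / (256 * d ^+ 9) * (d ^+ 2 - t ^+ 2) ^+ 4).
Proof.
rewrite indicE; have [h|h] := boolP (t \in `[- d, d]%classic).
  rewrite mul1r /profile exprMn /profile_cst sqr_sqrtr; last first.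
    exact: (divr_ge0 (ler0n _ 315) (mulr_ge0 (ler0n _ 256) (exprn_ge0 _ (ltW d0)))).
  rewrite ramp_pos -?exprM// subr_ge0 -(real_normK (num_real t)) lerXn2r ?nnegrE ?(ltW d0)//.
  by move: h; rewrite inE/= in_itv/= ler_norml.
rewrite mul0r (profile_out _).1 ?expr0n//.
move: h; rewrite notin_setE/= in_itv/= -ler_norml => /negP; rewrite -ltNge; exact: ltW.
Qed.

Lemma is_derive_monomial (n : nat) (x : R) :
  is_derive x 1 (fun t : R => t ^+ n.+1 / n.+1%:R) (x ^+ n).
Proof.
have h := is_deriveZ (n.+1%:R^-1) (is_deriveX n.+1 (is_derive_id x (1 : R))).
have e : (fun t : R => t ^+ n.+1 / n.+1%:R) = n.+1%:R^-1 *: ((id : R -> R) ^+ n.+1).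
  by apply/funext => t; rewrite fctE /GRing.scale/= mulrC.
rewrite e; apply: (is_derive_eq h); rewrite /GRing.scale/= mulr1 -[_ *+ _]mulr_natl.
by rewrite mulrA mulVf ?mul1r// pnatr_eq0.
Qed.

Lemma rint_profile_sqr : \int[mu]_t (profile t ^+ 2) = 1.
Proof.
under eq_Rintegral do rewrite profile_sqr.
have dd : - d < d by rewrite gt0_cp.
have dn0 : d != 0 by rewrite gt_eqF.
pose c : R := 315 / (256 * d ^+ 9).
pose f (t : R) : R := c * (d ^+ 2 - t ^+ 2) ^+ 4.
(* Termwise antiderivative of the binomial expansion of [(d^2 - t^2)^4]. *)
pose P (t : R) : R := c * (d ^+ 8 * (t ^+ 1 / 1%:R) + (- (4 * d ^+ 6)) * (t ^+ 3 / 3%:R) +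
  6 * d ^+ 4 * (t ^+ 5 / 5%:R) + (- (4 * d ^+ 2)) * (t ^+ 7 / 7%:R) + 1 * (t ^+ 9 / 9%:R)).
have dP (x : R) : is_derive x 1 P (f x).
  have m0 := is_deriveZ (d ^+ 8) (is_derive_monomial 0 x).
  have m2 := is_deriveZ (- (4 * d ^+ 6)) (is_derive_monomial 2 x).
  have m4 := is_deriveZ (6 * d ^+ 4) (is_derive_monomial 4 x).
  have m6 := is_deriveZ (- (4 * d ^+ 2)) (is_derive_monomial 6 x).
  have m8 := is_deriveZ 1 (is_derive_monomial 8 x).
  have m := is_deriveZ c (is_deriveD (is_deriveD (is_deriveD (is_deriveD m0 m2) m4) m6) m8).
  by apply: (is_derive_eq m); rewrite /f /GRing.scale/=; ring.
have cf (x : R) : {for x, continuous f}.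
  apply: cvgM; first exact: cvg_cst.
  have h : (fun t : R => d ^+ 2 - t ^+ 2) @ x --> d ^+ 2 - x ^+ 2.
    by apply: cvgB; [exact: cvg_cst|exact: exprn_continuous].
  exact: (cvg_comp _ _ h (@exprn_continuous _ 4 _)).
rewrite (rint_FTC2 dd (fun x _ => dP x) (fun x _ => cf x)).
by rewrite /P /c; field.
Qed.

Lemma rint_profile_odd : \int[mu]_t (t * profile t ^+ 2) = 0.
Proof.
under eq_Rintegral do rewrite profile_sqr mulrCA.
have dd : - d < d by rewrite gt0_cp.
have dn0 : d != 0 by rewrite gt_eqF.
pose c : R := 315 / (256 * d ^+ 9).
pose f (t : R) : R := t * (c * (d ^+ 2 - t ^+ 2) ^+ 4).
(* The derivative of [(d^2 - t^2)^5 / 5] is [- 2 t (d^2 - t^2)^4]; being even, this primitive takes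
   the same value at both endpoints. *)
pose P (t : R) : R := (- (c / 2)) * ((d ^+ 2 - t ^+ 2) ^+ 5 / 5%:R).
have dP (x : R) : is_derive x 1 P (f x).
  have h : is_derive x 1 (fun t : R => d ^+ 2 - t ^+ 2) (- (2 * x)).
    have h1 := is_deriveB (is_derive_cst (d ^+ 2) x 1) (is_deriveX 2 (is_derive_id x (1 : R))).
    by apply: (is_derive_eq h1); rewrite /GRing.scale/= mulr1 expr1 sub0r.
  have h2 := @is_derive1_comp _ (fun y => y ^+ 5 / 5%:R) _ x _ _ (is_derive_monomial 4 _) h.
  by apply: (is_derive_eq (is_deriveZ (- (c / 2)) h2)); rewrite /f /GRing.scale/=; field.
have cf (x : R) : {for x, continuous f}.
  apply: cvgM; first exact: cvg_id.
  apply: cvgM; first exact: cvg_cst.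
  have h : (fun t : R => d ^+ 2 - t ^+ 2) @ x --> d ^+ 2 - x ^+ 2.
    by apply: cvgB; [exact: cvg_cst|exact: exprn_continuous].
  exact: (cvg_comp _ _ h (@exprn_continuous _ 4 _)).
rewrite (rint_FTC2 dd (fun x _ => dP x) (fun x _ => cf x)).
by rewrite /P sqrrN subrr.
Qed.

Lemma profile_le (t : R) : profile t ^+ 2 <= 315 / (256 * d).
Proof.
rewrite profile_sqr indicE; have [h|_] := boolP (t \in `[- d, d]%classic); last first.
  by rewrite mul0r (divr_ge0 (ler0n _ 315) (mulr_ge0 (ler0n _ 256) (ltW d0))).
rewrite mul1r.
have h4 : (d ^+ 2 - t ^+ 2) ^+ 4 <= d ^+ 8.
  rewrite -[8%N]/(2 * 4)%N exprM lerXn2r ?nnegrE ?exprn_ge0 ?(ltW d0)//.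
    rewrite subr_ge0 -(real_normK (num_real t)) lerXn2r ?nnegrE ?(ltW d0)//.
    by move: h; rewrite inE/= in_itv/= ler_norml.
  by rewrite lerBlDr lerDl sqr_ge0.
apply: (le_trans (ler_wpM2l _ h4)).
  exact: (divr_ge0 (ler0n _ 315) (mulr_ge0 (ler0n _ 256) (exprn_ge0 _ (ltW d0)))).
by rewrite le_eqVlt; apply/orP; left; apply/eqP; field; rewrite gt_eqF.
Qed.

Lemma profile_bounded : exists2 M : R, 0 <= M & forall t, `|profile t| <= M /\ `|dprofile t| <= M.
Proof.
have [M1 M10 h1] := continuous_bounded_itv d continuous_profile.
have [M2 M20 h2] := continuous_bounded_itv d continuous_dprofile.
exists (M1 + M2); first exact: addr_ge0.
move=> t; have [td|dt] := leP `|t| d.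
  by split; [rewrite (le_trans (h1 _ td))// lerDl|rewrite (le_trans (h2 _ td))// lerDr].
by have [-> ->] := profile_out (ltW dt); rewrite normr0 addr_ge0.
Qed.

End Profile.

(** * Gram kernels *)

Section CauchySchwarz.
Context d (T : measurableType d) (R : realType).
Variable mu : {measure set T -> \bar R}.
Implicit Types f g : T -> R.

Lemma normM_le_sqr (x y : R) : `|x * y| <= (x ^+ 2 + y ^+ 2) / 2.
Proof.
rewrite ler_norml; apply/andP; split.
  by have := sqr_ge0 (x + y); lra.
by have := sqr_ge0 (x - y); lra.
Qed.

Lemma norm_le_sqr (x : R) : `|x| <= 1 + x ^+ 2.
Proof. by have := normM_le_sqr x 1; rewrite mulr1 expr1n; have := sqr_ge0 x; lra. Qed.

Lemma igM_sqr f g : measurable_fun setT f -> measurable_fun setT g ->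
  ig mu (fun x => f x ^+ 2) -> ig mu (fun x => g x ^+ 2) -> ig mu (fun x => f x * g x).
Proof.
move=> mf mg f2 g2; apply: (ig_le _ (fun x => normM_le_sqr (f x) (g x))).
  exact: measurable_funM.
under [X in ig _ X]funext do rewrite mulrC.
by apply: igZ; exact: igD.
Qed.

Lemma rintM_le f g : measurable_fun setT f -> measurable_fun setT g ->
  ig mu (fun x => f x ^+ 2) -> ig mu (fun x => g x ^+ 2) ->
  \int[mu]_x `|f x * g x| <= (\int[mu]_x (f x ^+ 2) + \int[mu]_x (g x ^+ 2)) / 2.
Proof.
move=> mf mg f2 g2; rewrite -rintD// mulrC -rintZ; last exact: igD.
apply: rint_le; first by apply: ig_norm; exact: igM_sqr.
  by apply: igZ; exact: igD.
by move=> x; rewrite [leRHS]mulrC; exact: normM_le_sqr.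
Qed.

Lemma discriminant_le (a b c : R) : 0 <= a ->
  (forall t, 0 <= t ^+ 2 * a + 2 * t * b + c) -> b ^+ 2 <= a * c.
Proof.
move=> a0 h; have [a00|an0] := eqVneq a 0.
  have [->|b0] := eqVneq b 0; first by rewrite a00 mul0r expr0n.
  (* With [a = 0] and [b] nonzero the polynomial is affine, and it takes the value -1 at this
     point. *)
  have := h (- (c + 1) / (2 * b)).
  have -> : 2 * (- (c + 1) / (2 * b)) * b = - (c + 1) by field.
  by rewrite a00; lra.
have ap : 0 < a by rewrite lt_neqAle eq_sym an0.
have := h (- b / a).
have -> : (- b / a) ^+ 2 * a + 2 * (- b / a) * b + c = (a * c - b ^+ 2) / a by field.
by rewrite pmulr_lge0 ?invr_gt0// subr_ge0.
Qed.

(** Discriminant of the nonnegative polynomial [t |-> \int (t f + g)^2]. *)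
Lemma cauchy_schwarz f g : measurable_fun setT f -> measurable_fun setT g ->
  ig mu (fun x => f x ^+ 2) -> ig mu (fun x => g x ^+ 2) ->
  (\int[mu]_x (f x * g x)) ^+ 2 <= \int[mu]_x (f x ^+ 2) * \int[mu]_x (g x ^+ 2).
Proof.
move=> mf mg f2 g2; have fg := igM_sqr mf mg f2 g2.
apply: discriminant_le; first by apply: rint_ge0 => x; exact: sqr_ge0.
move=> t; have i1 := igZ (t ^+ 2) f2; have i2 := igZ (2 * t) fg.
rewrite -(rintZ _ f2) -(rintZ _ fg) -(rintD i1 i2) -(rintD (igD i1 i2) g2).
apply: rint_ge0 => x; have := sqr_ge0 (t * f x + g x).
by rewrite (_ : (_ + _) ^+ 2 = t ^+ 2 * f x ^+ 2 + 2 * t * (f x * g x) + g x ^+ 2)//; ring.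
Qed.

Lemma rint_restrict (K : set T) f : measurable K ->
  \int[mu]_(x in K) f x = \int[mu]_x (\1_K x * f x).
Proof.
move=> mK; rewrite /Rintegral; congr fine; rewrite integral_mkcond.
apply: eq_integral => x _; rewrite patchE indicE.
by case: ifP; rewrite ?mul1r ?mul0r.
Qed.

End CauchySchwarz.

(** * Kernels with square-integrable slices and their weak derivatives *)

Section Kernels.
Context {R : realType}.
Implicit Types (f k : R3 R * R3 R -> R) (q : R3 R -> R).

(* Every slice counts, not only almost every one, so that Gram kernels are
   integrals of integrable functions at every point. *)
Definition sq_kernel f q : Prop :=
  [/\ measurable_fun setT f, measurable_fun setT q,
      forall r, ig leb3 (fun u => f (u, r) ^+ 2) &
      forall r, \int[leb3]_u (f (u, r) ^+ 2) <= q r].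

Lemma measurable_slice1 f u : measurable_fun setT f ->
  measurable_fun setT (fun r => f (u, r)).
Proof. by move=> mf; exact: (measurableT_comp mf (measurable_pair1 u)). Qed.

Lemma measurable_slice2 f r : measurable_fun setT f ->
  measurable_fun setT (fun u => f (u, r)).
Proof. by move=> mf; exact: (measurableT_comp mf (measurable_pair2 r)). Qed.

Definition gram f k : R3 R * R3 R -> R :=
  fun p => \int[leb3]_u (f (u, p.1) * k (u, p.2)).

Definition triple1 f (z : R3 R * (R3 R * R3 R)) := f (z.1, z.2.1).
Definition triple2 f (z : R3 R * (R3 R * R3 R)) := f (z.1, z.2.2).

Lemma measurable_triple1 f : measurable_fun setT f -> measurable_fun setT (triple1 f).
Proof.
move=> mf; apply: (measurableT_comp mf).
apply: measurable_fun_pair => //; exact: (measurableT_comp measurable_fst measurable_snd).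
Qed.

Lemma measurable_triple2 f : measurable_fun setT f -> measurable_fun setT (triple2 f).
Proof.
move=> mf; apply: (measurableT_comp mf).
apply: measurable_fun_pair => //; exact: (measurableT_comp measurable_snd measurable_snd).
Qed.

Lemma measurable_gram f k : measurable_fun setT f -> measurable_fun setT k ->
  measurable_fun setT (gram f k).
Proof.
move=> mf mk.
apply: (@measurable_par2 _ _ _ _ R leb3 (fun z => triple1 f z * triple2 k z)).
by apply: measurable_funM; [exact: measurable_triple1|exact: measurable_triple2].
Qed.

Lemma sq_kernel_ge0 f q r : sq_kernel f q -> 0 <= q r.
Proof. by case=> _ _ _ h; apply: le_trans (h r); apply: rint_ge0 => u; exact: sqr_ge0. Qed.

Lemma ig_gram f k q q' r s : sq_kernel f q -> sq_kernel k q' ->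
  ig leb3 (fun u => f (u, r) * k (u, s)).
Proof.
by move=> [mf _ f2 _] [mk _ k2 _]; apply: igM_sqr => //; exact: measurable_slice2.
Qed.

Lemma gram_norm_le f k q q' r s : sq_kernel f q -> sq_kernel k q' ->
  \int[leb3]_u `|f (u, r) * k (u, s)| <= (q r + q' s) / 2.
Proof.
move=> [mf _ f2 hf] [mk _ k2 hk].
apply: le_trans (rintM_le _ _ (f2 r) (k2 s)) _; [exact: measurable_slice2..|].
by rewrite ler_pM2r// lerD.
Qed.

Lemma gram_le f k q q' p : sq_kernel f q -> sq_kernel k q' ->
  `|gram f k p| <= (q p.1 + q' p.2) / 2.
Proof.
move=> hf hk; apply: le_trans (gram_norm_le _ _ hf hk).
by apply: rint_normle; exact: ig_gram hf hk.
Qed.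

Lemma gramC f k r s : gram f k (r, s) = gram k f (s, r).
Proof. by rewrite /gram; congr Rintegral; apply/funext => u; rewrite mulrC. Qed.

Lemma ig_tensor (x y : R3 R -> R) : ig leb3 x -> ig leb3 y ->
  ig leb6 (fun p => x p.1 * y p.2).
Proof.
move=> ix iy; apply: (@ig_tonelli1' _ _ _ _ R leb3 leb3 _
    (fun r => (\int[leb3]_s `|y s|) * `|x r|)).
- apply: measurable_funM.
    exact: (measurableT_comp (ig_meas ix) measurable_fst).
  exact: (measurableT_comp (ig_meas iy) measurable_snd).
- apply: nearW => r; split => /=; first exact: (igZ (x r) iy).
  under eq_Rintegral do rewrite normrM.
  by rewrite mulrC rintZ//; exact: ig_norm.
- by apply: igZ; exact: ig_norm.
Qed.

Lemma L1_loc6_add_sides (q q' : R3 R -> R) : L1_loc3 q -> L1_loc3 q' ->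
  forall n : nat, ig leb6 (fun p => \1_(cube n%:R) p.1 * \1_(cube n%:R) p.2 *
    ((q p.1 + q' p.2) / 2)).
Proof.
move=> hq hq' n; have c1 : ig leb3 (fun x : R3 R => \1_(cube n%:R) x).
  by apply: ig_indic; [exact: measurable_cube|exact: leb3_cube_lty].
have := igZ 2^-1 (igD (ig_tensor (L1_loc3_cube n%:R hq) c1)
  (ig_tensor c1 (L1_loc3_cube n%:R hq'))).
by congr (ig _ _); apply/funext => p; ring.
Qed.

Lemma L1_loc6_le f (q q' : R3 R -> R) : measurable_fun setT f -> L1_loc3 q -> L1_loc3 q' ->
  (forall p, `|f p| <= (q p.1 + q' p.2) / 2) -> L1_loc6 f.
Proof.
move=> mf lq lq' h.
apply: ig_cube_L1_loc6 => // n; apply: ig_le (L1_loc6_add_sides lq lq' n).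
  have mc : measurable_fun setT (\1_(cube n%:R) : R3 R -> R).
    apply: measurable_indic; exact: measurable_cube.
  apply: measurable_funM => //; apply: measurable_funM.
    exact: (measurableT_comp mc measurable_fst).
  exact: (measurableT_comp mc measurable_snd).
move=> p; rewrite normrM [leLHS]mulrC [leRHS]mulrC.
have c0 : 0 <= \1_(cube n%:R) p.1 * \1_(cube n%:R) p.2 :> R by rewrite mulr_ge0// indicE.
by rewrite (ger0_norm c0) ler_wpM2r.
Qed.

Lemma L1_loc3_cst (c : R) : L1_loc3 (fun=> c : R).
Proof. by apply: ig_cube_L1_loc3 => // n; exact: ig_cube_cst. Qed.

Lemma L1_loc3D (q q' : R3 R -> R) : L1_loc3 q -> L1_loc3 q' -> L1_loc3 (fun r => q r + q' r).
Proof.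
move=> lq lq'; apply: ig_cube_L1_loc3.
  by apply: measurable_funD; [case: lq|case: lq'].
move=> n; have := igD (L1_loc3_cube n%:R lq) (L1_loc3_cube n%:R lq').
by congr (ig _ _); apply/funext => r; rewrite mulrDr.
Qed.

Lemma L1_loc3Z (c : R) (q : R3 R -> R) : L1_loc3 q -> L1_loc3 (fun r => c * q r).
Proof.
move=> lq; apply: ig_cube_L1_loc3.
  by apply: measurable_funM => //; case: lq.
move=> n; have := igZ c (L1_loc3_cube n%:R lq).
by congr (ig _ _); apply/funext => r; rewrite mulrCA.
Qed.

Lemma L1_loc3_sum (I : Type) (s : seq I) (h : I -> R3 R -> R) :
  (forall i, L1_loc3 (h i)) -> L1_loc3 (fun x => \sum_(i <- s) h i x).
Proof.
move=> hi; elim: s => [|i s IH].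
  by under [X in L1_loc3 X]funext do rewrite big_nil; exact: L1_loc3_cst.
by under [X in L1_loc3 X]funext do rewrite big_cons; exact: L1_loc3D.
Qed.

Lemma L1_loc3_le (w q : R3 R -> R) : measurable_fun setT w -> L1_loc3 q ->
  (forall r, `|w r| <= q r) -> L1_loc3 w.
Proof.
move=> mw lq h; apply: ig_cube_L1_loc3 => // n.
apply: ig_le (L1_loc3_cube n%:R lq).
  by apply: measurable_funM => //; apply: measurable_indic; exact: measurable_cube.
by move=> x; rewrite normrM (ger0_norm (_ : 0 <= \1__ _)) ?ler_wpM2l ?indicE.
Qed.

Lemma ig_L1_loc3 (q : R3 R -> R) : ig leb3 q -> L1_loc3 q.
Proof.
move=> iq; apply: ig_cube_L1_loc3; first exact: ig_meas iq.
by move=> n; apply: ig_indicM => //; exact: measurable_cube.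
Qed.

Lemma L1_loc6_gram f k q q' : sq_kernel f q -> sq_kernel k q' -> L1_loc3 q -> L1_loc3 q' ->
  L1_loc6 (gram f k).
Proof.
move=> hf hk lq lq'; apply: (L1_loc6_le _ lq lq') => [|p]; last exact: gram_le.
by case: hf hk => mf _ _ _ [mk _ _ _]; exact: measurable_gram.
Qed.

(* The slices are required to be differentiable for every [u], which is what
   the explicit kernels below satisfy. *)
Definition sliced_derivative (e : R3 R) f k : Prop :=
  exists q : R3 R -> R, [/\ measurable_fun setT f, measurable_fun setT k, L1_loc3 q,
    forall u r, `|f (u, r)| <= q r /\ `|k (u, r)| <= q r &
    forall u, line_derivative e (fun r => f (u, r)) (fun r => k (u, r))].

Lemma sliced_weak3 e f k u : sliced_derivative e f k ->
  weak_derivative3 (fun r => f (u, r)) (fun r => k (u, r)) e.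
Proof.
move=> [q [mf mk lq b l]]; apply: line_weak => //.
  by apply: L1_loc3_le lq _ => [|r]; [exact: measurable_slice1|have [] := b u r].
by apply: L1_loc3_le lq _ => [|r]; [exact: measurable_slice1|have [] := b u r].
Qed.

(** Fubini: the test function is sliced at each [u], and the majorant [q], uniform in [u], provides
    local integrability on R^6. *)
Lemma sliced_weak6 e f k : sliced_derivative e f k -> weak_derivative6 f k (0, e).
Proof.
move=> h; have [q [mf mk lq b _]] := h.
have l2 := L1_loc3Z 2 lq; have l0 := L1_loc3_cst 0.
have bnd (g : R3 R * R3 R -> R) : measurable_fun setT g -> (forall u r, `|g (u, r)| <= q r) -> L1_loc6 g.
  move=> mg bg; apply: (L1_loc6_le mg l0 l2) => -[u r].
  by rewrite add0r mulrC mulKf ?pnatr_eq0.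
have Lf : L1_loc6 f by apply: bnd => // u r; have [] := b u r.
have Lk : L1_loc6 k by apply: bnd => // u r; have [] := b u r.
split=> // phi tphi.
rewrite (@rfub1 _ _ _ _ R leb3 leb3 _ (ig_L1_loc_test6 Lf (test_derive _ tphi))).
have i2 := ig_L1_loc_test6 Lk tphi.
rewrite (@rfub1 _ _ _ _ R leb3 leb3 _ i2) -rintN; last exact: (rfub_ig1 i2).
congr Rintegral; apply/funext => u.
have [_ _ /(_ _ (test_slice1 u tphi)) <-] := sliced_weak3 u h.
apply: eq_Rintegral => r _.
exact: (esym (congr1 (fun y => f (u, r) * y) (derive_slice1 phi u e r))).
Qed.

Lemma ig_gram_test f k q q' (Phi : R3 R * R3 R -> R) : sq_kernel f q -> sq_kernel k q' ->
  L1_loc3 q -> L1_loc3 q' -> test_function Phi ->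
  ig (leb3 \x leb6)%E (fun z => triple1 f z * triple2 k z * Phi z.2).
Proof.
move=> hf hk lq lq' tP; have [mf _ _ _] := hf; have [mk _ _ _] := hk.
pose w (p : R3 R * R3 R) := (q p.1 + q' p.2) / 2.
have mw : measurable_fun setT w.
  apply: measurable_funM => //; apply: measurable_funD.
    by case: lq => mq _; exact: (measurableT_comp mq measurable_fst).
  by case: lq' => mq _; exact: (measurableT_comp mq measurable_snd).
have lw : L1_loc6 w.
  apply: (L1_loc6_le mw lq lq') => p; rewrite ger0_norm//.
  by rewrite divr_ge0// addr_ge0// ?(sq_kernel_ge0 _ hf)// (sq_kernel_ge0 _ hk).
apply: (@ig_tonelli2' _ _ _ _ R leb3 leb6 _ (fun p => `|w p * Phi p|)).
- apply: measurable_funM.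
    by apply: measurable_funM; [exact: measurable_triple1|exact: measurable_triple2].
  exact: (measurableT_comp (test_measurable6 tP) measurable_snd).
- apply: nearW => -[r s]; rewrite /triple1 /triple2/=.
  have i := ig_gram r s hf hk.
  split; first by have := igZ (Phi (r, s)) i; by congr (ig _ _); apply/funext => u; rewrite mulrC.
  under eq_Rintegral do rewrite normrM mulrC.
  have w0 : 0 <= w (r, s).
    by rewrite divr_ge0// addr_ge0// ?(sq_kernel_ge0 _ hf)// (sq_kernel_ge0 _ hk).
  rewrite rintZ; last exact: ig_norm.
  rewrite (normrM (w (r, s))) (ger0_norm w0) mulrC ler_wpM2r//.
  exact: gram_norm_le hf hk.
- by apply: ig_norm; exact: ig_L1_loc_test6.
Qed.

(** Integrating over [u] last reduces a Gram kernel to the tensor product of two slices at a fixed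
    [u], where the two variables separate. *)
Lemma gram_test f k q q' (Phi : R3 R * R3 R -> R) : sq_kernel f q -> sq_kernel k q' ->
  L1_loc3 q -> L1_loc3 q' -> test_function Phi ->
  \int[leb6]_p (gram f k p * Phi p) =
  \int[leb3]_u \int[leb6]_p (f (u, p.1) * k (u, p.2) * Phi p) /\
  {ae leb3, forall u, ig leb6 (fun p => f (u, p.1) * k (u, p.2) * Phi p)}.
Proof.
move=> hf hk lq lq' tP; have i := ig_gram_test hf hk lq lq' tP; split; last first.
  exact: (rfub_ae1 i).
rewrite [RHS](rfub12 i); congr Rintegral; apply/funext => -[r s].
rewrite mulrC -rintZ; last exact: ig_gram hf hk.
by congr Rintegral; apply/funext => u; rewrite mulrC.
Qed.

(** At fixed [u] one integrates by parts in the first variable, then in the second, and the two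
    signs cancel. The three integrability hypotheses allow Fubini before, between and after these
    steps. *)
Lemma gram_weak_div e f1 k1 f2 k2 (Phi : R3 R * R3 R -> R) :
  sliced_derivative e f1 k1 -> sliced_derivative e f2 k2 -> test_function Phi ->
  forall u, ig leb6 (fun p => f1 (u, p.1) * f2 (u, p.2) * 'D_(e, 0) ('D_(0, e) Phi) p) ->
  ig leb6 (fun p => k1 (u, p.1) * f2 (u, p.2) * 'D_(0, e) Phi p) ->
  ig leb6 (fun p => k1 (u, p.1) * k2 (u, p.2) * Phi p) ->
  \int[leb6]_p (f1 (u, p.1) * f2 (u, p.2) * 'D_(e, 0) ('D_(0, e) Phi) p) =
  \int[leb6]_p (k1 (u, p.1) * k2 (u, p.2) * Phi p).
Proof.
move=> h1 h2 tP u i0 i1 i2.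
have [L1 Lk1 W1] := sliced_weak3 u h1.
have [L2 Lk2 W2] := sliced_weak3 u h2.
rewrite (rfub2 i0)/=.
transitivity (\int[leb3]_s \int[leb3]_r - (k1 (u, r) * f2 (u, s) * 'D_(0, e) Phi (r, s))).
  congr Rintegral; apply/funext => s.
  have tD : test_function (fun r => 'D_(0, e) Phi (r, s)).
    exact: (@test_slice2 _ ('D_(0, e) Phi) s (test_derive _ tP)).
  transitivity (\int[leb3]_r (f2 (u, s) * (f1 (u, r) * 'D_e (fun r => 'D_(0, e) Phi (r, s)) r))).
    apply: eq_Rintegral => r _.
    have -> : 'D_e (fun r => 'D_(0, e) Phi (r, s)) r = 'D_(e, 0) ('D_(0, e) Phi) (r, s).
      exact: (derive_slice2 ('D_(0, e) Phi) s e r).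
    by ring.
  rewrite rintZ; last exact: (ig_L1_loc_test L1 (test_derive _ tD)).
  rewrite (W1 _ tD) -rintN; last exact: (ig_L1_loc_test Lk1 tD).
  rewrite -rintZ; last by apply: igN; exact: (ig_L1_loc_test Lk1 tD).
  by congr Rintegral; apply/funext => r; ring.
rewrite -(rfub12 (igN i1)) (rfub1 i2)/=.
congr Rintegral; apply/funext => r.
have tD := test_slice1 r tP.
transitivity (\int[leb3]_s (- k1 (u, r) * (f2 (u, s) * 'D_e (fun s => Phi (r, s)) s))).
  apply: eq_Rintegral => s _.
  have -> : 'D_e (fun s => Phi (r, s)) s = 'D_(0, e) Phi (r, s) by exact: derive_slice1.
  by ring.
rewrite rintZ; last exact: (ig_L1_loc_test L2 (test_derive _ tD)).
rewrite (W2 _ tD) mulrNN -rintZ; last exact: (ig_L1_loc_test Lk2 tD).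
by congr Rintegral; apply/funext => s; ring.
Qed.

Lemma gram_div12 e f1 k1 f2 k2 q1 q2 (Phi : R3 R * R3 R -> R) :
  sliced_derivative e f1 k1 -> sliced_derivative e f2 k2 ->
  sq_kernel f1 q1 -> sq_kernel f2 q1 -> sq_kernel k1 q2 -> sq_kernel k2 q2 ->
  L1_loc3 q1 -> L1_loc3 q2 -> test_function Phi ->
  \int[leb6]_p (gram f1 f2 p * 'D_(e, 0) ('D_(0, e) Phi) p) =
  \int[leb6]_p (gram k1 k2 p * Phi p).
Proof.
move=> h1 h2 s1 s2 sk1 sk2 L1 L2 tP.
have tD : test_function ('D_(0, e) Phi) by exact: test_derive.
have tDD : test_function ('D_(e, 0) ('D_(0, e) Phi)) by exact: test_derive.
have [-> a0] := gram_test s1 s2 L1 L1 tDD.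
(* The mixed product is the term between the two integrations by parts; it is integrable for almost
   every [u], which is enough. *)
have [_ a1] := gram_test sk1 s2 L2 L1 tD.
have [-> a2] := gram_test sk1 sk2 L2 L2 tP.
apply: rint_ae.
- exact: (ig_meas (rfub_ig1 (ig_gram_test s1 s2 L1 L1 tDD))).
- exact: (ig_meas (rfub_ig1 (ig_gram_test sk1 sk2 L2 L2 tP))).
have a12 := ae_mono2 (fun u => @conj _ _) a1 a2.
apply: (ae_mono2 _ a0 a12) => u i0 [i1 i2]; exact: gram_weak_div.
Qed.

End Kernels.

(** * The phase kernel *)

Section Cutoff.
Context {R : realType}.
Local Notation mu := (@lebesgue_measure R).
Local Notation mR := (measurableTypeR R).

Definition coord3 (b : 'I_3) (r : R3 R) : R := [:: r.1.1; r.1.2; r.2]`_b.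

Lemma ord3P (P : 'I_3 -> Prop) :
  P ord0 -> P (lift ord0 ord0) -> P (lift ord0 (lift ord0 ord0)) -> forall b, P b.
Proof.
move=> h0 h1 h2 [[|[|[|//]]] i].
- by rewrite (_ : Ordinal i = ord0)//; apply: val_inj.
- by rewrite (_ : Ordinal i = lift ord0 ord0)//; apply: val_inj.
- by rewrite (_ : Ordinal i = lift ord0 (lift ord0 ord0))//; apply: val_inj.
Qed.

Lemma measurable_coord b : measurable_fun setT (coord3 b).
Proof.
move: b; apply: ord3P; rewrite /coord3/=; [exact: measurable_R3_11|exact: measurable_R3_12|exact: measurable_R3_2].
Qed.

Lemma coord3D b (x y : R3 R) : coord3 b (x + y) = coord3 b x + coord3 b y.
Proof. by move: b; apply: ord3P. Qed.

Lemma coord3N b (x : R3 R) : coord3 b (- x) = - coord3 b x.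
Proof. by move: b; apply: ord3P. Qed.

Lemma coord3B b (x y : R3 R) : coord3 b (x - y) = coord3 b x - coord3 b y.
Proof. by rewrite coord3D coord3N. Qed.

Lemma coord3Z b (t : R) (x : R3 R) : coord3 b (t *: x) = t * coord3 b x.
Proof. by move: b; apply: ord3P. Qed.

Lemma coord_basis3 (a b : 'I_3) : coord3 b (basis3 a) = (a == b)%:R.
Proof. by move: b; apply: ord3P; rewrite /coord3 /basis3/=; case: a => [[|[|[|]]]]. Qed.

Lemma cube_coord (r : R) x b : cube r x -> `|coord3 b x| <= r.
Proof. by move=> /cubeP[h1 h2 h3]; move: b; apply: ord3P. Qed.

Lemma line_affine_coord e (b : 'I_3) (u : R3 R) :
  line_derivative e (fun x => coord3 b (u - x)) (fun=> - coord3 b e).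
Proof.
apply: line_C1 => //.
- under [X in measurable_fun _ X]funext do rewrite coord3B.
  by apply: measurable_funB => //; exact: measurable_coord.
- move=> x t.
  have -> : (fun t : R => coord3 b (u - (x + t *: e))) = fun t => coord3 b (u - x) - coord3 b e * t.
    by apply/funext => y; rewrite !coord3B coord3D coord3Z; ring.
  have h := is_deriveB (is_derive_cst (coord3 b (u - x)) t 1) (is_deriveZ (coord3 b e) (is_derive_id t (1 : R))).
  by apply: (is_derive_eq h); rewrite /GRing.scale/= mulr1 sub0r.
- by move=> x; exact: cst_continuous.
Qed.

Lemma rint_prod3 (p1 p2 p3 : mR -> R) : ig mu p1 -> ig mu p2 -> ig mu p3 ->
  ig leb3 (fun y => p1 y.1.1 * p2 y.1.2 * p3 y.2) /\
  \int[leb3]_y (p1 y.1.1 * p2 y.1.2 * p3 y.2) =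
  \int[mu]_t p1 t * \int[mu]_t p2 t * \int[mu]_t p3 t.
Proof.
have two d (T : measurableType d) (m : {sigma_finite_measure set T -> \bar R})
    (x : T -> R) (y : mR -> R) : ig m x -> ig mu y ->
    ig (m \x mu)%E (fun p => x p.1 * y p.2) /\
    \int[(m \x mu)%E]_p (x p.1 * y p.2) = \int[m]_t x t * \int[mu]_t y t.
  move=> ix iy; have i : ig (m \x mu)%E (fun p => x p.1 * y p.2).
    apply: (@ig_tonelli1' _ _ _ _ R m mu _ (fun r => (\int[mu]_s `|y s|) * `|x r|)).
    - apply: measurable_funM.
        exact: (measurableT_comp (ig_meas ix) measurable_fst).
      exact: (measurableT_comp (ig_meas iy) measurable_snd).
    - apply: nearW => r; split => /=; first exact: (igZ (x r) iy).
      under eq_Rintegral do rewrite normrM.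
      by rewrite mulrC rintZ//; exact: ig_norm.
    - by apply: igZ; exact: ig_norm.
  split=> //; rewrite (rfub1 i)/= mulrC -rintZ//; congr Rintegral; apply/funext => r.
  by rewrite rintZ// mulrC.
move=> i1 i2 i3; have [i12 e12] := two _ _ mu p1 p2 i1 i2.
have [i e] := two _ _ leb2 (fun p => p1 p.1 * p2 p.2) p3 i12 i3.
by split; [exact: i|rewrite e; congr (_ * _); exact: e12].
Qed.

Variable d : R.
Hypothesis d0 : 0 < d.
Local Notation p := (profile d).
Local Notation dp := (dprofile d).

Definition cutoff (y : R3 R) : R := p (coord3 ord0 y) * p (coord3 (lift ord0 ord0) y) *
  p (coord3 (lift ord0 (lift ord0 ord0)) y).

(** The derivative along [e] of [x |-> cutoff (u - x)], expressed in [y = u - x]; hence the minus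
    signs. *)
Definition dcutoff (e y : R3 R) : R :=
  ((dp (coord3 ord0 y) * (- coord3 ord0 e)) * p (coord3 (lift ord0 ord0) y) +
   p (coord3 ord0 y) * (dp (coord3 (lift ord0 ord0) y) * (- coord3 (lift ord0 ord0) e))) *
     p (coord3 (lift ord0 (lift ord0 ord0)) y) +
  p (coord3 ord0 y) * p (coord3 (lift ord0 ord0) y) *
  (dp (coord3 (lift ord0 (lift ord0 ord0)) y) * (- coord3 (lift ord0 (lift ord0 ord0)) e)).

Lemma measurable_profile_coord b : measurable_fun setT (fun y => p (coord3 b y)).
Proof.
apply: (@measurableT_comp _ _ _ _ _ _ p); last exact: measurable_coord.
by apply: continuous_measurable_fun; exact: continuous_profile.
Qed.

Lemma measurable_dprofile_coord b : measurable_fun setT (fun y => dp (coord3 b y)).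
Proof.
apply: (@measurableT_comp _ _ _ _ _ _ dp); last exact: measurable_coord.
by apply: continuous_measurable_fun; exact: continuous_dprofile.
Qed.

Lemma measurable_cutoff : measurable_fun setT cutoff.
Proof.
by apply: measurable_funM; first apply: measurable_funM; exact: measurable_profile_coord.
Qed.

Lemma measurable_dcutoff e : measurable_fun setT (dcutoff e).
Proof.
have mp := measurable_profile_coord; have mdp := measurable_dprofile_coord.
apply: measurable_funD.
  apply: measurable_funM => //; apply: measurable_funD.
    by apply: measurable_funM => //; exact: measurable_funM.
  by apply: measurable_funM => //; exact: measurable_funM.
by apply: measurable_funM; exact: measurable_funM.
Qed.

Lemma line_cutoff e u : line_derivative e (fun x => cutoff (u - x)) (fun x => dcutoff e (u - x)).
Proof.
have lp b : line_derivative e (fun x => p (coord3 b (u - x)))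
    (fun x => dp (coord3 b (u - x)) * (- coord3 b e)).
  apply: (line_chain _ _ (line_affine_coord e b u)); last exact: continuous_dprofile.
  by move=> y; exact: is_derive_profile.
exact: (lineM (lineM (lp _) (lp _)) (lp _)).
Qed.

Lemma cutoff_out e y : ~ cube d y -> cutoff y = 0 /\ dcutoff e y = 0.
Proof.
move=> ny; have [b hb] : exists b, d < `|coord3 b y|.
  apply: contrapT => h; apply: ny; apply/cubeP.
  have {}h b : `|coord3 b y| <= d.
    by rewrite leNgt; apply/negP => hb; apply: h; exists b.
  by split; [exact: (h ord0)|exact: (h (lift ord0 ord0))|exact: (h (lift ord0 (lift ord0 ord0)))].
have [] := profile_out d0 (ltW hb); move: b {hb}; apply: ord3P => p0 dp0;
  rewrite /cutoff /dcutoff p0 dp0; split; ring.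
Qed.

Lemma cutoff_bounded e : cube 1 e ->
  exists2 M : R, 0 <= M & forall y, `|cutoff y| <= M * \1_(cube d) y /\
    `|dcutoff e y| <= M * \1_(cube d) y.
Proof.
move=> he; have [M M0 hM] := profile_bounded d0.
have {}he b : `|coord3 b e| <= 1 by exact: cube_coord.
(* The product rule has three terms, each at most [M ^+ 3]; the last summand accounts for the cutoff
   itself. *)
exists (3 * M ^+ 3 + M ^+ 3); first by rewrite addr_ge0// ?mulr_ge0 ?exprn_ge0.
move=> y; rewrite indicE; case: (pselect (cube d y)) => hy; last first.
  by have [-> ->] := cutoff_out e hy; rewrite memNset// mulr0 normr0.
rewrite mem_set// mulr1.
have {}hM b : `|p (coord3 b y)| <= M /\ `|dp (coord3 b y)| <= M by exact: hM.
have M3 (x1 x2 x3 : R) : `|x1| <= M -> `|x2| <= M -> `|x3| <= M -> `|x1 * x2 * x3| <= M ^+ 3.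
  by move=> h1 h2 h3; rewrite !normrM exprS expr2 mulrA !ler_pM ?mulr_ge0.
have MM0 : 0 <= M ^+ 3 by exact: exprn_ge0.
have hdp b : `|dp (coord3 b y) * (- coord3 b e)| <= M.
  by rewrite normrM normrN -[leRHS]mulr1 ler_pM//; have [] := hM b.
have hp b : `|p (coord3 b y)| <= M by have [] := hM b.
split; first by rewrite (le_trans (M3 _ _ _ (hp _) (hp _) (hp _)))// lerDr mulr_ge0.
rewrite /dcutoff mulrDl.
apply: (le_trans (ler_normD _ _)); apply: (@le_trans _ _ ((M ^+ 3 + M ^+ 3) + M ^+ 3)).
  apply: lerD; last exact: M3.
  by apply: (le_trans (ler_normD _ _)); apply: lerD; exact: M3.
by lra.
Qed.

Lemma cutoff_sqr y : cutoff y ^+ 2 = (p y.1.1 ^+ 2) * (p y.1.2 ^+ 2) * (p y.2 ^+ 2).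
Proof. by rewrite /cutoff !exprMn. Qed.

Lemma ig_profile_poly (w : R -> R) : continuous w -> ig mu (fun t : mR => w t * p t ^+ 2).
Proof.
move=> cw; have := @ig_continuous_itv R (fun t => w t * p t ^+ 2) (- d) d.
rewrite (_ : (fun t : mR => \1_`[- d, d] t * (w t * p t ^+ 2)) = (fun t => w t * p t ^+ 2)).
  apply=> x _; apply: cvgM; first exact: cw.
  exact: (cvg_comp _ _ (@continuous_profile _ d x) (@exprn_continuous _ 2 _)).
apply/funext => t; rewrite indicE; have [h|h] := boolP (t \in `[- d, d]%classic).
  by rewrite mul1r.
rewrite (profile_out d0 _).1 ?expr0n ?mulr0//.
move: h; rewrite notin_setE/= in_itv/= -ler_norml => /negP; rewrite -ltNge; exact: ltW.
Qed.

Lemma ig_profile_sqr : ig mu (fun t : mR => p t ^+ 2).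
Proof.
have c1 : continuous (fun _ : R => 1 : R) by exact: cst_continuous.
rewrite (_ : (fun t : mR => p t ^+ 2) = fun t : mR => 1 * p t ^+ 2).
  exact: ig_profile_poly c1.
by apply/funext => t; rewrite mul1r.
Qed.

Lemma rint_cutoff_sqr : ig leb3 (fun y => cutoff y ^+ 2) /\ \int[leb3]_y (cutoff y ^+ 2) = 1.
Proof.
have i := ig_profile_sqr.
have [j e] := rint_prod3 i i i.
rewrite (_ : (fun y => cutoff y ^+ 2) = fun y => (p y.1.1 ^+ 2) * (p y.1.2 ^+ 2) * (p y.2 ^+ 2)).
  by split=> //; rewrite e rint_profile_sqr// !mulr1.
by apply/funext => y; exact: cutoff_sqr.
Qed.

Lemma rint_coord_cutoff_sqr b : ig leb3 (fun y => coord3 b y * cutoff y ^+ 2) /\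
  \int[leb3]_y (coord3 b y * cutoff y ^+ 2) = 0.
Proof.
have i := ig_profile_sqr.
have j : ig mu (fun t : mR => t * p t ^+ 2).
  by apply: (@ig_profile_poly id) => x; exact: cvg_id.
have o := rint_profile_odd d0.
move: b; apply: ord3P.
- have [k e] := rint_prod3 j i i.
  rewrite (_ : (fun y => _) = fun y => (y.1.1 * p y.1.1 ^+ 2) * (p y.1.2 ^+ 2) * (p y.2 ^+ 2)).
    by split=> //; rewrite e o !mul0r.
  by apply/funext => y; rewrite cutoff_sqr /coord3/=; ring.
- have [k e] := rint_prod3 i j i.
  rewrite (_ : (fun y => _) = fun y => (p y.1.1 ^+ 2) * (y.1.2 * p y.1.2 ^+ 2) * (p y.2 ^+ 2)).
    by split=> //; rewrite e o mulr0 mul0r.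
  by apply/funext => y; rewrite cutoff_sqr /coord3/=; ring.
- have [k e] := rint_prod3 i i j.
  rewrite (_ : (fun y => _) = fun y => (p y.1.1 ^+ 2) * (p y.1.2 ^+ 2) * (y.2 * p y.2 ^+ 2)).
    by split=> //; rewrite e o mulr0.
  by apply/funext => y; rewrite cutoff_sqr /coord3/=; ring.
Qed.

Lemma cutoff_sqr_le y : cutoff y ^+ 2 <= (315 / (256 * d)) ^+ 3 * \1_(cube d) y.
Proof.
rewrite indicE; case: (pselect (cube d y)) => hy; last first.
  by have [-> _] := cutoff_out 0 hy; rewrite memNset// mulr0 expr0n.
rewrite mem_set// mulr1 cutoff_sqr; set c := 315 / (256 * d).
have -> : c ^+ 3 = c * c * c by rewrite exprS expr2 mulrA.
have h (t : R) : p t ^+ 2 <= c by exact: profile_le.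
by apply: ler_pM => //; [apply: mulr_ge0; exact: sqr_ge0|exact: sqr_ge0|apply: ler_pM => //; exact: sqr_ge0].
Qed.

End Cutoff.

(** * Uniform smallness of the mass of small cubes *)

Section SmallCubes.
Context {R : realType}.
Local Notation mu := (@lebesgue_measure R).
Local Notation mR := (measurableTypeR R).

Lemma line_sum e (I : Type) (s : seq I) (f k : I -> R3 R -> R) :
  (forall i, line_derivative e (f i) (k i)) ->
  line_derivative e (fun x => \sum_(i <- s) f i x) (fun x => \sum_(i <- s) k i x).
Proof.
move=> h; elim: s => [|i s IH].
  rewrite (_ : (fun x => _) = fun=> 0); last by apply/funext => x; rewrite big_nil.
  rewrite (_ : (fun x : R3 R => \sum_(i <- [::]) k i x) = fun=> 0); last by apply/funext => x; rewrite big_nil.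
  exact: line_cst.
rewrite (_ : (fun x => _) = fun x => f i x + \sum_(i <- s) f i x); last by apply/funext => x; rewrite big_cons.
rewrite (_ : (fun x : R3 R => \sum_(i <- i :: s) k i x) = fun x => k i x + \sum_(i <- s) k i x); last by apply/funext => x; rewrite big_cons.
exact: lineD.
Qed.

Lemma measurable_diff3 : measurable_fun setT (fun z : R3 R * R3 R => z.1 - z.2 : R3 R).
Proof.
have m1 : measurable_fun setT (fun p : R3 R * R3 R => p.1) by exact: measurable_fst.
have m2 : measurable_fun setT (fun p : R3 R * R3 R => p.2) by exact: measurable_snd.
have -> : (fun z : R3 R * R3 R => z.1 - z.2 : R3 R) = fun z =>
    (z.1.1.1 - z.2.1.1, z.1.1.2 - z.2.1.2, z.1.2 - z.2.2) by [].
apply: measurable_fun_pair; first apply: measurable_fun_pair.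
- apply: measurable_funB; [exact: (measurableT_comp measurable_R3_11 m1)|exact: (measurableT_comp measurable_R3_11 m2)].
- apply: measurable_funB; [exact: (measurableT_comp measurable_R3_12 m1)|exact: (measurableT_comp measurable_R3_12 m2)].
- apply: measurable_funB; [exact: (measurableT_comp measurable_R3_2 m1)|exact: (measurableT_comp measurable_R3_2 m2)].
Qed.

Lemma measurable_of_diff (f : R3 R -> R) : measurable_fun setT f ->
  measurable_fun setT (fun z : R3 R * R3 R => f (z.1 - z.2)).
Proof. by move=> mf; exact: (measurableT_comp mf measurable_diff3). Qed.

Lemma measurable_of_snd (f : R3 R -> R) : measurable_fun setT f ->
  measurable_fun setT (fun z : R3 R * R3 R => f z.2).
Proof. by move=> mf; exact: (measurableT_comp mf measurable_snd). Qed.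

Lemma rint_indic_cube (d : R) : 0 < d ->
  ig leb3 (\1_(cube d) : R3 R -> R) /\ \int[leb3]_x (\1_(cube d) x : R) = (2 * d) ^+ 3.
Proof.
move=> d0; split; first by apply: ig_indic; [exact: measurable_cube|exact: leb3_cube_lty].
rewrite rint_indic; last exact: measurable_cube.
have e : mu (`[- d, d]%classic : set mR) = (2 * d)%:E.
  rewrite lebesgue_measure_itv/= lte_fin gt0_cp// -EFinB; congr EFin; ring.
have h : leb3 (cube d) = ((2 * d) * (2 * d) * (2 * d))%:E.
  by rewrite /cube leb3X// e -!EFinM.
by apply: (etrans (congr1 fine h)) => /=; ring.
Qed.

Lemma cubeN (d : R) x : \1_(cube d) (- x) = \1_(cube d) x :> R.
Proof.
rewrite !indicE; congr (_ %:R); congr nat_of_bool.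
have h y : cube d y -> cube d (- y).
  by move=> /cubeP[h1 h2 h3]; apply/cubeP; rewrite !normrN.
by apply/idP/idP; rewrite !inE => /h; rewrite ?opprK.
Qed.

Lemma measurable_cube_diff (d : R) :
  measurable_fun setT (fun z : R3 R * R3 R => \1_(cube d) (z.1 - z.2) : R).
Proof. by apply: measurable_of_diff; apply: measurable_indic; exact: measurable_cube. Qed.

Lemma rint_cube_diff1 (d : R) (r : R3 R) : 0 < d ->
  ig leb3 (fun u : R3 R => \1_(cube d) (u - r) : R) /\
  \int[leb3]_u (\1_(cube d) (u - r) : R) = (2 * d) ^+ 3.
Proof.
move=> d0; have [i e] := rint_indic_cube d0; split; first exact: (ig_shift3 (- r) i).
by rewrite -e; exact: (rint_shift3 (- r) (ig_meas i)).
Qed.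

Lemma rint_cube_diff2 (d : R) (u : R3 R) : 0 < d ->
  ig leb3 (fun r : R3 R => \1_(cube d) (u - r) : R) /\
  \int[leb3]_r (\1_(cube d) (u - r) : R) = (2 * d) ^+ 3.
Proof.
move=> d0; have -> : (fun r : R3 R => \1_(cube d) (u - r) : R) = fun r => \1_(cube d) (r - u).
  by apply/funext => r; rewrite -cubeN opprB.
exact: rint_cube_diff1.
Qed.

(* This is what makes the operator norm of the density matrix small. *)
Lemma uniform_small_cubes (w : R3 R -> R) (eps : R) : ig leb3 w -> (forall r, 0 <= w r) ->
  0 < eps -> exists d : R, [/\ 0 < d, d <= 1 &
    forall u, \int[leb3]_r (w r * \1_(cube d) (u - r)) <= eps].
Proof.
move=> iw w0 e0.
(* Truncation at height [n]: the remainder has total mass at most [eps / 2] for [n] large, and the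
   truncated part has mass at most [n (2d)^3] in any cube of side [2d]. *)
pose t (n : nat) (r : R3 R) := Num.min (w r) n%:R.
have mt n : measurable_fun setT (t n) by apply: measurable_minr => //; exact: ig_meas iw.
have t0 n r : 0 <= t n r by rewrite /t le_min w0 ler0n.
have tw n r : t n r <= w r by rewrite /t ge_min lexx.
have ct r : t n r @[n --> \oo] --> w r.
  have [n hn] : exists n : nat, w r <= n%:R.
    by exists (Num.truncn (w r)).+1; apply/ltW/truncnS_gt.
  apply: cvg_near_cst; near=> m; rewrite /t; apply/min_idPl.
  by apply: (le_trans hn); rewrite ler_nat; near: m; exact: nbhs_infty_ge.
have [||it cit] := @rint_dct _ _ _ leb3 t w w mt (ig_meas iw) _ iw _.
- by apply: nearW => r; exact: ct.
- by move=> n r; rewrite ger0_norm.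
have [n hn] : exists n, \int[leb3]_r w r - \int[leb3]_r t n r <= eps / 2.
  have /cvgrPdist_le /(_ (eps / 2)) : \int[leb3]_r t n r @[n --> \oo] --> \int[leb3]_r w r by [].
  rewrite divr_gt0// => /(_ erefl)[n _ /(_ n (leqnn n))/= h]; exists n.
  exact: le_trans (ler_norm _) h.
have itn : ig leb3 (t n) by apply: ig_le iw => // r; rewrite ger0_norm.
(* As [d <= 1], one has [n (2d)^3 <= 8 n d], which this choice makes at most [eps / 2]. *)
pose d := Num.min 1 (eps / (16 * (n%:R + 1))).
have n0 : (0 : R) < n%:R + 1 by rewrite ltr_wpDl.
have d0 : 0 < d by rewrite /d lt_min ltr01 divr_gt0// mulr_gt0.
have d1 : d <= 1 by rewrite /d ge_min lexx.
exists d; split=> // u.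
have [ic ec] := rint_cube_diff2 u d0.
have mc := ig_meas ic.
have c0 r : 0 <= \1_(cube d) (u - r) :> R by rewrite indicE.
have c1 r : \1_(cube d) (u - r) <= 1 :> R by rewrite indicE lern1 leq_b1.
have h r : w r * \1_(cube d) (u - r) <= (w r - t n r) + n%:R * \1_(cube d) (u - r).
  have tn : t n r <= n%:R by rewrite /t ge_min lexx orbT.
  have a1 : 0 <= 1 - \1_(cube d) (u - r) :> R by rewrite subr_ge0.
  have a2 : 0 <= w r - t n r by rewrite subr_ge0.
  have a3 : 0 <= n%:R - t n r by rewrite subr_ge0.
  have := mulr_ge0 a1 a2; have := mulr_ge0 (c0 r) a3.
  move: (\1_(cube d) (u - r) : R) (t n r) (n%:R : R) => c y z; lra.
have i1 : ig leb3 (fun r => w r * \1_(cube d) (u - r)).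
  apply: (ig_le _ _ iw) => [|r]; first by apply: measurable_funM => //; exact: ig_meas iw.
  by rewrite ger0_norm ?mulr_ge0// -[leRHS]mulr1 ler_wpM2l.
apply: (le_trans (rint_le i1 (igD (igB iw itn) (igZ n%:R ic)) h)).
rewrite rintD; [|exact: igB|exact: igZ].
rewrite rintB// rintZ// ec.
suff : n%:R * (2 * d) ^+ 3 <= eps / 2 by lra.
have d3 : d ^+ 3 <= d.
  have h2 : d ^+ 2 <= 1 by apply: exprn_ile1 => //; exact: ltW.
  by rewrite -[leRHS]mulr1 exprS; apply: ler_wpM2l => //; exact: ltW.
have dn : (n%:R + 1) * d <= eps / 16.
  rewrite mulrC -ler_pdivlMr// /d ge_min; apply/orP; right.
  by rewrite -mulrA -invfM.
have : n%:R * d ^+ 3 <= n%:R * d by rewrite ler_wpM2l.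
by rewrite exprMn; lra.
Unshelve. all: by end_near. Qed.

End SmallCubes.

(** * Mass, energy, current and operator norm of the phase kernel *)

Section PhaseKernel.
Context {R : realType}.
Local Notation mR := (measurableTypeR R).
Variables (rho : R3 R -> R) (kappa : 'I_3 -> R3 R -> R).
Variables (drho : 'I_3 -> R3 R -> R) (dkappa : 'I_3 -> 'I_3 -> R3 R -> R).
Variable d : R.
Hypothesis rho0 : forall r, 0 <= rho r.
Hypothesis irho : ig leb3 rho.
Hypothesis Wrho : forall a, weak_derivative3 rho (drho a) (basis3 a).
Hypothesis Lrho : L1_loc3 (fun r => (rho r)^-1 * \sum_(a < 3) drho a r ^+ 2).
Hypothesis Lkappa : forall a, L1_loc3 (fun r => rho r * kappa a r ^+ 2).
Hypothesis Wkappa : forall a b, weak_derivative3 (kappa b) (dkappa a b) (basis3 a).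
Hypothesis Ldkappa : forall a b,
  L1_loc3 (fun r => (1 + sqnorm3 r) * rho r * dkappa a b r ^+ 2).
Hypothesis d0 : 0 < d.
Hypothesis d1 : d <= 1.

Definition amp (r : R3 R) := Num.sqrt (rho r).
Definition damp a (r : R3 R) := drho a r / (2 * Num.sqrt (rho r)).

Definition phase (z : R3 R * R3 R) : R :=
  2^-1 * \sum_(b < 3) coord3 b (z.1 - z.2) * kappa b z.2.
Definition dphase a (z : R3 R * R3 R) : R :=
  2^-1 * \sum_(b < 3) ((- coord3 b (basis3 a)) * kappa b z.2 +
                       coord3 b (z.1 - z.2) * dkappa a b z.2).

Definition kerA (z : R3 R * R3 R) : R := amp z.2 * (cutoff d (z.1 - z.2) * cos (phase z)).
Definition kerB (z : R3 R * R3 R) : R := amp z.2 * (cutoff d (z.1 - z.2) * sin (phase z)).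

Definition dkerA a (z : R3 R * R3 R) : R :=
  damp a z.2 * (cutoff d (z.1 - z.2) * cos (phase z)) +
  amp z.2 * (dcutoff d (basis3 a) (z.1 - z.2) * cos (phase z) +
             cutoff d (z.1 - z.2) * (- sin (phase z) * dphase a z)).
Definition dkerB a (z : R3 R * R3 R) : R :=
  damp a z.2 * (cutoff d (z.1 - z.2) * sin (phase z)) +
  amp z.2 * (dcutoff d (basis3 a) (z.1 - z.2) * sin (phase z) +
             cutoff d (z.1 - z.2) * (cos (phase z) * dphase a z)).

(** Majorant, up to a constant, of the squared derivatives of both kernels at [(u, r)], free of [u].
    Its terms come from the gradients of the amplitude, of the cutoff and, for the last two, of the
    phase. *)
Definition energy a (r : R3 R) : R :=
  2 * damp a r ^+ 2 + 2 * rho r + rho r * kappa a r ^+ 2 +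
  \sum_(b < 3) rho r * dkappa a b r ^+ 2.

Lemma mrho : measurable_fun setT rho. Proof. exact: ig_meas irho. Qed.

Lemma mdrho a : measurable_fun setT (drho a).
Proof. by have [_ [m _] _] := Wrho a. Qed.

Lemma mkappa b : measurable_fun setT (kappa b).
Proof. by have [[m _] _ _] := Wkappa ord0 b. Qed.

Lemma mdkappa a b : measurable_fun setT (dkappa a b).
Proof. by have [_ [m _] _] := Wkappa a b. Qed.

Lemma msqrt : measurable_fun [set: mR] (@Num.sqrt R).
Proof. by apply: continuous_measurable_fun; exact: sqrt_continuous. Qed.

Lemma measurable_amp : measurable_fun setT amp.
Proof. exact: (measurableT_comp msqrt mrho). Qed.

Lemma measurable_damp a : measurable_fun setT (damp a).
Proof.
apply: measurable_funM; first exact: mdrho.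
apply: (measurableT_comp (@measurable_invr R)).
by apply: measurable_funM => //; exact: measurable_amp.
Qed.

Lemma amp_sqr r : amp r ^+ 2 = rho r.
Proof. by rewrite /amp sqr_sqrtr. Qed.

(* Also valid where [rho r = 0], both sides being then [0]. *)
Lemma damp_sqr a r : damp a r ^+ 2 = (rho r)^-1 * drho a r ^+ 2 / 4.
Proof. by rewrite /damp exprMn exprVn exprMn sqr_sqrtr// invfM (_ : 2 ^+ 2 = 4 :> R); ring. Qed.

Lemma damp_sqr_le a r : damp a r ^+ 2 <= (rho r)^-1 * \sum_(a < 3) drho a r ^+ 2.
Proof.
have h : (rho r)^-1 * drho a r ^+ 2 <= (rho r)^-1 * \sum_(a < 3) drho a r ^+ 2.
  rewrite ler_wpM2l ?invr_ge0// (bigD1 a)//= lerDl; apply: sumr_ge0 => i _; exact: sqr_ge0.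
apply: le_trans h; rewrite damp_sqr.
have : 0 <= (rho r)^-1 * drho a r ^+ 2 by rewrite mulr_ge0 ?invr_ge0 ?sqr_ge0.
by lra.
Qed.

Lemma L1_loc3_damp_sqr a : L1_loc3 (fun r => damp a r ^+ 2).
Proof.
apply: L1_loc3_le Lrho _ => [|r].
  by under [X in measurable_fun _ X]funext do rewrite expr2; apply: measurable_funM; exact: measurable_damp.
by rewrite ger0_norm ?sqr_ge0//; exact: damp_sqr_le.
Qed.

Lemma L1_loc3_damp a : L1_loc3 (damp a).
Proof.
apply: L1_loc3_le (L1_loc3D (L1_loc3_cst 1) (L1_loc3_damp_sqr a)) _ => [|r].
  exact: measurable_damp.
exact: norm_le_sqr.
Qed.

Lemma L1_loc3_rho_dkappa a b : L1_loc3 (fun r => rho r * dkappa a b r ^+ 2).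
Proof.
apply: L1_loc3_le (Ldkappa a b) _ => [|r].
  apply: measurable_funM; first exact: mrho.
  by under [X in measurable_fun _ X]funext do rewrite expr2; apply: measurable_funM; exact: mdkappa.
have h : 0 <= rho r * dkappa a b r ^+ 2 by rewrite mulr_ge0 ?sqr_ge0.
rewrite ger0_norm// -mulrA mulrDl mul1r lerDl mulr_ge0//.
by rewrite /sqnorm3 !addr_ge0 ?sqr_ge0.
Qed.

Lemma L1_loc3_energy a : L1_loc3 (energy a).
Proof.
apply: L1_loc3D; last by apply: L1_loc3_sum => b; exact: L1_loc3_rho_dkappa.
apply: L1_loc3D; last exact: Lkappa.
by apply: L1_loc3D; apply: L1_loc3Z; [exact: L1_loc3_damp_sqr|exact: ig_L1_loc3].
Qed.

Lemma energy_ge0 a r : 0 <= energy a r.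
Proof.
apply: addr_ge0; last by apply: sumr_ge0 => b _; rewrite mulr_ge0 ?sqr_ge0.
by apply: addr_ge0; [apply: addr_ge0|]; rewrite mulr_ge0 ?sqr_ge0.
Qed.

Lemma line_amp a : line_derivative (basis3 a) amp (damp a).
Proof.
have [_ _ h] := weak_line (cube1_basis3 a) (Wrho a).
split; [exact: measurable_amp|exact: measurable_damp|].
by apply: ae_mono2 h (ae_ig_line (cube1_basis3 a) (L1_loc3_damp a)) => x h1 h2; exact: ac_sqrt.
Qed.

Lemma line_phase a u : line_derivative (basis3 a) (fun x => phase (u, x)) (fun x => dphase a (u, x)).
Proof.
apply: lineZ; apply: line_sum => b; apply: lineM; first exact: line_affine_coord.
exact: weak_line (cube1_basis3 a) (Wkappa a b).
Qed.

Lemma line_kerA a u : line_derivative (basis3 a) (fun x => kerA (u, x)) (fun x => dkerA a (u, x)).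
Proof.
apply: (lineM (line_amp a)); apply: (lineM (line_cutoff d (basis3 a) u)).
apply: (line_chain (@is_derive_cos R) _ (line_phase a u)).
by move=> x; apply: cvgN; exact: continuous_sin.
Qed.

Lemma line_kerB a u : line_derivative (basis3 a) (fun x => kerB (u, x)) (fun x => dkerB a (u, x)).
Proof.
apply: (lineM (line_amp a)); apply: (lineM (line_cutoff d (basis3 a) u)).
by apply: (line_chain (@is_derive_sin R) _ (line_phase a u)); exact: continuous_cos.
Qed.

Lemma measurable_phase : measurable_fun setT phase.
Proof.
apply: measurable_funM => //; apply: measurable_sum => b; apply: measurable_funM.
  by apply: measurable_of_diff; exact: measurable_coord.
by apply: measurable_of_snd; exact: mkappa.
Qed.

Lemma measurable_dphase a : measurable_fun setT (dphase a).
Proof.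
apply: measurable_funM => //; apply: measurable_sum => b; apply: measurable_funD.
  by apply: measurable_funM => //; apply: measurable_of_snd; exact: mkappa.
apply: measurable_funM; first by apply: measurable_of_diff; exact: measurable_coord.
by apply: measurable_of_snd; exact: mdkappa.
Qed.

Lemma measurable_cos_phase : measurable_fun setT (fun z => cos (phase z)).
Proof.
have mc : measurable_fun [set: mR] (@cos R) by apply: continuous_measurable_fun; exact: continuous_cos.
exact: (measurableT_comp mc measurable_phase).
Qed.

Lemma measurable_sin_phase : measurable_fun setT (fun z => sin (phase z)).
Proof.
have mc : measurable_fun [set: mR] (@sin R) by apply: continuous_measurable_fun; exact: continuous_sin.
exact: (measurableT_comp mc measurable_phase).
Qed.

Lemma measurable_ker : [/\ measurable_fun setT kerA, measurable_fun setT kerB &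
  forall a, measurable_fun setT (dkerA a) /\ measurable_fun setT (dkerB a)].
Proof.
have mC := measurable_cos_phase; have mS := measurable_sin_phase.
have ma := measurable_of_snd measurable_amp.
have md a := measurable_of_snd (measurable_damp a).
have mg := measurable_of_diff (measurable_cutoff d).
have mdg a := measurable_of_diff (measurable_dcutoff d (basis3 a)).
have mp := measurable_dphase.
split; [by apply: measurable_funM => //; exact: measurable_funM..|move=> a].
split.
- apply: measurable_funD; first by apply: measurable_funM => //; exact: measurable_funM.
  apply: measurable_funM => //; apply: measurable_funD; first exact: measurable_funM.
  apply: measurable_funM => //; apply: measurable_funM => //.
  exact: measurableT_comp.
- apply: measurable_funD; first by apply: measurable_funM => //; exact: measurable_funM.
  apply: measurable_funM => //; apply: measurable_funD; first exact: measurable_funM.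
  by apply: measurable_funM => //; exact: measurable_funM.
Qed.

Lemma ker_sqr z : kerA z ^+ 2 + kerB z ^+ 2 = rho z.2 * cutoff d (z.1 - z.2) ^+ 2.
Proof.
rewrite -amp_sqr /kerA /kerB -[RHS]mulr1 -(cos2Dsin2 (phase z)).
by move: (amp _) (cutoff _ _) (cos _) (sin _) => ? ? ? ?; ring.
Qed.

Lemma kerA_sqr_le z : kerA z ^+ 2 <= rho z.2 * cutoff d (z.1 - z.2) ^+ 2.
Proof. by rewrite -ker_sqr lerDl sqr_ge0. Qed.

Lemma kerB_sqr_le z : kerB z ^+ 2 <= rho z.2 * cutoff d (z.1 - z.2) ^+ 2.
Proof. by rewrite -ker_sqr lerDr sqr_ge0. Qed.

(** In the frame rotated by the phase, the derivative of the real amplitude and the phase term are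
    the real and imaginary components, hence orthogonal. *)
Lemma dker_sqr a z : dkerA a z ^+ 2 + dkerB a z ^+ 2 =
  (damp a z.2 * cutoff d (z.1 - z.2) + amp z.2 * dcutoff d (basis3 a) (z.1 - z.2)) ^+ 2 +
  rho z.2 * (cutoff d (z.1 - z.2) * dphase a z) ^+ 2.
Proof.
rewrite -amp_sqr /dkerA /dkerB -[RHS]mulr1 -(cos2Dsin2 (phase z)).
by move: (amp _) (damp _ _) (cutoff _ _) (dcutoff _ _ _) (dphase _ _) (cos _) (sin _) => ? ? ? ? ? ? ?; ring.
Qed.

(** This is minus the imaginary part of [G^*] times the derivative of [G], to which the derivative
    of the real amplitude does not contribute. As [dphase] contains [- kappa / 2], the result has
    the right sign. *)
Lemma dker_current a z : dkerA a z * kerB z - dkerB a z * kerA z =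
  - (rho z.2 * (cutoff d (z.1 - z.2) ^+ 2 * dphase a z)).
Proof.
rewrite -amp_sqr /dkerA /dkerB /kerA /kerB -[RHS]mulr1 -(cos2Dsin2 (phase z)).
by move: (amp _) (damp _ _) (cutoff _ _) (dcutoff _ _ _) (dphase _ _) (cos _) (sin _) => ? ? ? ? ? ? ?; ring.
Qed.

Lemma dphaseE a z : dphase a z = 2^-1 * (- kappa a z.2 + \sum_(b < 3) coord3 b (z.1 - z.2) * dkappa a b z.2).
Proof.
rewrite /dphase big_split/=; congr (_ * (_ + _)).
rewrite (bigD1 a)//= big1 ?addr0 => [|b ba]; first by rewrite coord_basis3 eqxx mulN1r.
by rewrite coord_basis3 eq_sym (negbTE ba) oppr0 mul0r.
Qed.

Lemma dphase_sqr_le a z : cube 1 (z.1 - z.2) ->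
  dphase a z ^+ 2 <= kappa a z.2 ^+ 2 + \sum_(b < 3) dkappa a b z.2 ^+ 2.
Proof.
move=> hz; rewrite dphaseE !big_ord_recl !big_ord0 !addr0.
have h (b : 'I_3) : (coord3 b (z.1 - z.2) * dkappa a b z.2) ^+ 2 <= dkappa a b z.2 ^+ 2.
  rewrite exprMn -[leRHS]mul1r ler_wpM2r ?sqr_ge0// -(expr1n _ 2) -real_normK ?num_real//.
  by rewrite lerXn2r ?nnegrE// cube_coord.
have := h ord0; have := h (lift ord0 ord0); have := h (lift ord0 (lift ord0 ord0)).
move: (coord3 _ _ * _) (coord3 _ _ * _) (coord3 _ _ * _) => x y t.
move: (dkappa _ _ _ ^+ 2) (dkappa _ _ _ ^+ 2) (dkappa _ _ _ ^+ 2) (kappa a z.2) => X Y T k hT hY hX.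
(* Cauchy-Schwarz for a sum of four terms, as an explicit sum of squares; its factor 4 is absorbed
   by the [2^-1] in [dphase]. *)
have e : 4 * (k ^+ 2 + x ^+ 2 + y ^+ 2 + t ^+ 2) - (- k + (x + (y + t))) ^+ 2 =
  (k + x) ^+ 2 + (k + y) ^+ 2 + (k + t) ^+ 2 + (x - y) ^+ 2 + (x - t) ^+ 2 + (y - t) ^+ 2 by ring.
have p : 0 <= 4 * (k ^+ 2 + x ^+ 2 + y ^+ 2 + t ^+ 2) - (- k + (x + (y + t))) ^+ 2.
  by rewrite e !addr_ge0 ?sqr_ge0.
rewrite exprMn (_ : 2^-1 ^+ 2 = 4^-1 :> R); last by field.
by lra.
Qed.

(** Everything vanishes outside the cube; inside it [d <= 1] bounds the coordinates of [u - x] by 1,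
    so that they disappear from the estimate. *)
Lemma dker_sqr_le a : exists2 M : R, 0 <= M & forall z,
  dkerA a z ^+ 2 + dkerB a z ^+ 2 <= M * (\1_(cube d) (z.1 - z.2) * energy a z.2).
Proof.
have [M M0 hM] := cutoff_bounded d0 (cube1_basis3 a : cube 1 (basis3 a : R3 R)).
exists (M ^+ 2); first exact: sqr_ge0.
move=> z; rewrite dker_sqr; have [hg hdg] := hM (z.1 - z.2).
case: (pselect (cube d (z.1 - z.2))) => hz; last first.
  have [-> ->] := cutoff_out d0 (basis3 a) hz.
  by rewrite indicE memNset//= !(mulr0, mul0r, addr0, expr0n).
have hc := dphase_sqr_le a (cube_subset d1 hz).
move: hg hdg; rewrite indicE mem_set// mulr1 mul1r => hg hdg.
have sq (x : R) : `|x| <= M -> x ^+ 2 <= M ^+ 2.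
  by move=> hx; rewrite -real_normK ?num_real// lerXn2r ?nnegrE.
have {}hg := sq _ hg; have {}hdg := sq _ hdg.
rewrite /energy.
have -> : \sum_(b < 3) rho z.2 * dkappa a b z.2 ^+ 2 = rho z.2 * \sum_(b < 3) dkappa a b z.2 ^+ 2.
  by rewrite mulr_sumr.
move: hc hg hdg (amp_sqr z.2) (rho0 z.2).
move: (\sum_(_ < _) _) (kappa a z.2 ^+ 2) (dphase _ _) (cutoff _ _) (dcutoff _ _ _) (amp _) (damp _ _) (rho _).
move=> S k w g dg s ds rh hw hg hdg e rh0.
have h1 : (ds * g + s * dg) ^+ 2 <= 2 * (ds ^+ 2 * g ^+ 2) + 2 * (rh * dg ^+ 2).
  by rewrite -e; have := sqr_ge0 (ds * g - s * dg); lra.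
have h2 : ds ^+ 2 * g ^+ 2 <= ds ^+ 2 * M ^+ 2 by rewrite ler_wpM2l ?sqr_ge0.
have h3 : rh * dg ^+ 2 <= rh * M ^+ 2 by rewrite ler_wpM2l.
have h4 : rh * (g * w) ^+ 2 <= rh * (M ^+ 2 * (k + S)).
  by rewrite ler_wpM2l// exprMn ler_pM ?sqr_ge0.
by lra.
Qed.

Lemma rint_rho_cutoff r : ig leb3 (fun u => rho r * cutoff d (u - r) ^+ 2) /\
  \int[leb3]_u (rho r * cutoff d (u - r) ^+ 2) = rho r.
Proof.
have [i e] := rint_cutoff_sqr d0; have j := ig_shift3 (- r) i.
split; first exact: igZ.
by rewrite rintZ// (rint_shift3 (- r) (ig_meas i)) e mulr1.
Qed.

Lemma ig_sqr_slice (f : R3 R * R3 R -> R) (q : R3 R -> R) r : measurable_fun setT f ->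
  ig leb3 q -> (forall u, f (u, r) ^+ 2 <= q u) -> ig leb3 (fun u => f (u, r) ^+ 2).
Proof.
move=> mf iq h; apply: ig_le iq => [|u]; last by rewrite ger0_norm ?sqr_ge0.
by apply: measurable_funX; exact: measurable_slice2.
Qed.

Lemma sq_kernel_of_le (f : R3 R * R3 R -> R) : measurable_fun setT f ->
  (forall z, f z ^+ 2 <= rho z.2 * cutoff d (z.1 - z.2) ^+ 2) -> sq_kernel f rho.
Proof.
move=> mf h; have i r : ig leb3 (fun u => f (u, r) ^+ 2).
  have [j _] := rint_rho_cutoff r.
  by apply: (ig_sqr_slice mf j) => u; exact: (h (u, r)).
split=> // [|r]; first exact: mrho.
have [j e] := rint_rho_cutoff r.
by rewrite -[leRHS]e; apply: rint_le => // u; exact: (h (u, r)).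
Qed.

Lemma sq_kerA : sq_kernel kerA rho.
Proof. by have [m _ _] := measurable_ker; apply: sq_kernel_of_le => // z; exact: kerA_sqr_le. Qed.

Lemma sq_kerB : sq_kernel kerB rho.
Proof. by have [_ m _] := measurable_ker; apply: sq_kernel_of_le => // z; exact: kerB_sqr_le. Qed.

Lemma sq_dker a : exists q, [/\ L1_loc3 q, sq_kernel (dkerA a) q & sq_kernel (dkerB a) q].
Proof.
have [M M0 h] := dker_sqr_le a; have [_ _ /(_ a)[mA mB]] := measurable_ker.
pose q (r : R3 R) := M * (2 * d) ^+ 3 * energy a r.
have lq : L1_loc3 q by apply: L1_loc3Z; exact: L1_loc3_energy.
have iw r : ig leb3 (fun u => M * energy a r * \1_(cube d) (u - r)) /\
    \int[leb3]_u (M * energy a r * \1_(cube d) (u - r)) = q r.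
  have [i e] := rint_cube_diff1 r d0; split; first exact: igZ.
  by rewrite rintZ// e /q; ring.
have aux (f : R3 R * R3 R -> R) : measurable_fun setT f ->
    (forall z, f z ^+ 2 <= dkerA a z ^+ 2 + dkerB a z ^+ 2) -> sq_kernel f q.
  move=> mf hf; have b u r : f (u, r) ^+ 2 <= M * energy a r * \1_(cube d) (u - r).
    by apply: (le_trans (hf _)); rewrite -mulrA [energy _ _ * _]mulrC; exact: (h (u, r)).
  have i r : ig leb3 (fun u => f (u, r) ^+ 2).
    by apply: (ig_sqr_slice mf (iw r).1) => u; exact: b.
  split=> // [|r]; first by case: lq.
  by rewrite -(iw r).2; apply: rint_le => //; exact: (iw r).1.
by exists q; split=> //; apply: aux => // z; rewrite ?lerDl ?lerDr sqr_ge0.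
Qed.

Lemma sliced_ker a : sliced_derivative (basis3 a) kerA (dkerA a) /\
  sliced_derivative (basis3 a) kerB (dkerB a).
Proof.
have [M M0 h] := dker_sqr_le a; have [mA mB /(_ a)[mdA mdB]] := measurable_ker.
pose c := (315 / (256 * d)) ^+ 3.
have c0 : 0 <= c.
  by apply: exprn_ge0; exact: (divr_ge0 (ler0n _ 315) (mulr_ge0 (ler0n _ 256) (ltW d0))).
(* The inequality [|x| <= 1 + x^2] turns the quadratic bounds into a majorant of the absolute
   values, uniform in [u]. *)
pose q (r : R3 R) := 1 + c * rho r + M * energy a r.
have lq : L1_loc3 q.
  apply: L1_loc3D; last by apply: L1_loc3Z; exact: L1_loc3_energy.
  by apply: L1_loc3D; [exact: L1_loc3_cst|apply: L1_loc3Z; exact: ig_L1_loc3].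
have e0 r : 0 <= M * energy a r by rewrite mulr_ge0// energy_ge0.
have r0 r : 0 <= c * rho r by rewrite mulr_ge0.
have b1 u r x : x ^+ 2 <= rho r * cutoff d (u - r) ^+ 2 -> `|x| <= q r.
  move=> hx; apply: (le_trans (norm_le_sqr _)); rewrite /q -addrA lerD2l.
  apply: (@le_trans _ _ (c * rho r)); last by rewrite lerDl.
  apply: (le_trans hx); rewrite [leRHS]mulrC ler_wpM2l//.
  apply: (le_trans (cutoff_sqr_le d0 _)); rewrite -[leRHS]mulr1 -/c.
  by apply: ler_wpM2l => //; rewrite indicE lern1 leq_b1.
have b2 u r x : x ^+ 2 <= dkerA a (u, r) ^+ 2 + dkerB a (u, r) ^+ 2 -> `|x| <= q r.
  move=> hx; apply: (le_trans (norm_le_sqr _)); rewrite /q -addrA lerD2l.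
  apply: (@le_trans _ _ (M * energy a r)); last by rewrite lerDr.
  apply: (le_trans hx); apply: (le_trans (h _)); rewrite ler_wpM2l//=.
  by rewrite -[leRHS]mul1r ler_wpM2r ?energy_ge0// indicE lern1 leq_b1.
split; exists q; split=> //.
- move=> u r; split; first by apply: (b1 u); exact: (kerA_sqr_le (u, r)).
  by apply: (b2 u); rewrite lerDl sqr_ge0.
- by move=> u; exact: line_kerA.
- move=> u r; split; first by apply: (b1 u); exact: (kerB_sqr_le (u, r)).
  by apply: (b2 u); rewrite lerDr sqr_ge0.
- by move=> u; exact: line_kerB.
Qed.

Lemma ker_mass r : \int[leb3]_u (kerA (u, r) * kerA (u, r) + kerB (u, r) * kerB (u, r)) = rho r.
Proof.
rewrite -[RHS](rint_rho_cutoff r).2; apply: eq_Rintegral => u _.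
by rewrite -!expr2 ker_sqr.
Qed.

Lemma ker_current a r :
  \int[leb3]_u (dkerA a (u, r) * kerB (u, r) - dkerB a (u, r) * kerA (u, r)) =
  2^-1 * rho r * kappa a r.
Proof.
have [i e] := rint_cutoff_sqr d0; have j := ig_shift3 (- r) i.
have e1 := rint_shift3 (- r) (ig_meas i); rewrite e in e1.
have ib b : ig leb3 (fun u => coord3 b (u - r) * cutoff d (u - r) ^+ 2).
  exact: (ig_shift3 (- r) (rint_coord_cutoff_sqr d0 b).1).
have e0 b : \int[leb3]_u (coord3 b (u - r) * cutoff d (u - r) ^+ 2) = 0.
  have [k z] := rint_coord_cutoff_sqr d0 b.
  by rewrite -z; exact: (rint_shift3 (- r) (ig_meas k)).
transitivity (\int[leb3]_u (2^-1 * rho r * kappa a r * cutoff d (u - r) ^+ 2 +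
    \sum_(b < 3) (- (2^-1 * rho r * dkappa a b r)) * (coord3 b (u - r) * cutoff d (u - r) ^+ 2))).
  apply: eq_Rintegral => u _; rewrite dker_current dphaseE/= !big_ord_recl !big_ord0.
  by ring.
rewrite rintD; [|exact: igZ|by apply: ig_sum => b; exact: igZ].
rewrite rintZ// e1 mulr1 rint_sum => [|b]; last exact: igZ.
by rewrite big1 ?addr0// => b _; rewrite rintZ// e0 mulr0.
Qed.

(** For fixed [u], Cauchy-Schwarz on the cube around [u] bounds the square by the integral of [f^2],
    at most [c eps], times the integral of [y^2] over the cube. Integrating over [u] gives each
    point the weight [(2d)^3]. *)
Lemma ker_operator_bound (f : R3 R * R3 R -> R) (eps : R) (y : R3 R -> R) :
  measurable_fun setT f ->
  (forall z, f z ^+ 2 <= rho z.2 * cutoff d (z.1 - z.2) ^+ 2) ->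
  (forall u, \int[leb3]_r (rho r * \1_(cube d) (u - r)) <= eps) ->
  measurable_fun setT y -> ig leb3 (fun r => y r ^+ 2) ->
  ig leb3 (fun u => (\int[leb3]_r (f (u, r) * y r)) ^+ 2) /\
  \int[leb3]_u ((\int[leb3]_r (f (u, r) * y r)) ^+ 2) <= 15 * eps * \int[leb3]_r (y r ^+ 2).
Proof.
move=> mf hf heps my iy.
pose c := (315 / (256 * d)) ^+ 3.
have c0 : 0 <= c.
  by apply: exprn_ge0; exact: (divr_ge0 (ler0n _ 315) (mulr_ge0 (ler0n _ 256) (ltW d0))).
pose X (z : R3 R * R3 R) : R := \1_(cube d) (z.1 - z.2).
have mX : measurable_fun setT X by exact: measurable_cube_diff.
have X01 z : 0 <= X z <= 1 by rewrite /X indicE ler0n lern1 leq_b1.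
have XX z : X z * X z = X z by rewrite /X indicE; case: (_ \in _); rewrite ?mulr1 ?mulr0.
have hfX z : f z ^+ 2 <= c * (rho z.2 * X z).
  apply: (le_trans (hf z)); rewrite [leRHS]mulrCA ler_wpM2l//; exact: cutoff_sqr_le.
(* As [f] vanishes outside the cube, the indicator can be shared between both factors of the
   Cauchy-Schwarz inequality. *)
have fX z : f z = f z * X z.
  have [->|fn0] := eqVneq (f z) 0; first by rewrite mul0r.
  have : X z * (1 - X z) = 0 by rewrite mulrBr mulr1 XX subrr.
  move/eqP; rewrite mulf_eq0 subr_eq0 => /orP[/eqP X0|/eqP <-]; last by rewrite mulr1.
  have := hfX z; rewrite X0 !mulr0 => h.
  by move: fn0; rewrite -sqrf_eq0 (_ : f z ^+ 2 = 0) ?eqxx//; apply/eqP; rewrite eq_le h sqr_ge0.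
have irX u : ig leb3 (fun r => rho r * X (u, r)).
  apply: (ig_le _ _ irho) => [|r].
    by apply: measurable_funM; [exact: mrho|exact: measurable_slice1].
  have /andP[x0 x1] := X01 (u, r).
  by rewrite ger0_norm ?mulr_ge0// -[leRHS]mulr1 ler_wpM2l.
have if2 u : ig leb3 (fun r => f (u, r) ^+ 2).
  apply: (ig_le _ _ (igZ c (irX u))) => [|r]; last by rewrite ger0_norm ?sqr_ge0//; exact: (hfX (u, r)).
  by apply: measurable_funX; exact: measurable_slice1.
have hXy2 z : (X z * y z.2) ^+ 2 = X z * y z.2 ^+ 2 by rewrite exprMn expr2 XX.
have mXy2 : measurable_fun setT (fun z => X z * y z.2 ^+ 2).
  apply: measurable_funM => //; apply: (measurable_of_snd (f := fun r => y r ^+ 2)).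
  exact: measurable_funX.
have iXy u : ig leb3 (fun r => (X (u, r) * y r) ^+ 2).
  apply: (ig_le _ _ iy) => [|r].
    by apply: measurable_funX; apply: measurable_funM => //; exact: measurable_slice1.
  have /andP[x0 x1] := X01 (u, r).
  have h2 : 0 <= y r ^+ 2 by exact: sqr_ge0.
  rewrite (hXy2 (u, r))/= (ger0_norm (mulr_ge0 x0 h2)) -[leRHS]mul1r.
  by apply: ler_wpM2r.
have i2 : ig leb6 (fun z => X z * y z.2 ^+ 2).
  apply: (@ig_tonelli2' _ _ _ _ R leb3 leb3 _ (fun r => (2 * d) ^+ 3 * y r ^+ 2)) => //; last exact: igZ.
  apply: nearW => r /=; have [i e] := rint_cube_diff1 r d0.
  split; first by have := igZ (y r ^+ 2) i; congr (ig _ _); apply/funext => u; rewrite mulrC.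
  rewrite -e [leRHS]mulrC -rintZ// le_eqVlt; apply/orP; left; apply/eqP.
  apply: eq_Rintegral => u _; have /andP[x0 _] := X01 (u, r).
  by rewrite (ger0_norm (mulr_ge0 x0 (sqr_ge0 (y r)))) mulrC.
pose h u := \int[leb3]_r (X (u, r) * y r ^+ 2).
have ih : ig leb3 h by exact: (rfub_ig1 i2).
have eh : \int[leb3]_u h u = (2 * d) ^+ 3 * \int[leb3]_r (y r ^+ 2).
  rewrite (rfub12 i2) -rintZ//; apply: eq_Rintegral => r _ /=.
  have [i e] := rint_cube_diff1 r d0.
  by rewrite -e mulrC -rintZ//; apply: eq_Rintegral => u _; rewrite mulrC.
have ce0 : 0 <= c * eps.
  rewrite mulr_ge0// (le_trans _ (heps 0))//; apply: rint_ge0 => r.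
  by rewrite mulr_ge0// indicE.
have pt u : (\int[leb3]_r (f (u, r) * y r)) ^+ 2 <= c * eps * h u.
  have -> : \int[leb3]_r (f (u, r) * y r) = \int[leb3]_r (f (u, r) * (X (u, r) * y r)).
    by apply: eq_Rintegral => r _; rewrite mulrA -fX.
  have mXy : measurable_fun setT (fun r => X (u, r) * y r).
    by apply: measurable_funM => //; exact: measurable_slice1.
  apply: (le_trans (cauchy_schwarz (measurable_slice1 u mf) mXy (if2 u) (iXy u))).
  have -> : \int[leb3]_x ((X (u, x) * y x) ^+ 2) = h u.
    by apply: eq_Rintegral => r _; exact: (hXy2 (u, r)).
  apply: ler_wpM2r.
    apply: rint_ge0 => r; have /andP[x0 _] := X01 (u, r).
    by rewrite mulr_ge0 ?sqr_ge0.
  apply: (le_trans (rint_le (if2 u) (igZ c (irX u)) (fun r => hfX (u, r)))).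
  by rewrite rintZ//; apply: ler_wpM2l => //; exact: heps.
have mF : measurable_fun setT (fun u => \int[leb3]_r (f (u, r) * y r)).
  apply: (@measurable_par1 _ _ _ _ R leb3 (fun z => f z * y z.2)).
  by apply: measurable_funM => //; exact: measurable_of_snd.
have iF : ig leb3 (fun u => (\int[leb3]_r (f (u, r) * y r)) ^+ 2).
  apply: (ig_le _ _ (igZ (c * eps) ih)) => [|u]; first exact: measurable_funX.
  by rewrite ger0_norm ?sqr_ge0.
split; first exact: iF.
apply: (le_trans (rint_le iF (igZ (c * eps) ih) pt)).
rewrite rintZ// eh mulrA; apply: ler_wpM2r.
  by apply: rint_ge0 => r; exact: sqr_ge0.
have eps0 : 0 <= eps.
  by rewrite (le_trans _ (heps 0))//; apply: rint_ge0 => r; rewrite mulr_ge0// indicE.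
(* The powers of [d] cancel: the bound on the squared cutoff times the volume of the cube is scale
   invariant, and [(315/128)^3 < 15]. *)
have -> : c * eps * (2 * d) ^+ 3 = (315 / 128) ^+ 3 * eps.
  by rewrite /c; field; rewrite gt_eqF.
by apply: ler_wpM2r => //; lra.
Qed.

End PhaseKernel.

(** * Trace-class Gram kernels *)

Section ComplexFunctions.
Context {R : realType}.
Implicit Types (x y : R[i]).

Lemma ReM x y : complex.Re (x * y) = complex.Re x * complex.Re y - complex.Im x * complex.Im y.
Proof. by case: x; case: y. Qed.

Lemma ImM x y : complex.Im (x * y) = complex.Re x * complex.Im y + complex.Im x * complex.Re y.
Proof. by case: x; case: y. Qed.

Lemma ReD x y : complex.Re (x + y) = complex.Re x + complex.Re y.
Proof. by case: x; case: y. Qed.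

Lemma ImD x y : complex.Im (x + y) = complex.Im x + complex.Im y.
Proof. by case: x; case: y. Qed.

Lemma ReB x y : complex.Re (x - y) = complex.Re x - complex.Re y.
Proof. by case: x; case: y. Qed.

Lemma ImB x y : complex.Im (x - y) = complex.Im x - complex.Im y.
Proof. by case: x; case: y. Qed.

Lemma ReJ x : complex.Re (x^*%C) = complex.Re x.
Proof. by case: x. Qed.

Lemma ImJ x : complex.Im (x^*%C) = - complex.Im x.
Proof. by case: x. Qed.

Lemma complex_ext x y : complex.Re x = complex.Re y -> complex.Im x = complex.Im y -> x = y.
Proof. by case: x; case: y => ? ? ? ? /= -> ->. Qed.

Lemma Re_nat (n : nat) : complex.Re (n%:R : R[i]) = n%:R.
Proof. by elim: n => [//|n IH]; rewrite -addn1 natrD ReD IH natrD. Qed.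

Lemma Im_nat (n : nat) : complex.Im (n%:R : R[i]) = 0.
Proof. by elim: n => [//|n IH]; rewrite -addn1 natrD ImD IH addr0. Qed.

End ComplexFunctions.

(** * Orthogonal expansions in L^2(K) *)

Section SquareIntegrable.
Context d (T : measurableType d) (R : realType).
Variable mu : {measure set T -> \bar R}.
Variable K : set T.
Hypothesis mK : measurable K.
Implicit Types f g h : T -> R[i].

(** Extension by 0 outside [K], so that all integrals can be taken over the whole space. *)
Definition reK f (x : T) : R := \1_K x * complex.Re (f x).
Definition imK f (x : T) : R := \1_K x * complex.Im (f x).

Lemma measurable_restrict_indic (w : T -> R) :
  measurable_fun K w <-> measurable_fun setT (fun x => \1_K x * w x).
Proof.
rewrite (_ : (fun x => _) = w \_ K); first by exact: measurable_restrictT.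
by apply/funext => x; rewrite patchE indicE; case: ifP; rewrite ?mul1r ?mul0r.
Qed.

Lemma sqK f x : reK f x ^+ 2 + imK f x ^+ 2 = \1_K x * sqnormC (f x).
Proof.
by rewrite /reK /imK /sqnormC indicE; case: (_ \in _) => /=; ring.
Qed.

Lemma L2P f : L2 mu K f <-> [/\ measurable_fun setT (reK f), measurable_fun setT (imK f) &
  ig mu (fun x => reK f x ^+ 2 + imK f x ^+ 2)].
Proof.
have e : (\int[mu]_(x in K) (sqnormC (f x))%:E =
    \int[mu]_x `|reK f x ^+ 2 + imK f x ^+ 2|%:E)%E.
  rewrite integral_mkcond; apply: eq_integral => x _; rewrite sqK patchE indicE.
  rewrite ger0_norm ?mulr_ge0 ?addr_ge0 ?sqr_ge0//.
  by case: ifP; rewrite ?mul1r ?mul0r.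
split=> [[m1 m2]|[m1 m2]].
  rewrite e => l; have n1 := (measurable_restrict_indic _).1 m1.
  have n2 := (measurable_restrict_indic _).1 m2.
  split=> //; apply/igP; split=> //.
  by apply: measurable_funD; exact: measurable_funX.
move=> /igP[_]; rewrite -e => l; split=> //; exact/measurable_restrict_indic.
Qed.

Definition wRe f g (x : T) : R := reK f x * reK g x + imK f x * imK g x.
Definition wIm f g (x : T) : R := reK f x * imK g x - imK f x * reK g x.

Lemma L2_ig f : L2 mu K f -> [/\ measurable_fun setT (reK f), measurable_fun setT (imK f),
  ig mu (fun x => reK f x ^+ 2) & ig mu (fun x => imK f x ^+ 2)].
Proof.
move=> /L2P[m1 m2 i]; split=> //; (apply: ig_le i => [|x]; first exact: measurable_funX).
- by rewrite ger0_norm ?sqr_ge0// lerDl sqr_ge0.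
- by rewrite ger0_norm ?sqr_ge0// lerDr sqr_ge0.
Qed.

Lemma ig_w f g : L2 mu K f -> L2 mu K g -> ig mu (wRe f g) /\ ig mu (wIm f g).
Proof.
move=> /L2_ig[m1 m2 i1 i2] /L2_ig[n1 n2 j1 j2].
by split; [apply: igD|apply: igB]; exact: igM_sqr.
Qed.

Definition cinner f g : R[i] := cintegral mu K (fun x => (f x)^*%C * g x).

Lemma cinnerE f g : cinner f g = ((\int[mu]_x wRe f g x) +i* (\int[mu]_x wIm f g x))%C.
Proof.
rewrite /cinner /cintegral !(rint_restrict _ _ mK).
apply: complex_ext => /=; apply: eq_Rintegral => x _.
  by rewrite ReM ReJ ImJ /wRe /reK /imK indicE; case: (_ \in _) => /=; ring.
by rewrite ImM ReJ ImJ /wIm /reK /imK indicE; case: (_ \in _) => /=; ring.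
Qed.

Definition subZ (c : R[i]) f g (x : T) : R[i] := f x - c * g x.

Lemma subZE c f g x :
  reK (subZ c f g) x = reK f x - (complex.Re c * reK g x - complex.Im c * imK g x) /\
  imK (subZ c f g) x = imK f x - (complex.Re c * imK g x + complex.Im c * reK g x).
Proof. by rewrite /reK /imK /subZ ReB ImB ReM ImM; split; ring. Qed.

Lemma L2_subZ c f g : L2 mu K f -> L2 mu K g -> L2 mu K (subZ c f g).
Proof.
move=> Lf Lg; have [m1 m2 i1 i2] := L2_ig Lf; have [n1 n2 j1 j2] := L2_ig Lg.
have m3 : measurable_fun setT (reK (subZ c f g)).
  rewrite (_ : reK _ = fun x => reK f x - (complex.Re c * reK g x - complex.Im c * imK g x)).
    by apply: measurable_funB => //; apply: measurable_funB; exact: measurable_funM.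
  by apply/funext => x; have [] := subZE c f g x.
have m4 : measurable_fun setT (imK (subZ c f g)).
  rewrite (_ : imK _ = fun x => imK f x - (complex.Re c * imK g x + complex.Im c * reK g x)).
    by apply: measurable_funB => //; apply: measurable_funD; exact: measurable_funM.
  by apply/funext => x; have [] := subZE c f g x.
apply/L2P; split=> //.
have := igD (igD (igZ 2 i1) (igZ 2 i2)) (igD (igZ (2 * sqnormC c) j1) (igZ (2 * sqnormC c) j2)).
apply: ig_le => [|x]; first by apply: measurable_funD; exact: measurable_funX.
rewrite ger0_norm ?addr_ge0 ?sqr_ge0//; have [-> ->] := subZE c f g x; rewrite /sqnormC.
move: (reK f x) (imK f x) (reK g x) (imK g x) (complex.Re c) (complex.Im c) => a b u v s t.
have := sqr_ge0 (a + (s * u - t * v)); have := sqr_ge0 (b + (s * v + t * u)).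
by lra.
Qed.

Lemma cinner_subZ h c f g : L2 mu K h -> L2 mu K f -> L2 mu K g ->
  cinner h (subZ c f g) = cinner h f - c * cinner h g.
Proof.
move=> Lh Lf Lg; rewrite !cinnerE.
have [i1 i2] := ig_w Lh Lf; have [j1 j2] := ig_w Lh Lg.
apply: complex_ext => /=; rewrite ?ReB ?ImB ?ReM ?ImM/=.
  rewrite -!rintZ// -rintB//; [|exact: igZ..].
  rewrite -rintB//; last by apply: igB; exact: igZ.
  by apply: eq_Rintegral => x _; rewrite /wRe /wIm; have [-> ->] := subZE c f g x; ring.
rewrite -!rintZ// -rintD//; [|exact: igZ..].
rewrite -rintB//; last by apply: igD; exact: igZ.
by apply: eq_Rintegral => x _; rewrite /wRe /wIm; have [-> ->] := subZE c f g x; ring.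
Qed.

Definition normsq f : R := \int[mu]_x (reK f x ^+ 2 + imK f x ^+ 2).

Lemma normsqE f : L2 mu K f -> (\int[mu]_(x in K) (sqnormC (f x))%:E = (normsq f)%:E)%E.
Proof.
move=> /L2P[_ _ i]; rewrite /normsq EFin_rint// integral_mkcond.
apply: eq_integral => x _; rewrite sqK patchE indicE.
by case: ifP; rewrite ?mul1r ?mul0r.
Qed.

Lemma normsq_subZ c f g : L2 mu K f -> L2 mu K g -> cinner g f = c -> cinner g g = 1 ->
  normsq (subZ c f g) = normsq f - sqnormC c.
Proof.
move=> Lf Lg ec eg; have [i1 i2] := ig_w Lg Lf; have [j1 _] := ig_w Lg Lg.
have /L2P[_ _ k1] := Lf.
have n1 : \int[mu]_x wRe g g x = 1 by move: eg; rewrite cinnerE => /(congr1 (@complex.Re R)).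
have cr : \int[mu]_x wRe g f x = complex.Re c by move: ec; rewrite cinnerE => <-.
have ci : \int[mu]_x wIm g f x = complex.Im c by move: ec; rewrite cinnerE => <-.
transitivity (\int[mu]_x ((reK f x ^+ 2 + imK f x ^+ 2) - (2 * complex.Re c * wRe g f x +
    2 * complex.Im c * wIm g f x) + sqnormC c * wRe g g x)).
  apply: eq_Rintegral => x _; have [-> ->] := subZE c f g x.
  by rewrite /wRe /wIm /sqnormC; ring.
have z1 := igZ (2 * complex.Re c) i1; have z2 := igZ (2 * complex.Im c) i2.
have z3 := igZ (sqnormC c) j1.
rewrite (rintD (igB k1 (igD z1 z2)) z3) (rintB k1 (igD z1 z2)) (rintD z1 z2).
by rewrite !rintZ// n1 cr ci /sqnormC /normsq; ring.
Qed.

Variable e : nat -> T -> R[i].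
Hypothesis Le : forall k, L2 mu K (e k).
Hypothesis e_orth : forall j k, cinner (e j) (e k) = (j == k)%:R.

(** Remainder of the expansion, defined recursively so that the Bessel identity removes one
    component at a time. The coefficients may be those of [f] itself because orthogonality leaves
    them unchanged ([residual_spec]). *)
Fixpoint residual f n : T -> R[i] :=
  if n is n'.+1 then subZ (cinner (e n') f) (residual f n') (e n') else f.

Lemma residualE f n x : residual f n x = f x - \sum_(k < n) cinner (e k) f * e k x.
Proof.
elim: n => [|n IH] /=; first by rewrite big_ord0 subr0.
by rewrite /subZ IH big_ord_recr/= opprD addrA.
Qed.

Lemma residual_spec f n : L2 mu K f -> L2 mu K (residual f n) /\
  forall j, (n <= j)%N -> cinner (e j) (residual f n) = cinner (e j) f.
Proof.
move=> Lf; elim: n => [//|n [IH1 IH2]] /=; split; first exact: L2_subZ.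
move=> j nj; rewrite cinner_subZ// IH2 ?(ltnW nj)// e_orth gtn_eqF//.
by rewrite mulr0 subr0.
Qed.

Lemma bessel f n : L2 mu K f ->
  normsq (residual f n) = normsq f - \sum_(0 <= k < n) sqnormC (cinner (e k) f).
Proof.
move=> Lf; elim: n => [|n IH] /=; first by rewrite big_nil subr0.
have [L h] := residual_spec n Lf.
rewrite normsq_subZ//; last by rewrite e_orth eqxx.
  by rewrite IH big_nat_recr//=; ring.
exact: h.
Qed.

Lemma parseval f : L2 mu K f ->
  (fun n => \int[mu]_(x in K) (sqnormC (f x - \sum_(k < n) cinner (e k) f * e k x))%:E)%E
    @ \oo --> 0%E ->
  (forall n, \sum_(0 <= k < n) sqnormC (cinner (e k) f) <= normsq f) /\
  \sum_(0 <= k < n) sqnormC (cinner (e k) f) @[n --> \oo] --> normsq f.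
Proof.
move=> Lf h; have n0 g : 0 <= normsq g.
  by apply: rint_ge0 => x; rewrite addr_ge0 ?sqr_ge0.
have b n := bessel n Lf.
split=> [n|]; first by have := n0 (residual f n); rewrite b subr_ge0.
have h' : (normsq (residual f n))%:E @[n --> \oo] --> (0 : R)%:E.
  move: h; apply: cvg_trans; apply: near_eq_cvg; apply: nearW => n.
  rewrite -normsqE; last by have [] := residual_spec n Lf.
  by apply: eq_integral => x _; rewrite residualE.
have {}h' : normsq (residual f n) @[n --> \oo] --> (0 : R) by move/fine_cvgP: h' => [_].
rewrite (_ : (fun n => _) = fun n => normsq f - normsq (residual f n)); last first.
  by apply/funext => n; rewrite b; ring.
by rewrite -[X in _ --> X]subr0; apply: cvgB => //; exact: cvg_cst.
Qed.

End SquareIntegrable.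

(** * Total integrals of Gram kernels *)

Section GramIntegrals.
Context {R : realType}.
Implicit Types (f k : R3 R * R3 R -> R) (w v : R3 R -> R).

Lemma rint_tensor (x y : R3 R -> R) : ig leb3 x -> ig leb3 y ->
  \int[leb6]_p (x p.1 * y p.2) = \int[leb3]_r x r * \int[leb3]_s y s.
Proof.
move=> ix iy; rewrite (rfub1 (ig_tensor ix iy))/= mulrC -rintZ//.
by apply: eq_Rintegral => r _; rewrite rintZ// mulrC.
Qed.

(** Unlike the additive bound [gram_norm_le], this one has a square that is integrable on the
    product as soon as [w] and [v] are integrable, which makes Gram kernels Hilbert-Schmidt. *)
Lemma gram_sqrt_le f k w v r s : sq_kernel f w -> sq_kernel k v ->
  \int[leb3]_u `|f (u, r) * k (u, s)| <= Num.sqrt (w r) * Num.sqrt (v s).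
Proof.
move=> hf hk; have [mf _ f2 bf] := hf; have [mk _ k2 bk] := hk.
have nf : measurable_fun setT (fun u => `|f (u, r)|).
  by apply: measurableT_comp => //; exact: measurable_slice2.
have nk : measurable_fun setT (fun u => `|k (u, s)|).
  by apply: measurableT_comp => //; exact: measurable_slice2.
have sqn (x : R) : `|x| ^+ 2 = x ^+ 2 by rewrite real_normK ?num_real.
have ef : (fun u => `|f (u, r)| ^+ 2) = fun u => f (u, r) ^+ 2 by apply/funext => u.
have ek : (fun u => `|k (u, s)| ^+ 2) = fun u => k (u, s) ^+ 2 by apply/funext => u.
have h := @cauchy_schwarz _ _ _ leb3 _ _ nf nk; rewrite ef ek in h.
have {}h := h (f2 r) (k2 s).
have e : \int[leb3]_u `|f (u, r) * k (u, s)| = \int[leb3]_u (`|f (u, r)| * `|k (u, s)|).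
  by apply: eq_Rintegral => u _; rewrite normrM.
have w0 := sq_kernel_ge0 r hf; have v0 := sq_kernel_ge0 s hk.
rewrite e -sqrtrM// -[leLHS]ger0_norm; last by apply: rint_ge0 => u; rewrite mulr_ge0.
rewrite -sqrtr_sqr ler_sqrt ?mulr_ge0//; apply: (le_trans h).
by apply: ler_pM => //; apply: rint_ge0 => u; rewrite sqr_ge0.
Qed.

Lemma ig_triple f k w v : sq_kernel f w -> sq_kernel k v ->
  ig leb3 (fun r => Num.sqrt (w r)) -> ig leb3 (fun r => Num.sqrt (v r)) ->
  ig (leb3 \x leb6)%E (fun z => triple1 f z * triple2 k z).
Proof.
move=> hf hk iw iv; have [mf _ _ _] := hf; have [mk _ _ _] := hk.
apply: (@ig_tonelli2' _ _ _ _ R leb3 leb6 _ (fun p => Num.sqrt (w p.1) * Num.sqrt (v p.2))).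
- by apply: measurable_funM; [exact: measurable_triple1|exact: measurable_triple2].
- apply: nearW => -[r s]; split; first exact: (ig_gram r s hf hk).
  exact: gram_sqrt_le hf hk.
- exact: (ig_tensor iw iv).
Qed.

(** Used with the vector absorbed into the kernels: the quadratic form of a Gram kernel then becomes
    an integral of squares over [u]. *)
Lemma gram_total f k w v : sq_kernel f w -> sq_kernel k v ->
  ig leb3 (fun r => Num.sqrt (w r)) -> ig leb3 (fun r => Num.sqrt (v r)) ->
  (forall u, ig leb3 (fun r => f (u, r))) -> (forall u, ig leb3 (fun r => k (u, r))) ->
  [/\ ig leb6 (gram f k),
      ig leb3 (fun u => (\int[leb3]_r f (u, r)) * (\int[leb3]_r k (u, r))) &
      \int[leb6]_p gram f k p =
      \int[leb3]_u ((\int[leb3]_r f (u, r)) * (\int[leb3]_r k (u, r)))].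
Proof.
move=> hf hk iw iv jf jk; have i := ig_triple hf hk iw iv.
have e : (fun u => (\int[leb3]_r f (u, r)) * (\int[leb3]_r k (u, r))) =
    fun u => \int[leb6]_p (triple1 f (u, p) * triple2 k (u, p)).
  by apply/funext => u; rewrite -rint_tensor.
rewrite e; split; [exact: (rfub_ig2 i)|exact: (rfub_ig1 i)|].
exact: (esym (rfub12 i)).
Qed.

End GramIntegrals.

(** * Positivity, quadratic form and trace of Gram kernels *)

Section TraceClass.
Context {R : realType}.
Variables (m : nat) (A B : 'I_m -> R3 R * R3 R -> R) (q : R3 R -> R) (K : set (R3 R)).
Hypothesis mK : measurable K.
Hypothesis hA : forall a, sq_kernel (A a) q.
Hypothesis hB : forall a, sq_kernel (B a) q.
Hypothesis iq : ig leb3 (fun r => \1_K r * q r).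
Hypothesis sA : forall a u, ig leb3 (fun r => \1_K r * A a (u, r) ^+ 2).
Hypothesis sB : forall a u, ig leb3 (fun r => \1_K r * B a (u, r) ^+ 2).

(* The kernel of the sum of the operators V_a^* V_a, for V_a = A_a + i B_a. *)
Definition gram_re (p : R3 R * R3 R) : R :=
  \sum_(a < m) \int[leb3]_u (A a (u, p.1) * A a (u, p.2) + B a (u, p.1) * B a (u, p.2)).
Definition gram_im (p : R3 R * R3 R) : R :=
  \sum_(a < m) \int[leb3]_u (A a (u, p.1) * B a (u, p.2) - B a (u, p.1) * A a (u, p.2)).
Definition gram_kernel (p : R3 R * R3 R) : R[i] := (gram_re p +i* gram_im p)%C.

Lemma gram_reE p : gram_re p = \sum_(a < m) (gram (A a) (A a) p + gram (B a) (B a) p).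
Proof.
apply: eq_bigr => a _; rewrite rintD//.
  exact: (ig_gram p.1 p.2 (hA a) (hA a)).
exact: (ig_gram p.1 p.2 (hB a) (hB a)).
Qed.

Lemma gram_imE p : gram_im p = \sum_(a < m) (gram (A a) (B a) p - gram (B a) (A a) p).
Proof.
apply: eq_bigr => a _; rewrite rintB//.
  exact: (ig_gram p.1 p.2 (hA a) (hB a)).
exact: (ig_gram p.1 p.2 (hB a) (hA a)).
Qed.

Lemma q_ge0 : (0 < m)%N -> forall r, 0 <= q r.
Proof. by move=> m0 r; exact: (sq_kernel_ge0 r (hA (Ordinal m0))). Qed.

Lemma gram_kernel_adj : kernel_adj gram_kernel = gram_kernel.
Proof.
apply/funext => -[r s]; apply: complex_ext; rewrite /kernel_adj ?ReJ ?ImJ/=.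
  by rewrite !gram_reE; apply: eq_bigr => a _; rewrite gramC [in X in _ + X]gramC.
rewrite !gram_imE -sumrN; apply: eq_bigr => a _.
by rewrite gramC [in X in _ - X]gramC opprB.
Qed.

Lemma measurable_gram_re : measurable_fun setT gram_re.
Proof.
rewrite (_ : gram_re = fun p => \sum_(a < m) (gram (A a) (A a) p + gram (B a) (B a) p)).
  apply: measurable_sum => a; have [mA _ _ _] := hA a; have [mB _ _ _] := hB a.
  by apply: measurable_funD; exact: measurable_gram.
by apply/funext => p; exact: gram_reE.
Qed.

Lemma measurable_gram_im : measurable_fun setT gram_im.
Proof.
rewrite (_ : gram_im = fun p => \sum_(a < m) (gram (A a) (B a) p - gram (B a) (A a) p)).
  apply: measurable_sum => a; have [mA _ _ _] := hA a; have [mB _ _ _] := hB a.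
  by apply: measurable_funB; exact: measurable_gram.
by apply/funext => p; exact: gram_imE.
Qed.

Lemma gram_kernel_le p : `|gram_re p| <= m%:R * (2 * (Num.sqrt (q p.1) * Num.sqrt (q p.2))) /\
  `|gram_im p| <= m%:R * (2 * (Num.sqrt (q p.1) * Num.sqrt (q p.2))).
Proof.
have h (f k : R3 R * R3 R -> R) : sq_kernel f q -> sq_kernel k q ->
    `|gram f k p| <= Num.sqrt (q p.1) * Num.sqrt (q p.2).
  move=> hf hk; apply: le_trans (gram_sqrt_le _ _ hf hk).
  by apply: rint_normle; exact: ig_gram hf hk.
have s (F : 'I_m -> R) (c : R) : (forall a, `|F a| <= c) -> `|\sum_(a < m) F a| <= m%:R * c.
  move=> hF; apply: (le_trans (ler_norm_sum _ _ _)).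
  rewrite -[m in m%:R]card_ord mulr_natl -sumr_const; apply: ler_sum => a _; exact: hF.
split; rewrite ?gram_reE ?gram_imE; apply: s => a; rewrite mulr_natl mulr2n.
  by apply: (le_trans (ler_normD _ _)); apply: lerD; exact: h.
by apply: (le_trans (ler_normB _ _)); apply: lerD; exact: h.
Qed.

Lemma indicX (p : R3 R * R3 R) : \1_(K `*` K) p = \1_K p.1 * \1_K p.2 :> R.
Proof.
rewrite !indicE -natrM; congr (_ %:R).
have -> : (p \in K `*` K) = (p.1 \in K) && (p.2 \in K).
  by apply/idP/andP; rewrite !inE => -[].
by case: (_ \in _); case: (_ \in _).
Qed.

Lemma L2_gram_kernel : L2 leb6 (K `*` K) gram_kernel.
Proof.
have mKK : measurable (K `*` K) by exact: measurableX.
have mi : measurable_fun setT (\1_(K `*` K) : R3 R * R3 R -> R) by exact: measurable_indic.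
have mr : measurable_fun setT (reK (K `*` K) gram_kernel).
  by apply: measurable_funM => //; exact: measurable_gram_re.
have mim : measurable_fun setT (imK (K `*` K) gram_kernel).
  by apply: measurable_funM => //; exact: measurable_gram_im.
apply/(L2P _ mKK); split=> //.
(* Both parts are at most [2 m] times the product of the square roots of [q]; the sum of the two
   squares gives 8. *)
have := igZ (8 * m%:R ^+ 2) (ig_tensor iq iq); apply: ig_le => [|p].
  by apply: measurable_funD; exact: measurable_funX.
rewrite sqK indicX ger0_norm; last first.
  by rewrite mulr_ge0 ?addr_ge0 ?sqr_ge0// !indicE -natrM.
have -> : 8 * m%:R ^+ 2 * (\1_K p.1 * q p.1 * (\1_K p.2 * q p.2)) =
    \1_K p.1 * \1_K p.2 * (8 * m%:R ^+ 2 * (q p.1 * q p.2)) by ring.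
apply: ler_wpM2l; first by rewrite !indicE -natrM.
rewrite /sqnormC/=; have [h1 h2] := gram_kernel_le p.
(* For [m = 0] nothing is known about the sign of [q], but the kernel itself vanishes. *)
have [m0|m0] := posnP m.
  move: h1 h2; rewrite !m0 !mul0r !normr_le0 => /eqP -> /eqP ->.
  by rewrite expr0n/= addr0 mulr0 mul0r.
have q0 := q_ge0 m0.
set c := m%:R * _ in h1 h2.
have c2 : c ^+ 2 = 4 * m%:R ^+ 2 * (q p.1 * q p.2).
  by rewrite /c !exprMn !sqr_sqrtr ?q0//; ring.
have b (x : R) : `|x| <= c -> x ^+ 2 <= c ^+ 2.
  move=> hx; rewrite -real_normK ?num_real// lerXn2r ?nnegrE//.
  exact: le_trans hx.
by have := b _ h1; have := b _ h2; rewrite c2; lra.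
Qed.

Section Form.
Variable phi : R3 R -> R[i].
Hypothesis Lphi : L2 leb3 K phi.
Local Notation x := (reK K phi).
Local Notation y := (imK K phi).

(** Real part of [V_a(u, r) phi(r)], with [phi] extended by 0, so that [formRe] and [formIm] are the
    two parts of the image of [phi] under the operator [V_a]. *)
Definition actRe a (z : R3 R * R3 R) : R := A a z * x z.2 - B a z * y z.2.
Definition actIm a (z : R3 R * R3 R) : R := A a z * y z.2 + B a z * x z.2.
Definition formRe a (u : R3 R) : R := \int[leb3]_r actRe a (u, r).
Definition formIm a (u : R3 R) : R := \int[leb3]_r actIm a (u, r).

Let weight (r : R3 R) : R := 2 * (q r * (x r ^+ 2 + y r ^+ 2)).

Lemma indic_reK (r : R3 R) : \1_K r * x r = x r.
Proof. by rewrite /reK indicE; case: (_ \in _); rewrite ?mul1r ?mul0r. Qed.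

Lemma indic_imK (r : R3 R) : \1_K r * y r = y r.
Proof. by rewrite /imK indicE; case: (_ \in _); rewrite ?mul1r ?mul0r. Qed.

Lemma sq_kernel_act a : sq_kernel (actRe a) weight /\ sq_kernel (actIm a) weight.
Proof.
have [mx my ix iy] := L2_ig mK Lphi.
have [mA mq A2 bA] := hA a; have [mB _ B2 bB] := hB a.
have mx2 := measurable_of_snd mx; have my2 := measurable_of_snd my.
have mw : measurable_fun setT weight.
  apply: measurable_funM => //; apply: measurable_funM => //.
  by apply: measurable_funD; exact: measurable_funX.
have aux (f : R3 R * R3 R -> R) : measurable_fun setT f ->
    (forall u r, f (u, r) ^+ 2 <= (x r ^+ 2 + y r ^+ 2) * (A a (u, r) ^+ 2 + B a (u, r) ^+ 2)) ->
    sq_kernel f weight.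
  move=> mf h.
  have iAB r : ig leb3 (fun u => (x r ^+ 2 + y r ^+ 2) * (A a (u, r) ^+ 2 + B a (u, r) ^+ 2)).
    by apply: igZ; exact: igD.
  have i r : ig leb3 (fun u => f (u, r) ^+ 2).
    apply: (ig_le _ _ (iAB r)) => [|u]; last by rewrite ger0_norm ?sqr_ge0.
    by apply: measurable_funX; exact: measurable_slice2.
  split=> // r; apply: (le_trans (rint_le (i r) (iAB r) (h^~ r))).
  rewrite rintZ; last exact: igD.
  rewrite rintD// /weight [q r * _]mulrC mulrCA; apply: ler_wpM2l.
    by rewrite addr_ge0 ?sqr_ge0.
  by rewrite mulr_natl mulr2n lerD.
split; apply: aux.
- by apply: measurable_funB; exact: measurable_funM.
- move=> u r; rewrite /actRe/=.
  have -> : (x r ^+ 2 + y r ^+ 2) * (A a (u, r) ^+ 2 + B a (u, r) ^+ 2) =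
    (A a (u, r) * x r - B a (u, r) * y r) ^+ 2 + (A a (u, r) * y r + B a (u, r) * x r) ^+ 2 by ring.
  by rewrite lerDl sqr_ge0.
- by apply: measurable_funD; exact: measurable_funM.
- move=> u r; rewrite /actIm/=.
  have -> : (x r ^+ 2 + y r ^+ 2) * (A a (u, r) ^+ 2 + B a (u, r) ^+ 2) =
    (A a (u, r) * x r - B a (u, r) * y r) ^+ 2 + (A a (u, r) * y r + B a (u, r) * x r) ^+ 2 by ring.
  by rewrite lerDr sqr_ge0.
Qed.

(** Up to a factor [weight] is the product of two integrable functions, [q] on [K] and [|phi|^2], so
    its square root is integrable by the inequality of the means. *)
Lemma ig_sqrt_weight : (0 < m)%N -> ig leb3 (fun r => Num.sqrt (weight r)).
Proof.
move=> m0; have /(L2P _ mK)[_ _ i] := Lphi.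
have [_ [mw _ _ _]] := sq_kernel_act (Ordinal m0); have [[_ mw' _ _] _] := sq_kernel_act (Ordinal m0).
have q0 := q_ge0 m0.
apply: (ig_le _ _ (igD (igZ 1 iq) i)) => [|r].
  exact: (measurableT_comp (@msqrt R) mw').
rewrite ger0_norm ?sqrtr_ge0// mul1r.
have n0 : 0 <= x r ^+ 2 + y r ^+ 2 by rewrite addr_ge0 ?sqr_ge0.
have k0 : 0 <= \1_K r * q r by rewrite mulr_ge0// indicE.
have -> : weight r = 2 * ((\1_K r * q r) * (x r ^+ 2 + y r ^+ 2)).
  by rewrite /weight -(indic_reK r) -(indic_imK r) indicE; case: (_ \in _) => /=; ring.
have am (s t : R) : 0 <= s -> 0 <= t -> Num.sqrt (2 * (s * t)) <= s + t.
  move=> s0 t0; have st0 : 0 <= s + t by exact: addr_ge0.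
  rewrite -(ger0_norm st0) -sqrtr_sqr ler_sqrt ?sqr_ge0//.
  by have := sqr_ge0 s; have := sqr_ge0 t; lra.
exact: am.
Qed.

Lemma ig_act a u : ig leb3 (fun r => actRe a (u, r)) /\ ig leb3 (fun r => actIm a (u, r)).
Proof.
have [mx my ix iy] := L2_ig mK Lphi.
have [mA _ _ _] := hA a; have [mB _ _ _] := hB a.
have mi : measurable_fun setT (\1_K : R3 R -> R) by exact: measurable_indic.
have aux (f : R3 R * R3 R -> R) (w : R3 R -> R) : measurable_fun setT f ->
    ig leb3 (fun r => \1_K r * f (u, r) ^+ 2) ->
    measurable_fun setT w -> ig leb3 (fun r => w r ^+ 2) -> (forall r, \1_K r * w r = w r) ->
    ig leb3 (fun r => f (u, r) * w r).
  move=> mf i mw iw ew.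
  rewrite (_ : (fun r => _) = fun r => (\1_K r * f (u, r)) * w r); last first.
    by apply/funext => r; rewrite -mulrA mulrCA ew.
  apply: igM_sqr => //.
    by apply: measurable_funM => //; exact: measurable_slice1.
  move: i; congr (ig _ _); apply/funext => r.
  by rewrite indicE; case: (_ \in _) => /=; ring.
have ex := indic_reK; have ey := indic_imK.
by split; [apply: igB|apply: igD]; exact: aux.
Qed.

Lemma gram_act a : (0 < m)%N ->
  [/\ ig leb6 (fun p => gram (actRe a) (actRe a) p + gram (actIm a) (actIm a) p),
      ig leb6 (fun p => gram (actRe a) (actIm a) p - gram (actIm a) (actRe a) p),
      ig leb3 (fun u => formRe a u ^+ 2 + formIm a u ^+ 2),
      \int[leb6]_p (gram (actRe a) (actRe a) p + gram (actIm a) (actIm a) p) =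
      \int[leb3]_u (formRe a u ^+ 2 + formIm a u ^+ 2) &
      \int[leb6]_p (gram (actRe a) (actIm a) p - gram (actIm a) (actRe a) p) = 0].
Proof.
move=> m0; have [h1 h2] := sq_kernel_act a; have w := ig_sqrt_weight m0.
have j1 u : ig leb3 (fun r => actRe a (u, r)) by have [] := ig_act a u.
have j2 u : ig leb3 (fun r => actIm a (u, r)) by have [] := ig_act a u.
have [a1 b1 c1] := gram_total h1 h1 w w j1 j1.
have [a2 b2 c2] := gram_total h2 h2 w w j2 j2.
have [a3 b3 c3] := gram_total h1 h2 w w j1 j2.
have [a4 b4 c4] := gram_total h2 h1 w w j2 j1.
have d1 : ig leb3 (fun u => formRe a u ^+ 2 + formIm a u ^+ 2).
  exact: igD b1 b2.
split=> //; [exact: igD|exact: igB| |].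
  by rewrite rintD// c1 c2 -rintD.
rewrite rintB// c3 c4 -rintB//; rewrite -[RHS](rint0 leb3).
by apply: eq_Rintegral => u _; rewrite mulrC subrr.
Qed.

(** Expanding the complex product writes the integrand through Gram kernels of [actRe] and [actIm];
    [gram_total] gives the sum of the squared norms of the [V_a phi], and the imaginary part cancels
    by symmetry. *)
Lemma kernel_formE : kernel_form K gram_kernel phi =
  ((\sum_(a < m) \int[leb3]_u (formRe a u ^+ 2 + formIm a u ^+ 2)) +i* 0)%C.
Proof.
have mKK : measurable (K `*` K) by exact: measurableX.
have act a (p : R3 R * R3 R) :
    gram (actRe a) (actRe a) p + gram (actIm a) (actIm a) p =
    (x p.1 * x p.2 + y p.1 * y p.2) *
      \int[leb3]_u (A a (u, p.1) * A a (u, p.2) + B a (u, p.1) * B a (u, p.2)) +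
    (y p.1 * x p.2 - x p.1 * y p.2) *
      \int[leb3]_u (A a (u, p.1) * B a (u, p.2) - B a (u, p.1) * A a (u, p.2)) /\
    gram (actRe a) (actIm a) p - gram (actIm a) (actRe a) p =
    (x p.1 * y p.2 - y p.1 * x p.2) *
      \int[leb3]_u (A a (u, p.1) * A a (u, p.2) + B a (u, p.1) * B a (u, p.2)) +
    (x p.1 * x p.2 + y p.1 * y p.2) *
      \int[leb3]_u (A a (u, p.1) * B a (u, p.2) - B a (u, p.1) * A a (u, p.2)).
  have [h1 h2] := sq_kernel_act a.
  have i1 := igD (ig_gram p.1 p.2 (hA a) (hA a)) (ig_gram p.1 p.2 (hB a) (hB a)).
  have i2 := igB (ig_gram p.1 p.2 (hA a) (hB a)) (ig_gram p.1 p.2 (hB a) (hA a)).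
  split.
    rewrite -(rintD (ig_gram p.1 p.2 h1 h1) (ig_gram p.1 p.2 h2 h2)).
    rewrite -(rintZ _ i1) -(rintZ _ i2) -(rintD (igZ _ i1) (igZ _ i2)).
    by apply: eq_Rintegral => u _; rewrite /actRe /actIm/=; ring.
  rewrite -(rintB (ig_gram p.1 p.2 h1 h2) (ig_gram p.1 p.2 h2 h1)).
  rewrite -(rintZ _ i1) -(rintZ _ i2) -(rintD (igZ _ i1) (igZ _ i2)).
  by apply: eq_Rintegral => u _; rewrite /actRe /actIm/=; ring.
rewrite /kernel_form /cintegral !(rint_restrict _ _ mKK).
apply: complex_ext => /=.
  transitivity (\int[leb6]_p \sum_(a < m) (gram (actRe a) (actRe a) p + gram (actIm a) (actIm a) p)).
    apply: eq_Rintegral => p _; under eq_bigr do rewrite (act _ _).1.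
    rewrite big_split/= -!mulr_sumr -/(gram_re p) -/(gram_im p) indicX.
    rewrite /reK /imK /gram_kernel; case: (phi p.1) (phi p.2) => [? ?] [? ?].
    by move: (gram_re p) (gram_im p) (\1_K p.1 : R) (\1_K p.2 : R) => ? ? ? ? /=; ring.
  rewrite rint_sum => [|a]; last by have [] := gram_act a (leq_ltn_trans (leq0n a) (ltn_ord a)).
  by apply: eq_bigr => a _; have [] := gram_act a (leq_ltn_trans (leq0n a) (ltn_ord a)).
transitivity (\int[leb6]_p \sum_(a < m) (gram (actRe a) (actIm a) p - gram (actIm a) (actRe a) p)).
  apply: eq_Rintegral => p _; under eq_bigr do rewrite (act _ _).2.
  rewrite big_split/= -!mulr_sumr -/(gram_re p) -/(gram_im p) indicX.
  rewrite /reK /imK /gram_kernel; case: (phi p.1) (phi p.2) => [? ?] [? ?].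
  by move: (gram_re p) (gram_im p) (\1_K p.1 : R) (\1_K p.2 : R) => ? ? ? ? /=; ring.
rewrite rint_sum => [|a]; last by have [] := gram_act a (leq_ltn_trans (leq0n a) (ltn_ord a)).
by apply: big1 => a _; have [] := gram_act a (leq_ltn_trans (leq0n a) (ltn_ord a)).
Qed.

End Form.

Lemma gram_kernel_psd : kernel_psd K gram_kernel.
Proof.
move=> phi Lphi; rewrite kernel_formE// lecE/= eqxx/=.
by apply: sumr_ge0 => a _; apply: rint_ge0 => u; rewrite addr_ge0 ?sqr_ge0.
Qed.

(** A positive operator is its own absolute value; since the kernel is its own adjoint at every
    point, the two products coincide literally. *)
Lemma gram_kernel_abs : kernel_abs K gram_kernel gram_kernel.
Proof.
split; [exact: L2_gram_kernel|exact: gram_kernel_psd|].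
by apply: nearW => p _; rewrite gram_kernel_adj.
Qed.

(** The complex conjugate of [V_a(u, .)], so that its inner product with [phi] is, up to
    conjugation, the value of [V_a phi] at [u]. *)
Definition slice a (u r : R3 R) : R[i] := (A a (u, r) -i* B a (u, r))%C.

Lemma L2_slice a u : L2 leb3 K (slice a u).
Proof.
have [mA _ _ _] := hA a; have [mB _ _ _] := hB a.
have mi : measurable_fun setT (\1_K : R3 R -> R) by exact: measurable_indic.
apply/(L2P _ mK); split.
- by apply: measurable_funM => //; exact: measurable_slice1.
- apply: measurable_funM => //; apply: measurableT_comp => //; exact: measurable_slice1.
have := igD (sA a u) (sB a u); congr (ig _ _); apply/funext => r.
by rewrite sqK /sqnormC/= mulrDr sqrrN.
Qed.

Lemma form_slice phi a u : L2 leb3 K phi ->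
  sqnormC (cinner leb3 K phi (slice a u)) = formRe phi a u ^+ 2 + formIm phi a u ^+ 2.
Proof.
move=> Lphi; rewrite (cinnerE leb3 mK) /sqnormC/=; congr (_ ^+ 2 + _).
  apply: eq_Rintegral => r _; rewrite /wRe /actRe /reK /imK/= indicE.
  by case: (_ \in _) => /=; ring.
have [_ i] := ig_w mK Lphi (L2_slice a u).
rewrite -sqrrN -rintN//; congr (_ ^+ 2).
apply: eq_Rintegral => r _; rewrite /wIm /actIm /reK /imK/= indicE.
by case: (_ \in _) => /=; ring.
Qed.

Definition mass (r : R3 R) : R :=
  \sum_(a < m) \int[leb3]_u (A a (u, r) ^+ 2 + B a (u, r) ^+ 2).

Lemma normsq_slice a :
  [/\ ig leb3 (fun u => normsq leb3 K (slice a u)),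
      ig leb3 (fun r => \1_K r * \int[leb3]_u (A a (u, r) ^+ 2 + B a (u, r) ^+ 2)) &
      \int[leb3]_u normsq leb3 K (slice a u) =
      \int[leb3]_r (\1_K r * \int[leb3]_u (A a (u, r) ^+ 2 + B a (u, r) ^+ 2))].
Proof.
have [mA _ A2 bA] := hA a; have [mB _ B2 bB] := hB a.
pose f (z : R3 R * R3 R) : R := \1_K z.2 * (A a z ^+ 2 + B a z ^+ 2).
have mi : measurable_fun setT (\1_K : R3 R -> R) by exact: measurable_indic.
have i : ig leb6 f.
  apply: (@ig_tonelli2' _ _ _ _ R leb3 leb3 _ (fun r => 2 * (\1_K r * q r))); last exact: igZ.
    apply: measurable_funM; first exact: (measurableT_comp mi measurable_snd).
    by apply: measurable_funD; exact: measurable_funX.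
  apply: nearW => r /=; have ir := igD (A2 r) (B2 r).
  have k0 : 0 <= \1_K r :> R by rewrite indicE.
  split; first exact: (igZ (\1_K r) ir).
  have -> : \int[leb3]_u `|\1_K r * (A a (u, r) ^+ 2 + B a (u, r) ^+ 2)| =
      \1_K r * \int[leb3]_u (A a (u, r) ^+ 2 + B a (u, r) ^+ 2).
    rewrite -rintZ//; apply: eq_Rintegral => u _.
    by rewrite ger0_norm// mulr_ge0// addr_ge0 ?sqr_ge0.
  rewrite mulrCA; apply: ler_wpM2l => //.
  by rewrite rintD// mulr_natl mulr2n lerD.
have e1 u : \int[leb3]_r f (u, r) = normsq leb3 K (slice a u).
  apply: eq_Rintegral => r _; rewrite sqK /f/= /sqnormC/= sqrrN//.
have e2 : (fun r => \int[leb3]_u f (u, r)) =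
    fun r => \1_K r * \int[leb3]_u (A a (u, r) ^+ 2 + B a (u, r) ^+ 2).
  by apply/funext => r; rewrite -rintZ//; exact: igD.
have {}e1 := funext e1.
have j1 := rfub_ig1 i; have j2 := rfub_ig2 i; have j3 := rfub12 i.
by rewrite e1 in j1 j3; rewrite e2 in j2 j3.
Qed.

Lemma cvg_sumr (I : Type) (s : seq I) (w : I -> nat -> R) (l : I -> R) :
  (forall i, w i n @[n --> \oo] --> l i) ->
  \sum_(i <- s) w i n @[n --> \oo] --> \sum_(i <- s) l i.
Proof.
move=> h; elim: s => [|i s IH].
  rewrite big_nil; under eq_fun do rewrite big_nil; exact: cvg_cst.
rewrite big_cons; under eq_fun do rewrite big_cons; exact: cvgD.
Qed.

(** For each [u], the squared values at [u] of the [V_a e_k] sum over [k] to the squared norm of the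
    slice, by Parseval. Dominated convergence in [u], with these norms as majorant, gives the
    trace. *)
Lemma gram_kernel_trace (e : nat -> R3 R -> R[i]) : L2_onb K e ->
  (forall k, 0 <= complex.Re (kernel_form K gram_kernel (e k))) /\
  series (fun k => complex.Re (kernel_form K gram_kernel (e k))) @ \oo -->
    \int[leb3]_r (\1_K r * mass r).
Proof.
move=> [Le orth compl]; split.
  by move=> k; have := gram_kernel_psd (Le k); rewrite lecE => /andP[].
have pars a u := parseval mK Le orth (L2_slice a u) (compl _ (L2_slice a u)).
pose S a (n : nat) u := \sum_(0 <= k < n) sqnormC (cinner leb3 K (e k) (slice a u)).
have SE a n u : S a n u = \sum_(0 <= k < n) (formRe (e k) a u ^+ 2 + formIm (e k) a u ^+ 2).
  by apply: eq_bigr => k _; rewrite form_slice.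
have igk a k : ig leb3 (fun u => formRe (e k) a u ^+ 2 + formIm (e k) a u ^+ 2).
  by have [] := gram_act (Le k) a (leq_ltn_trans (leq0n a) (ltn_ord a)).
have iS a n : ig leb3 (S a n).
  by rewrite (funext (SE a n)); apply: ig_sum => k; exact: igk.
have lim a : \int[leb3]_u S a n u @[n --> \oo] -->
    \int[leb3]_r (\1_K r * \int[leb3]_u (A a (u, r) ^+ 2 + B a (u, r) ^+ 2)).
  have [j1 j2 j3] := normsq_slice a; rewrite -j3.
  have [||] := @rint_dct _ _ _ leb3 (S a) (fun u => normsq leb3 K (slice a u))
    (fun u => normsq leb3 K (slice a u)) (fun n => ig_meas (iS a n)) (ig_meas j1) _ j1 _ => //.
    by apply: nearW => u; have [] := pars a u.
  move=> n u; rewrite ger0_norm; first exact: (pars a u).1.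
  by apply: sumr_ge0 => k _; apply: addr_ge0; exact: sqr_ge0.
have -> : \int[leb3]_r (\1_K r * mass r) =
    \sum_(a < m) \int[leb3]_r (\1_K r * \int[leb3]_u (A a (u, r) ^+ 2 + B a (u, r) ^+ 2)).
  rewrite -rint_sum => [|a]; last by have [] := normsq_slice a.
  by apply: eq_Rintegral => r _; rewrite mulr_sumr.
rewrite (_ : series _ = fun n => \sum_(a < m) \int[leb3]_u S a n u); first exact: cvg_sumr.
apply/funext => n.
transitivity (\sum_(0 <= k < n) \sum_(a < m)
    \int[leb3]_u (formRe (e k) a u ^+ 2 + formIm (e k) a u ^+ 2)).
  by apply: eq_bigr => k _; rewrite (kernel_formE (Le k)).
rewrite exchange_big/=; apply: eq_bigr => a _.
rewrite -(rint_sum _ (igk a)); apply: eq_Rintegral => u _; exact: (esym (SE a n u)).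
Qed.

Lemma gram_kernel_trace_class : trace_class_kernel K gram_kernel.
Proof.
split; first exact: L2_gram_kernel.
exists gram_kernel; first exact: gram_kernel_abs.
move=> e /gram_kernel_trace[e0 c].
set t := \int[leb3]_r _ in c.
suff -> : (\sum_(0 <= k <oo) (complex.Re (kernel_form K gram_kernel (e k)))%:E = t%:E)%E by rewrite ltry.
apply/cvg_lim => //.
rewrite (_ : (fun n => _) = EFin \o series (fun k => complex.Re (kernel_form K gram_kernel (e k)))).
  by apply/fine_cvgP; split; [exact: nearW|exact: c].
by apply/funext => n; rewrite /= -sumEFin.
Qed.

Lemma gram_kernel_has_trace :
  has_trace K gram_kernel ((\int[leb3]_r (\1_K r * mass r)) +i* 0)%C.
Proof.
move=> e he; have [_ c] := gram_kernel_trace he; split; first exact: c.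
rewrite (_ : series _ = fun=> 0); first exact: cvg_cst.
apply/funext => n; apply: big1 => k _.
by have [Le _ _] := he; rewrite (kernel_formE (Le k)).
Qed.

End TraceClass.

(** * Separability of L2 and restriction to the diagonal *)

Section SquareIntegrableReal.
Context d (T : measurableType d) (R : realType).
Variable mu : {measure set T -> \bar R}.
Implicit Types f g h : T -> R.

Definition sqi f := measurable_fun setT f /\ ig mu (fun x => f x ^+ 2).

Lemma sqiD f g : sqi f -> sqi g -> sqi (fun x => f x + g x).
Proof.
move=> [mf i] [mg j]; have m := measurable_funD mf mg; split=> //.
apply: (ig_le _ _ (igD (igZ 2 i) (igZ 2 j))) => [|x]; first exact: measurable_funX.
rewrite ger0_norm ?sqr_ge0//; have := sqr_ge0 (f x - g x).
by move: (f x) (g x) => a b; lra.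
Qed.

Lemma sqiZ (c : R) f : sqi f -> sqi (fun x => c * f x).
Proof.
move=> [mf i]; split; first exact: measurable_funM.
have := igZ (c ^+ 2) i; congr (ig _ _); apply/funext => x; ring.
Qed.

Lemma sqiB f g : sqi f -> sqi g -> sqi (fun x => f x - g x).
Proof.
move=> hf hg; have := sqiD hf (sqiZ (-1) hg); congr sqi; apply/funext => x; ring.
Qed.

Lemma sqi_sum (I : Type) (s : seq I) (w : I -> T -> R) : (forall i, sqi (w i)) ->
  sqi (fun x => \sum_(i <- s) w i x).
Proof.
move=> h; elim: s => [|i s IH].
  rewrite (_ : (fun x => _) = fun=> 0); last by apply/funext => x; rewrite big_nil.
  by split => //; have := ig0 mu; congr (ig _ _); apply/funext => x; rewrite expr0n.
rewrite (_ : (fun x => _) = fun x => w i x + \sum_(i <- s) w i x); last first.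
  by apply/funext => x; rewrite big_cons.
exact: sqiD.
Qed.

(** The squared distance avoids roots; its triangle inequality costs a factor 2. *)
Definition dist2 f g : R := \int[mu]_x ((f x - g x) ^+ 2).

Lemma dist2_triangle f g h : sqi f -> sqi g -> sqi h ->
  dist2 f h <= 2 * dist2 f g + 2 * dist2 g h.
Proof.
move=> hf hg hh; have [_ i] := sqiB hf hg; have [_ j] := sqiB hg hh; have [_ k] := sqiB hf hh.
rewrite /dist2 -!rintZ// -rintD ?(igZ _ i) ?(igZ _ j)//; [|exact: igZ..].
apply: rint_le => //; first by apply: igD; exact: igZ.
move=> x; have := sqr_ge0 (f x - g x - (g x - h x)).
by move: (f x) (g x) (h x) => a b c; lra.
Qed.

Lemma dist2C f g : dist2 f g = dist2 g f.
Proof. by apply: eq_Rintegral => x _; rewrite -sqrrN opprB. Qed.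

End SquareIntegrableReal.

(** * A countable dense family in L^2 *)

Section Separability.
Import HBNNSimple.
Context {R : realType}.
Local Notation mR := (measurableTypeR R).

Definition box_index : Type := (nat * ((rat * rat) * (rat * rat) * (rat * rat)))%type.

Definition box_set (i : box_index) : set (R3 R) :=
  open_box (ratr i.2.1.1.1) (ratr i.2.1.1.2) (ratr i.2.1.2.1) (ratr i.2.1.2.2)
    (ratr i.2.2.1) (ratr i.2.2.2).

(** Indicators are always cut by a cube in the Dynkin argument of [approximable_indic]; carrying the
    cube here makes its initial case an equality. *)
Definition box_fun (i : box_index) (x : R3 R) : R := \1_(cube i.1%:R) x * \1_(box_set i) x.

(** With rational coefficients and rational boxes these combinations form a countable family, dense
    in L^2 by [approximable_sqi]. *)
Definition comb (s : seq (rat * box_index)) (x : R3 R) : R :=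
  \sum_(p <- s) ratr p.1 * box_fun p.2 x.

Definition approximable (f : R3 R -> R) : Prop := sqi leb3 f /\
  forall eps, 0 < eps -> exists s, dist2 leb3 f (comb s) <= eps.

Lemma sqi_cube_indic (A : set (R3 R)) (m : nat) : measurable A ->
  sqi leb3 (fun x => \1_(cube m%:R) x * \1_A x).
Proof.
move=> mA; have ic : ig leb3 (\1_(cube m%:R) : R3 R -> R).
  by apply: ig_indic; [exact: measurable_cube|exact: leb3_cube_lty].
have mm : measurable_fun setT (fun x : R3 R => \1_(cube m%:R) x * \1_A x : R).
  by apply: measurable_funM; [exact: ig_meas ic|exact: measurable_indic].
split=> //; apply: (ig_le _ _ ic) => [|x]; first exact: measurable_funX.
by rewrite !indicE -natrM -natrX normr_nat ler_nat; case: (_ \in _); case: (_ \in _).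
Qed.

Lemma sqi_comb s : sqi leb3 (comb s).
Proof.
apply: sqi_sum => p; apply: sqiZ; apply: sqi_cube_indic; exact: measurable_open_box.
Qed.

Lemma approximable_comb s : approximable (comb s).
Proof.
split; first exact: sqi_comb.
move=> eps e0; exists s; rewrite /dist2; under eq_Rintegral do rewrite subrr expr0n.
by rewrite rint0 ltW.
Qed.

Lemma approximable_close f : sqi leb3 f ->
  (forall eps, 0 < eps -> exists2 g, approximable g & dist2 leb3 f g <= eps) -> approximable f.
Proof.
move=> hf h; split=> // eps e0.
have e4 : 0 < eps / 4 by rewrite divr_gt0.
have [g [sg ag] fg] := h _ e4; have [s gs] := ag _ e4; exists s.
apply: (le_trans (dist2_triangle hf sg (sqi_comb s))).
by lra.
Qed.

Lemma approximableD f g : approximable f -> approximable g ->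
  approximable (fun x => f x + g x).
Proof.
move=> [sf af] [sg ag]; have sfg := sqiD sf sg; split=> // eps e0.
have e4 : 0 < eps / 4 by rewrite divr_gt0.
have [s hs] := af _ e4; have [t ht] := ag _ e4; exists (s ++ t).
have [_ i1] := sqiB sf (sqi_comb s); have [_ i2] := sqiB sg (sqi_comb t).
have [_ i3] := sqiB sfg (sqi_comb (s ++ t)).
have : dist2 leb3 (fun x => f x + g x) (comb (s ++ t)) <=
    2 * dist2 leb3 f (comb s) + 2 * dist2 leb3 g (comb t).
  rewrite /dist2 -!rintZ// -rintD; [|exact: igZ..].
  apply: rint_le => //; first by apply: igD; exact: igZ.
  move=> x; rewrite {1}/comb big_cat/= -/(comb s x) -/(comb t x).
  move: (f x) (g x) (comb s x) (comb t x) => a b c e.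
  by have := sqr_ge0 ((a - c) - (b - e)); lra.
by move=> /le_trans; apply; lra.
Qed.

Lemma approximable_ratZ (q : rat) f : approximable f ->
  approximable (fun x => ratr q * f x).
Proof.
move=> [sf af]; split; first exact: sqiZ.
move=> eps e0; pose c : R := ratr q.
have e1 : 0 < eps / (c ^+ 2 + 1) by rewrite divr_gt0// ltr_wpDl// sqr_ge0.
have [s hs] := af _ e1; exists [seq (q * p.1, p.2) | p <- s].
have ec x : comb [seq (q * p.1, p.2) | p <- s] x = c * comb s x.
  rewrite /comb big_map mulr_sumr; apply: eq_bigr => p _ /=.
  by rewrite rmorphM/= -mulrA.
have [_ i] := sqiB sf (sqi_comb s).
rewrite /dist2; under eq_Rintegral do rewrite ec -mulrBr exprMn.
rewrite rintZ//; apply: (@le_trans _ _ (c ^+ 2 * (eps / (c ^+ 2 + 1)))).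
  by apply: ler_wpM2l => //; exact: sqr_ge0.
rewrite mulrCA -[leRHS]mulr1 ler_wpM2l ?(ltW e0)// ler_pdivrMr ?ltr_wpDl ?sqr_ge0//.
by rewrite mul1r lerDl.
Qed.

Lemma approximableZ (c : R) f : approximable f -> approximable (fun x => c * f x).
Proof.
move=> af; have [sf _] := af; apply: approximable_close; first exact: sqiZ.
move=> eps e0; pose n := \int[leb3]_x (f x ^+ 2).
have n0 : 0 <= n by apply: rint_ge0 => x; exact: sqr_ge0.
(* The bound by 1 replaces [(c - q)^2] by [c - q]; the other bound makes its product with [n] at
   most [eps]. *)
pose dl := Num.min 1 (eps / (n + 1)).
have dl0 : 0 < dl by rewrite /dl lt_min ltr01 divr_gt0// ltr_wpDl.
have cd : c - dl < c by rewrite ltrBlDr ltrDl.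
have [_ [[q ->] h1 h2]] := rational_between cd.
exists (fun x => ratr q * f x); first exact: approximable_ratZ.
have -> : dist2 leb3 (fun x => c * f x) (fun x => ratr q * f x) = (c - ratr q) ^+ 2 * n.
  rewrite -rintZ; last by have [] := sf.
  by apply: eq_Rintegral => x _; rewrite -mulrBl exprMn.
have b0 : 0 <= c - ratr q by rewrite subr_ge0 ltW.
have b1 : c - ratr q <= dl by rewrite lerBlDr -lerBlDl ltW// ltrBlDl addrC -ltrBlDl.
have b2 : (c - ratr q) ^+ 2 <= dl.
  rewrite expr2; apply: (@le_trans _ _ (dl * 1)); last by rewrite mulr1.
  apply: ler_pM => //; apply: (le_trans b1); by rewrite /dl ge_min lexx.
apply: (@le_trans _ _ (eps / (n + 1) * n)).
  by apply: ler_wpM2r => //; apply: (le_trans b2); rewrite /dl ge_min lexx orbT.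
by rewrite mulrAC ler_pdivrMr ?ltr_wpDl// ler_wpM2l ?(ltW e0)// lerDl.
Qed.

Lemma approximable_sum (I : Type) (s : seq I) (w : I -> R3 R -> R) :
  (forall i, approximable (w i)) -> approximable (fun x => \sum_(i <- s) w i x).
Proof.
move=> h; elim: s => [|i s IH].
  rewrite (_ : (fun x => _) = comb [::]); first exact: approximable_comb.
  by apply/funext => x; rewrite /comb !big_nil.
rewrite (_ : (fun x => _) = fun x => w i x + \sum_(i <- s) w i x); last first.
  by apply/funext => x; rewrite big_cons.
exact: approximableD.
Qed.

Lemma approximable_dct (f : R3 R -> R) (f_ : nat -> R3 R -> R) (g : R3 R -> R) :
  sqi leb3 f -> (forall n, approximable (f_ n)) ->
  (forall x, f_ n x @[n --> \oo] --> f x) -> ig leb3 g ->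
  (forall n x, (f x - f_ n x) ^+ 2 <= g x) -> approximable f.
Proof.
move=> sf af cf ig_g hg; apply: approximable_close => // eps e0.
have sfn n : sqi leb3 (fun x => f x - f_ n x) by apply: sqiB => //; have [] := af n.
have [||_ c] := @rint_dct _ _ _ leb3 (fun n x => (f x - f_ n x) ^+ 2) (fun=> 0) g
  (fun n => ig_meas (sfn n).2) (measurable_cst _) _ ig_g _.
- apply: nearW => x; have h : f x - f_ n x @[n --> \oo] --> f x - f x.
    by apply: cvgB; [exact: cvg_cst|exact: cf].
  by have := cvg_comp _ _ h (@exprn_continuous _ 2 _); rewrite subrr expr0n.
- by move=> n x; rewrite ger0_norm ?sqr_ge0.
rewrite rint0 in c; move/cvgrPdist_le : c => /(_ _ e0)[n _ /(_ n (leqnn n))/=].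
rewrite sub0r normrN ger0_norm; last by apply: rint_ge0 => x; exact: sqr_ge0.
by exists (f_ n).
Qed.

(** Dynkin induction on [A], for all cubes at once: the cube keeps every indicator in L^2 and
    dominates the partial sums for disjoint unions. *)
Lemma approximable_indic (A : set (R3 R)) (m : nat) : measurable A ->
  approximable (fun x => \1_(cube m%:R) x * \1_A x).
Proof.
move=> mA; have : forall m : nat, approximable (fun x => \1_(cube m%:R) x * \1_A x); last exact.
have mc k : measurable_fun setT (\1_(cube k%:R) : R3 R -> R).
  by apply: measurable_indic; exact: measurable_cube.
(* Complements are taken inside a cube, so its own indicator must be a combination: the open
   rational box of half-side [k + 1] contains the closed cube. *)
have apT (k : nat) : approximable (fun x => \1_(cube k%:R) x * \1_setT x).
  pose i : box_index := (k, ((- (k.+1%:R), k.+1%:R), (- (k.+1%:R), k.+1%:R), (- (k.+1%:R), k.+1%:R))).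
  rewrite (_ : (fun x => _) = comb [:: (1, i)]); first exact: approximable_comb.
  apply/funext => x; rewrite /comb big_seq1 /= rmorph1 mul1r /box_fun/= indicT mulr1.
  rewrite !indicE; have [hx|_] := boolP (x \in cube k%:R); last by rewrite mul0r.
  rewrite mem_set ?mulr1//; move: hx; rewrite inE => /cubeP[h1 h2 h3].
  have lt (y : R) : `|y| <= k%:R -> ratr (- k.+1%:R) < y < ratr k.+1%:R.
    rewrite rmorphN/= !ratr_nat -ltr_norml => /le_lt_trans; apply; by rewrite ltr_nat.
  by split; exact: lt.
have mS : <<s rational_boxes >> A by rewrite -rational_boxes_generate.
move: mS; apply: (@dynkin_induction _ (R3 R) rational_boxes
  (fun A => forall m : nat, approximable (fun x => \1_(cube m%:R) x * \1_A x))
  rational_boxes_generate rational_boxes_setI) => //.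
- move=> _ [_ [_ [_ [_ [_ [_ [[[a1 ->] [b1 ->]] [[a2 ->] [b2 ->]] [[a3 ->] [b3 ->]] ->]]]]]]] k.
  pose i : box_index := (k, ((a1, b1), (a2, b2), (a3, b3))).
  rewrite (_ : (fun x => _) = comb [:: (1, i)]); first exact: approximable_comb.
  by apply/funext => x; rewrite /comb big_seq1 /= rmorph1 mul1r.
- move=> S mS hS k; have := approximableD (apT k) (approximableZ (-1) (hS k)).
  congr approximable; apply/funext => x; rewrite indicT !indicE in_setC.
  by case: (x \in S) => /=; ring.
- move=> F mF tF hF k.
  have aF n : approximable (fun x => \sum_(i < n) \1_(cube k%:R) x * \1_(F i) x).
    by apply: approximable_sum => i; exact: hF.
  have ic : ig leb3 (\1_(cube k%:R) : R3 R -> R).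
    by apply: ig_indic; [exact: measurable_cube|exact: leb3_cube_lty].
  apply: (approximable_dct _ aF _ ic).
  + by apply: sqi_cube_indic; exact: bigcupT_measurable.
  + move=> x; under eq_fun do rewrite -mulr_sumr.
    apply: cvgM; first exact: cvg_cst.
    have [[j _ Fj]|nF] := pselect ((\bigcup_j F j) x).
      rewrite indicE mem_set; last by exists j.
      apply: cvg_near_cst; exists j.+1 => // n /= kn.
      by rewrite (sum_indic_trivIset _ _ tF Fj) kn.
    rewrite indicE memNset//; apply: cvg_near_cst; apply: nearW => n.
    by rewrite big1// => i _; rewrite indicE memNset// => Fi; apply: nF; exists i.
  + move=> n x; rewrite -mulr_sumr -mulrBr exprMn.
    have s01 : (\1_(\bigcup_j F j) x - \sum_(i < n) \1_(F i) x) ^+ 2 <= 1 :> R.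
      have [[j _ Fj]|nF] := pselect ((\bigcup_j F j) x).
        rewrite indicE mem_set; last by exists j.
        rewrite (sum_indic_trivIset _ _ tF Fj); case: (j < n)%N.
          by rewrite subrr expr0n.
        by rewrite subr0 expr1n.
      rewrite indicE memNset// big1 => [|i _]; first by rewrite subr0 expr0n.
      by rewrite indicE memNset// => Fi; apply: nF; exists i.
    have c01 : \1_(cube k%:R) x ^+ 2 = \1_(cube k%:R) x :> R.
      by rewrite indicE; case: (_ \in _); rewrite ?expr1n ?expr0n.
    by rewrite c01 -[leRHS]mulr1 ler_wpM2l// indicE.
Qed.

Lemma approximable_nnsfun (g : {nnsfun R3 R >-> R}) (m : nat) :
  approximable (fun x => \1_(cube m%:R) x * g x).
Proof.
rewrite (_ : (fun x => _) = fun x => \sum_(y <- fset_set (range g))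
    y * (\1_(cube m%:R) x * \1_(g @^-1` [set y]) x)); last first.
  apply/funext => x; rewrite (fimfunE g x) fsbig_finite//= mulr_sumr.
  by apply: eq_bigr => y _; rewrite mulrCA.
apply: approximable_sum => y; apply: approximableZ; apply: approximable_indic.
by rewrite -[X in measurable X]setTI; exact: (measurable_funP g).
Qed.

Lemma approximable_ge0 (f : R3 R -> R) : sqi leb3 f -> (forall x, 0 <= f x) -> approximable f.
Proof.
move=> sf f0; have [mf i2] := sf.
have mef : measurable_fun setT (EFin \o f) by exact/measurable_EFinP.
have f0' x : [set: R3 R] x -> (0 <= (EFin \o f) x)%E by move=> _; rewrite lee_fin.
have [g [ndg cg]] := approximation measurableT mef f0'.
have cg' x : g n x @[n --> \oo] --> f x by have /fine_cvgP[_] := cg x I.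
have gf n x : g n x <= f x.
  have nd : nondecreasing_seq (fun n => g n x) by move=> a b ab; exact/lefP/ndg.
  have cv : cvgn (fun n => g n x) by apply/cvg_ex; exists (f x); exact: cg'.
  by have := nondecreasing_cvgn_le nd cv n; rewrite (cvg_lim (@Rhausdorff R) (cg' x)).
apply: (@approximable_dct f (fun n x => \1_(cube n%:R) x * g n x) (fun x => f x ^+ 2)) => //.
- by move=> n; exact: approximable_nnsfun.
- move=> x; have [k _ hk] : (\bigcup_n cube n%:R) x by rewrite bigcup_cube.
  apply: cvg_trans (cg' x); apply: near_eq_cvg; exists k => // n /= kn.
  rewrite indicE mem_set ?mul1r//; apply: cube_subset hk; by rewrite ler_nat.
- move=> n x; have g0 : 0 <= g n x by exact: fun_ge0.
  have c1 : 0 <= (\1_(cube n%:R) x : R) by rewrite indicE.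
  have c2 : (\1_(cube n%:R) x : R) <= 1 by rewrite indicE lern1 leq_b1.
  have h1 : 0 <= \1_(cube n%:R) x * g n x by rewrite mulr_ge0.
  have h2 : \1_(cube n%:R) x * g n x <= f x.
    by apply: le_trans (gf n x); rewrite -[leRHS]mul1r ler_wpM2r.
  by rewrite lerXn2r ?nnegrE ?subr_ge0// lerBlDr lerDl.
Qed.

Lemma approximable_sqi (f : R3 R -> R) : sqi leb3 f -> approximable f.
Proof.
move=> [mf i2].
have aux (g : R3 R -> R) : measurable_fun setT g -> (forall x, 0 <= g x <= `|f x|) -> approximable g.
  move=> mg hg; apply: approximable_ge0; last by move=> x; have /andP[] := hg x.
  split=> //; apply: (ig_le _ _ i2) => [|x]; first exact: measurable_funX.
  have /andP[g0 gf] := hg x.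
  by rewrite ger0_norm ?sqr_ge0// -[leRHS]real_normK ?num_real// lerXn2r ?nnegrE.
have mn : measurable_fun setT (fun x => `|f x|) by exact: measurableT_comp.
have a1 : approximable (fun x => 2^-1 * (`|f x| + f x)).
  apply: aux => [|x]; first exact: (measurable_funM (measurable_cst _) (measurable_funD mn mf)).
  have := ler_norm (f x); have := ler_norm (- f x); rewrite normrN.
  by move: `|f x| => y h1 h2; apply/andP; split; lra.
have a2 : approximable (fun x => 2^-1 * (`|f x| - f x)).
  apply: aux => [|x]; first exact: (measurable_funM (measurable_cst _) (measurable_funB mn mf)).
  have := ler_norm (f x); have := ler_norm (- f x); rewrite normrN.
  by move: `|f x| => y h1 h2; apply/andP; split; lra.
have := approximableD a1 (approximableZ (-1) a2).
by congr approximable; apply/funext => x; move: `|f x| => y; lra.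
Qed.

End Separability.

(** * Restriction of a Gram identity to the diagonal *)

Section Diagonal.
Context {R : realType}.
Variables (m : nat) (P Q : 'I_m -> R3 R * R3 R -> R).
Hypothesis mP : forall i, measurable_fun setT (P i).
Hypothesis mQ : forall i, measurable_fun setT (Q i).
Hypothesis P2 : {ae leb3, forall r, forall i, ig leb3 (fun u => P i (u, r) ^+ 2)}.
Hypothesis Q2 : {ae leb3, forall r, forall i, ig leb3 (fun u => Q i (u, r) ^+ 2)}.
Hypothesis PQ0 : {ae leb6, forall p, \sum_(i < m) \int[leb3]_u (P i (u, p.1) * Q i (u, p.2)) = 0}.

Local Notation index := {ffun 'I_m -> seq (rat * box_index)}.

Definition close_set (c : index * nat) : set (R3 R) :=
  [set s | forall i, dist2 leb3 (fun u => Q i (u, s)) (comb (c.1 i)) <= c.2.+1%:R^-1 ^+ 2].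

(** There are countably many of these negligible sets. If [r] avoids them all, then every ball of
    the countable family that contains the slices at [r] also contains those at a non-negligible set
    of parameters. *)
Definition bad_set (c : index * nat) : set (R3 R) :=
  if pselect (leb3.-negligible (close_set c)) then close_set c else set0.

Lemma double_le (x y z : R) : x <= z ^+ 2 -> y <= z ^+ 2 ->
  2 * x + 2 * y <= (2 * z) ^+ 2.
Proof. by move=> h1 h2; rewrite exprMn; lra. Qed.

Lemma ae_not_bad : {ae leb3, forall r, forall c, bad_set c r -> False}.
Proof.
pose B (n : nat) := if @unpickle (index * nat)%type n is Some c then bad_set c else set0.
have nB : leb3.-negligible (\bigcup_n B n).
  apply: negligible_bigcup => n; rewrite /B; case: unpickle => [c|]; last exact: negligible_set0.
  by rewrite /bad_set; case: pselect => [//|?]; exact: negligible_set0.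
apply: negligibleS nB => r /= /existsNP[c] /contrapT hc.
by exists (pickle c) => //; rewrite /B pickleK.
Qed.

(* Almost every slice of [Q] is, by separability, a limit of other slices
   [Q i (., s)] with [s] outside any prescribed null set. *)
Lemma gram_diagonal : {ae leb3, forall r, \sum_(i < m) \int[leb3]_u (P i (u, r) * Q i (u, r)) = 0}.
Proof.
have h1 := ae_prod_ae1 PQ0.
apply: (ae_mono2 _ (ae_mono2 (fun r => @conj _ _) P2 Q2) (ae_mono2 (fun r => @conj _ _) h1 ae_not_bad)).
move=> r [hP hQ] [hr hbad].
have sP i : sqi leb3 (fun u => P i (u, r)) by split; [exact: measurable_slice2|exact: hP].
have sQ i : sqi leb3 (fun u => Q i (u, r)) by split; [exact: measurable_slice2|exact: hQ].
set x := \sum_(i < m) _.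
pose C := \sum_(i < m) Num.sqrt (\int[leb3]_u (P i (u, r) ^+ 2)).
have C0 : 0 <= C by apply: sumr_ge0 => i _; exact: sqrtr_ge0.
(* The slices at [r] and at a suitable [s] both lie within [1/(k+1)] of the same combinations, hence
   within [2/(k+1)] of each other. As the sum vanishes at [(r, s)], Cauchy-Schwarz bounds it at
   [(r, r)]. *)
have key (k : nat) : `|x| * k.+1%:R <= 2 * C.
  have k0 : 0 < k.+1%:R^-1 :> R by rewrite invr_gt0.
  have ex i : exists s, dist2 leb3 (fun u => Q i (u, r)) (comb s) <= k.+1%:R^-1 ^+ 2.
    by have [_] := approximable_sqi (sQ i); apply; exact: exprn_gt0.
  pose j : index := [ffun i => sval (cid (ex i))].
  have rE : close_set (j, k) r by move=> i; rewrite /= ffunE; exact: svalP (cid (ex i)).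
  have nE : ~ leb3.-negligible (close_set (j, k)).
    by move=> nn; apply: (hbad (j, k)); rewrite /bad_set; case: pselect.
  (* A non-negligible set is not contained in the null set where the identity or the square
     integrability fails. *)
  have [s [sE s0 s2]] : exists s, [/\ close_set (j, k) s,
      \sum_(i < m) \int[leb3]_u (P i (u, r) * Q i (u, s)) = 0 &
      forall i, ig leb3 (fun u => Q i (u, s) ^+ 2)].
    apply: contrapT => hn; apply: nE.
    have := ae_mono2 (fun r => @conj _ _) hr Q2; apply: negligibleS => s sE /= [a b].
    by apply: hn; exists s.
  have sQs i : sqi leb3 (fun u => Q i (u, s)) by split; [exact: measurable_slice2|exact: s2].
  have sW i := sqiB (sQ i) (sQs i).
  have -> : x = \sum_(i < m) \int[leb3]_u (P i (u, r) * (Q i (u, r) - Q i (u, s))).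
    have e : x = x - \sum_(i < m) \int[leb3]_u (P i (u, r) * Q i (u, s)) by rewrite s0 subr0.
    rewrite {}e /x -sumrB; apply: eq_bigr => i _.
    rewrite -rintB; last 2 first.
    - by apply: igM_sqr; [exact: (sP i).1|exact: (sQ i).1|exact: (sP i).2|exact: (sQ i).2].
    - by apply: igM_sqr; [exact: (sP i).1|exact: (sQs i).1|exact: (sP i).2|exact: (sQs i).2].
    by apply: eq_Rintegral => u _; rewrite mulrBr.
  rewrite -ler_pdivlMr//; apply: (le_trans (ler_norm_sum _ _ _)).
  rewrite mulrAC mulr_sumr; apply: ler_sum => i _.
  have cs := cauchy_schwarz (sP i).1 (sW i).1 (sP i).2 (sW i).2.
  have d4 : dist2 leb3 (fun u => Q i (u, r)) (fun u => Q i (u, s)) <= (2 * k.+1%:R^-1) ^+ 2.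
    apply: (le_trans (dist2_triangle (sQ i) (sqi_comb (j i)) (sQs i))).
    have h2 := sE i; rewrite dist2C in h2; exact: (double_le (rE i) h2).
  set I := \int[leb3]_u _ in cs *; set p := \int[leb3]_u _ in cs *.
  have p0 : 0 <= p by apply: rint_ge0 => u; exact: sqr_ge0.
  have a0 : 0 <= Num.sqrt p * (2 * k.+1%:R^-1) by rewrite mulr_ge0 ?sqrtr_ge0// mulr_ge0// ltW.
  have -> : 2 / k.+1%:R * Num.sqrt p = Num.sqrt p * (2 * k.+1%:R^-1) by rewrite mulrC.
  rewrite -(ger0_norm a0) -!sqrtr_sqr ler_sqrt ?sqr_ge0//.
  apply: (le_trans cs); rewrite exprMn sqr_sqrtr//.
  by apply: ler_wpM2l.
apply/eqP; rewrite -normr_le0 leNgt; apply/negP => x0.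
have := key (Num.truncn (2 * C / `|x|)); rewrite leNgt => /negP; apply.
by rewrite [ltRHS]mulrC -ltr_pdivrMr//; exact: truncnS_gt.
Qed.

End Diagonal.

(** * Weak derivatives of locally square-integrable kernels *)

Section LocallySquareIntegrable.
Context {R : realType}.
Implicit Types (f k : R3 R * R3 R -> R) (g psi : R3 R -> R).

Lemma ae_fst (P : R3 R -> Prop) : {ae leb3, forall r, P r} ->
  {ae @leb6 R, forall p, P p.1}.
Proof.
move=> [N [mN N0 sN]]; exists (N `*` setT); split; first exact: measurableX.
  apply: (etrans (product_measure1E _ _ mN measurableT)).
  exact: (etrans (congr1 (fun x => (x * _)%E) N0) (mul0e _)).
by move=> p /= np; split=> //; exact: sN.
Qed.

Lemma ae_snd (P : R3 R -> Prop) : {ae leb3, forall r, P r} ->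
  {ae @leb6 R, forall p, P p.2}.
Proof.
move=> [N [mN N0 sN]]; exists (setT `*` N); split; first exact: measurableX.
  apply: (etrans (product_measure1E _ _ measurableT mN)).
  exact: (etrans (congr1 (fun x => (_ * x)%E) N0) (mule0 _)).
by move=> p /= np; split=> //; exact: sN.
Qed.

Definition loc_sq_kernel f := measurable_fun setT f /\
  forall n : nat, ig leb6 (fun z => \1_(cube n%:R) z.2 * f z ^+ 2).

Lemma loc_sq_kernel_ae f : loc_sq_kernel f ->
  {ae leb3, forall r, ig leb3 (fun u => f (u, r) ^+ 2)}.
Proof.
move=> [mf h]; have : {ae leb3, forall r, forall n : nat, ig leb3 (fun u => \1_(cube n%:R) r * f (u, r) ^+ 2)}.
  by apply: ae_foralln => n; exact: (rfub_ae2 (h n)).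
apply: ae_mono => r hr; have [n _ rn] : (\bigcup_n cube n%:R) r by rewrite bigcup_cube.
have := hr n; congr (ig _ _); apply/funext => u.
by rewrite indicE mem_set// mul1r.
Qed.

Lemma ig_sq_loc f : measurable_fun setT f -> ig leb6 (fun z => f z ^+ 2) -> loc_sq_kernel f.
Proof.
move=> mf i; split=> // n.
have mc : measurable_fun setT (\1_(cube n%:R) : R3 R -> R).
  by apply: measurable_indic; exact: measurable_cube.
apply: (@ig_bounded_mul _ _ _ _ _ _ 1 _ _ i); last by move=> z; exact: norm_indic_le1.
exact: (measurableT_comp mc measurable_snd).
Qed.

Lemma sq_kernel_loc f q : sq_kernel f q -> L1_loc3 q -> loc_sq_kernel f.
Proof.
move=> [mf mq f2 bf] lq; split=> // n.
have mc : measurable_fun setT (\1_(cube n%:R) : R3 R -> R).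
  by apply: measurable_indic; exact: measurable_cube.
apply: (@ig_tonelli2' _ _ _ _ R leb3 leb3 _ (fun r => \1_(cube n%:R) r * q r)); last exact: L1_loc3_cube.
  apply: measurable_funM; first exact: (measurableT_comp mc measurable_snd).
  exact: measurable_funX.
apply: nearW => r /=; split; first exact: (igZ (\1_(cube n%:R) r) (f2 r)).
have c0 : 0 <= (\1_(cube n%:R) r : R) by rewrite indicE.
have -> : \int[leb3]_u `|\1_(cube n%:R) r * f (u, r) ^+ 2| = \1_(cube n%:R) r * \int[leb3]_u (f (u, r) ^+ 2).
  rewrite -(rintZ _ (f2 r)); apply: eq_Rintegral => u _.
  by rewrite (ger0_norm (mulr_ge0 c0 (sqr_ge0 _))).
exact: ler_wpM2l.
Qed.

Definition cube_bounded psi := measurable_fun setT psi /\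
  exists (M : R) (n : nat), 0 <= M /\ forall r, `|psi r| <= M * \1_(cube n%:R) r.

Lemma cube_bounded_test psi : test_function psi -> cube_bounded psi.
Proof. by move=> t; split; [exact: test_measurable3|exact: test_le3]. Qed.

Lemma cube_bounded_indic (n : nat) : cube_bounded (\1_(cube n%:R) : R3 R -> R).
Proof.
split; first by apply: measurable_indic; exact: measurable_cube.
by exists 1, n; split=> // r; rewrite mul1r ger0_norm// indicE.
Qed.

Lemma cube_bounded_sqr psi : cube_bounded psi -> ig leb3 (fun r => psi r ^+ 2).
Proof.
move=> [mp [M [n [M0 h]]]].
have ic : ig leb3 (\1_(cube n%:R) : R3 R -> R).
  by apply: ig_indic; [exact: measurable_cube|exact: leb3_cube_lty].
apply: (ig_le _ _ (igZ (M ^+ 2) ic)) => [|r]; first exact: measurable_funX.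
rewrite ger0_norm ?sqr_ge0//.
have -> : M ^+ 2 * \1_(cube n%:R) r = (M * \1_(cube n%:R) r) ^+ 2.
  by rewrite exprMn indicE; case: (_ \in _); rewrite ?expr1n ?expr0n.
rewrite -[leLHS]real_normK ?num_real// lerXn2r ?nnegrE//.
by rewrite mulr_ge0// indicE.
Qed.

Lemma ig_loc_sq f g psi : loc_sq_kernel f -> measurable_fun setT g ->
  ig leb3 (fun u => g u ^+ 2) -> cube_bounded psi ->
  ig leb6 (fun z => f z * g z.1 * psi z.2).
Proof.
move=> [mf lf] mg ig2 [mp [M [n [M0 h]]]].
have ic : ig leb3 (\1_(cube n%:R) : R3 R -> R).
  by apply: ig_indic; [exact: measurable_cube|exact: leb3_cube_lty].
apply: (ig_le _ _ (igZ M (igD (lf n) (ig_tensor ig2 ic)))) => [|z].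
  apply: measurable_funM; last exact: (measurableT_comp mp measurable_snd).
  by apply: measurable_funM => //; exact: (measurableT_comp mg measurable_fst).
have hz := h z.2; have hfg := normM_le_sqr (f z) (g z.1).
have c0 : 0 <= (\1_(cube n%:R) z.2 : R) by rewrite indicE.
have -> : M * (\1_(cube n%:R) z.2 * f z ^+ 2 + g z.1 ^+ 2 * \1_(cube n%:R) z.2) =
    (f z ^+ 2 + g z.1 ^+ 2) * (M * \1_(cube n%:R) z.2) by ring.
rewrite normrM; apply: ler_pM => //; apply: (le_trans hfg).
have := sqr_ge0 (f z); have := sqr_ge0 (g z.1).
by move: (f z ^+ 2) (g z.1 ^+ 2) => a b; lra.
Qed.

(* Separating the variables of the test function: [h] is arbitrary, so the
   fundamental lemma applies in the first variable. *)
Lemma weak6_slice e f k phi : weak_derivative6 f k (0, e) ->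
  loc_sq_kernel f -> loc_sq_kernel k -> test_function phi ->
  {ae leb3, forall u, ig leb3 (fun r => f (u, r) * 'D_e phi r + k (u, r) * phi r) /\
    \int[leb3]_r (f (u, r) * 'D_e phi r + k (u, r) * phi r) = 0}.
Proof.
move=> [Lf Lk W] sf sk tphi; have tD := test_derive e tphi.
have bD := cube_bounded_test tD; have bp := cube_bounded_test tphi.
have ic g : cube_bounded g ->
    ig leb6 (fun z => g z.1 * (f z * 'D_e phi z.2 + k z * phi z.2)).
  move=> bg; have g2 := cube_bounded_sqr bg; have [mg _] := bg.
  have := igD (ig_loc_sq sf mg g2 bD) (ig_loc_sq sk mg g2 bp).
  by congr (ig _ _); apply/funext => z; ring.
have mc : measurable_fun setT (fun z => f z * 'D_e phi z.2 + k z * phi z.2).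
  have [mf _] := sf; have [mk _] := sk; have [mD _] := bD; have [mp _] := bp.
  apply: measurable_funD; apply: measurable_funM => //.
    exact: (measurableT_comp mD measurable_snd).
  exact: (measurableT_comp mp measurable_snd).
pose w u := \int[leb3]_r (f (u, r) * 'D_e phi r + k (u, r) * phi r).
have mw : measurable_fun setT w.
  exact: (@measurable_par1 _ _ _ _ R leb3 (fun z => f z * 'D_e phi z.2 + k z * phi z.2) mc).
have aew (n : nat) : {ae leb3, forall u, ig leb3 (fun r => \1_(cube n%:R) u * (f (u, r) * 'D_e phi r + k (u, r) * phi r))}.
  exact: (rfub_ae1 (ic _ (cube_bounded_indic n))).
have aei : {ae leb3, forall u, ig leb3 (fun r => f (u, r) * 'D_e phi r + k (u, r) * phi r)}.
  apply: ae_mono (ae_foralln aew) => u hu.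
  have [n _ un] : (\bigcup_n cube n%:R) u by rewrite bigcup_cube.
  by have := hu n; congr (ig _ _); apply/funext => r; rewrite indicE mem_set// mul1r.
have eqw g : cube_bounded g -> {ae leb3, forall u,
    \int[leb3]_r (g u * (f (u, r) * 'D_e phi r + k (u, r) * phi r)) = g u * w u}.
  by move=> _; apply: ae_mono aei => u iu; rewrite rintZ.
apply: (ae_mono2 (fun u => @conj _ _) aei); apply: fundamental_lemma.
  apply: ig_cube_L1_loc3 => // n; have [mi _] := cube_bounded_indic n.
  apply: (ig_ae _ (eqw _ (cube_bounded_indic n))); first exact: measurable_funM.
  exact: (rfub_ig1 (ic _ (cube_bounded_indic n))).
move=> h th; have bh := cube_bounded_test th; have [mh _] := bh.
transitivity (\int[leb3]_u \int[leb3]_r (h u * (f (u, r) * 'D_e phi r + k (u, r) * phi r))).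
  apply: rint_ae.
  - exact: measurable_funM.
  - exact: (ig_meas (rfub_ig1 (ic _ bh))).
  by apply: ae_mono (eqw _ bh) => u ->; rewrite mulrC.
rewrite -(rfub1 (ic _ bh)).
have tT := test_tensor th tphi; have := W _ tT.
have i1 : ig leb6 (fun p => f p * (h p.1 * 'D_e phi p.2)).
  have := ig_loc_sq sf mh (cube_bounded_sqr bh) bD.
  by congr (ig _ _); apply/funext => z; ring.
have i2 : ig leb6 (fun p => k p * (h p.1 * phi p.2)).
  have := ig_loc_sq sk mh (cube_bounded_sqr bh) bp.
  by congr (ig _ _); apply/funext => z; ring.
have -> : (fun p => f p * 'D_(0, e) (fun p : R3 R * R3 R => h p.1 * phi p.2) p) =
    fun p => f p * (h p.1 * 'D_e phi p.2).
  by apply/funext => p; rewrite (derive_tensor _ _ th tphi).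
move/eqP; rewrite -subr_eq0 opprK -rintD// => /eqP e0; rewrite -[RHS]e0.
by apply: eq_Rintegral => z _; ring.
Qed.

End LocallySquareIntegrable.

(** * Differentiating a vanishing Gram kernel *)

Section WeakGram.
Context {R : realType}.
Variables (m : nat) (e : R3 R) (f k Q : 'I_m -> R3 R * R3 R -> R).
Hypothesis W : forall i, weak_derivative6 (f i) (k i) (0, e).
Hypothesis sf : forall i, loc_sq_kernel (f i).
Hypothesis sk : forall i, loc_sq_kernel (k i).
Hypothesis mQ : forall i, measurable_fun setT (Q i).
Hypothesis Q2 : {ae leb3, forall s, forall i, ig leb3 (fun u => Q i (u, s) ^+ 2)}.
Hypothesis fQ0 : {ae leb6, forall p, \sum_(i < m) \int[leb3]_u (f i (u, p.1) * Q i (u, p.2)) = 0}.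

(** For almost every fixed [s], integrating [f] against [Q(., s)] commutes with the weak derivative
    in the other variable. A function vanishing almost everywhere has zero weak derivative, and the
    fundamental lemma concludes. *)
Lemma weak_gram_eq0 :
  {ae leb6, forall p, \sum_(i < m) \int[leb3]_u (k i (u, p.1) * Q i (u, p.2)) = 0}.
Proof.
have mk i : measurable_fun setT (k i) by have [] := sk i.
have mf i : measurable_fun setT (f i) by have [] := sf i.
have mg (F : 'I_m -> R3 R * R3 R -> R) : (forall i, measurable_fun setT (F i)) ->
    measurable_fun setT (fun p => \sum_(i < m) \int[leb3]_u (F i (u, p.1) * Q i (u, p.2))).
  by move=> mF; apply: measurable_sum => i; exact: measurable_gram.
apply: ae2_ae_prod.
  by have := mg _ mk measurableT [set 0] (measurable_set1 _); rewrite setTI.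
apply: (ae_mono2 _ Q2 (ae_prod_ae2 fQ0)) => s q2 f0.
pose q i u := Q i (u, s).
have mq i : measurable_fun setT (q i) by exact: measurable_slice2.
have igF (F : 'I_m -> R3 R * R3 R -> R) i psi : (forall i, loc_sq_kernel (F i)) -> cube_bounded psi ->
    ig leb6 (fun z => F i z * q i z.1 * psi z.2).
  by move=> hF bpsi; exact: (ig_loc_sq (hF i) (mq i) (q2 i) bpsi).
have aeF (F : 'I_m -> R3 R * R3 R -> R) psi i : (forall i, loc_sq_kernel (F i)) ->
    {ae leb3, forall r, \int[leb3]_u (F i (u, r) * q i u * psi r) =
      (\int[leb3]_u (F i (u, r) * Q i (u, s))) * psi r}.
  move=> hF; apply: ae_mono (loc_sq_kernel_ae (hF i)) => r hr.
  rewrite mulrC -rintZ; last by apply: igM_sqr => //; apply: measurable_slice2; have [] := hF i.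
  by apply: eq_Rintegral => u _; rewrite mulrC.
have mG (F : 'I_m -> R3 R * R3 R -> R) i : (forall i, loc_sq_kernel (F i)) ->
    measurable_fun setT (fun r => \int[leb3]_u (F i (u, r) * Q i (u, s))).
  move=> hF; have [mFi _] := hF i.
  exact: (measurable_slice2 s (measurable_gram mFi (mQ i))).
have swap (F : 'I_m -> R3 R * R3 R -> R) psi : (forall i, loc_sq_kernel (F i)) -> cube_bounded psi ->
    ig leb3 (fun r => (\sum_(i < m) \int[leb3]_u (F i (u, r) * Q i (u, s))) * psi r) /\
    \int[leb3]_r ((\sum_(i < m) \int[leb3]_u (F i (u, r) * Q i (u, s))) * psi r) =
    \sum_(i < m) \int[leb6]_z (F i z * q i z.1 * psi z.2).
  move=> hF bpsi; have [mpsi _] := bpsi.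
  have i1 i : ig leb3 (fun r => (\int[leb3]_u (F i (u, r) * Q i (u, s))) * psi r).
    apply: (ig_ae _ (aeF F psi i hF)); first by apply: measurable_funM => //; exact: mG.
    exact: (rfub_ig2 (igF F i psi hF bpsi)).
  have e1 : (fun r => (\sum_(i < m) \int[leb3]_u (F i (u, r) * Q i (u, s))) * psi r) =
      fun r => \sum_(i < m) (\int[leb3]_u (F i (u, r) * Q i (u, s))) * psi r.
    by apply/funext => r; rewrite mulr_suml.
  rewrite e1; split; first exact: ig_sum.
  rewrite rint_sum//; apply: eq_bigr => i _.
  rewrite (rfub2 (igF F i psi hF bpsi)); apply: rint_ae.
  - by apply: measurable_funM => //; exact: mG.
  - exact: (ig_meas (rfub_ig2 (igF F i psi hF bpsi))).
  by apply: ae_mono (aeF F psi i hF) => r ->.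
apply: fundamental_lemma.
  apply: ig_cube_L1_loc3; first by apply: measurable_sum => i; exact: mG.
  move=> n; have [i1 _] := swap k _ sk (cube_bounded_indic n).
  by move: i1; congr (ig _ _); apply/funext => r; rewrite mulrC.
move=> phi tphi; have bp := cube_bounded_test tphi; have bD := cube_bounded_test (test_derive e tphi).
have [_ ->] := swap k phi sk bp; have [_ efD] := swap f _ sf bD.
have z0 : \sum_(i < m) \int[leb6]_z (f i z * q i z.1 * 'D_e phi z.2) = 0.
  rewrite -efD -[RHS](rint0 leb3); apply: rint_ae => //.
    by apply: measurable_funM; [apply: measurable_sum => i; exact: mG|exact: bD.1].
  by apply: ae_mono f0 => r /= ->; rewrite mul0r.
transitivity (\sum_(i < m) (\int[leb6]_z (f i z * q i z.1 * 'D_e phi z.2) +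
    \int[leb6]_z (k i z * q i z.1 * phi z.2))); first by rewrite big_split/= z0 add0r.
apply: big1 => i _.
have j1 := igF f i _ sf bD; have j2 := igF k i _ sk bp.
rewrite -rintD// (rfub1 (igD j1 j2))/= -[RHS](rint0 leb3); apply: rint_ae => //.
  exact: (ig_meas (rfub_ig1 (igD j1 j2))).
apply: ae_mono (weak6_slice (W i) (sf i) (sk i) tphi) => u [iu h0].
transitivity (\int[leb3]_r (q i u * (f i (u, r) * 'D_e phi r + k i (u, r) * phi r))).
  by apply: eq_Rintegral => r _ /=; ring.
by rewrite rintZ// h0 mulr0.
Qed.

End WeakGram.

(** * Independence of the factorization *)

Section KernelTools.
Context {R : realType}.
Implicit Types (f k : R3 R * R3 R -> R) (q : R3 R -> R) (G : R3 R * R3 R -> R[i]).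

(** The coefficients 1 and -1 are kept explicit because the four integrals come weighted by
    [times]. *)
Lemma balanceD (a b x y z : R) : 1 * a + 1 * b + -1 * x + -1 * y = 0 ->
  a + b = z -> x + y = z.
Proof. lra. Qed.

Lemma balanceB (a b x y z : R) : 1 * a + -1 * b + -1 * x + 1 * y = 0 ->
  a - b = z -> x - y = z.
Proof. lra. Qed.

Lemma balanceD0 (a b x y : R) : a + b = x + y ->
  1 * a + 1 * b + -1 * x + -1 * y = 0.
Proof. lra. Qed.

Lemma balanceB0 (a b x y : R) : a - b = x - y ->
  1 * a + -1 * b + -1 * x + 1 * y = 0.
Proof. lra. Qed.

Lemma sqr_sum_le (x y z t : R) :
  (x - y) ^+ 2 + (z + t) ^+ 2 <=
  (2 * x ^+ 2 + 2 * y ^+ 2) + (2 * z ^+ 2 + 2 * t ^+ 2).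
Proof. have := sqr_ge0 (x + y); have := sqr_ge0 (z - t); lra. Qed.

Lemma indicT1 d (T : measurableType d) (x : T) : \1_setT x = 1 :> R.
Proof. by rewrite indicT. Qed.

Lemma L2_setT d (T : measurableType d) (mu : {measure set T -> \bar R}) (F : T -> R[i]) :
  L2 mu setT F -> [/\ measurable_fun setT (fun x => complex.Re (F x)),
    measurable_fun setT (fun x => complex.Im (F x)),
    ig mu (fun x => complex.Re (F x) ^+ 2) & ig mu (fun x => complex.Im (F x) ^+ 2)].
Proof.
move=> /(L2_ig measurableT).
have -> : reK setT F = fun x => complex.Re (F x) by apply/funext => x; rewrite /reK indicT1 mul1r.
by have -> : imK setT F = fun x => complex.Im (F x) by apply/funext => x; rewrite /imK indicT1 mul1r.
Qed.

Lemma kernel_mulE G p : kernel_mul setT (kernel_adj G) G p =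
  ((\int[leb3]_u (complex.Re (G (u, p.1)) * complex.Re (G (u, p.2)) +
                  complex.Im (G (u, p.1)) * complex.Im (G (u, p.2)))) +i*
   (\int[leb3]_u (complex.Re (G (u, p.1)) * complex.Im (G (u, p.2)) -
                  complex.Im (G (u, p.1)) * complex.Re (G (u, p.2)))))%C.
Proof.
apply: complex_ext; apply: eq_Rintegral => u _; rewrite /kernel_adj/=.
  by case: (G (u, p.1)) (G (u, p.2)) => [? ?] [? ?] /=; ring.
by case: (G (u, p.1)) (G (u, p.2)) => [? ?] [? ?] /=; ring.
Qed.

Lemma ig_compact q (K : set (R3 R)) : compact K -> L1_loc3 q -> ig leb3 (fun r => \1_K r * q r).
Proof.
move=> cK lq; have [n Kn] := compact_sub_cube cK.
have := ig_indicM (compact_measurable3 cK) (L1_loc3_cube n%:R lq).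
congr (ig _ _); apply/funext => r; rewrite !indicE; have [rK|_] := boolP (r \in K); last by rewrite !mul0r.
have -> : r \in cube n%:R by rewrite inE; apply: Kn; move: rK; rewrite inE.
by rewrite !mul1r.
Qed.

Lemma sq_kernel_le f q q' : measurable_fun setT q' -> (forall r, q r <= q' r) ->
  sq_kernel f q -> sq_kernel f q'.
Proof. by move=> mq' h [mf mq f2 b]; split=> // r; exact: le_trans (b r) (h r). Qed.

Lemma sq_kernel_ig f q : sq_kernel f q -> ig leb3 q -> ig leb6 (fun z => f z ^+ 2).
Proof.
move=> [mf mq f2 b] iq; apply: (@ig_tonelli2' _ _ _ _ R leb3 leb3 _ q) => //.
  exact: measurable_funX.
apply: nearW => r /=; split; first exact: f2.
apply: le_trans (b r); rewrite le_eqVlt; apply/orP; left; apply/eqP.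
by apply: eq_Rintegral => u _; rewrite ger0_norm ?sqr_ge0.
Qed.

Lemma L1_loc6D f k : L1_loc6 f -> L1_loc6 k -> L1_loc6 (fun z => f z + k z).
Proof.
move=> lf lk; apply: ig_cube_L1_loc6; first by apply: measurable_funD; [case: lf|case: lk].
move=> n; have := igD (L1_loc6_cube n%:R n%:R lf) (L1_loc6_cube n%:R n%:R lk).
by congr (ig _ _); apply/funext => r; rewrite mulrDr.
Qed.

Lemma L1_loc6Z (c : R) f : L1_loc6 f -> L1_loc6 (fun z => c * f z).
Proof.
move=> lf; apply: ig_cube_L1_loc6; first by apply: measurable_funM => //; case: lf.
move=> n; have := igZ c (L1_loc6_cube n%:R n%:R lf).
by congr (ig _ _); apply/funext => r; rewrite mulrCA.
Qed.

Lemma L1_loc6_sum (I : Type) (s : seq I) (w : I -> R3 R * R3 R -> R) :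
  (forall i, L1_loc6 (w i)) -> L1_loc6 (fun z => \sum_(i <- s) w i z).
Proof.
move=> h; elim: s => [|i s IH].
  rewrite (_ : (fun z => _) = fun=> 0); last by apply/funext => z; rewrite big_nil.
  apply: (L1_loc6_le (measurable_cst _) (L1_loc3_cst 0) (L1_loc3_cst 0)) => z.
  by rewrite normr0 addr0 mul0r.
rewrite (_ : (fun z => _) = fun z => w i z + \sum_(i <- s) w i z); last first.
  by apply/funext => z; rewrite big_cons.
exact: L1_loc6D.
Qed.

Definition times (a : R) f (z : R3 R * R3 R) : R := a * f z.

Lemma weak6Z (c : R) f k v : weak_derivative6 f k v ->
  weak_derivative6 (times c f) (times c k) v.
Proof.
move=> [lf lk W]; split; [exact: L1_loc6Z..|move=> phi tphi].
have i1 := ig_L1_loc_test6 lf (test_derive v tphi); have i2 := ig_L1_loc_test6 lk tphi.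
transitivity (\int[leb6]_p (c * (f p * 'D_v phi p))).
  by apply: eq_Rintegral => p _; rewrite mulrA.
rewrite rintZ// W// mulrN -rintZ//; congr (- _).
by apply: eq_Rintegral => p _; rewrite mulrA.
Qed.

Lemma loc_sqZ (c : R) f : loc_sq_kernel f -> loc_sq_kernel (times c f).
Proof.
move=> [mf h]; split; first exact: measurable_funM.
move=> n; have := igZ (c ^+ 2) (h n); congr (ig _ _); apply/funext => z; rewrite /times; ring.
Qed.

(** Puts the two parts of the model factor and those of an arbitrary factor into one family, so that
    the equality of two Gram kernels becomes the vanishing of a single sum, as [gram_diagonal] and
    [weak_gram_eq0] require. *)
Definition four (f1 f2 f3 f4 : R3 R * R3 R -> R) (i : 'I_4) : R3 R * R3 R -> R :=
  nth f1 [:: f1; f2; f3; f4] i.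

Lemma four_all (P : (R3 R * R3 R -> R) -> Prop) f1 f2 f3 f4 :
  P f1 -> P f2 -> P f3 -> P f4 -> forall i, P (four f1 f2 f3 f4 i).
Proof. by move=> h1 h2 h3 h4 [[|[|[|[|]]]]]. Qed.

Lemma four_all2 (P : (R3 R * R3 R -> R) -> (R3 R * R3 R -> R) -> Prop) f1 f2 f3 f4 k1 k2 k3 k4 :
  P f1 k1 -> P f2 k2 -> P f3 k3 -> P f4 k4 ->
  forall i, P (four f1 f2 f3 f4 i) (four k1 k2 k3 k4 i).
Proof. by move=> h1 h2 h3 h4 [[|[|[|[|]]]]]. Qed.

Lemma four_sum (w : (R3 R * R3 R -> R) -> (R3 R * R3 R -> R) -> R) f1 f2 f3 f4 k1 k2 k3 k4 :
  \sum_(i < 4) w (four f1 f2 f3 f4 i) (four k1 k2 k3 k4 i) = w f1 k1 + w f2 k2 + w f3 k3 + w f4 k4.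
Proof. by rewrite !big_ord_recl big_ord0 addr0 !addrA. Qed.

Definition sq_slices f := {ae leb3, forall r, ig leb3 (fun u => f (u, r) ^+ 2)}.

Lemma four_ae f1 f2 f3 f4 : sq_slices f1 -> sq_slices f2 -> sq_slices f3 -> sq_slices f4 ->
  {ae leb3, forall r, forall i, ig leb3 (fun u => four f1 f2 f3 f4 i (u, r) ^+ 2)}.
Proof.
move=> h1 h2 h3 h4.
have h12 := ae_mono2 (fun r => @conj _ _) h1 h2.
have h34 := ae_mono2 (fun r => @conj _ _) h3 h4.
apply: (ae_mono2 _ h12 h34) => r [a b] [c e].
exact: (@four_all (fun f => ig leb3 (fun u => f (u, r) ^+ 2))).
Qed.

Lemma sq_slicesZ (c : R) f : sq_slices f -> sq_slices (times c f).
Proof.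
apply: ae_mono => r i; have := igZ (c ^+ 2) i; congr (ig _ _); apply/funext => u; rewrite /times; ring.
Qed.

Lemma four_gram a1 a2 a3 a4 f1 f2 f3 f4 k1 k2 k3 k4 r s :
  (forall i, measurable_fun setT (four f1 f2 f3 f4 i)) ->
  (forall i, measurable_fun setT (four k1 k2 k3 k4 i)) ->
  (forall i, ig leb3 (fun u => four f1 f2 f3 f4 i (u, r) ^+ 2)) ->
  (forall i, ig leb3 (fun u => four k1 k2 k3 k4 i (u, s) ^+ 2)) ->
  let I f k := \int[leb3]_u (f (u, r) * k (u, s)) in
  [/\ \sum_(i < 4) I (four (times a1 f1) (times a2 f2) (times a3 f3) (times a4 f4) i) (four k1 k2 k3 k4 i) =
        a1 * I f1 k1 + a2 * I f2 k2 + a3 * I f3 k3 + a4 * I f4 k4,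
      \int[leb3]_u (f1 (u, r) * k1 (u, s) + f2 (u, r) * k2 (u, s)) = I f1 k1 + I f2 k2,
      \int[leb3]_u (f1 (u, r) * k1 (u, s) - f2 (u, r) * k2 (u, s)) = I f1 k1 - I f2 k2,
      \int[leb3]_u (f3 (u, r) * k3 (u, s) + f4 (u, r) * k4 (u, s)) = I f3 k3 + I f4 k4 &
      \int[leb3]_u (f3 (u, r) * k3 (u, s) - f4 (u, r) * k4 (u, s)) = I f3 k3 - I f4 k4].
Proof.
move=> mf mk i2 j2 I.
have i i : ig leb3 (fun u => four f1 f2 f3 f4 i (u, r) * four k1 k2 k3 k4 i (u, s)).
  by apply: igM_sqr => //; exact: measurable_slice2.
have i1 := i (@Ordinal 4 0 isT); have i2' := i (@Ordinal 4 1 isT).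
have i3 := i (@Ordinal 4 2 isT); have i4 := i (@Ordinal 4 3 isT).
rewrite /four/= in i1 i2' i3 i4.
split; [|exact: rintD|exact: rintB|exact: rintD|exact: rintB].
rewrite (four_sum I) /I -(rintZ a1 i1) -(rintZ a2 i2') -(rintZ a3 i3) -(rintZ a4 i4).
by congr (_ + _ + _ + _); apply: eq_Rintegral => u _; rewrite /times mulrA.
Qed.

Lemma measurable_times a f : measurable_fun setT f -> measurable_fun setT (times a f).
Proof. by move=> mf; exact: measurable_funM. Qed.

End KernelTools.

(** * The density matrix built from a pair of real kernels *)

Section Model.
Context {R : realType}.
Variables (rho : R3 R -> R) (j : 'I_3 -> R3 R -> R).
Variables (A B : R3 R * R3 R -> R) (dA dB : 'I_3 -> R3 R * R3 R -> R) (c : R).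
Hypothesis irho : ig leb3 rho.
Hypothesis sA : sq_kernel A rho.
Hypothesis sB : sq_kernel B rho.
Hypothesis bAB : forall z, A z ^+ 2 <= c * rho z.2 /\ B z ^+ 2 <= c * rho z.2.
Hypothesis slAB : forall a, sliced_derivative (basis3 a) A (dA a) /\
  sliced_derivative (basis3 a) B (dB a).
Hypothesis sdAB : forall a, exists q, [/\ L1_loc3 q, sq_kernel (dA a) q & sq_kernel (dB a) q].
Hypothesis bdAB : forall a, exists2 w, L1_loc3 w & forall z, dA a z ^+ 2 + dB a z ^+ 2 <= w z.2.
Hypothesis massAB : forall r,
  \int[leb3]_u (A (u, r) * A (u, r) + B (u, r) * B (u, r)) = rho r.
Hypothesis currentAB : forall a r,
  \int[leb3]_u (dA a (u, r) * B (u, r) - dB a (u, r) * A (u, r)) = j a r.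
Hypothesis boundAB : forall y : R3 R -> R, measurable_fun setT y -> ig leb3 (fun r => y r ^+ 2) ->
  forall f, f = A \/ f = B -> ig leb3 (fun u => (\int[leb3]_r (f (u, r) * y r)) ^+ 2) /\
    \int[leb3]_u ((\int[leb3]_r (f (u, r) * y r)) ^+ 2) <= 2^-1 * \int[leb3]_r (y r ^+ 2).

Definition model_G (z : R3 R * R3 R) : R[i] := (A z +i* B z)%C.
Definition model_V a (z : R3 R * R3 R) : R[i] := (dA a z +i* dB a z)%C.
Definition model_D := gram_kernel (fun _ : 'I_1 => A) (fun _ : 'I_1 => B).
Definition model_T := gram_kernel dA dB.

Lemma model_D_mul p : model_D p = kernel_mul setT (kernel_adj model_G) model_G p.
Proof. by rewrite kernel_mulE /model_D /gram_kernel /gram_re /gram_im !big_ord1. Qed.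

Let mA : measurable_fun setT A. Proof. by case: sA. Qed.
Let mB : measurable_fun setT B. Proof. by case: sB. Qed.

Lemma factorization_parts G : factorization model_D G ->
  [/\ measurable_fun setT (fun z => complex.Re (G z)), measurable_fun setT (fun z => complex.Im (G z)),
      ig leb6 (fun z => complex.Re (G z) ^+ 2), ig leb6 (fun z => complex.Im (G z) ^+ 2) &
      {ae leb6, forall p,
        \int[leb3]_u (A (u, p.1) * A (u, p.2) + B (u, p.1) * B (u, p.2)) =
        \int[leb3]_u (complex.Re (G (u, p.1)) * complex.Re (G (u, p.2)) +
                      complex.Im (G (u, p.1)) * complex.Im (G (u, p.2))) /\
        \int[leb3]_u (A (u, p.1) * B (u, p.2) - B (u, p.1) * A (u, p.2)) =
        \int[leb3]_u (complex.Re (G (u, p.1)) * complex.Im (G (u, p.2)) -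
                      complex.Im (G (u, p.1)) * complex.Re (G (u, p.2)))}].
Proof.
move=> [/L2_setT[m1 m2 i1 i2] h].
split; [exact: m1|exact: m2|exact: i1|exact: i2|apply: ae_mono h => p].
by rewrite model_D_mul !kernel_mulE => -[].
Qed.

Lemma sq_slices_model : sq_slices A /\ sq_slices B.
Proof. by split; apply: nearW => r; [case: sA|case: sB]. Qed.

Lemma sq_slices_ig (f : R3 R * R3 R -> R) : ig leb6 (fun z => f z ^+ 2) -> sq_slices f.
Proof. by move=> i; exact: (rfub_ae2 i). Qed.

(** The real parts of the two factorizations agree almost everywhere on R^6, which says nothing on
    the diagonal, a null set; [gram_diagonal] transfers the equality there. *)
Lemma model_density_unique G : factorization model_D G ->
  {ae leb3, forall r, kernel_mul setT (kernel_adj G) G (r, r) = (rho r)%:C%C}.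
Proof.
move=> /factorization_parts[m1 m2 i1 i2 h].
pose f (z : R3 R * R3 R) := complex.Re (G z); pose g (z : R3 R * R3 R) := complex.Im (G z).
have [slA slB] := sq_slices_model.
have slf : sq_slices f by exact: sq_slices_ig.
have slg : sq_slices g by exact: sq_slices_ig.
have mfg : forall i, measurable_fun setT (four A B f g i).
  by apply: (@four_all _ (fun F => measurable_fun setT F)).
have P2 := four_ae (sq_slicesZ 1 slA) (sq_slicesZ 1 slB) (sq_slicesZ (-1) slf) (sq_slicesZ (-1) slg).
have Q2 := four_ae slA slB slf slg.
have mP : forall i, measurable_fun setT (four (times 1 A) (times 1 B) (times (-1) f) (times (-1) g) i).
  by apply: (@four_all _ (fun F => measurable_fun setT F)); exact: measurable_times.
have sumE r s := @four_gram R 1 1 (-1) (-1) A B f g A B f g r s mfg mfg.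
have e0 : {ae leb6, forall p, \sum_(i < 4) \int[leb3]_u
    (four (times 1 A) (times 1 B) (times (-1) f) (times (-1) g) i (u, p.1) * four A B f g i (u, p.2)) = 0}.
  apply: (ae_mono2 _ h (ae_mono2 (fun p => @conj _ _) (ae_fst Q2) (ae_snd Q2))) => -[r s] [hrs _] [hr hs].
  have [-> h1 _ h2 _] := sumE r s hr hs.
  exact/balanceD0/(etrans (esym h1) (etrans hrs h2)).
have dg := gram_diagonal mP mfg P2 Q2 e0.
apply: (ae_mono2 _ dg Q2) => r d0 q2; rewrite kernel_mulE/=.
apply: complex_ext => /=; last first.
  by rewrite -[RHS](rint0 leb3); apply: eq_Rintegral => u _; ring.
have [e h1 _ h2 _] := sumE r r q2 q2.
have d1 := etrans (esym e) d0; have h3 := etrans (esym h1) (massAB r).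
exact: (etrans h2 (balanceD d1 h3)).
Qed.

(** The imaginary parts of the two factorizations are compared: [weak_gram_eq0] differentiates their
    difference in the first argument, and [gram_diagonal] then restricts the result to the
    diagonal. *)
Lemma model_current_unique G V a : regular_factorization model_D G V ->
  {ae leb3, forall r, complex.Re (complex_current G V a r) = j a r}.
Proof.
move=> [/factorization_parts[m1 m2 i1 i2 h] W LV].
pose f (z : R3 R * R3 R) := complex.Re (G z); pose g (z : R3 R * R3 R) := complex.Im (G z).
pose vf (z : R3 R * R3 R) := complex.Re (V a z); pose vg (z : R3 R * R3 R) := complex.Im (V a z).
have [Wf Wg] := W a.
have [slA slB] := sq_slices_model.
have slf : sq_slices f by exact: sq_slices_ig.
have slg : sq_slices g by exact: sq_slices_ig.
have mvf : measurable_fun setT vf by have [_ [m _] _] := Wf.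
have mvg : measurable_fun setT vg by have [_ [m _] _] := Wg.
have lV : loc_sq_kernel vf /\ loc_sq_kernel vg.
  suff aux (n : nat) : ig leb6 (fun z => \1_(cube n%:R) z.2 * vf z ^+ 2) /\
      ig leb6 (fun z => \1_(cube n%:R) z.2 * vg z ^+ 2).
    by split; split=> // n; have [] := aux n.
  have mC : measurable (setT `*` cube n%:R : set (R3 R * R3 R)).
    by apply: measurableX => //; exact: measurable_cube.
  have [_ _ k1 k2] := L2_ig mC (LV a _ (@compact_cube R n%:R)).
  have ci (z : R3 R * R3 R) : \1_(setT `*` cube n%:R) z = \1_(cube n%:R) z.2 :> R.
    by rewrite !indicE in_setX in_setT.
  have c2 (z : R3 R * R3 R) (x : R) : (\1_(setT `*` cube n%:R) z * x) ^+ 2 = \1_(cube n%:R) z.2 * x ^+ 2.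
    by rewrite ci exprMn indicE; case: (_ \in _); rewrite ?expr1n ?expr0n.
  split; [move: k1|move: k2]; congr (ig _ _); apply/funext => z; exact: c2.
have [lvf lvg] := lV.
have [q [lq sdA sdB]] := sdAB a.
have [mdA _ _ _] := sdA; have [mdB _ _ _] := sdB.
have ldA := sq_kernel_loc sdA lq; have ldB := sq_kernel_loc sdB lq.
have lA := sq_kernel_loc sA (ig_L1_loc3 irho); have lB := sq_kernel_loc sB (ig_L1_loc3 irho).
have lf := ig_sq_loc m1 i1; have lg := ig_sq_loc m2 i2.
have [slAd slBd] := slAB a.
have WA := sliced_weak6 slAd; have WB := sliced_weak6 slBd.
have mF : forall i, measurable_fun setT (four A B f g i).
  by apply: (@four_all _ (fun F => measurable_fun setT F)).
have mQ : forall i, measurable_fun setT (four B A g f i).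
  by apply: (@four_all _ (fun F => measurable_fun setT F)).
have mD : forall i, measurable_fun setT (four (dA a) (dB a) vf vg i).
  by apply: (@four_all _ (fun F => measurable_fun setT F)).
have Q2 := four_ae slB slA slg slf.
have F2 := four_ae slA slB slf slg.
have D2 := four_ae (loc_sq_kernel_ae ldA) (loc_sq_kernel_ae ldB) (loc_sq_kernel_ae lvf) (loc_sq_kernel_ae lvg).
have tD2 := four_ae (sq_slicesZ 1 (loc_sq_kernel_ae ldA)) (sq_slicesZ (-1) (loc_sq_kernel_ae ldB))
  (sq_slicesZ (-1) (loc_sq_kernel_ae lvf)) (sq_slicesZ 1 (loc_sq_kernel_ae lvg)).
have mtD : forall i, measurable_fun setT (four (times 1 (dA a)) (times (-1) (dB a)) (times (-1) vf) (times 1 vg) i).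
  by apply: (@four_all _ (fun F => measurable_fun setT F)); exact: measurable_times.
have Wi := @four_all2 _ (fun F K => weak_derivative6 F K (0, basis3 a)) _ _ _ _ _ _ _ _
  (weak6Z 1 WA) (weak6Z (-1) WB) (weak6Z (-1) Wf) (weak6Z 1 Wg).
have li := @four_all _ (fun F => loc_sq_kernel F) _ _ _ _ (loc_sqZ 1 lA) (loc_sqZ (-1) lB) (loc_sqZ (-1) lf) (loc_sqZ 1 lg).
have ldi := @four_all _ (fun F => loc_sq_kernel F) _ _ _ _ (loc_sqZ 1 ldA) (loc_sqZ (-1) ldB) (loc_sqZ (-1) lvf) (loc_sqZ 1 lvg).
have e0 : {ae leb6, forall p, \sum_(i < 4) \int[leb3]_u
    (four (times 1 A) (times (-1) B) (times (-1) f) (times 1 g) i (u, p.1) * four B A g f i (u, p.2)) = 0}.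
  apply: (ae_mono2 _ h (ae_mono2 (fun p => @conj _ _) (ae_fst F2) (ae_snd Q2))) => -[r s] [_ hrs] [hr hs].
  have [-> _ h1 _ h2] := @four_gram R 1 (-1) (-1) 1 A B f g B A g f r s mF mQ hr hs.
  exact/balanceB0/(etrans (esym h1) (etrans hrs h2)).
have e1 := weak_gram_eq0 Wi li ldi mQ Q2 e0.
have dg := gram_diagonal mtD mQ tD2 Q2 e1.
apply: (ae_mono2 _ dg (ae_mono2 (fun p => @conj _ _) D2 Q2)) => r d0 [d2 q2].
have [e _ h1 _ h2] := @four_gram R 1 (-1) (-1) 1 (dA a) (dB a) vf vg B A g f r r mD mQ d2 q2.
(* The factor [- i] turns the imaginary part of [V^* G] into the real part of the current. *)
have -> : complex.Re (complex_current G V a r) = \int[leb3]_u (vf (u, r) * g (u, r) - vg (u, r) * f (u, r)).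
  apply: eq_Rintegral => u _; rewrite /vf /vg /f /g.
  by case: (V a (u, r)) (G (u, r)) => [? ?] [? ?] /=; ring.
have d1 := etrans (esym e) d0; have h3 := etrans (esym h1) (currentAB a r).
exact: (etrans h2 (balanceB d1 h3)).
Qed.

Let mT : measurable [set: R3 R] := measurableT.

Let iqT : ig leb3 (fun r => \1_setT r * rho r).
Proof. by move: irho; congr (ig _ _); apply/funext => r; rewrite indicT1 mul1r. Qed.

Lemma ig_slice_sqr (f : R3 R * R3 R -> R) u : measurable_fun setT f ->
  (forall z, f z ^+ 2 <= c * rho z.2) -> ig leb3 (fun r => f (u, r) ^+ 2).
Proof.
move=> mf h; apply: (ig_le _ _ (igZ c irho)) => [|r].
  by apply: measurable_funX; exact: measurable_slice1.
by rewrite ger0_norm ?sqr_ge0//; exact: (h (u, r)).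
Qed.

Let slA (a : 'I_1) u : ig leb3 (fun r => \1_setT r * A (u, r) ^+ 2).
Proof.
have := ig_slice_sqr u mA (fun z => (bAB z).1).
by congr (ig _ _); apply/funext => r; rewrite indicT1 mul1r.
Qed.

Let slB (a : 'I_1) u : ig leb3 (fun r => \1_setT r * B (u, r) ^+ 2).
Proof.
have := ig_slice_sqr u mB (fun z => (bAB z).2).
by congr (ig _ _); apply/funext => r; rewrite indicT1 mul1r.
Qed.

Let sA1 (a : 'I_1) : sq_kernel A rho. Proof. exact: sA. Qed.
Let sB1 (a : 'I_1) : sq_kernel B rho. Proof. exact: sB. Qed.

(** The form is the squared norm of [(A + i B)(x + i y)]. By [sqr_sum_le] it is at most twice the
    sum of the four squared norms of [A] and [B] applied to [x] and [y]; with the bound 1/2 on each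
    this is twice the squared norm of [phi]. *)
Lemma model_pauli phi : L2 leb3 setT phi ->
  0 <= kernel_form setT model_D phi <= 2 * inner setT phi phi.
Proof.
move=> Lphi; rewrite (kernel_formE mT sA1 sB1 iqT slA slB Lphi) big_ord1.
have [mx my ix iy] := L2_ig mT Lphi.
have -> : inner setT phi phi = ((\int[leb3]_r (reK setT phi r ^+ 2 + imK setT phi r ^+ 2)) +i* 0)%C.
  apply: (etrans (cinnerE leb3 mT phi phi)); apply: complex_ext => /=.
    by apply: eq_Rintegral => r _; rewrite /wRe !expr2.
  by rewrite -[RHS](rint0 leb3); apply: eq_Rintegral => r _; rewrite /wIm mulrC subrr.
rewrite mulr_natl mulr2n !lecE/= !addr0 !eqxx/=.
apply/andP; split; first by apply: rint_ge0 => u; rewrite addr_ge0 ?sqr_ge0.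
set x := reK setT phi; set y := imK setT phi.
have sl (f : R3 R * R3 R -> R) (w : R3 R -> R) u : f = A \/ f = B -> measurable_fun setT w ->
    ig leb3 (fun r => w r ^+ 2) -> ig leb3 (fun r => f (u, r) * w r).
  move=> hf mw iw; have mf : measurable_fun setT f by case: hf => ->.
  apply: igM_sqr => //; first exact: measurable_slice1.
  by case: hf => ->; apply: ig_slice_sqr => // z; have [] := bAB z.
have [i1 b1] := boundAB mx ix (or_introl erefl); have [i2 b2] := boundAB my iy (or_introl erefl).
have [i3 b3] := boundAB mx ix (or_intror erefl); have [i4 b4] := boundAB my iy (or_intror erefl).
pose I (f : R3 R * R3 R -> R) w u := \int[leb3]_r (f (u, r) * w r).
have hF u : formRe (fun _ : 'I_1 => A) (fun=> B) setT phi ord0 u = I A x u - I B y u.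
  by rewrite -rintB//; apply: sl => //; [left|right].
have hH u : formIm (fun _ : 'I_1 => A) (fun=> B) setT phi ord0 u = I A y u + I B x u.
  by rewrite -rintD//; apply: sl => //; [left|right].
have [_ _ j0 _ _] := gram_act mT sA1 sB1 iqT slA slB Lphi ord0 (ltn0Sn 0).
have jj := igD (igD (igZ 2 i1) (igZ 2 i4)) (igD (igZ 2 i2) (igZ 2 i3)).
apply: (le_trans (rint_le j0 jj _)).
  move=> u; rewrite hF hH /I.
  exact: sqr_sum_le.
rewrite (rintD (igD (igZ 2 i1) (igZ 2 i4)) (igD (igZ 2 i2) (igZ 2 i3))).
rewrite (rintD (igZ 2 i1) (igZ 2 i4)) (rintD (igZ 2 i2) (igZ 2 i3)).
rewrite (rintZ 2 i1) (rintZ 2 i2) (rintZ 2 i3) (rintZ 2 i4) (rintD ix iy).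
move: b1 b2 b3 b4.
move: (\int[leb3]_u _) (\int[leb3]_u _) (\int[leb3]_u _) (\int[leb3]_u _) (\int[leb3]_u _) (\int[leb3]_u _).
by move=> a1 a2 a3 a4 a5 a6; lra.
Qed.

Lemma model_rdm1 N : \int[leb3]_r rho r = N%:R -> rdm1 N model_D.
Proof.
move=> hN; split.
- exact: (gram_kernel_trace_class mT sA1 sB1 iqT slA slB).
- apply: nearW => p.
  exact: (esym (congr1 (fun F => F p) (gram_kernel_adj sA1 sB1))).
- exact: model_pauli.
have := gram_kernel_has_trace mT sA1 sB1 iqT slA slB.
congr has_trace; apply: complex_ext; rewrite ?Re_nat ?Im_nat//= -hN.
apply: eq_Rintegral => r _; rewrite indicT1 mul1r /mass big_ord1 -massAB.
by apply: eq_Rintegral => u _; rewrite !expr2.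
Qed.

Lemma factorization_model : factorization model_D model_G.
Proof.
split; last by apply: nearW => p; exact: model_D_mul.
have i := igD (sq_kernel_ig sA irho) (sq_kernel_ig sB irho).
have eR : reK setT model_G = A by apply/funext => z; rewrite /reK indicT1 mul1r.
have eI : imK setT model_G = B by apply/funext => z; rewrite /imK indicT1 mul1r.
by apply/(L2P _ measurableT); rewrite eR eI.
Qed.

Lemma model_has_density : has_density model_D rho.
Proof. by split; [exists model_G; exact: factorization_model|exact: model_density_unique]. Qed.

(** The value [s = 1] serves for the real part of the kernel and [s = -1] for the imaginary part. *)
Lemma weak_div12_gram (f1 f2 g1 g2 : R3 R * R3 R -> R) (k1 k2 l1 l2 : 'I_3 -> R3 R * R3 R -> R)
    (q1 q2 : R3 R -> R) (s : R) :
  (forall a, [/\ sliced_derivative (basis3 a) f1 (k1 a), sliced_derivative (basis3 a) f2 (k2 a),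
     sliced_derivative (basis3 a) g1 (l1 a) & sliced_derivative (basis3 a) g2 (l2 a)]) ->
  [/\ sq_kernel f1 q1, sq_kernel f2 q1, sq_kernel g1 q1 & sq_kernel g2 q1] ->
  (forall a, [/\ sq_kernel (k1 a) q2, sq_kernel (k2 a) q2, sq_kernel (l1 a) q2 & sq_kernel (l2 a) q2]) ->
  L1_loc3 q1 -> L1_loc3 q2 ->
  weak_div12 (fun p => gram f1 f2 p + s * gram g1 g2 p)
    (fun p => \sum_(a < 3) (gram (k1 a) (k2 a) p + s * gram (l1 a) (l2 a) p)).
Proof.
move=> hs [sf1 sf2 sg1 sg2] hk lq1 lq2.
have Lf : L1_loc6 (gram f1 f2) by exact: (L1_loc6_gram sf1 sf2 lq1 lq1).
have Lg : L1_loc6 (gram g1 g2) by exact: (L1_loc6_gram sg1 sg2 lq1 lq1).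
have Lk a : L1_loc6 (gram (k1 a) (k2 a)).
  by have [h1 h2 _ _] := hk a; exact: (L1_loc6_gram h1 h2 lq2 lq2).
have Ll a : L1_loc6 (gram (l1 a) (l2 a)).
  by have [_ _ h1 h2] := hk a; exact: (L1_loc6_gram h1 h2 lq2 lq2).
split.
- by apply: L1_loc6D => //; exact: L1_loc6Z.
- by apply: L1_loc6_sum => a; apply: L1_loc6D => //; exact: L1_loc6Z.
move=> phi tphi.
have tDD a : test_function ('D_(basis3 a, 0) ('D_(0, basis3 a) phi)).
  by apply: test_derive; exact: test_derive.
have if1 a := ig_L1_loc_test6 Lf (tDD a); have ig1 a := ig_L1_loc_test6 Lg (tDD a).
have ik a := ig_L1_loc_test6 (Lk a) tphi; have il a := ig_L1_loc_test6 (Ll a) tphi.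
transitivity (\int[leb6]_p \sum_(a < 3)
    (gram f1 f2 p * 'D_(basis3 a, 0) ('D_(0, basis3 a) phi) p +
     s * (gram g1 g2 p * 'D_(basis3 a, 0) ('D_(0, basis3 a) phi) p))).
  by apply: eq_Rintegral => p _; rewrite mulr_sumr; apply: eq_bigr => a _; ring.
rewrite rint_sum => [|a]; last exact: (igD (if1 a) (igZ s (ig1 a))).
transitivity (\int[leb6]_p \sum_(a < 3)
    (gram (k1 a) (k2 a) p * phi p + s * (gram (l1 a) (l2 a) p * phi p))); last first.
  by apply: eq_Rintegral => p _; rewrite mulr_suml; apply: eq_bigr => a _; ring.
rewrite rint_sum => [|a]; last exact: (igD (ik a) (igZ s (il a))).
apply: eq_bigr => a _.
rewrite (rintD (if1 a) (igZ s (ig1 a))) (rintZ s (ig1 a)) (rintD (ik a) (igZ s (il a))) (rintZ s (il a)).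
have [s1 s2 s3 s4] := hs a; have [h1 h2 h3 h4] := hk a.
congr (_ + _ * _).
  exact: (gram_div12 s1 s2 sf1 sf2 h1 h2 lq1 lq2 tphi).
exact: (gram_div12 s3 s4 sg1 sg2 h3 h4 lq1 lq2 tphi).
Qed.

Lemma common_bound : exists q, [/\ L1_loc3 q, (forall a, sq_kernel (dA a) q) &
  (forall a, sq_kernel (dB a) q)].
Proof.
have [q hq] := choice sdAB.
have lq : L1_loc3 (fun r => \sum_(a < 3) q a r) by apply: L1_loc3_sum => a; have [] := hq a.
have le a r : q a r <= \sum_(b < 3) q b r.
  rewrite (bigD1 a)//= lerDl; apply: sumr_ge0 => b _.
  by have [_ h _] := hq b; exact: (sq_kernel_ge0 r h).
exists (fun r => \sum_(a < 3) q a r); split=> // a.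
  by have [_ h _] := hq a; exact: (sq_kernel_le lq.1 (le a) h).
by have [_ _ h] := hq a; exact: (sq_kernel_le lq.1 (le a) h).
Qed.

(** Differentiating under the integral in both arguments turns [D = G^dagger * G] into the sum over
    [a] of [V_a^dagger * V_a]. This is again a Gram kernel, hence trace-class on every compact set,
    where its mass is finite. *)
Lemma model_kinetic : locally_finite_kinetic_energy model_D.
Proof.
have [q [lq sdA sdB]] := common_bound.
have lr := ig_L1_loc3 irho.
exists model_T.
  split.
    have := @weak_div12_gram A A B B dA dA dB dB rho q 1
      (fun a => And4 (slAB a).1 (slAB a).1 (slAB a).2 (slAB a).2) (And4 sA sA sB sB)
      (fun a => And4 (sdA a) (sdA a) (sdB a) (sdB a)) lr lq.
    congr weak_div12; apply/funext => p.
      by rewrite /= (gram_reE sA1 sB1) big_ord1 mul1r.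
    by rewrite /= (gram_reE sdA sdB); apply: eq_bigr => a _; rewrite mul1r.
  have := @weak_div12_gram A B B A dA dB dB dA rho q (-1)
    (fun a => And4 (slAB a).1 (slAB a).2 (slAB a).2 (slAB a).1) (And4 sA sB sB sA)
    (fun a => And4 (sdA a) (sdB a) (sdB a) (sdA a)) lr lq.
  congr weak_div12; apply/funext => p.
    by rewrite /= (gram_imE sA1 sB1) big_ord1 mulN1r.
  by rewrite /= (gram_imE sdA sdB); apply: eq_bigr => a _; rewrite mulN1r.
move=> K cK; have mK := compact_measurable3 cK.
have sl (f : R3 R * R3 R -> R) a u : measurable_fun setT f ->
    (forall z, f z ^+ 2 <= dA a z ^+ 2 + dB a z ^+ 2) -> ig leb3 (fun r => \1_K r * f (u, r) ^+ 2).
  move=> mf h; have [w lw hw] := bdAB a; apply: ig_compact => //.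
  apply: (L1_loc3_le _ lw) => [|r]; first by apply: measurable_funX; exact: measurable_slice1.
  by rewrite ger0_norm ?sqr_ge0//; apply: le_trans (h _) (hw _).
apply: (gram_kernel_trace_class mK sdA sdB (ig_compact cK lq)) => a u.
  by apply: (sl _ a) => [|z]; [case: (sdA a)|rewrite lerDl sqr_ge0].
by apply: (sl _ a) => [|z]; [case: (sdB a)|rewrite lerDr sqr_ge0].
Qed.

Lemma regular_factorization_model : regular_factorization model_D model_G model_V.
Proof.
split; first exact: factorization_model.
  by move=> a; have [h1 h2] := slAB a; split; exact: sliced_weak6.
move=> a K cK; have mK := compact_measurable3 cK.
have [q [lq sdA sdB]] := sdAB a; have [mdA _ _ _] := sdA; have [mdB _ _ _] := sdB.
have [n Kn] := compact_sub_cube cK.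
have [_ lA] := sq_kernel_loc sdA lq; have [_ lB] := sq_kernel_loc sdB lq.
have mTK : measurable (setT `*` K : set (R3 R * R3 R)) by exact: measurableX.
have mi : measurable_fun setT (\1_(setT `*` K) : R3 R * R3 R -> R) by exact: measurable_indic.
have mRe : measurable_fun setT (reK (setT `*` K) (model_V a)) by exact: measurable_funM.
have mIm : measurable_fun setT (imK (setT `*` K) (model_V a)) by exact: measurable_funM.
apply/(L2P _ mTK); split=> //.
apply: (ig_le _ _ (igD (lA n) (lB n))) => [|z].
  by apply: measurable_funD; exact: measurable_funX.
rewrite ger0_norm ?addr_ge0 ?sqr_ge0// sqK -mulrDr; apply: ler_wpM2r.
  by rewrite addr_ge0 ?sqr_ge0.
rewrite !indicE in_setX in_setT/= ler_nat; have [zK|//] := boolP (z.2 \in K).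
by rewrite mem_set//; apply: Kn; move: zK; rewrite inE.
Qed.

Lemma model_paramagnetic_current : has_paramagnetic_current model_D j.
Proof.
split; first exact: model_kinetic.
  by exists model_G, model_V; exact: regular_factorization_model.
by move=> G V rf a; exact: model_current_unique.
Qed.

End Model.

Theorem mainTheorem2 (R : realType) (N : nat) (rho : R3 R -> R)
    (kappa : 'I_3 -> R3 R -> R)
    (drho : 'I_3 -> R3 R -> R) (dkappa : 'I_3 -> 'I_3 -> R3 R -> R)
    (q : \bar R) :
  (1 <= N)%N ->
  measurable_fun setT rho ->
  (forall r, 0 <= rho r) ->
  (\int[leb3]_r (rho r)%:E = N%:R%:E)%E ->
  (forall b, measurable_fun setT (kappa b)) ->
  ('N[leb3]_1 [EFin \o rho] < +oo)%E ->
  (1 < q)%E ->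
  ('N[leb3]_q [EFin \o rho] < +oo)%E ->
  (forall a, weak_derivative3 rho (drho a) (basis3 a)) ->
  L1_loc3 (fun r => (rho r)^-1 * \sum_(a < 3) drho a r ^+ 2) ->
  (forall a, L1_loc3 (fun r => rho r * kappa a r ^+ 2)) ->
  (forall a b, weak_derivative3 (kappa b) (dkappa a b) (basis3 a)) ->
  (forall a b,
    L1_loc3 (fun r => (1 + sqnorm3 r) * rho r * dkappa a b r ^+ 2)) ->
  exists D : R3 R * R3 R -> R[i],
    [/\ rdm1 N D, has_density D rho &
        has_paramagnetic_current D (fun a r => 2^-1 * rho r * kappa a r)].
Proof.
move=> _ mrho rho0 intrho _ _ _ _ Wrho Lrho Lkappa Wkappa Ldkappa.
have irho : ig leb3 rho.
  apply/igP; split=> //; under eq_integral do rewrite ger0_norm//.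
  by rewrite intrho ltry.
have hN : \int[leb3]_r rho r = N%:R by rewrite /Rintegral intrho.
(* With the factor 15 of [ker_operator_bound] this gives the bound 1/2 used in [model_pauli]. *)
have e0 : 0 < 30^-1 :> R by rewrite invr_gt0.
have [d [d0 d1 small]] := uniform_small_cubes irho rho0 e0.
pose A := kerA rho kappa d; pose B := kerB rho kappa d.
pose dA := dkerA rho kappa drho dkappa d; pose dB := dkerB rho kappa drho dkappa d.
pose c := (315 / (256 * d)) ^+ 3.
have c0 : 0 <= c.
  by apply: exprn_ge0; exact: (divr_ge0 (ler0n _ 315) (mulr_ge0 (ler0n _ 256) (ltW d0))).
have sA : sq_kernel A rho := sq_kerA rho0 irho Wrho Wkappa d0.
have sB : sq_kernel B rho := sq_kerB rho0 irho Wrho Wkappa d0.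
have cut (z : R3 R * R3 R) : rho z.2 * cutoff d (z.1 - z.2) ^+ 2 <= c * rho z.2.
  rewrite mulrC; apply: ler_wpM2r => //; apply: (le_trans (cutoff_sqr_le d0 _)).
  by rewrite -[leRHS]mulr1; apply: ler_wpM2l => //; rewrite indicE lern1 leq_b1.
have bAB z : A z ^+ 2 <= c * rho z.2 /\ B z ^+ 2 <= c * rho z.2.
  by split; [apply: le_trans (cut z); exact: kerA_sqr_le|apply: le_trans (cut z); exact: kerB_sqr_le].
have slAB := sliced_ker rho0 irho Wrho Lrho Lkappa Wkappa Ldkappa d0 d1.
have sdAB := sq_dker rho0 irho Wrho Lrho Lkappa Wkappa Ldkappa d0 d1.
have bdAB a : exists2 w, L1_loc3 w & forall z, dA a z ^+ 2 + dB a z ^+ 2 <= w z.2.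
  have [M M0 hM] := dker_sqr_le kappa drho dkappa rho0 d0 d1 a.
  exists (fun r => M * energy rho kappa drho dkappa a r).
    by apply: L1_loc3Z; exact: L1_loc3_energy.
  move=> z; apply: (le_trans (hM z)); apply: ler_wpM2l => //.
  rewrite -[leRHS]mul1r; apply: ler_wpM2r; first exact: energy_ge0.
  by rewrite indicE lern1 leq_b1.
have boundAB (y : R3 R -> R) : measurable_fun setT y -> ig leb3 (fun r => y r ^+ 2) ->
    forall f, f = A \/ f = B -> ig leb3 (fun u => (\int[leb3]_r (f (u, r) * y r)) ^+ 2) /\
      \int[leb3]_u ((\int[leb3]_r (f (u, r) * y r)) ^+ 2) <= 2^-1 * \int[leb3]_r (y r ^+ 2).
  move=> my iy f hf.
  have mf : measurable_fun setT f by case: hf => ->; [case: sA|case: sB].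
  have bf (z : R3 R * R3 R) : f z ^+ 2 <= rho z.2 * cutoff d (z.1 - z.2) ^+ 2.
    by case: hf => ->; [exact: kerA_sqr_le|exact: kerB_sqr_le].
  have := ker_operator_bound rho0 irho d0 mf bf small my iy.
  by rewrite (_ : 15 / 30 = 2^-1 :> R)//; field.
have mass := ker_mass kappa rho0 d0.
have current := ker_current kappa drho dkappa rho0 d0.
exists (model_D A B); split.
- exact: (model_rdm1 irho sA sB bAB mass boundAB hN).
- exact: (model_has_density irho sA sB mass).
- exact: (model_paramagnetic_current irho sA sB slAB sdAB bdAB current).
Qed.
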